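(* Consider the ODE $\dfrac{df}{dz}=\dfrac{Pf}{z}+\dfrac{Qf}{1-z}$ for $f$ with values in $\mathbb C^N$, where $P,Q\in\mathrm{End}(\mathbb C^N)$ satisfy the following: - $Q(x)=\phi(x)v$ with $\phi\in(\mathbb C^N)^*$, $v\in\mathbb C^N$ and $\phi(v)=\delta\neq0$; - $P$ has distinct eigenvalues $\lambda_1,\dots,\lambda_N$, no two differing by a positive integer, and $Q$ is in general position with respect to $P$; - $R=Q-P$ has distinct eigenvalues $-\mu_1,\dots,-\mu_N$, no two of the $\mu_j$ differing by a positive integer, and $Q$ is in general position with respect to $R$. Let $\xi_i$ be eigenvectors of $P$ ($P\xi_i=\lambda_i\xi_i$) and $\zeta_j$ eigenvectors of $R$ ($R\zeta_j=-\mu_j\zeta_j$), normalised by $\phi(\xi_i)=1=\phi(\zeta_j)$. Let $f_i(z)=\sum_{n\ge0}\xi_{i,n}z^{\lambda_i+n}$ with $\xi_{i,0}=\xi_i$, and $h_j(z)=\sum_{n\ge0}\zeta_{j,n}z^{\mu_j-n}$ with $\zeta_{j,0}=\zeta_j$, be the formal series solutions of the ODE. Then $f_i$ converges on $\{|z|<1\}\setminus[0,1)$ and $h_j$ on $\{|z|>1\}\setminus[1,\infty)$. Both extend to single-valued holomorphic functions on $\mathbb C\setminus[0,\infty)$, and there $f_i=\sum_jc_{ij}h_j$ with $$c_{ij}=e^{i\pi(\lambda_i-\mu_j)}\frac{\prod_{k\ne i}\Gamma(\lambda_i-\lambda_k+1)\prod_{m\ne j}\Gamma(\mu_j-\mu_m)}{\prod_{m\ne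 j}\Gamma(\lambda_i-\mu_m+1)\prod_{k\ne i}\Gamma(\mu_j-\lambda_k)}.$$
   Context: ''$Q$ in general position with respect to $P$'' means: $P$ has a basis of eigenvectors $\xi_i$ with $\phi(\xi_i)\ne0$ for all $i$, and writing $v=\sum_i\delta_i\xi_i$ one has $\delta_i\ne0$ for all $i$ (similarly for $R$). Complex powers are taken as $z^s=\exp(s\log z)$ with $\arg z\in(0,2\pi)$ on $\mathbb C\setminus[0,\infty)$. $1/\Gamma$ is understood as an entire function. *)

(* Defs.v *)
From Stdlib Require Import Reals.
From Coquelicot Require Import Coquelicot.
From mathcomp Require Import ssreflect ssrbool eqtype ssrnat fintype bigop.

Set Implicit Arguments.
Unset Strict Implicit.

Definition csum (N : nat) (F : 'I_N -> C) : C :=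
  \big[Cplus/RtoC 0%R]_(i < N) F i.
Definition cprod_except (N : nat) (i : 'I_N) (F : 'I_N -> C) : C :=
  \big[Cmult/RtoC 1%R]_(k < N | k != i) F k.

Definition cvec (N : nat) := 'I_N -> C.
Definition cmat (N : nat) := 'I_N -> 'I_N -> C.
Definition covec (N : nat) := 'I_N -> C.

Definition vzero (N : nat) : cvec N := fun _ => RtoC 0%R.
Definition mapply (N : nat) (A : cmat N) (x : cvec N) : cvec N :=
  fun r => csum (fun c => Cmult (A r c) (x c)).
Definition cvapply (N : nat) (phi : covec N) (x : cvec N) : C :=
  csum (fun c => Cmult (phi c) (x c)).
Definition vadd (N : nat) (x y : cvec N) : cvec N := fun r => Cplus (x r) (y r).
Definition vsub (N : nat) (x y : cvec N) : cvec N := fun r => Cminus (x r) (y r).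
Definition vscale (N : nat) (a : C) (x : cvec N) : cvec N := fun r => Cmult a (x r).
Definition msub (N : nat) (A B : cmat N) : cmat N := fun r c => Cminus (A r c) (B r c).
Definition vlincomb (N : nat) (c : 'I_N -> C) (e : 'I_N -> cvec N) : cvec N :=
  fun r => csum (fun i => Cmult (c i) (e i r)).

(* e_1,...,e_N is a basis of C^N (N linearly independent vectors in C^N) *)
Definition is_basis (N : nat) (e : 'I_N -> cvec N) : Prop :=
  forall c : 'I_N -> C, vlincomb c e = @vzero N -> forall i, c i = RtoC 0%R.

(* "Q (x) = phi(x) v is in general position with respect to M":
   M has a basis of eigenvectors e_i with phi(e_i) <> 0 for all i, and
   writing v = sum_i delta_i e_i one has delta_i <> 0 for all i. *)
Definition general_position (N : nat) (M : cmat N) (phi : covec N) (v : cvec N)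
  : Prop :=
  exists (e : 'I_N -> cvec N) (ev : 'I_N -> C),
    is_basis e /\
    (forall i, mapply M (e i) = vscale (ev i) (e i)) /\
    (forall i, cvapply phi (e i) <> RtoC 0%R) /\
    exists delta : 'I_N -> C,
      (forall i, delta i <> RtoC 0%R) /\ v = vlincomb delta e.

Definition Cexp (w : C) : C :=
  Cmult (RtoC (exp (Re w))) (Cplus (RtoC (cos (Im w))) (Cmult Ci (RtoC (sin (Im w))))).

(* argument with values in (0, 2 pi) on C \ [0, oo) *)
Definition Carg (z : C) : R :=
  if Rle_dec 0 (Im z) then acos (Re z / Cmod z)
  else (2 * PI - acos (Re z / Cmod z))%R.

Definition Clog (z : C) : C := Cplus (RtoC (ln (Cmod z))) (Cmult Ci (RtoC (Carg z))).

Definition Cpowc (z s : C) : C := Cexp (Cmult s (Clog z)).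

Definition slit (z : C) : Prop := ~ (Im z = 0%R /\ (0 <= Re z)%R).

(* Gauss' formula: 1/Gamma(z) = lim_n z(z+1)...(z+n) / (n! n^z),
   an entire function (n^z = exp(z ln n) for the positive real n). *)
Definition rGamma_seq (z : C) (n : nat) : C :=
  Cdiv (\big[Cmult/RtoC 1%R]_(k < n.+1) Cplus z (RtoC (INR k)))
       (Cmult (RtoC (INR (Factorial.fact n))) (Cexp (Cmult z (RtoC (ln (INR n)))))).

Definition rGamma (z : C) : C := @lim C_CompleteNormedModule (filtermap (rGamma_seq z) eventually).
Definition CGamma (z : C) : C := Cinv (rGamma z).

Definition prevc (N : nat) (a : nat -> cvec N) (n : nat) : cvec N :=
  match n with O => @vzero N | S m => a m end.

(* f(z) = sum_n a_n z^(lam + n) is a formal solution of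
   df/dz = P f / z + Q f / (1 - z), i.e. of z(1-z) f' = (1-z) P f + z Q f:
   comparing coefficients of z^(lam+n):
   (lam+n) a_n - (lam+n-1) a_{n-1} = P a_n - P a_{n-1} + Q a_{n-1}. *)
Definition formal_sol_at0 (N : nat) (P Q : cmat N) (lam : C) (a : nat -> cvec N)
  : Prop :=
  forall n : nat,
    vsub (vscale (Cplus lam (RtoC (INR n))) (a n))
         (vscale (Cminus (Cplus lam (RtoC (INR n))) (RtoC 1%R)) (prevc a n))
    = vadd (vsub (mapply P (a n)) (mapply P (prevc a n))) (mapply Q (prevc a n)).

(* h(z) = sum_n b_n z^(mu - n) is a formal solution of the same ODE:
   comparing coefficients of z^(mu+1-n):
   (mu-n+1) b_{n-1} - (mu-n) b_n = P b_{n-1} - P b_n + Q b_n. *)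
Definition formal_sol_atinf (N : nat) (P Q : cmat N) (mu : C) (b : nat -> cvec N)
  : Prop :=
  forall n : nat,
    vsub (vscale (Cplus (Cminus mu (RtoC (INR n))) (RtoC 1%R)) (prevc b n))
         (vscale (Cminus mu (RtoC (INR n))) (b n))
    = vadd (vsub (mapply P (prevc b n)) (mapply P (b n))) (mapply Q (b n)).

Definition conn_coef (N : nat) (lam mu : 'I_N -> C) (i j : 'I_N) : C :=
  Cmult (Cexp (Cmult Ci (Cmult (RtoC PI) (Cminus (lam i) (mu j)))))
   (Cmult
     (Cmult (cprod_except i (fun k => CGamma (Cplus (Cminus (lam i) (lam k)) (RtoC 1%R))))
            (cprod_except j (fun m => CGamma (Cminus (mu j) (mu m)))))
     (Cmult (cprod_except j (fun m => rGamma (Cplus (Cminus (lam i) (mu m)) (RtoC 1%R))))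
            (cprod_except i (fun k => rGamma (Cminus (mu j) (lam k)))))).

Definition holo_slit (f : C -> C) : Prop :=
  forall z, slit z -> ex_derive (K := C_AbsRing) (V := C_NormedModule) f z.

(* Main.v *)
(** In the coordinate [s = log z], and after diagonalising [P], the equation is [y_k' = lam_k y_k + z / (1 - z) * sum_l residue_l y_l]
    with [residue_k = prod_m (lam_k - mu_m) / prod_(k' <> k) (lam_k - lam_k')]. Its solutions at [0] and at infinity are explicit
    hypergeometric series, and a conformal map of the strip [0 < Im s < 2 pi] onto the disc continues them to the whole strip.

    For the connection coefficients, assume first that no [lam_k - mu_m] is an integer. Two explicit gauge transformations raise
    [lam_i] by 1, respectively [mu_j] by 1, and multiply each basis solution by a known factor, so the coefficients for the
    parameters [lam_i + M], [mu_j + M] are those for [lam_i], [mu_j] times an explicit quotient of Pochhammer products. When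
    [Re (lam_i - mu_j)] is sufficiently negative, the relation can be evaluated at [z = -1], where the series converge absolutely
    and uniformly in [M]. As [M] tends to infinity, [f_i] and [h_j] become the same nonzero binomial series, the other [h_m]
    drop out, and the quotients of Pochhammer products converge to quotients of Gamma values by Gauss' formula. Raising [mu_j]
    repeatedly reduces the general generic case to this one. Finally both sides depend continuously on the parameters, and
    replacing [lam] by [lam + i / (q + 1)] is generic for large [q]. *)

From HB Require Import structures.
From Stdlib Require Import Reals Lra Lia Classical ClassicalEpsilon FunctionalExtensionality.
From Coquelicot Require Import Coquelicot.
From mathcomp Require Import ssreflect ssrfun ssrbool eqtype ssrnat seq choice fintype bigop perm ssralg matrix mxalgebra poly.
Require Import Defs.

Set Implicit Arguments.
Unset Strict Implicit.
Unset Printing Implicit Defensive.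

Delimit Scope ring_scope with ring.
Delimit Scope R_scope with R.
Local Open Scope R_scope.
Local Open Scope C_scope.
Delimit Scope nat_scope with N.

(** The series of f_i and h_j converge in disjoint regions, so comparing them needs global solutions
    first. The conformal map makes one power series serve the whole strip, and constant pairings
    with solutions of the adjoint equation replace existence and uniqueness theorems: a local
    solution is recorded by a constant vector, and the theorem becomes a relation between the
    vectors of f_i and of the h_j. Coefficients exist because the vectors of the h_j are
    independent; only their values need analysis. At z = -1 a fixed set of parameters gives a single
    scalar equation for N unknown coefficients, which is why the parameters are moved: raising lam_i
    and mu_j together keeps lam_i - mu_j, so one binomial factor survives while the remaining
    factors cancel in the limit. Integer shifts could make some lam_k - mu_m vanish, hence the
    generic case. Adding the same imaginary number to every lam_k leaves all lam_i - lam_k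
    unchanged, and the mixed differences enter c_ij only through an exponential and the entire
    function 1/Gamma, so the final passage to the limit meets no pole. *)

(** * Auxiliary facts on complex numbers *)

Lemma C_ext (z w : C) : Re z = Re w -> Im z = Im w -> z = w.
Proof. by case: z => a b; case: w => c d /= -> ->. Qed.

Lemma im_le_Cmod (c : C) : (Rabs (Im c) <= Cmod c)%R.
Proof.
have := re_le_Cmod (Cmult Ci c); rewrite Cmod_mult Cmod_Ci Rmult_1_l.
by rewrite re_mult /= !Rmult_0_l Rminus_0_l Rmult_1_l Rabs_Ropp.
Qed.

Lemma Cmod_le_abs (c : C) : (Cmod c <= Rabs (Re c) + Rabs (Im c))%R.
Proof.
have -> : c = RtoC (Re c) + Ci * RtoC (Im c) by apply: C_ext => /=; ring.
apply: Rle_trans (Cmod_triangle _ _) _.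
rewrite Cmod_mult Cmod_Ci !Cmod_R /=.
by apply: Req_le; congr (Rabs _ + _)%R; [ring | rewrite Rmult_1_l; congr Rabs; ring].
Qed.

Lemma Cmod_sub_sym (a b : C) : Cmod (a - b) = Cmod (b - a).
Proof. by rewrite -Cmod_opp Copp_minus_distr. Qed.

Lemma re_minus (a b : C) : Re (a - b) = (Re a - Re b)%R.
Proof. by []. Qed.
Lemma im_minus (a b : C) : Im (a - b) = (Im a - Im b)%R.
Proof. by []. Qed.

(** * Limits of complex sequences *)

(** Componentwise, so that the lemmas on real limits apply directly; [Clim_filterlim] and
    [filterlim_Clim] translate to and from filter limits, and [Clim_lim] to [lim]. *)
Definition Clim (u : nat -> C) (l : C) : Prop :=
  is_lim_seq (fun n => Re (u n)) (Re l) /\ is_lim_seq (fun n => Im (u n)) (Im l).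

Lemma Clim_Cmod_sub u l : Clim u l -> is_lim_seq (fun n => Cmod (u n - l)) 0%R.
Proof.
case=> h1 h2.
apply: (@is_lim_seq_le_le (fun _ => 0%R) _
  (fun n => Rabs (Re (u n) - Re l) + Rabs (Im (u n) - Im l))%R).
- by move=> n; split; [apply: Cmod_ge_0 | apply: Cmod_le_abs].
- exact: is_lim_seq_const.
- have -> : 0%R = (Rabs (Re l - Re l) + Rabs (Im l - Im l))%R.
    by rewrite !Rminus_diag Rabs_R0 Rplus_0_r.
  apply: is_lim_seq_plus'; apply: (is_lim_seq_abs _ (Rbar.Finite _)); apply: is_lim_seq_minus' => //;
  exact: is_lim_seq_const.
Qed.

Lemma Clim_squeeze u l (e : nat -> R) :
  (forall n, (Cmod (u n - l) <= e n)%R) -> is_lim_seq e 0%R -> Clim u l.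
Proof.
move=> h he.
have key (f : nat -> R) (x : R) : (forall n, Rabs (f n - x) <= e n)%R -> is_lim_seq f x.
  move=> hf; apply: (@is_lim_seq_le_le (fun n => x - e n)%R _ (fun n => x + e n)%R).
  - by move=> n; have := Rabs_le_between (f n - x) (e n); have := hf n; move=> h1 [h2 _]; move: (h2 h1); lra.
  - have {2}-> : x = (x - 0)%R by ring.
    by apply: is_lim_seq_minus' => //; apply: is_lim_seq_const.
  - have {2}-> : x = (x + 0)%R by ring.
    by apply: is_lim_seq_plus' => //; apply: is_lim_seq_const.
split; apply: key => n; apply: Rle_trans (h n).
  exact: (re_le_Cmod (u n - l)).
exact: (im_le_Cmod (u n - l)).
Qed.

Lemma Clim_ext u v l : (forall n, u n = v n) -> Clim u l -> Clim v l.
Proof.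
move=> h [h1 h2]; split.
  by apply: is_lim_seq_ext h1 => n; rewrite h.
by apply: is_lim_seq_ext h2 => n; rewrite h.
Qed.

Lemma Clim_ext_loc u v l (n0 : nat) :
  (forall n, (n0 <= n)%N -> u n = v n) -> Clim u l -> Clim v l.
Proof.
move=> h [h1 h2]; split.
  by apply: is_lim_seq_ext_loc h1; exists n0 => n /leP hn; rewrite h.
by apply: is_lim_seq_ext_loc h2; exists n0 => n /leP hn; rewrite h.
Qed.

Lemma Clim_const l : Clim (fun _ => l) l.
Proof. by split; apply: is_lim_seq_const. Qed.

Lemma Clim_unique u l l' : Clim u l -> Clim u l' -> l = l'.
Proof.
move=> [h1 h2] [h3 h4]; apply: C_ext.
  by move: (is_lim_seq_unique _ _ h1) (is_lim_seq_unique _ _ h3) => ->; case.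
by move: (is_lim_seq_unique _ _ h2) (is_lim_seq_unique _ _ h4) => ->; case.
Qed.

Lemma Clim_plus u v l m : Clim u l -> Clim v m -> Clim (fun n => u n + v n) (l + m).
Proof. by move=> [h1 h2] [h3 h4]; split; apply: is_lim_seq_plus'. Qed.

Lemma Clim_mult u v l m : Clim u l -> Clim v m -> Clim (fun n => u n * v n) (l * m).
Proof.
move=> [h1 h2] [h3 h4]; split.
  by apply: is_lim_seq_minus'; apply: is_lim_seq_mult'.
by apply: is_lim_seq_plus'; apply: is_lim_seq_mult'.
Qed.

Lemma Clim_scal a u l : Clim u l -> Clim (fun n => a * u n) (a * l).
Proof. exact: Clim_mult (Clim_const a). Qed.

Lemma Clim_opp u l : Clim u l -> Clim (fun n => - u n) (- l).
Proof. by move=> [h1 h2]; split; apply: ((is_lim_seq_opp _ (Rbar.Finite _)).1). Qed.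

Lemma Clim_minus u v l m : Clim u l -> Clim v m -> Clim (fun n => u n - v n) (l - m).
Proof. by move=> hu hv; apply: Clim_plus => //; apply: Clim_opp. Qed.

Lemma Clim_Cmod u l : Clim u l -> is_lim_seq (fun n => Cmod (u n)) (Cmod l).
Proof.
move=> /Clim_Cmod_sub h.
apply: (@is_lim_seq_le_le (fun n => Cmod l - Cmod (u n - l))%R _ (fun n => Cmod l + Cmod (u n - l))%R).
- move=> n; have h1 := Cmod_triangle l (u n - l); have h2 := Cmod_triangle (u n) (l - u n).
  have e1 : l + (u n - l) = u n by ring.
  have e2 : u n + (l - u n) = l by ring.
  by rewrite e1 in h1; rewrite e2 Cmod_sub_sym in h2; lra.
- have {2}-> : Cmod l = (Cmod l - 0)%R by ring.
  by apply: is_lim_seq_minus' => //; apply: is_lim_seq_const.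
- have {2}-> : Cmod l = (Cmod l + 0)%R by ring.
  by apply: is_lim_seq_plus' => //; apply: is_lim_seq_const.
Qed.

Lemma Cinv_parts (z : C) : / z = Cconj z * RtoC (/ (Cmod z ^ 2)).
Proof.
rewrite Cmod2_alt; case: z => a b; apply: C_ext; rewrite /= /Rdiv; ring.
Qed.

Lemma Clim_inv u (l : C) : l <> 0 -> Clim u l -> Clim (fun n => / u n) (/ l).
Proof.
move=> l0 hu; have hm := Clim_Cmod hu; case: hu => h1 h2.
have hc : Clim (fun n => Cconj (u n)) (Cconj l).
  by split=> //; apply: ((is_lim_seq_opp _ (Rbar.Finite _)).1).
have hr : Clim (fun n => RtoC (/ (Cmod (u n) ^ 2))) (RtoC (/ (Cmod l ^ 2))).
  split; last exact: is_lim_seq_const.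
  apply: (is_lim_seq_inv _ (Rbar.Finite _)).
    rewrite /= Rmult_1_r; apply: (is_lim_seq_ext (fun n => Cmod (u n) * Cmod (u n))%R).
      by move=> n /=; ring.
    exact: is_lim_seq_mult'.
  move=> [] /=; rewrite Rmult_1_r => /Rmult_integral h.
  by apply: l0; apply: Cmod_eq_0; case: h.
rewrite Cinv_parts; apply: Clim_ext (Clim_mult hc hr) => n.
by rewrite (Cinv_parts (u n)).
Qed.

Lemma Clim_div u v (l m : C) : m <> 0 -> Clim u l -> Clim v m -> Clim (fun n => u n / v n) (l / m).
Proof. by move=> m0 hu hv; apply: Clim_mult => //; apply: Clim_inv. Qed.

Lemma Clim_big_sum (I : Type) (r : seq I) (P : pred I) (u : I -> nat -> C) (l : I -> C) :
  (forall i, P i -> Clim (u i) (l i)) ->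
  Clim (fun n => \big[Cplus/RtoC 0]_(i <- r | P i) u i n) (\big[Cplus/RtoC 0]_(i <- r | P i) l i).
Proof.
move=> h; elim: r => [|i r IH].
  by rewrite big_nil; apply: Clim_ext (Clim_const _) => n; rewrite big_nil.
rewrite big_cons; case Pi: (P i); last by apply: Clim_ext IH => n; rewrite big_cons Pi.
by apply: Clim_ext (Clim_plus (h i Pi) IH) => n; rewrite big_cons Pi.
Qed.

Lemma Clim_big_prod (I : Type) (r : seq I) (P : pred I) (u : I -> nat -> C) (l : I -> C) :
  (forall i, P i -> Clim (u i) (l i)) ->
  Clim (fun n => \big[Cmult/RtoC 1]_(i <- r | P i) u i n) (\big[Cmult/RtoC 1]_(i <- r | P i) l i).
Proof.
move=> h; elim: r => [|i r IH].
  by rewrite big_nil; apply: Clim_ext (Clim_const _) => n; rewrite big_nil.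
rewrite big_cons; case Pi: (P i); last by apply: Clim_ext IH => n; rewrite big_cons Pi.
by apply: Clim_ext (Clim_mult (h i Pi) IH) => n; rewrite big_cons Pi.
Qed.

Lemma Clim_csum N (u : 'I_N -> nat -> C) (l : 'I_N -> C) :
  (forall i, Clim (u i) (l i)) -> Clim (fun n => csum (fun i => u i n)) (csum l).
Proof. by move=> h; apply: Clim_big_sum => i _. Qed.

Lemma Clim_incr_1 u l : Clim u l -> Clim (fun n => u n.+1) l.
Proof. by move=> [h1 h2]; split; apply: (is_lim_seq_incr_1 (fun n => _ (u n)) _).1. Qed.

Lemma Clim_incr_1' u l : Clim (fun n => u n.+1) l -> Clim u l.
Proof.
move=> [h1 h2]; split; first exact: (is_lim_seq_incr_1 (fun n => Re (u n)) _).2.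
exact: (is_lim_seq_incr_1 (fun n => Im (u n)) _).2.
Qed.

Lemma Clim_ne u (l : C) : l <> 0 -> Clim u l -> exists n0 : nat, forall n, (n0 <= n)%N -> u n <> 0.
Proof.
move=> l0 /Clim_Cmod_sub /is_lim_seq_spec h.
have lp : (0 < Cmod l)%R by apply/Cmod_gt_0.
case: (h (mkposreal _ lp)) => n0 hn; exists n0 => n /leP /hn /=.
rewrite Rminus_0_r Rabs_pos_eq; last exact: Cmod_ge_0.
move=> h1 h2; move: h1; rewrite h2 /Cminus Cplus_0_l Cmod_opp; lra.
Qed.

Lemma Clim_filterlim u l :
  Clim u l -> filterlim u eventually (@locally C_UniformSpace l).
Proof.
move=> [h1 h2] P [e he]; move/is_lim_seq_spec: h1 => /(_ e) h1; move/is_lim_seq_spec: h2 => /(_ e) h2.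
case: h1 => n1 h1; case: h2 => n2 h2; exists (n1 + n2)%N => n hn.
by apply: he; split; [apply: h1 | apply: h2]; move: hn; rewrite -plusE; lia.
Qed.

(** * Absolutely convergent complex series *)

Definition summable (a : nat -> C) : Prop := ex_series (fun n => Cmod (a n)).
(** [Series] is total, so the value is meaningful only together with [summable], which demands
    absolute convergence. *)
Definition Cser (a : nat -> C) : C := (Series (fun n => Re (a n)), Series (fun n => Im (a n))).

Lemma summable_le a (b : nat -> R) :
  (forall n, (Cmod (a n) <= b n)%R) -> ex_series b -> summable a.
Proof.
move=> h; apply: ex_series_le => n; rewrite /norm /= /abs /= Rabs_pos_eq; last exact: Cmod_ge_0.
exact: h.
Qed.

Lemma summable_ext a b : (forall n, a n = b n) -> summable a -> summable b.
Proof. by move=> h; apply: ex_series_ext => n; rewrite h. Qed.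

Lemma summable_re a : summable a -> ex_series (fun n => Re (a n)).
Proof. by apply: ex_series_le => n; apply: re_le_Cmod. Qed.
Lemma summable_im a : summable a -> ex_series (fun n => Im (a n)).
Proof. by apply: ex_series_le => n; apply: im_le_Cmod. Qed.

Lemma summable_scal c a : summable a -> summable (fun n => c * a n).
Proof.
move=> h; apply: (summable_le (b := fun n => (Cmod c * Cmod (a n))%R)).
  by move=> n; rewrite Cmod_mult; lra.
exact: (ex_series_scal_l (Cmod c)).
Qed.

Lemma summable_plus a b : summable a -> summable b -> summable (fun n => a n + b n).
Proof.
move=> ha hb; apply: summable_le (fun n => Cmod_triangle _ _) _.
exact: (ex_series_plus (V := R_NormedModule)).
Qed.

Lemma summable_opp a : summable a -> summable (fun n => - a n).
Proof. by apply: ex_series_ext => n; rewrite Cmod_opp. Qed.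

Lemma summable_minus a b : summable a -> summable b -> summable (fun n => a n - b n).
Proof. by move=> ha hb; apply: summable_plus => //; apply: summable_opp. Qed.

Lemma summable_S a : summable a <-> summable (fun n => a n.+1).
Proof. exact: (ex_series_incr_1 (fun n => Cmod (a n))). Qed.

Lemma Cser_ext a b : (forall n, a n = b n) -> Cser a = Cser b.
Proof. by move=> h; rewrite /Cser; congr pair; apply: Series_ext => n; rewrite h. Qed.

Lemma Cser_plus a b : summable a -> summable b ->
  Cser (fun n => a n + b n) = Cser a + Cser b.
Proof.
move=> ha hb; apply: C_ext.
  exact: Series_plus (summable_re ha) (summable_re hb).
exact: Series_plus (summable_im ha) (summable_im hb).
Qed.

Lemma Cser_scal c a : summable a -> Cser (fun n => c * a n) = c * Cser a.
Proof.
move=> ha; have hr := summable_re ha; have hi := summable_im ha.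
apply: C_ext => /=.
  rewrite Series_minus; [|exact: (ex_series_scal_l (Re c))|exact: (ex_series_scal_l (Im c))].
  by rewrite !Series_scal_l.
rewrite Series_plus; [|exact: (ex_series_scal_l (Re c))|exact: (ex_series_scal_l (Im c))].
by rewrite !Series_scal_l.
Qed.

Lemma Cser_opp a : summable a -> Cser (fun n => - a n) = - Cser a.
Proof.
move=> ha; have -> : - Cser a = (- RtoC 1) * Cser a by ring.
by rewrite -Cser_scal //; apply: Cser_ext => n; ring.
Qed.

Lemma Cser_minus a b : summable a -> summable b ->
  Cser (fun n => a n - b n) = Cser a - Cser b.
Proof.
by move=> ha hb; rewrite Cser_plus ?Cser_opp //; apply: summable_opp.
Qed.

Lemma Cser_S a : summable a -> Cser a = a 0%N + Cser (fun n => a n.+1).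
Proof.
move=> ha; apply: C_ext => /=.
  exact: (Series_incr_1 _ (summable_re ha)).
exact: (Series_incr_1 _ (summable_im ha)).
Qed.

Lemma summable_0 : summable (fun _ => RtoC 0).
Proof.
apply: (ex_series_ext (fun _ => 0%R)); first by move=> n; rewrite Cmod_0.
by exists 0%R; apply: is_lim_seq_ext (is_lim_seq_const 0) => n; rewrite sum_n_const Rmult_0_r.
Qed.

Lemma Cser_0 : Cser (fun _ => RtoC 0) = RtoC 0.
Proof.
rewrite -[RHS](Cmult_0_l (Cser (fun _ => RtoC 0))) -(Cser_scal _ summable_0).
by apply: Cser_ext => n; rewrite Cmult_0_l.
Qed.

Lemma csum_ext N (F G : 'I_N -> C) : (forall i, F i = G i) -> csum F = csum G.
Proof. by move=> h; apply: eq_bigr => i _. Qed.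

Lemma summable_big (I : Type) (r : seq I) (a : I -> nat -> C) :
  (forall i, summable (a i)) -> summable (fun n => \big[Cplus/RtoC 0]_(i <- r) a i n) /\
  Cser (fun n => \big[Cplus/RtoC 0]_(i <- r) a i n) = \big[Cplus/RtoC 0]_(i <- r) Cser (a i).
Proof.
move=> h; elim: r => [|i r [IH1 IH2]].
  split; first by apply: summable_ext summable_0 => n; rewrite big_nil.
  by rewrite big_nil -[RHS]Cser_0; apply: Cser_ext => n; rewrite big_nil.
split; first by apply: summable_ext (summable_plus (h i) IH1) => n; rewrite big_cons.
rewrite big_cons -IH2 -Cser_plus //.
by apply: Cser_ext => n; rewrite big_cons.
Qed.

Lemma summable_csum N (a : 'I_N -> nat -> C) :
  (forall i, summable (a i)) -> summable (fun n => csum (fun i => a i n)).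
Proof. by move=> h; apply: (summable_big _ h).1. Qed.

Lemma Cser_csum N (a : 'I_N -> nat -> C) :
  (forall i, summable (a i)) -> Cser (fun n => csum (fun i => a i n)) = csum (fun i => Cser (a i)).
Proof. by move=> h; apply: (summable_big _ h).2. Qed.

Lemma sum_n_C_parts (a : nat -> C) n :
  @sum_n C_AbelianGroup a n = (sum_n (fun n => Re (a n)) n, sum_n (fun n => Im (a n)) n).
Proof.
elim: n => [|n IH]; first by rewrite !sum_O; case: (a 0%N).
by rewrite !sum_Sn IH.
Qed.

Lemma Series_lim (b : nat -> R) : ex_series b -> is_lim_seq (sum_n b) (Series b).
Proof. exact: Series_correct. Qed.

Lemma Cser_Clim a : summable a -> Clim (fun n => @sum_n C_AbelianGroup a n) (Cser a).
Proof.
move=> ha; split.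
  apply: is_lim_seq_ext (Series_lim (summable_re ha)) => n.
  by rewrite sum_n_C_parts.
apply: is_lim_seq_ext (Series_lim (summable_im ha)) => n.
by rewrite sum_n_C_parts.
Qed.

Lemma is_series_Cser a : summable a -> @is_series C_AbsRing C_NormedModule a (Cser a).
Proof. by move=> ha; apply: (Clim_filterlim (Cser_Clim ha)). Qed.

Lemma Cmod_Cser a : summable a -> (Cmod (Cser a) <= Series (fun n => Cmod (a n)))%R.
Proof.
move=> ha; apply: (is_lim_seq_le _ _ (Rbar.Finite _) (Rbar.Finite _) _ (Clim_Cmod (Cser_Clim ha)) (Series_lim ha)).
move=> n; exact: (norm_sum_n_m (V := C_NormedModule)).
Qed.

Lemma is_lim_seq_eps (u : nat -> R) (l : R) :
  (forall eps : R, (0 < eps)%R -> exists n0 : nat, forall n, (n0 <= n)%N -> (Rabs (u n - l) < eps)%R) ->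
  is_lim_seq u l.
Proof.
move=> h; apply/is_lim_seq_spec => eps; case: (h eps (cond_pos eps)) => n0 hn.
by exists n0 => n /leP; apply: hn.
Qed.

Lemma is_lim_seq_epsE (u : nat -> R) (l : R) : is_lim_seq u l ->
  forall eps : R, (0 < eps)%R -> exists n0 : nat, forall n, (n0 <= n)%N -> (Rabs (u n - l) < eps)%R.
Proof.
move=> /is_lim_seq_spec h eps he; case: (h (mkposreal eps he)) => n0 hn.
by exists n0 => n /leP; apply: hn.
Qed.

Lemma Series_tail_lim (b : nat -> R) : ex_series b ->
  is_lim_seq (fun k => Series (fun n => b (k + n)%coq_nat)) 0%R.
Proof.
move=> hb; apply: (is_lim_seq_incr_1 _ _).2.
apply: (is_lim_seq_ext (fun k => Series b - sum_f_R0 b k)%R).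
  by move=> k; rewrite (Series_incr_n b k.+1) //=; [ring | lia].
have -> : 0%R = (Series b - Series b)%R by ring.
apply: is_lim_seq_minus'; first exact: is_lim_seq_const.
by apply: is_lim_seq_ext (Series_lim hb) => n; rewrite sum_n_Reals.
Qed.

(** Dominated convergence for series. The bound is asked only from [q0] on because perturbed
    denominators may vanish for small [q]. *)
Lemma tannery (a : nat -> nat -> C) (l : nat -> C) (b : nat -> R) (q0 : nat) :
  ex_series b -> (forall q n, (q0 <= q)%N -> (Cmod (a q n) <= b n)%R) ->
  (forall n, Clim (fun q => a q n) (l n)) ->
  summable l /\ Clim (fun q => Cser (a q)) (Cser l).
Proof.
move=> hb hab hl.
have lb n : (Cmod (l n) <= b n)%R.
  apply: (is_lim_seq_le_loc _ _ (Rbar.Finite _) (Rbar.Finite _) _ (Clim_Cmod (hl n)) (is_lim_seq_const (b n))).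
  by exists q0 => q /leP hq; apply: hab.
have sl : summable l by apply: summable_le lb hb.
have sa q : (q0 <= q)%N -> summable (a q) by move=> hq; apply: summable_le hb => n; apply: hab.
split=> //.
have b0 n : (0 <= b n)%R by apply: Rle_trans (lb n); apply: Cmod_ge_0.
suff h : is_lim_seq (fun q => Cmod (Cser (a (q + q0)%coq_nat) - Cser l)) 0%R.
  have h' : Clim (fun q => Cser (a (q + q0)%coq_nat)) (Cser l).
    by apply: Clim_squeeze h => n; apply: Rle_refl.
  by case: h' => h1 h2; split; [apply: (is_lim_seq_incr_n _ q0 _).2 h1 | apply: (is_lim_seq_incr_n _ q0 _).2 h2].
apply: is_lim_seq_eps => eps he.
(* The terms differ by at most twice [b n]: the tail costs two times [eps / 4], the finite head
   another [eps / 4]. *)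
have [k hk] := is_lim_seq_epsE (Series_tail_lim hb) (eps := (eps / 4)%R) ltac:(lra).
have {hk} := hk k (leqnn k); rewrite Rminus_0_r => hk.
pose e q n := Cmod (a (q + q0)%coq_nat n - l n).
have eb q n : (0 <= e q n <= 2 * b n)%R.
  split; first exact: Cmod_ge_0.
  apply: Rle_trans (Cmod_triangle _ _) _; rewrite Cmod_opp.
  have hq : (q0 <= (q + q0)%coq_nat)%N by rewrite plusE leq_addl.
  by have := hab _ n hq; have := lb n; lra.
have se q : ex_series (e q).
  apply: (ex_series_le (V := R_CompleteNormedModule) _ (fun n => 2 * b n)%R); last exact: (ex_series_scal_l 2).
  by move=> n; rewrite /norm /= /abs /= Rabs_pos_eq; have := eb q n; lra.
have main q : (Cmod (Cser (a (q + q0)%coq_nat) - Cser l) <= Series (e q))%R.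
  have hq : (q0 <= (q + q0)%coq_nat)%N by rewrite plusE leq_addl.
  rewrite -Cser_minus //; last exact: sa.
  by apply: Cmod_Cser; apply: summable_minus => //; apply: sa.
have fin : is_lim_seq (fun q => sum_f_R0 (e q) k) 0%R.
  elim: (k) => [|j IH] /=.
    apply: is_lim_seq_ext ((is_lim_seq_incr_n _ q0 _).1 (Clim_Cmod_sub (hl 0%N))) => n //.
  have -> : 0%R = (0 + 0)%R by ring.
  by apply: is_lim_seq_plus' => //; apply: ((is_lim_seq_incr_n _ q0 _).1 (Clim_Cmod_sub (hl j.+1))).
have [n1 hn1] := is_lim_seq_epsE fin (eps := (eps / 4)%R) ltac:(lra).
have ek : Series (fun n => b (k + n)%coq_nat) = (b k + Series (fun n => b (k.+1 + n)%coq_nat))%R.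
  rewrite (Series_incr_1 (fun n => b (k + n)%coq_nat)); last exact: (ex_series_incr_n b k).1.
  by rewrite Nat.add_0_r; congr (_ + _)%R; apply: Series_ext => n; congr b; lia.
exists n1 => q hq; rewrite Rminus_0_r Rabs_pos_eq; last exact: Cmod_ge_0.
apply: Rle_lt_trans (main q) _.
rewrite (Series_incr_n (e q) k.+1) /=; [|lia|exact: se].
have := hn1 q hq; rewrite Rminus_0_r => /Rabs_def2 [h1 _].
have h2 : (Series (fun n => e q (k.+1 + n)%coq_nat) <= 2 * Series (fun n => b (k.+1 + n)%coq_nat))%R.
  rewrite -Series_scal_l; apply: Series_le => [n|]; first exact: eb.
  by apply: (ex_series_scal_l 2); apply: (ex_series_incr_n b k.+1).1.
have := b0 k; have := Rle_abs (Series (fun n => b (k + n)%coq_nat)); rewrite /= in h2; move: hk h1 h2; rewrite ek /=; lra.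
Qed.

(** * Complex derivatives and power series *)

(** A remainder form of the complex derivative, suited to explicit estimates; [Cder_ex_derive]
    converts it to the notion used in [holo_slit]. *)
Definition Cder (f : C -> C) (z L : C) : Prop :=
  forall eps : R, (0 < eps)%R -> exists eta : R, (0 < eta)%R /\
  forall h : C, (Cmod h < eta)%R -> (Cmod (f (z + h)%C - f z - h * L) <= eps * Cmod h)%R.

Lemma Cder_quad (f : C -> C) (z L : C) (K eta : R) : (0 < eta)%R ->
  (forall h : C, (Cmod h < eta)%R -> (Cmod (f (z + h)%C - f z - h * L) <= K * (Cmod h * Cmod h))%R) ->
  Cder f z L.
Proof.
move=> e0 hq eps he.
have hK : (0 < Rabs K + 1)%R by have := Rabs_pos K; lra.
exists (Rmin eta (eps / (Rabs K + 1)))%R; split.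
  by apply: Rmin_pos => //; apply: Rdiv_lt_0_compat.
move=> h hh; apply: Rle_trans (hq h (Rlt_le_trans _ _ _ hh (Rmin_l _ _))) _.
have h1 := Rlt_le_trans _ _ _ hh (Rmin_r _ _).
have h0 := Cmod_ge_0 h.
have h2 : ((Rabs K + 1) * Cmod h <= eps)%R.
  apply: (Rmult_le_reg_r (/ (Rabs K + 1))%R); first exact: Rinv_0_lt_compat.
  have -> : ((Rabs K + 1) * Cmod h * / (Rabs K + 1) = Cmod h)%R by field; lra.
  by apply: Rlt_le; apply: h1.
have := Rle_abs K; nra.
Qed.

Lemma Cder_ext (f g : C -> C) (z L : C) : (forall x, f x = g x) -> Cder f z L -> Cder g z L.
Proof. by move=> h hf eps /hf [eta [e0 he]]; exists eta; split=> // k hk; rewrite -!h; apply: he. Qed.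

Lemma Cder_eq (f : C -> C) (z L L' : C) : L = L' -> Cder f z L -> Cder f z L'.
Proof. by move=> ->. Qed.

Lemma Cder_const (c z : C) : Cder (fun _ => c) z 0.
Proof.
apply: (@Cder_quad _ _ _ 0%R 1%R); first lra.
move=> h _; have -> : c - c - h * 0 = 0 by ring.
rewrite Cmod_0; lra.
Qed.

Lemma Cder_id (z : C) : Cder (fun x => x) z 1.
Proof.
apply: (@Cder_quad _ _ _ 0%R 1%R); first lra.
move=> h _; have -> : z + h - z - h * 1 = 0 by ring.
rewrite Cmod_0; lra.
Qed.

Lemma Cder_plus (f g : C -> C) (z L M : C) :
  Cder f z L -> Cder g z M -> Cder (fun x => f x + g x) z (L + M).
Proof.
move=> hf hg eps he.
have [e1 [p1 h1]] := hf (eps / 2)%R ltac:(lra).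
have [e2 [p2 h2]] := hg (eps / 2)%R ltac:(lra).
exists (Rmin e1 e2); split; first exact: Rmin_pos.
move=> h hh.
have := h1 h (Rlt_le_trans _ _ _ hh (Rmin_l _ _)); have := h2 h (Rlt_le_trans _ _ _ hh (Rmin_r _ _)).
have -> : f (z + h) + g (z + h) - (f z + g z) - h * (L + M) =
  (f (z + h) - f z - h * L) + (g (z + h) - g z - h * M) by ring.
have := Cmod_triangle (f (z + h) - f z - h * L) (g (z + h) - g z - h * M); lra.
Qed.

Lemma Cder_lip (f : C -> C) (z L : C) : Cder f z L ->
  exists eta : R, (0 < eta)%R /\ forall h, (Cmod h < eta)%R ->
   (Cmod (f (z + h)%C - f z) <= (Cmod L + 1) * Cmod h)%R.
Proof.
move=> hf; have [e1 [p1 h1]] := hf 1%R ltac:(lra).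
exists e1; split=> // h hh; have := h1 h hh.
have e : f (z + h) - f z = (f (z + h) - f z - h * L) + h * L by ring.
rewrite {2}e; have := Cmod_triangle (f (z + h) - f z - h * L) (h * L); rewrite Cmod_mult; lra.
Qed.

Lemma Cder_comp (f g : C -> C) (z L M : C) :
  Cder g z M -> Cder f (g z) L -> Cder (fun x => f (g x)) z (M * L).
Proof.
move=> hg hf eps he.
have l0 := Cmod_ge_0 L; have m0 := Cmod_ge_0 M.
have [e1 [p1 h1]] := Cder_lip hg.
have [e2 [p2 h2]] := hf (eps / (2 * (Cmod M + 1)))%R ltac:(apply: Rdiv_lt_0_compat; lra).
have [e3 [p3 h3]] := hg (eps / (2 * (Cmod L + 1)))%R ltac:(apply: Rdiv_lt_0_compat; lra).
exists (Rmin (Rmin e1 e3) (e2 / (Cmod M + 1)))%R; split.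
  by apply: Rmin_pos; [apply: Rmin_pos | apply: Rdiv_lt_0_compat; lra].
move=> h hh.
have hh1 := Rlt_le_trans _ _ _ hh (Rle_trans _ _ _ (Rmin_l _ _) (Rmin_l _ _)).
have hh3 := Rlt_le_trans _ _ _ hh (Rle_trans _ _ _ (Rmin_l _ _) (Rmin_r _ _)).
have hh2 := Rlt_le_trans _ _ _ hh (Rmin_r _ _).
have {h1} h1 := h1 h hh1; have {h3} h3 := h3 h hh3.
pose k := g (z + h) - g z.
have hk : (Cmod k < e2)%R.
  apply: Rle_lt_trans h1 _; move: hh2 => /(Rmult_lt_compat_l (Cmod M + 1)%R _ _ ltac:(lra)).
  by have -> : ((Cmod M + 1) * (e2 / (Cmod M + 1)) = e2)%R by field; lra.
have {h2} := h2 k hk; rewrite -/k in h1 h3.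
have -> : g z + k = g (z + h) by rewrite /k; ring.
move=> h2.
have -> : f (g (z + h)) - f (g z) - h * (M * L) =
  (f (g (z + h)) - f (g z) - k * L) + (k - h * M) * L by ring.
apply: Rle_trans (Cmod_triangle _ _) _; rewrite Cmod_mult.
have h0 := Cmod_ge_0 h.
have a1 : (eps / (2 * (Cmod M + 1)) * Cmod k <= eps / 2 * Cmod h)%R.
  have -> : (eps / 2 * Cmod h = eps / (2 * (Cmod M + 1)) * ((Cmod M + 1) * Cmod h))%R by field; lra.
  by apply: Rmult_le_compat_l => //; apply: Rlt_le; apply: Rdiv_lt_0_compat; lra.
have a2 : (Cmod (k - h * M) * Cmod L <= eps / 2 * Cmod h)%R.
  apply: (Rle_trans _ (eps / (2 * (Cmod L + 1)) * Cmod h * (Cmod L + 1))).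
    by apply: Rmult_le_compat => //; [apply: Cmod_ge_0 | lra].
  by apply: Req_le; field; lra.
lra.
Qed.

Lemma Cder_sq (z : C) : Cder (fun x => x * x) z (2 * z).
Proof.
apply: (@Cder_quad _ _ _ 1%R 1%R); first lra.
move=> h _; have -> : (z + h) * (z + h) - z * z - h * (2 * z) = h * h by ring.
rewrite Cmod_mult; lra.
Qed.

Lemma Cder_scal (c : C) (f : C -> C) (z L : C) :
  Cder f z L -> Cder (fun x => c * f x) z (c * L).
Proof.
move=> hf; have h : Cder (fun x => c * x) (f z) c.
  apply: (@Cder_quad _ _ _ 0%R 1%R); first lra.
  move=> h _; have -> : c * (f z + h) - c * f z - h * c = 0 by ring.
  rewrite Cmod_0; lra.
by apply: Cder_eq (Cder_comp hf h); ring.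
Qed.

Lemma Cder_opp (f : C -> C) (z L : C) : Cder f z L -> Cder (fun x => - f x) z (- L).
Proof.
move=> hf; have := Cder_scal (- RtoC 1) hf.
by move=> h; apply: Cder_eq (Cder_ext _ h) => [|x]; ring.
Qed.

(** Polarisation: f g is half of (f + g)^2 - f^2 - g^2, so the chain rule with [Cder_sq]
    suffices. *)
Lemma Cder_mult (f g : C -> C) (z L M : C) :
  Cder f z L -> Cder g z M -> Cder (fun x => f x * g x) z (L * g z + f z * M).
Proof.
move=> hf hg.
have h1 := Cder_comp (Cder_plus hf hg) (Cder_sq _).
have h2 := Cder_opp (Cder_comp hf (Cder_sq _)).
have h3 := Cder_opp (Cder_comp hg (Cder_sq _)).
have := Cder_scal (/ 2) (Cder_plus (Cder_plus h1 h2) h3).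
by move=> h; apply: Cder_eq (Cder_ext _ h) => [|x] /=; field.
Qed.

Lemma Cder_inv (z : C) : z <> 0 -> Cder Cinv z (- / (z * z)).
Proof.
move=> z0; have m0 : (0 < Cmod z)%R by apply/Cmod_gt_0.
apply: (@Cder_quad _ _ _ (2 / (Cmod z * Cmod z * Cmod z))%R (Cmod z / 2)%R); first lra.
move=> h hh.
have hz : (Cmod z / 2 <= Cmod (z + h))%R.
  have := Cmod_triangle (z + h) (- h); rewrite Cmod_opp.
  have -> : z + h + - h = z by ring.
  lra.
have zh0 : z + h <> 0 by move/(f_equal Cmod); rewrite Cmod_0; lra.
have -> : / (z + h) - / z - h * (- / (z * z)) = h * h * / ((z * z) * (z + h)).
  by field; split.
rewrite !Cmod_mult Cmod_inv; last by apply: Cmult_neq_0 => //; apply: Cmult_neq_0.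
rewrite Rmult_comm; apply: Rmult_le_compat_r; first by have := Cmod_ge_0 h; nra.
rewrite !Cmod_mult.
have -> : (2 / (Cmod z * Cmod z * Cmod z) = / (Cmod z * Cmod z * (Cmod z / 2)))%R by field; lra.
apply: Rinv_le_contravar; first by have := Rmult_lt_0_compat _ _ m0 m0; nra.
by apply: Rmult_le_compat_l; nra.
Qed.

Lemma Cder_csum N (f : 'I_N -> C -> C) (z : C) (L : 'I_N -> C) :
  (forall i, Cder (f i) z (L i)) -> Cder (fun x => csum (fun i => f i x)) z (csum L).
Proof.
rewrite /csum => h; elim: (index_enum _) => [|i r IH].
  by rewrite big_nil; apply: Cder_ext (Cder_const _ _) => x; rewrite big_nil.
rewrite big_cons; apply: Cder_ext (Cder_plus (h i) IH) => x.
by rewrite big_cons.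
Qed.

Lemma Cder_Clim (f : C -> C) (z L : C) (u : nat -> C) :
  Cder f z L -> Clim u z -> Clim (fun n => f (u n)) (f z).
Proof.
move=> /Cder_lip [eta [e0 he]] /Clim_Cmod_sub hu.
have h1 : is_lim_seq (fun n => (Cmod L + 1) * Cmod (u n - z))%R 0%R.
  have -> : 0%R = ((Cmod L + 1) * 0)%R by ring.
  exact: (is_lim_seq_scal_l _ (Cmod L + 1)%R (Rbar.Finite _) hu).
have [n0 hn0] := is_lim_seq_epsE hu e0.
have h2 : Clim (fun n => f (u (n + n0)%coq_nat)) (f z).
  apply: (Clim_squeeze _ ((is_lim_seq_incr_n _ n0 _).1 h1)) => n.
  have -> : u (n + n0)%coq_nat = z + (u (n + n0)%coq_nat - z) by ring.
  have -> : z + (u (n + n0)%coq_nat - z) - z = u (n + n0)%coq_nat - z by ring.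
  apply: he; have := hn0 (n + n0)%coq_nat; rewrite Rminus_0_r Rabs_pos_eq; last exact: Cmod_ge_0.
  by apply; rewrite plusE leq_addl.
by case: h2 => a b; split; [apply: (is_lim_seq_incr_n _ n0 _).2 a | apply: (is_lim_seq_incr_n _ n0 _).2 b].
Qed.

Lemma Cder_line (f : C -> C) (a d : C) (t : R) (L : C) : Cder f (a + RtoC t * d) L ->
  derivable_pt_lim (fun x => Re (f (a + RtoC x * d))) t (Re (d * L)) /\
  derivable_pt_lim (fun x => Im (f (a + RtoC x * d))) t (Im (d * L)).
Proof.
move=> hf.
have key (P : C -> R) : (forall z, Rabs (P z) <= Cmod z)%R ->
    (forall z w, P (z - w)%C = P z - P w)%R -> (forall (r : R) z, P (RtoC r * z)%C = r * P z)%R ->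
    derivable_pt_lim (fun x => P (f (a + RtoC x * d)%C)) t (P (d * L)%C).
  move=> h1 h2 h3 eps he.
  have d0 := Cmod_ge_0 d.
  have [eta [e0 hl]] := hf (eps / (2 * (Cmod d + 1)))%R ltac:(apply: Rdiv_lt_0_compat; lra).
  have q0 : (0 < eta / (Cmod d + 1))%R by apply: Rdiv_lt_0_compat; lra.
  exists (mkposreal _ q0) => h hn /= hh.
  have hk : (Cmod (RtoC h * d) < eta)%R.
    rewrite Cmod_mult Cmod_R.
    have := Rmult_lt_compat_r (Cmod d + 1)%R _ _ ltac:(lra) hh.
    have -> : (eta / (Cmod d + 1) * (Cmod d + 1) = eta)%R by field; lra.
    by have := Rabs_pos h; nra.
  have := hl _ hk.
  have -> : a + RtoC t * d + RtoC h * d = a + RtoC (t + h) * d by rewrite RtoC_plus; ring.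
  set F := f _; set G := f _ => hl'.
  have -> : ((P F - P G) / h - P (d * L)%C = P (F - G - RtoC h * (d * L))%C / h)%R.
    by rewrite !h2 h3; field.
  rewrite Rabs_div //.
  have hp : (0 < Rabs h)%R by apply: Rabs_pos_lt.
  apply: (Rle_lt_trans _ (eps / 2)); last lra.
  apply: (Rmult_le_reg_r (Rabs h)) => //.
  have -> : (Rabs (P (F - G - RtoC h * (d * L))%C) / Rabs h * Rabs h = Rabs (P (F - G - RtoC h * (d * L))%C))%R by field; lra.
  apply: Rle_trans (h1 _) _; rewrite Cmult_assoc; apply: Rle_trans hl' _.
  rewrite Cmod_mult Cmod_R.
  have -> : (eps / 2 * Rabs h = eps / (2 * (Cmod d + 1)) * (Rabs h * (Cmod d + 1)))%R by field; lra.
  apply: Rmult_le_compat_l; first by apply: Rlt_le; apply: Rdiv_lt_0_compat; lra.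
  by apply: Rmult_le_compat_l; lra.
split; apply: key => //.
- exact: re_le_Cmod.
- by move=> r z; rewrite re_scal_l.
- exact: im_le_Cmod.
- by move=> r z; rewrite im_scal_l.
Qed.

(** The mean value theorem for the real and imaginary parts along the segment. Only segments are
    used, hence the convex domains below. *)
Lemma Cder0_const (f : C -> C) (a b : C) :
  (forall t : R, (0 <= t <= 1)%R -> Cder f (a + RtoC t * (b - a)) 0) -> f a = f b.
Proof.
move=> h.
have key (g : R -> R) : (forall t, (0 <= t <= 1)%R -> derivable_pt_lim g t 0) -> g 0%R = g 1%R.
  move=> hg; have [c [hc _]] := @MVT_cor2 g (fun _ => 0%R) 0 1 ltac:(lra) hg.
  by move: hc; rewrite Rmult_0_l; lra.
have e0 : a + RtoC 0 * (b - a) = a by ring.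
have e1 : a + RtoC 1 * (b - a) = b by ring.
have z0 : (b - a) * RtoC 0 = RtoC 0 by ring.
apply: C_ext.
  have := key (fun t => Re (f (a + RtoC t * (b - a)))); rewrite e0 e1; apply=> t /h /Cder_line [+ _].
  by rewrite z0.
have := key (fun t => Im (f (a + RtoC t * (b - a)))); rewrite e0 e1; apply=> t /h /Cder_line [_ +].
by rewrite z0.
Qed.

Lemma Cder_ex_derive (f : C -> C) (z L : C) :
  Cder f z L -> ex_derive (K := C_AbsRing) (V := C_NormedModule) f z.
Proof.
move=> hf; exists L; split; first exact: is_linear_scal_l.
move=> x hx; have {x hx}-> : x = z.
  by symmetry; apply: (is_filter_lim_locally_unique (V := AbsRing_NormedModule C_AbsRing)).
move=> eps; have [eta [e0 he]] := hf eps (cond_pos eps).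
exists (mkposreal _ e0) => y hy.
have := he (y - z); have -> : z + (y - z) = y by ring.
exact.
Qed.

(** ** Power series with radius of convergence at least 1 *)

Definition PSc (c : nat -> C) (w : C) : C := Cser (fun n => c n * Cpow w n).

(** Radius of convergence at least 1, expressed by a geometric bound at every smaller radius. This
    form passes at once to shifted coefficients, to sums and to multiplication by n. *)
Definition gb (c : nat -> C) : Prop :=
  forall rho : R, (0 < rho < 1)%R -> exists B : R, forall n, (Cmod (c n) * rho ^ n <= B)%R.

(** The quotient (1 - t^n) / (1 - t) = 1 + t + ... + t^(n-1) is at least n t^n; this stronger
    inequality is the one that induction proves. *)
Lemma n_geom_bound (t : R) (n : nat) : (0 <= t < 1)%R -> (INR n * t ^ n * (1 - t) <= 1)%R.
Proof.
move=> ht; suff : (INR n * t ^ n * (1 - t) <= 1 - t ^ n)%R by have := pow_le t n ltac:(lra); lra.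
elim: n => [|n IH]; first by rewrite /=; lra.
rewrite S_INR /=; have p0 := pow_le t n ltac:(lra).
have p1 : (t ^ n <= 1)%R by rewrite -(pow1 n); apply: pow_incr; lra.
have h1 := Rmult_le_compat_l t _ _ (proj1 ht) IH.
have h2 : (0 <= (1 - t) * (1 - t * t ^ n))%R by apply: Rmult_le_pos; nra.
lra.
Qed.

Lemma gb_mul_n c : gb c -> gb (fun n => RtoC (INR n) * c n).
Proof.
move=> hc rho hr.
have [r [h1 h2]] : exists r, (rho < r)%R /\ (r < 1)%R by exists ((rho + 1) / 2)%R; lra.
have [B hB] := hc r ltac:(lra).
have hq : (0 <= rho / r < 1)%R.
  split; first by apply: Rlt_le; apply: Rdiv_lt_0_compat; lra.
  by apply: (Rmult_lt_reg_r r); [lra | have -> : (rho / r * r = rho)%R by field; lra]; lra.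
exists (B / (1 - rho / r))%R => n.
rewrite Cmod_mult Cmod_R Rabs_pos_eq; last exact: pos_INR.
have -> : (INR n * Cmod (c n) * rho ^ n = (Cmod (c n) * r ^ n) * (INR n * (rho / r) ^ n))%R.
  by rewrite /Rdiv Rpow_mult_distr pow_inv; field; apply: pow_nonzero; lra.
have h3 := n_geom_bound n hq.
apply: (Rmult_le_reg_r (1 - rho / r)); first lra.
have -> : (B / (1 - rho / r) * (1 - rho / r) = B * 1)%R by field; lra.
rewrite Rmult_assoc; apply: Rmult_le_compat => //.
- by apply: Rmult_le_pos; [apply: Cmod_ge_0 | apply: pow_le; lra].
- apply: Rmult_le_pos; last lra.
  by apply: Rmult_le_pos; [apply: pos_INR | apply: pow_le; lra].
Qed.

Lemma gb_S c : gb c -> gb (fun n => c n.+1).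
Proof.
move=> hc rho hr; have [B hB] := hc rho hr; exists (B / rho)%R => n.
apply: (Rmult_le_reg_r rho); first lra.
have -> : (B / rho * rho = B)%R by field; lra.
by have := hB n.+1; rewrite /=; lra.
Qed.

Lemma gb_dc c : gb c -> gb (fun n => RtoC (INR n.+1) * c n.+1).
Proof. by move/gb_mul_n /gb_S. Qed.

Lemma gb_scal a c : gb c -> gb (fun n => a * c n).
Proof.
move=> hc rho hr; have [B hB] := hc rho hr; exists (Cmod a * B)%R => n.
rewrite Cmod_mult Rmult_assoc; apply: Rmult_le_compat_l => //; exact: Cmod_ge_0.
Qed.

Lemma gb_plus c d : gb c -> gb d -> gb (fun n => c n + d n).
Proof.
move=> hc hd rho hr; have [B hB] := hc rho hr; have [D hD] := hd rho hr; exists (B + D)%R => n.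
have p := pow_le rho n ltac:(lra).
apply: (Rle_trans _ ((Cmod (c n) + Cmod (d n)) * rho ^ n)).
  by apply: Rmult_le_compat_r => //; apply: Cmod_triangle.
by have := hB n; have := hD n; lra.
Qed.

Lemma gb_le c d : (forall n, (Cmod (c n) <= Cmod (d n))%R) -> gb d -> gb c.
Proof.
move=> h hd rho hr; have [D hD] := hd rho hr; exists D => n.
by apply: Rle_trans (hD n); apply: Rmult_le_compat_r => //; apply: pow_le; lra.
Qed.

Lemma gb_abs_summable c (r : R) : gb c -> (0 <= r < 1)%R -> ex_series (fun n => Cmod (c n) * r ^ n)%R.
Proof.
move=> hc hr; set rho := ((r + 1) / 2)%R.
have hr1 : (r < rho /\ rho < 1)%R by rewrite /rho; lra.
have [B hB] := hc rho ltac:(lra).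
apply: (ex_series_le (V := R_CompleteNormedModule) _ (fun n => B * (r / rho) ^ n)%R).
  move=> n; rewrite /norm /= /abs /= Rabs_pos_eq; last first.
    by apply: Rmult_le_pos; [apply: Cmod_ge_0 | apply: pow_le; lra].
  have -> : (Cmod (c n) * r ^ n = Cmod (c n) * rho ^ n * (r / rho) ^ n)%R.
    by rewrite /Rdiv Rpow_mult_distr pow_inv; field; apply: pow_nonzero; lra.
  apply: Rmult_le_compat_r => //; apply: pow_le.
  by apply: Rmult_le_pos; [lra | apply: Rlt_le; apply: Rinv_0_lt_compat; lra].
apply: (ex_series_scal_l B); apply: ex_series_geom; rewrite Rabs_pos_eq.
  by apply: (Rmult_lt_reg_r rho); [lra | have -> : (r / rho * rho = r)%R by field; lra]; lra.
by apply: Rmult_le_pos; [lra | apply: Rlt_le; apply: Rinv_0_lt_compat; lra].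
Qed.

Lemma gb_summable c w : gb c -> (Cmod w < 1)%R -> summable (fun n => c n * Cpow w n).
Proof.
move=> hc hw; have := gb_abs_summable hc (conj (Cmod_ge_0 w) hw).
by apply: ex_series_ext => n; rewrite Cmod_mult Cmod_pow.
Qed.

(** The derivative n w^(n-1), generated by the product rule so that no predecessor of the exponent
    occurs. *)
Fixpoint dpow (w : C) (n : nat) : C :=
  if n is m.+1 then w * dpow w m + Cpow w m else 0.

Lemma dpowS w n : dpow w n.+1 = RtoC (INR n.+1) * Cpow w n.
Proof.
elim: n => [|n IH]; first by rewrite /=; ring.
by rewrite [LHS]/= -/(dpow w n.+1) IH (S_INR n.+1) RtoC_plus Cpow_S; ring.
Qed.

(** Both bounds are multiplied through by powers of [r], since the natural exponents n - 1 and n - 2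
    would force case distinctions. With D_n = [dpow w n], the remainders E_n satisfy E_(n+1) = (w +
    h) E_n + h^2 D_n, which drives the induction. *)
Lemma pow_taylor (w h : C) (r : R) (n : nat) : (0 < r)%R -> (Cmod w <= r)%R -> (Cmod (w + h) <= r)%R ->
  (Cmod (dpow w n) * r <= INR n * r ^ n)%R /\
  (Cmod (Cpow (w + h) n - Cpow w n - h * dpow w n) * (r * r) <= Cmod h * Cmod h * (INR n * INR n * r ^ n))%R.
Proof.
move=> r0 hw hwh; elim: n => [|n [IH1 IH2]].
  rewrite /= Cmod_0; have -> : 1 - 1 - h * 0 = 0 by ring.
  by rewrite Cmod_0; lra.
have p0 := pow_le r n ltac:(lra).
have pw : (Cmod (Cpow w n) <= r ^ n)%R by rewrite Cmod_pow; apply: pow_incr; split=> //; apply: Cmod_ge_0.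
have n0 := pos_INR n.
have d0 := Cmod_ge_0 (dpow w n).
split.
  have := Cmod_triangle (w * dpow w n) (Cpow w n); rewrite Cmod_mult => ht.
  rewrite S_INR /=.
  have : (Cmod w * Cmod (dpow w n) * r <= r * (INR n * r ^ n))%R.
    rewrite Rmult_assoc; apply: Rmult_le_compat => //; first exact: Cmod_ge_0.
    by apply: Rmult_le_pos; lra.
  by nra.
have e : Cpow (w + h) n.+1 - Cpow w n.+1 - h * dpow w n.+1 =
  (w + h) * (Cpow (w + h) n - Cpow w n - h * dpow w n) + h * h * dpow w n by rewrite /=; ring.
rewrite e; have := Cmod_triangle ((w + h) * (Cpow (w + h) n - Cpow w n - h * dpow w n)) (h * h * dpow w n).
rewrite !Cmod_mult => ht.
set E := Cmod (_ - _ - _) in IH2 ht *; have E0 : (0 <= E)%R by apply: Cmod_ge_0.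
have h0 := Cmod_ge_0 h.
have a1 : (Cmod (w + h) * E * (r * r) <= r * (Cmod h * Cmod h * (INR n * INR n * r ^ n)))%R.
  rewrite Rmult_assoc; apply: Rmult_le_compat => //; first exact: Cmod_ge_0.
  by apply: Rmult_le_pos => //; nra.
have a2 : (Cmod h * Cmod h * Cmod (dpow w n) * (r * r) <= Cmod h * Cmod h * r * (INR n * r ^ n))%R.
  have -> : (Cmod h * Cmod h * Cmod (dpow w n) * (r * r) = Cmod h * Cmod h * r * (Cmod (dpow w n) * r))%R by ring.
  by apply: Rmult_le_compat_l => //; apply: Rmult_le_pos; nra.
rewrite S_INR /=.
apply: (Rle_trans _ (r * (Cmod h * Cmod h * (INR n * INR n * r ^ n)) + Cmod h * Cmod h * r * (INR n * r ^ n)))%R.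
  apply: Rle_trans (Rmult_le_compat_r (r * r) _ _ ltac:(nra) ht) _; lra.
have -> : (Cmod h * Cmod h * ((INR n + 1) * (INR n + 1) * (r * r ^ n)) =
 r * (Cmod h * Cmod h * (INR n * INR n * r ^ n)) + Cmod h * Cmod h * r * (INR n * r ^ n) + Cmod h * Cmod h * r * (INR n + 1) * r ^ n)%R by ring.
suff : (0 <= Cmod h * Cmod h * r * (INR n + 1) * r ^ n)%R by lra.
by apply: Rmult_le_pos => //; apply: Rmult_le_pos; nra.
Qed.

(** Termwise differentiation with a quadratic remainder: at a radius r strictly between |w| and 1
    the remainders are dominated by |h|^2 n^2 |c n| r^n / r^2, summable because multiplying the
    coefficients by n twice preserves [gb]. *)
Lemma Cder_PSc c w : gb c -> (Cmod w < 1)%R ->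
  Cder (PSc c) w (PSc (fun n => RtoC (INR n.+1) * c n.+1) w).
Proof.
move=> hc hw; set r := ((Cmod w + 1) / 2)%R.
have w0 := Cmod_ge_0 w.
have hr : (Cmod w < r /\ r < 1)%R by rewrite /r; lra.
have r0 : (0 < r)%R by lra.
have hb := gb_abs_summable (gb_mul_n (gb_mul_n hc)) (conj (Rlt_le _ _ r0) (proj2 hr)).
set b := (fun n => _ * _)%R in hb.
have eb n : (b n = Cmod (c n) * (INR n * INR n * r ^ n))%R.
  by rewrite /b !Cmod_mult !Cmod_R Rabs_pos_eq; [ring | apply: pos_INR].
apply: (@Cder_quad _ _ _ (Series b / (r * r))%R (r - Cmod w)%R); first lra.
move=> h hh.
have hwh : (Cmod (w + h) <= r)%R by have := Cmod_triangle w h; lra.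
have s1 : summable (fun n => c n * Cpow (w + h) n) by apply: gb_summable => //; lra.
have s2 : summable (fun n => c n * Cpow w n) by apply: gb_summable.
have s3 : summable (fun n => c n * dpow w n).
  apply/summable_S; apply: summable_ext (gb_summable (gb_dc hc) hw) => n.
  by rewrite dpowS; ring.
have -> : PSc (fun n => RtoC (INR n.+1) * c n.+1) w = Cser (fun n => c n * dpow w n).
  rewrite (Cser_S s3) [dpow w 0]/= Cmult_0_r Cplus_0_l; apply: Cser_ext => n.
  by rewrite dpowS; ring.
rewrite /PSc -Cser_scal // -!Cser_minus //; last 2 first.
- exact: summable_minus.
- exact: summable_scal.
have s4 : summable (fun n => c n * Cpow (w + h) n - c n * Cpow w n - h * (c n * dpow w n)).
  by apply: summable_minus; [apply: summable_minus | apply: summable_scal].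
apply: Rle_trans (Cmod_Cser s4) _.
have -> : (Series b / (r * r) * (Cmod h * Cmod h) = Series (fun n => (Cmod h * Cmod h / (r * r)) * b n))%R.
  by rewrite Series_scal_l; field; lra.
apply: Series_le; last exact: (ex_series_scal_l (Cmod h * Cmod h / (r * r))%R).
move=> n; split; first exact: Cmod_ge_0.
have -> : c n * Cpow (w + h) n - c n * Cpow w n - h * (c n * dpow w n) =
  c n * (Cpow (w + h) n - Cpow w n - h * dpow w n) by ring.
rewrite Cmod_mult eb.
have [_ ht] := pow_taylor n r0 (Rlt_le _ _ (proj1 hr)) hwh.
have rr : (0 < r * r)%R by nra.
apply: (Rmult_le_reg_r (r * r)) => //.
have -> : (Cmod h * Cmod h / (r * r) * (Cmod (c n) * (INR n * INR n * r ^ n)) * (r * r) =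
  Cmod (c n) * (Cmod h * Cmod h * (INR n * INR n * r ^ n)))%R by field; lra.
rewrite Rmult_assoc; apply: Rmult_le_compat_l => //; exact: Cmod_ge_0.
Qed.

(** * The exponential and the logarithm on the slit plane *)

Lemma re_Cexp (w : C) : Re (Cexp w) = (exp (Re w) * cos (Im w))%R.
Proof. rewrite /Cexp /=; ring. Qed.
Lemma im_Cexp (w : C) : Im (Cexp w) = (exp (Re w) * sin (Im w))%R.
Proof. rewrite /Cexp /=; ring. Qed.

Lemma Cexp_plus (a b : C) : Cexp (a + b) = Cexp a * Cexp b.
Proof.
apply: C_ext.
  rewrite [LHS]re_Cexp re_plus im_plus exp_plus cos_plus [RHS]re_mult !re_Cexp !im_Cexp; ring.
by rewrite [LHS]im_Cexp re_plus im_plus exp_plus sin_plus [RHS]im_mult !re_Cexp !im_Cexp; ring.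
Qed.

Lemma Cexp_0 : Cexp (RtoC 0) = RtoC 1.
Proof. by apply: C_ext; rewrite ?re_Cexp ?im_Cexp /= exp_0 ?cos_0 ?sin_0; ring. Qed.

Lemma Cmod_Cexp (w : C) : Cmod (Cexp w) = exp (Re w).
Proof.
rewrite /Cexp Cmod_mult Cmod_R Rabs_pos_eq; last by apply: Rlt_le; apply: exp_pos.
rewrite -[RHS]Rmult_1_r; congr (_ * _)%R.
rewrite /Cmod -sqrt_1; congr sqrt; rewrite /=.
have := sin2_cos2 (Im w); rewrite /Rsqr; lra.
Qed.

Lemma Cexp_ne0 (w : C) : Cexp w <> RtoC 0.
Proof. by move/(f_equal Cmod); rewrite Cmod_Cexp Cmod_0; have := exp_pos (Re w); lra. Qed.

Lemma Cexp_opp (w : C) : Cexp (- w) = / Cexp w.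
Proof.
have h : Cexp w * Cexp (- w) = 1 by rewrite -Cexp_plus Cplus_opp_r Cexp_0.
have -> : Cexp (- w) = / Cexp w * (Cexp w * Cexp (- w)) by field; apply: Cexp_ne0.
by rewrite h; field; apply: Cexp_ne0.
Qed.

Lemma Cexp_minus (a b : C) : Cexp (a - b) = Cexp a / Cexp b.
Proof. by rewrite /Cminus Cexp_plus Cexp_opp. Qed.

Lemma Cexp_nat (n : nat) (w : C) : Cexp (RtoC (INR n) * w) = Cpow (Cexp w) n.
Proof.
elim: n => [|n IH]; first by rewrite Cmult_0_l Cexp_0.
rewrite S_INR RtoC_plus Cpow_S -IH -Cexp_plus; congr Cexp; ring.
Qed.

Lemma Cexp_R (x : R) : Cexp (RtoC x) = RtoC (exp x).
Proof. by apply: C_ext; rewrite ?re_Cexp ?im_Cexp /= ?cos_0 ?sin_0; ring. Qed.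

Lemma Cexp_PI : Cexp (Ci * RtoC PI) = RtoC (-1).
Proof.
apply: C_ext; rewrite ?re_Cexp ?im_Cexp /=.
  have -> : (0 * PI - 1 * 0 = 0)%R by ring.
  have -> : (0 * 0 + 1 * PI = PI)%R by ring.
  by rewrite exp_0 cos_PI; ring.
have -> : (0 * 0 + 1 * PI = PI)%R by ring.
by rewrite sin_PI; ring.
Qed.

(** The inequality 1 + x <= exp x bounds from below; at -x it gives exp x (1 - x) <= 1, which bounds
    from above. *)
Lemma exp_est (x : R) : (Rabs x <= / 2)%R -> (Rabs (exp x - 1 - x) <= 2 * (x * x))%R /\ (exp x <= 2)%R.
Proof.
move=> hx; have /Rabs_le_between hx' := hx.
have h1 := exp_ineq1_le x; have h2 := exp_ineq1_le (- x).
have h3 : (exp x * exp (- x) = 1)%R by rewrite -exp_plus Rplus_opp_r exp_0.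
have h4 : (exp x * (1 - x) <= 1)%R by rewrite -h3; apply: Rmult_le_compat_l; [apply: Rlt_le; apply: exp_pos | lra].
have p := exp_pos x.
split; last by nra.
rewrite Rabs_pos_eq; nra.
Qed.

(** 1 - cos y = 2 sin^2 (y / 2), combined with |sin u| <= |u|. *)
Lemma cos_est (y : R) : (0 <= 1 - cos y <= y * y / 2)%R.
Proof.
split; first by have := COS_bound y; lra.
have -> : y = (2 * (y / 2))%R by field.
rewrite cos_2a_sin.
suff : (Rabs (sin (y / 2)) <= Rabs (y / 2))%R.
  move=> h; have := Rmult_le_compat _ _ _ _ (Rabs_pos _) (Rabs_pos _) h h.
  rewrite -!Rabs_mult !Rabs_pos_eq; nra.
move: (y / 2)%R => u.
wlog u0 : u / (0 <= u)%R.
  move=> h; case: (Rle_dec 0 u) => hu; first exact: h.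
  by have := h (- u)%R ltac:(lra); rewrite sin_neg !Rabs_Ropp.
rewrite (Rabs_pos_eq u) //; apply: Rabs_le.
case: u0 => [u0|<-]; last by rewrite sin_0; lra.
have h1 := sin_lt_x u u0; split; last lra.
case: (Rle_dec u PI) => hu; first by have := sin_ge_0 u (Rlt_le _ _ u0) hu; lra.
have := SIN_bound u; have := PI2_1; lra.
Qed.

Lemma sin_est (y : R) : (Rabs y <= 1 -> Rabs (sin y - y) <= y * y)%R.
Proof.
move=> hy; case: (MVT_abs sin cos 0 y) => [c _|c [hc1 _]]; first exact: derivable_pt_lim_sin.
have [c' [hc' hb]] : exists c, (sin y - y = (cos c - 1) * y /\ Rabs c <= Rabs y)%R.
  case: (MVT_gen (fun x => sin x - x)%R 0 y (fun x => cos x - 1)%R).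
  - move=> x _; auto_derive => //; ring.
  - move=> x _; apply: derivable_continuous_pt; apply: derivable_pt_minus; [exact: derivable_pt_sin | exact: derivable_pt_id].
  move=> c0 [hc0 e0]; exists c0; split; first by move: e0; rewrite sin_0; lra.
  move: hc0; rewrite /Rmin /Rmax; case: Rle_dec => h [h1 h2]; rewrite /Rabs; do 2 case: Rcase_abs => ?; lra.
rewrite hc' Rabs_mult.
have [q1 q2] := cos_est c'.
have a1 : (Rabs (cos c' - 1) <= Rabs y / 2)%R.
  rewrite Rabs_left1; last lra.
  have : (c' * c' = Rabs c' * Rabs c')%R by rewrite -Rabs_mult Rabs_pos_eq //; nra.
  have := Rabs_pos c'; nra.
have -> : (y * y = Rabs y * Rabs y)%R by rewrite -Rabs_mult Rabs_pos_eq //; nra.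
by have := Rabs_pos y; nra.
Qed.

Lemma Cexp_est (w : C) : (Cmod w <= / 2)%R -> (Cmod (Cexp w - 1 - w) <= 8 * (Cmod w * Cmod w))%R.
Proof.
move=> hw; have hx := Rle_trans _ _ _ (re_le_Cmod w) hw; have hy := Rle_trans _ _ _ (im_le_Cmod w) hw.
have rw := re_le_Cmod w; have iw := im_le_Cmod w.
apply: Rle_trans (Cmod_le_abs _) _.
rewrite !re_minus !im_minus re_Cexp im_Cexp re_RtoC im_RtoC.
move: hx hy rw iw; set x := Re w; set y := Im w; set m := Cmod w => hx hy rw iw.
have [e1 e2] := exp_est hx; have [c1 c2] := cos_est y; have s1 := @sin_est y ltac:(lra).
have ex0 := exp_pos x.
have xx : (x * x = Rabs x * Rabs x)%R by rewrite -Rabs_mult Rabs_pos_eq //; nra.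
have yy : (y * y = Rabs y * Rabs y)%R by rewrite -Rabs_mult Rabs_pos_eq //; nra.
have ax := Rabs_pos x; have ay := Rabs_pos y.
have a1 : (Rabs (exp x * cos y - 1 - x) <= 2 * (x * x) + y * y)%R.
  have -> : (exp x * cos y - 1 - x = (exp x - 1 - x) + exp x * - (1 - cos y))%R by ring.
  apply: Rle_trans (Rabs_triang _ _) _; rewrite Rabs_mult Rabs_Ropp (Rabs_pos_eq (exp x)) ?(Rabs_pos_eq (1 - cos y)); try lra.
  nra.
have sy : (Rabs (sin y) <= 2 * Rabs y)%R.
  have -> : sin y = ((sin y - y) + y)%R by ring.
  have := Rabs_triang (sin y - y) y; nra.
have a2 : (Rabs (exp x * sin y - 0 - y) <= 4 * (Rabs x * Rabs y) + y * y)%R.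
  have -> : (exp x * sin y - 0 - y = (exp x - 1) * sin y + (sin y - y))%R by ring.
  have h : (Rabs (exp x - 1) <= 2 * Rabs x)%R.
    have -> : (exp x - 1 = (exp x - 1 - x) + x)%R by ring.
    have := Rabs_triang (exp x - 1 - x) x; nra.
  have := Rabs_triang ((exp x - 1) * sin y) (sin y - y); rewrite Rabs_mult.
  have := Rmult_le_compat _ _ _ _ (Rabs_pos _) (Rabs_pos _) h sy; nra.
have : (Rabs x * Rabs y <= m * m)%R by apply: Rmult_le_compat.
have : (Rabs x * Rabs x <= m * m)%R by apply: Rmult_le_compat.
have : (Rabs y * Rabs y <= m * m)%R by apply: Rmult_le_compat.
lra.
Qed.

Lemma Cder_Cexp (w : C) : Cder Cexp w (Cexp w).
Proof.
apply: (@Cder_quad _ _ _ (Cmod (Cexp w) * 8)%R (/ 2)%R); first lra.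
move=> h hh; rewrite Cexp_plus.
have -> : Cexp w * Cexp h - Cexp w - h * Cexp w = Cexp w * (Cexp h - 1 - h) by ring.
rewrite Cmod_mult Rmult_assoc; apply: Rmult_le_compat_l; first exact: Cmod_ge_0.
by apply: Cexp_est; lra.
Qed.

Lemma Cder_Cexp_lin (a b s : C) : Cder (fun s => Cexp (a * s + b)) s (a * Cexp (a * s + b)).
Proof.
have h : Cder (fun s => a * s + b) s a.
  by apply: Cder_eq (Cder_plus (Cder_scal a (Cder_id s)) (Cder_const b s)); ring.
exact: (Cder_comp h (Cder_Cexp _)).
Qed.

Lemma Clim_Cexp u (l : C) : Clim u l -> Clim (fun n => Cexp (u n)) (Cexp l).
Proof. exact: (Cder_Clim (Cder_Cexp l)). Qed.

Lemma slit_ne0 (z : C) : slit z -> z <> RtoC 0.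
Proof. by move=> h e; apply: h; rewrite e /=; lra. Qed.

Lemma slit_den (z : C) : slit z -> (0 < Cmod z - Re z)%R.
Proof.
move=> h; case: (Rlt_dec 0 (Cmod z - Re z)%R) => // hn; case: h.
have h1 := Rle_trans _ _ _ (Rle_abs _) (re_le_Cmod z).
have e : Cmod z = Re z by lra.
have m := Cmod2_alt z; split; last by rewrite -e; apply: Cmod_ge_0.
move: m; rewrite e /= !Rmult_1_r => m.
have : (Im z * Im z = 0)%R by lra.
by case/Rmult_integral.
Qed.

(* The half-angle formula makes the branch cut of [Carg] disappear. *)
Lemma Carg_atan (z : C) : slit z -> Carg z = (PI - 2 * atan (Im z / (Cmod z - Re z)))%R.
Proof.
move=> hz; have d0 := slit_den hz; have z0 := slit_ne0 hz.
have m0 : (0 < Cmod z)%R by apply/Cmod_gt_0.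
set t := (Im z / (Cmod z - Re z))%R.
have [b1 b2] := atan_bound t.
have ec : cos (PI - 2 * atan t) = (Re z / Cmod z)%R.
  rewrite cos_minus cos_PI sin_PI cos_2a_cos cos_atan.
  have s0 : (0 < 1 + t * t)%R by nra.
  rewrite /Rsqr.
  have -> : (2 * (1 / sqrt (1 + t * t)) * (1 / sqrt (1 + t * t)) = 2 / (1 + t * t))%R.
    have sp := sqrt_lt_R0 _ s0; have := sqrt_sqrt (1 + t * t) ltac:(lra).
    by move: (sqrt _) sp => r r0 <-; field; lra.
  have e : (1 + t * t = 2 * Cmod z / (Cmod z - Re z))%R.
    rewrite /t; have m := Cmod2_alt z; rewrite /= !Rmult_1_r in m.
    have im2 : (Im z * Im z = Cmod z * Cmod z - Re z * Re z)%R by lra.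
    have -> : (1 + Im z / (Cmod z - Re z) * (Im z / (Cmod z - Re z)) =
       1 + (Im z * Im z) / ((Cmod z - Re z) * (Cmod z - Re z)))%R by field; lra.
    by rewrite im2; field; lra.
  by rewrite e; field; split; lra.
rewrite /Carg -ec; case: Rle_dec => him /=.
  have t0 : (0 <= t)%R by apply: Rmult_le_pos => //; apply: Rlt_le; apply: Rinv_0_lt_compat.
  have a0 : (0 <= atan t)%R by case: t0 => [h|<-]; [rewrite -atan_0; apply: Rlt_le; apply: atan_increasing | rewrite atan_0; lra].
  by rewrite acos_cos //; lra.
have t0 : (t < 0)%R.
  have him' : (Im z < 0)%R by lra.
  rewrite /t /Rdiv; have := Rinv_0_lt_compat _ d0; move: (/ _)%R => r; nra.
have a0 : (atan t < 0)%R by rewrite -atan_0; apply: atan_increasing.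
have -> : cos (PI - 2 * atan t) = cos (PI + 2 * atan t)%R.
  rewrite -(cos_neg (PI - _)) -(cos_period _ 1); congr cos; rewrite /=; ring.
rewrite /= acos_cos; [by lra | by split; lra].
Qed.

Lemma Carg_bound (z : C) : slit z -> (0 < Carg z < 2 * PI)%R.
Proof. by move=> /Carg_atan ->; have := atan_bound (Im z / (Cmod z - Re z)); lra. Qed.

Lemma re_Clog z : Re (Clog z) = ln (Cmod z).
Proof. rewrite /Clog /=; ring. Qed.
Lemma im_Clog z : Im (Clog z) = Carg z.
Proof. rewrite /Clog /=; ring. Qed.

Lemma Cexp_Clog (z : C) : z <> RtoC 0 -> Cexp (Clog z) = z.
Proof.
move=> z0; have m0 : (0 < Cmod z)%R by apply/Cmod_gt_0.
have m := Cmod2_alt z; rewrite /= !Rmult_1_r in m.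
have hb : (-1 <= Re z / Cmod z <= 1)%R.
  have /Rabs_le_between h := re_le_Cmod z.
  split; apply: (Rmult_le_reg_r (Cmod z)) => //; rewrite /Rdiv Rmult_assoc Rinv_l; lra.
have hs : (sqrt (1 - (Re z / Cmod z)²) = Rabs (Im z) / Cmod z)%R.
  have -> : (1 - (Re z / Cmod z)² = (Rabs (Im z) / Cmod z)²)%R.
    rewrite !Rsqr_div' -Rsqr_abs; rewrite /Rsqr; apply: (Rmult_eq_reg_r (Cmod z * Cmod z)); last nra.
    by field_simplify; lra.
  rewrite sqrt_Rsqr //; apply: Rmult_le_pos; first exact: Rabs_pos.
  by apply: Rlt_le; apply: Rinv_0_lt_compat.
apply: C_ext; rewrite ?re_Cexp ?im_Cexp re_Clog im_Clog exp_ln // /Carg; case: Rle_dec => him /=.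
- by rewrite cos_acos //; field; lra.
- have -> : cos (2 * PI - acos (Re z / Cmod z)) = cos (acos (Re z / Cmod z)).
    rewrite -(cos_neg (2 * PI - _)) -(cos_period _ 1); congr cos; rewrite /=; ring.
  by rewrite cos_acos //; field; lra.
- by rewrite sin_acos // hs Rabs_pos_eq //; field; lra.
- have -> : sin (2 * PI - acos (Re z / Cmod z)) = (- sin (acos (Re z / Cmod z)))%R.
    rewrite -sin_neg -(sin_period (- _) 1); congr sin; rewrite /=; ring.
  by rewrite sin_acos // hs Rabs_left1; [field; lra | lra].
Qed.

(* An inverse function argument: [Clog] is continuous and a right inverse of [Cexp]. *)
Lemma Carg_cont (z : C) : slit z -> forall eps : R, (0 < eps)%R -> exists eta : R, (0 < eta)%R /\
  forall h : C, (Cmod h < eta)%R -> slit (z + h) /\ (Rabs (Carg (z + h)%C - Carg z) < eps)%R.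
Proof.
move=> hz eps he; have d0 := slit_den hz.
set d := (Cmod z - Re z)%R in d0.
have hc : continuity_pt atan (Im z / d)%R by apply: derivable_continuous_pt; apply: derivable_pt_atan.
have [al [a0 ha]] := hc (eps / 2)%R ltac:(lra).
have i0 := Rabs_pos (Im z).
set eta := Rmin (d / 4) (al * (d * d / 4) / (d + 2 * Rabs (Im z) + 1))%R.
have e0 : (0 < eta)%R.
  apply: Rmin_pos; first lra.
  by apply: Rdiv_lt_0_compat; [apply: Rmult_lt_0_compat; nra | lra].
exists eta; split=> // h hh.
have h1 := Rlt_le_trans _ _ _ hh (Rmin_l _ _); have h2 := Rlt_le_trans _ _ _ hh (Rmin_r _ _).
have rh := re_le_Cmod h; have ih := im_le_Cmod h; have h0 := Cmod_ge_0 h.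
have /Rabs_le_between rh' := rh.
set d' := (Cmod (z + h)%C - Re (z + h)%C)%R.
have dd : (Rabs (d' - d) <= 2 * Cmod h)%R.
  rewrite /d' /d re_plus; have t1 := Cmod_triangle z h; have := Cmod_triangle (z + h) (- h).
  have -> : z + h + - h = z by ring.
  by rewrite Cmod_opp => t2; apply: Rabs_le; lra.
have /Rabs_le_between dd' := dd.
have d'0 : (d / 2 <= d')%R by lra.
have sl : slit (z + h).
  move=> [im0 re0]; have : d' = 0%R; last lra.
  rewrite /d'; have m := Cmod2_alt (z + h); rewrite im0 in m.
  have := Cmod_ge_0 (z + h); move: m re0; set A := Cmod _; set B := Re _ => /= m B0 A0.
  by have : ((A - B) * (A + B) = 0)%R; [lra | case/Rmult_integral; lra].
split=> //; rewrite !Carg_atan // -/d -/d'.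
have hq : (Rabs (Im (z + h)%C / d' - Im z / d) < al)%R.
  have -> : (Im (z + h)%C / d' - Im z / d = (Im h * d - Im z * (d' - d)) / (d' * d))%R.
    by rewrite im_plus; field; lra.
  rewrite Rabs_div; last nra.
  have p : (d * d / 2 <= d' * d)%R by nra.
  rewrite (Rabs_pos_eq (d' * d)); last nra.
  have n1 : (Rabs (Im h * d - Im z * (d' - d)) <= Cmod h * (d + 2 * Rabs (Im z) + 1))%R.
    apply: Rle_trans (Rabs_triang _ _) _; rewrite Rabs_Ropp !Rabs_mult (Rabs_pos_eq d); last lra.
    have := Rmult_le_compat_l _ _ _ i0 dd; nra.
  have n2 : (Cmod h * (d + 2 * Rabs (Im z) + 1) < al * (d * d / 4))%R.
    have := Rmult_lt_compat_r (d + 2 * Rabs (Im z) + 1)%R _ _ ltac:(lra) h2.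
    by rewrite /Rdiv (Rmult_assoc _ (/ _)) Rinv_l; [rewrite Rmult_1_r; lra | lra].
  apply: (Rmult_lt_reg_r (d' * d)); first nra.
  rewrite /Rdiv Rmult_assoc Rinv_l; last nra.
  nra.
have := ha (Im (z + h)%C / d')%R; rewrite /D_x /no_cond /= /R_dist.
case: (Req_dec (Im z / d) (Im (z + h)%C / d')) => [<- _|ne hx].
  rewrite Rminus_diag Rabs_R0; lra.
have := hx (conj (conj I ne) hq); set A := atan _; set B := atan _ => hAB.
have -> : (PI - 2 * A - (PI - 2 * B) = - (2 * (A - B)))%R by ring.
rewrite Rabs_Ropp Rabs_mult (Rabs_pos_eq 2); lra.
Qed.

Lemma ln_lip (x y : R) : (0 < x)%R -> (0 < y)%R -> (Rabs (ln y - ln x) <= Rabs (y - x) * (/ x + / y))%R.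
Proof.
move=> hx hy.
have key (a b : R) : (0 < a)%R -> (0 < b)%R -> (ln b - ln a <= (b - a) * / a)%R.
  move=> ha hb; rewrite -ln_div //.
  have h1 := exp_ineq1_le (ln (b / a)); rewrite exp_ln in h1; last exact: Rdiv_lt_0_compat.
  have e : ((b - a) * / a = b / a - 1)%R by field; lra.
  lra.
have k1 := key _ _ hx hy; have k2 := key _ _ hy hx.
have ix := Rinv_0_lt_compat _ hx; have iy := Rinv_0_lt_compat _ hy.
by rewrite /Rabs; do 2 case: Rcase_abs => ?; nra.
Qed.

(** Let k be the increment of [Clog], so that z + h = z exp k. Continuity makes k small, and then
    exp k = 1 + k + O(k^2) can be solved for k up to a second order error. *)
Lemma Cder_Clog (z : C) : slit z -> Cder Clog z (/ z).
Proof.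
move=> hz; have z0 := slit_ne0 hz.
have m0 : (0 < Cmod z)%R by apply/Cmod_gt_0.
have cont (e : R) : (0 < e)%R -> exists eta : R, (0 < eta)%R /\
    forall h : C, (Cmod h < eta)%R -> slit (z + h) /\ (Cmod (Clog (z + h) - Clog z) < e)%R.
  move=> he; have [eta [e0 hc]] := Carg_cont hz (eps := (e / 2)%R) ltac:(lra).
  set K := (/ Cmod z + / (Cmod z / 2))%R.
  have i1 := Rinv_0_lt_compat _ m0; have i2 := Rinv_0_lt_compat (Cmod z / 2)%R ltac:(lra).
  have K0 : (0 < K)%R by rewrite /K; lra.
  exists (Rmin (Rmin eta (Cmod z / 2)) (e / 2 / K)); split.
    by apply: Rmin_pos; [apply: Rmin_pos; lra | apply: Rdiv_lt_0_compat; lra].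
  move=> h hh.
  have h1 := Rlt_le_trans _ _ _ hh (Rle_trans _ _ _ (Rmin_l _ _) (Rmin_l _ _)).
  have h2 := Rlt_le_trans _ _ _ hh (Rle_trans _ _ _ (Rmin_l _ _) (Rmin_r _ _)).
  have h3 := Rlt_le_trans _ _ _ hh (Rmin_r _ _).
  have [sl hA] := hc h h1; split=> //.
  apply: Rle_lt_trans (Cmod_le_abs _) _; rewrite re_minus im_minus !re_Clog !im_Clog.
  have t1 := Cmod_triangle z h; have := Cmod_triangle (z + h) (- h).
  have -> : z + h + - h = z by ring.
  rewrite Cmod_opp => t2.
  have hm : (Cmod z / 2 <= Cmod (z + h)%C)%R by lra.
  have := ln_lip m0 (y := Cmod (z + h)) ltac:(lra).
  have : (/ Cmod (z + h)%C <= / (Cmod z / 2))%R by apply: Rinv_le_contravar; lra.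
  have : (Rabs (Cmod (z + h)%C - Cmod z) <= Cmod h)%R by apply: Rabs_le; lra.
  have : (Cmod h * K < e / 2)%R.
    have := Rmult_lt_compat_r K _ _ K0 h3.
    by have -> : (e / 2 / K * K = e / 2)%R by field; lra.
  have := Rabs_pos (Cmod (z + h)%C - Cmod z); rewrite /K; set a := Rabs _; set b := (/ Cmod (z + h))%R.
  set L := Rabs (ln _ - _)%R => a0 b1 b2 b3 b4.
  suff : (L < e / 2)%R by lra.
  apply: Rle_lt_trans b4 (Rle_lt_trans _ _ _ _ b1).
  apply: Rmult_le_compat => //; last lra.
  by have : (0 < b)%R by [apply: Rinv_0_lt_compat; lra]; lra.
move=> eps he.
(* The bound 1/16 makes the remainder of exp at most |k| / 2, hence |k| <= 2 |h| / |z|; the second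
   bound then makes 8 |k|^2 at most eps |h|. *)
have [eta [e0 hc]] := cont (Rmin (/ 16) (eps * Cmod z / 32))%R ltac:(apply: Rmin_pos; nra).
exists eta; split=> // h hh; have [sl hk] := hc h hh.
set k := Clog (z + h) - Clog z in hk *.
have k1 := Rlt_le_trans _ _ _ hk (Rmin_l _ _); have k2 := Rlt_le_trans _ _ _ hk (Rmin_r _ _).
have ez : z + h = z * Cexp k.
  rewrite -(Cexp_Clog (slit_ne0 sl)) -{2}(Cexp_Clog z0) -Cexp_plus; congr Cexp; rewrite /k; ring.
have est := @Cexp_est k ltac:(lra).
set E := Cexp k - 1 - k in est.
have hh' : h = z * (k + E).
  have -> : h = z + h - z by ring.
  by rewrite ez /E; ring.
have k0 := Cmod_ge_0 k; have E0 := Cmod_ge_0 E.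
have hE : (Cmod E <= / 2 * Cmod k)%R by nra.
have hkh : (Cmod k <= 2 * (Cmod h / Cmod z))%R.
  have : (Cmod h / Cmod z = Cmod (k + E))%R by rewrite hh' Cmod_mult; field; lra.
  have := Cmod_triangle (k + E) (- E); rewrite Cmod_opp.
  have -> : k + E + - E = k by ring.
  lra.
have -> : k - h * / z = - E by rewrite hh'; field.
rewrite Cmod_opp.
have h0 : (0 <= Cmod h / Cmod z)%R by apply: Rmult_le_pos; [apply: Cmod_ge_0 | apply: Rlt_le; apply: Rinv_0_lt_compat].
have -> : (eps * Cmod h = eps * Cmod z * (Cmod h / Cmod z))%R by field; lra.
apply: Rle_trans est _.
nra.
Qed.

(** * The field of complex numbers as a MathComp field *)

Lemma Ceq_boolP : Equality.axiom (fun x y : C => is_left (Ceq_dec x y)).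
Proof. by move=> x y; case: Ceq_dec => h; constructor. Qed.
HB.instance Definition _ := hasDecEq.Build C Ceq_boolP.

(** Classical description supplies the choice structure on which MathComp fields are built. *)
Definition Cfind (P : pred C) (n : nat) : option C :=
  if excluded_middle_informative (exists x, P x) is left h
  then Some (proj1_sig (constructive_indefinite_description _ h)) else None.

Lemma Cfind_correct (P : pred C) n x : Cfind P n = Some x -> P x.
Proof.
rewrite /Cfind; case: excluded_middle_informative => // h [<-].
by case: constructive_indefinite_description.
Qed.

Lemma Cfind_complete (P : pred C) : (exists x, P x) -> exists n, Cfind P n.
Proof. by move=> h; exists 0%N; rewrite /Cfind; case: excluded_middle_informative. Qed.

Lemma Cfind_ext (P Q : pred C) : P =1 Q -> Cfind P =1 Cfind Q.
Proof. by move=> h n; have -> : P = Q by apply: functional_extensionality; exact: h. Qed.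
HB.instance Definition _ := hasChoice.Build C Cfind_correct Cfind_complete Cfind_ext.

Lemma Cplus_opp_l (x : C) : - x + x = 0.
Proof. by rewrite Cplus_comm Cplus_opp_r. Qed.
HB.instance Definition _ :=
  @GRing.isZmodule.Build C (RtoC 0) Copp Cplus Cplus_assoc Cplus_comm Cplus_0_l Cplus_opp_l.

Lemma C1_neq0 : RtoC 1 != RtoC 0.
Proof. by apply/eqP => -[]; lra. Qed.
HB.instance Definition _ :=
  @GRing.Zmodule_isComNzRing.Build C (RtoC 1) Cmult Cmult_assoc Cmult_comm Cmult_1_l
    Cmult_plus_distr_r C1_neq0.

(** The field interface requires the inverse of 0 to be 0. *)
Definition Cinv0 (x : C) : C := if x == RtoC 0 then RtoC 0 else Cinv x.
Fact Cinv0_mul (x : C) : x != RtoC 0 -> Cinv0 x * x = 1.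
Proof. by move=> x0; rewrite /Cinv0 (negbTE x0); apply: Cinv_l; apply/eqP. Qed.
Fact Cinv0_0 : Cinv0 (RtoC 0) = 0.
Proof. by rewrite /Cinv0 eqxx. Qed.
HB.instance Definition _ := GRing.ComNzRing_isField.Build C Cinv0_mul Cinv0_0.

(** [csum] and [cprod_except] iterate [Cplus] and [Cmult] themselves; these instances make the big
    operator lemmas apply to them. *)
HB.instance Definition _ := Monoid.isComLaw.Build C (RtoC 0) Cplus Cplus_assoc Cplus_comm Cplus_0_l.
HB.instance Definition _ := Monoid.isComLaw.Build C (RtoC 1) Cmult Cmult_assoc Cmult_comm Cmult_1_l.

(** * Linear algebra over the complex numbers *)

Definition kron (N : nat) (i j : 'I_N) : C := if i == j then RtoC 1 else RtoC 0.

Lemma kronE N (i j : 'I_N) : ((i == j)%:R : C)%ring = kron i j.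
Proof. by rewrite /kron; case: (i == j). Qed.

Lemma csum_plus N (F G : 'I_N -> C) : csum (fun i => F i + G i) = csum F + csum G.
Proof. exact: big_split. Qed.

Lemma csum_scal N (a : C) (F : 'I_N -> C) : csum (fun i => a * F i) = a * csum F.
Proof. by symmetry; apply: (@GRing.mulr_sumr C). Qed.

Lemma csum_scal_r N (a : C) (F : 'I_N -> C) : csum (fun i => F i * a) = csum F * a.
Proof. by symmetry; apply: (@GRing.mulr_suml C). Qed.

Lemma csum_opp N (F : 'I_N -> C) : csum (fun i => - F i) = - csum F.
Proof. exact: (@GRing.sumrN C). Qed.

Lemma csum_minus N (F G : 'I_N -> C) : csum (fun i => F i - G i) = csum F - csum G.
Proof. by rewrite csum_plus csum_opp. Qed.

Lemma csum_exchange M N (F : 'I_M -> 'I_N -> C) :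
  csum (fun i => csum (fun j => F i j)) = csum (fun j => csum (fun i => F i j)).
Proof. exact: exchange_big. Qed.

Lemma csum_only N (i : 'I_N) (F : 'I_N -> C) : (forall k, k != i -> F k = RtoC 0) -> csum F = F i.
Proof.
move=> h; rewrite /csum (bigD1 i) //= big1 ?Cplus_0_r // => k /h //.
Qed.

Lemma csum_kron N (i : 'I_N) (F : 'I_N -> C) : csum (fun k => kron i k * F k) = F i.
Proof.
rewrite (@csum_only _ i) => [|k hk]; first by rewrite /kron eqxx Cmult_1_l.
by rewrite /kron eq_sym (negbTE hk) Cmult_0_l.
Qed.

Lemma csum_kron_r N (i : 'I_N) (F : 'I_N -> C) : csum (fun k => F k * kron k i) = F i.
Proof.
rewrite (@csum_only _ i) => [|k hk]; first by rewrite /kron eqxx Cmult_1_r.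
by rewrite /kron (negbTE hk) Cmult_0_r.
Qed.

Lemma csum_0 N : csum (fun _ : 'I_N => RtoC 0) = RtoC 0.
Proof. exact: big1_eq. Qed.

Lemma left_inverse_right N (A B : cmat N) :
  (forall a b, csum (fun k => A a k * B k b) = kron a b) ->
  forall a b, csum (fun k => B a k * A k b) = kron a b.
Proof.
move=> h a b; pose MA := (\matrix_(i, j) A i j)%ring : 'M[C]_N.
pose MB := (\matrix_(i, j) B i j)%ring : 'M[C]_N.
have h1 : (MA *m MB = 1%:M)%ring.
  apply/matrixP => i j; rewrite !mxE kronE -h.
  by apply: eq_bigr => k _; rewrite !mxE.
move: (mulmx1C h1) => /matrixP /(_ a b); rewrite !mxE kronE => <-.
transitivity (\sum_j MB a j * MA j b)%ring.
  by apply: eq_bigr => k _; rewrite !mxE.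
by [].
Qed.

Definition indep (N : nat) (e : 'I_N -> cvec N) : Prop :=
  forall c : 'I_N -> C, (forall k, csum (fun i => c i * e i k) = RtoC 0) -> forall i, c i = RtoC 0.

Lemma indep_row_free N (e : 'I_N -> cvec N) :
  indep e -> ((\matrix_(i, k) e i k)%ring : 'M[C]_N) \in unitmx.
Proof.
move=> h; rewrite -row_free_unit -kermx_eq0; apply/eqP/matrixP => i j; rewrite [RHS]mxE.
set K := kermx _; apply: (h (fun j => K i j)) => k.
have := mulmx_ker ((\matrix_(i, k) e i k)%ring : 'M[C]_N); rewrite -/K => /matrixP /(_ i k).
rewrite mxE [RHS]mxE => h0; apply: etrans h0; apply: eq_bigr => l _.
by congr Cmult; rewrite mxE.
Qed.

Lemma indep_inverse N (e : 'I_N -> cvec N) : indep e -> exists D : cmat N,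
  (forall i j, csum (fun k => e i k * D k j) = kron i j) /\
  (forall k l, csum (fun i => D k i * e i l) = kron k l).
Proof.
move=> /indep_row_free; set M := (\matrix_(i, k) _)%ring => uM.
have h i j : csum (fun k => e i k * invmx M k j) = kron i j.
  move: (mulmxV uM) => /matrixP /(_ i j); rewrite mxE [RHS]mxE kronE => <-.
  by apply: eq_bigr => k _; congr Cmult; rewrite mxE.
exists (fun k j => invmx M k j); split=> //; exact: left_inverse_right.
Qed.

(** Linear independence is an open condition: the determinant is continuous and nonzero at the
    limit. *)
Lemma indep_lim N (e : nat -> 'I_N -> cvec N) (e0 : 'I_N -> cvec N) :
  (forall i k, Clim (fun q => e q i k) (e0 i k)) -> indep e0 -> exists q, indep (e q).
Proof.
move=> hl /indep_row_free; rewrite unitmxE GRing.unitfE => /eqP d0.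
pose d q := (\det ((\matrix_(i, k) e q i k) : 'M[C]_N))%ring.
have hd : Clim d (\det ((\matrix_(i, k) e0 i k) : 'M[C]_N))%ring.
  rewrite /d /determinant; apply: Clim_big_sum => s _; apply: Clim_mult; first exact: Clim_const.
  by apply: Clim_big_prod => i _; rewrite mxE; apply: Clim_ext (hl i (s i)) => q; rewrite mxE.
have [q hq] := Clim_ne d0 hd; exists q => c hc i.
have {}hq : d q <> RtoC 0 by apply: hq.
have uM : ((\matrix_(i, k) e q i k)%ring : 'M[C]_N) \in unitmx by rewrite unitmxE GRing.unitfE; apply/eqP.
have : (((\row_i c i) : 'rV[C]_N) *m (\matrix_(i, k) e q i k) = 0)%ring.
  apply/matrixP => a k; rewrite !mxE -[RHS](hc k); apply: eq_bigr => j _; by rewrite !mxE.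
move/(f_equal (mulmx^~ (invmx (\matrix_(i, k) e q i k)%ring))); rewrite mulmxK // mul0mx.
by move/matrixP/(_ ord0 i); rewrite !mxE.
Qed.

(** Applying M - lam_l for all l in a list to a vanishing combination multiplies the coefficient of
    e_j by the factors lam_j - lam_l; with every l <> i in the list only the term of i survives. *)
Lemma eigen_indep N (M : cmat N) (lam : 'I_N -> C) (e : 'I_N -> cvec N) :
  (forall i k, lam i = lam k -> i = k) ->
  (forall i, mapply M (e i) = vscale (lam i) (e i)) ->
  (forall i, exists k, e i k <> RtoC 0) -> indep e.
Proof.
move=> inj he ne c hc i.
have key (s : seq 'I_N) k :
    csum (fun j => \big[Cmult/RtoC 1]_(l <- s) (lam j - lam l) * c j * e j k) = RtoC 0.
  elim: s k => [|l s IH] k.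
    by rewrite -[RHS](hc k); apply: csum_ext => j; rewrite big_nil; ring.
  transitivity (csum (fun j => M k j * csum (fun j' => \big[Cmult/RtoC 1]_(l <- s) (lam j' - lam l) * c j' * e j' j))
     - lam l * csum (fun j => \big[Cmult/RtoC 1]_(l <- s) (lam j - lam l) * c j * e j k)); last first.
    rewrite IH (csum_ext (G := fun j => RtoC 0)); last by move=> j; rewrite IH Cmult_0_r.
    by rewrite csum_0; ring.
  have -> : csum (fun j => M k j * csum (fun j' => \big[Cmult/RtoC 1]_(l <- s) (lam j' - lam l) * c j' * e j' j))
     = csum (fun j => csum (fun j' => M k j * (\big[Cmult/RtoC 1]_(l <- s) (lam j' - lam l) * c j' * e j' j))).
    by apply: csum_ext => j; rewrite -csum_scal.
  rewrite -csum_scal.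
  rewrite csum_exchange -csum_minus; apply: csum_ext => j.
  have hk : mapply M (e j) k = lam j * e j k by rewrite he.
  have -> : csum (fun i0 => M k i0 * (\big[Cmult/RtoC 1]_(l <- s) (lam j - lam l) * c j * e j i0)) =
    \big[Cmult/RtoC 1]_(l <- s) (lam j - lam l) * c j * mapply M (e j) k.
    by rewrite /mapply -csum_scal; apply: csum_ext => j0; ring.
  by rewrite hk big_cons; ring.
have [k hk] := ne i.
have := key [seq l <- index_enum 'I_N | l != i] k; rewrite (csum_only (i := i)) => [|j hj]; last first.
  rewrite (big_rem j) /=; last by rewrite mem_filter hj mem_index_enum.
  ring.
rewrite big_filter => h0.
have p0 : \big[Cmult/RtoC 1]_(l <- index_enum 'I_N | l != i) (lam i - lam l) <> RtoC 0.
  elim/big_ind: _ => [|x y hx hy|l hl]; [by move/eqP: C1_neq0 | exact: Cmult_neq_0 |].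
  by apply: Cminus_eq_contra => /inj e1; rewrite e1 eqxx in hl.
case: (Ceq_dec (c i) (RtoC 0)) => // ci0; case: (Cmult_neq_0 _ _ (Cmult_neq_0 _ _ p0 ci0) hk h0).
Qed.

(** * Partial fractions *)

Definition cprod (N : nat) (F : 'I_N -> C) : C := \big[Cmult/RtoC 1]_(i < N) F i.

Lemma cprod_ne0 N (F : 'I_N -> C) : (forall i, F i <> RtoC 0) -> cprod F <> RtoC 0.
Proof.
move=> h; rewrite /cprod; elim/big_ind: _ => [|x y hx hy|l hl] //; [by move/eqP: C1_neq0 | exact: Cmult_neq_0].
Qed.

Lemma cprod_except_ne0 N (i : 'I_N) (F : 'I_N -> C) :
  (forall k, k != i -> F k <> RtoC 0) -> cprod_except i F <> RtoC 0.
Proof.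
move=> h; rewrite /cprod_except; elim/big_ind: _ => [|x y hx hy|l hl] //; [by move/eqP: C1_neq0 | exact: Cmult_neq_0 | exact: h].
Qed.

Lemma cprod_D1 N (i : 'I_N) (F : 'I_N -> C) : cprod F = F i * cprod_except i F.
Proof. by rewrite /cprod (bigD1 i). Qed.

Lemma cprod_eq0 N (i : 'I_N) (F : 'I_N -> C) : F i = RtoC 0 -> cprod F = RtoC 0.
Proof. by move=> h; rewrite (cprod_D1 i) h Cmult_0_l. Qed.

Lemma cprod_ext N (F G : 'I_N -> C) : (forall i, F i = G i) -> cprod F = cprod G.
Proof. by move=> h; apply: eq_bigr => i _. Qed.

Lemma cprod_except_ext N (i : 'I_N) (F G : 'I_N -> C) :
  (forall k, k != i -> F k = G k) -> cprod_except i F = cprod_except i G.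
Proof. by move=> h; apply: eq_bigr => k; apply: h. Qed.

Lemma cprod_mult N (F G : 'I_N -> C) : cprod (fun i => F i * G i) = cprod F * cprod G.
Proof. exact: big_split. Qed.

Lemma cprod_except_mult N (i : 'I_N) (F G : 'I_N -> C) :
  cprod_except i (fun k => F k * G k) = cprod_except i F * cprod_except i G.
Proof. exact: big_split. Qed.

(** It vanishes exactly when the product of the X - mu_m is the characteristic polynomial of
    [diagm lam] minus [rank1 dl]. The leading terms cancel, so N distinct roots force vanishing: the
    lam_i in [residue_poly], the mu_m in [residue_unique]. *)
Definition charpoly_diff N (lam mu dl : 'I_N -> C) : {poly C} :=
  (\prod_m ('X - (mu m)%:P) - \prod_k ('X - (lam k)%:P)
   - \sum_k (dl k)%:P * \prod_(k' | k' != k) ('X - (lam k')%:P))%ring.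

Lemma size_charpoly_diff N (lam mu dl : 'I_N -> C) : (size (charpoly_diff lam mu dl) <= N)%N.
Proof.
have hs (a : 'I_N -> C) : size (\prod_m ('X - (a m)%:P))%ring = N.+1.
  by rewrite size_prod_XsubC; rewrite -[index_enum _]enumT size_enum_ord.
have hl (a : 'I_N -> C) : ((\prod_m ('X - (a m)%:P) : {poly C})`_N = 1)%ring.
    by have := monic_prod_XsubC (index_enum 'I_N) predT a; rewrite monicE /lead_coef hs => /eqP.
rewrite /charpoly_diff; apply: leq_trans (size_polyD _ _) _; rewrite size_polyN geq_max; apply/andP; split.
  apply/leq_sizeP => j hj; rewrite coefB; move: hj; rewrite leq_eqVlt => /orP [/eqP <-|hj].
    by rewrite !hl GRing.subrr.
  by rewrite !nth_default ?hs // GRing.subr0.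
apply: leq_trans (size_sum _ _ _) _; apply/bigmax_leqP => k _.
rewrite mul_polyC; apply: leq_trans (size_scale_leq _ _) _.
have := size_prod_XsubC (index_enum 'I_N) lam; rewrite (bigD1 k) //= => h.
have m : (\prod_(i < N | i != k) ('X - (lam i)%:P))%ring \is monic by apply: monic_prod_XsubC.
move: h; rewrite size_Mmonic ?polyXsubC_eq0 // size_XsubC add2n -pred_Sn => -[h]; rewrite h.
by rewrite -[index_enum _]enumT size_enum_ord.
Qed.

Lemma poly_eq0_of_roots N (p : {poly C}) (x : 'I_N -> C) :
  (forall i k, x i = x k -> i = k) -> (size p <= N)%N -> (forall i, p.[x i]%ring = RtoC 0) -> p = 0%ring.
Proof.
move=> inj hs h; apply/eqP; case: (boolP (p == 0%ring)) => // p0.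
have := @max_poly_roots _ p [seq x i | i <- enum 'I_N] p0; rewrite size_map size_enum_ord ltnNge hs.
move=> hh; exfalso; have : false; last by []; apply: hh.
  by apply/allP => _ /mapP [i _ ->]; rewrite rootE; apply/eqP; exact: h.
by rewrite map_inj_uniq ?enum_uniq // => i k /inj.
Qed.

Lemma charpoly_diffE N (lam mu dl : 'I_N -> C) (t : C) :
  (charpoly_diff lam mu dl).[t]%ring = cprod (fun m => t - mu m) - cprod (fun k => t - lam k)
    - csum (fun k => dl k * cprod_except k (fun k' => t - lam k')).
Proof.
rewrite /charpoly_diff !hornerE !horner_prod horner_sum /cprod /csum.
have e (a : C) : (('X - a%:P).[t] = t - a)%ring by rewrite !hornerE.
congr (_ + - _)%ring.
  by congr (_ + - _)%ring; apply: eq_bigr => i _; rewrite e.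
apply: eq_bigr => k _; rewrite hornerM hornerC horner_prod; congr Cmult.
by apply: eq_bigr => i _; rewrite e.
Qed.

(** The coordinates of [v] in the normalised eigenbasis of [P], as [general_position_residue]
    shows. *)
Definition residue (N : nat) (lam mu : 'I_N -> C) (k : 'I_N) : C :=
  cprod (fun m => lam k - mu m) / cprod_except k (fun k' => lam k - lam k').

Lemma distinct_prod N (lam : 'I_N -> C) (k : 'I_N) : (forall i k, lam i = lam k -> i = k) ->
  cprod_except k (fun k' => lam k - lam k') <> RtoC 0.
Proof.
move=> inj; apply: cprod_except_ne0 => k' hk; apply: Cminus_eq_contra => /inj e.
by rewrite e eqxx in hk.
Qed.

Lemma csum_except_at N (lam dl : 'I_N -> C) (k : 'I_N) :
  csum (fun k0 => dl k0 * cprod_except k0 (fun k' => lam k - lam k')) =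
  dl k * cprod_except k (fun k' => lam k - lam k').
Proof.
rewrite (csum_only (i := k)) // => j hj.
rewrite /cprod_except (bigD1 k) /=; last by rewrite eq_sym.
rewrite /Cminus Cplus_opp_r; ring.
Qed.

Lemma residue_poly N (lam mu : 'I_N -> C) (t : C) : (forall i k, lam i = lam k -> i = k) ->
  cprod (fun m => t - mu m) = cprod (fun k => t - lam k)
    + csum (fun k => residue lam mu k * cprod_except k (fun k' => t - lam k')).
Proof.
move=> inj.
have h : charpoly_diff lam mu (residue lam mu) = 0%ring.
  apply: (poly_eq0_of_roots inj (size_charpoly_diff _ _ _)) => i.
  rewrite charpoly_diffE csum_except_at (cprod_eq0 (i := i) (F := fun k => lam i - lam k)); last exact: Cplus_opp_r.
  have d0 := distinct_prod (k := i) inj; rewrite /residue; set p := cprod _; set q := cprod_except _ _ in d0 *.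
  change (p - RtoC 0 - p / q * q = RtoC 0); field; exact: d0.
have := charpoly_diffE lam mu (residue lam mu) t; rewrite h horner0 => /esym e.
have -> : cprod (fun m => t - mu m) = RtoC 0 + cprod (fun k => t - lam k) +
   csum (fun k => residue lam mu k * cprod_except k (fun k' => t - lam k')) by rewrite -[RtoC 0]e; ring.
ring.
Qed.

(** Drives the recursion of the coefficients at t = lam_i + 1 + n; at t = mu_m the right side
    vanishes and the identity becomes the secular equation of the rank one perturbation. *)
Lemma residue_pf N (lam mu : 'I_N -> C) (t : C) : (forall i k, lam i = lam k -> i = k) ->
  (forall k, t <> lam k) ->
  1 + csum (fun k => residue lam mu k / (t - lam k)) = cprod (fun m => t - mu m) / cprod (fun k => t - lam k).
Proof.
move=> inj ht; rewrite (residue_poly mu t inj).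
have p0 : cprod (fun k => t - lam k) <> RtoC 0 by apply: cprod_ne0 => k; apply: Cminus_eq_contra.
have -> : (cprod (fun k => t - lam k) + csum (fun k => residue lam mu k * cprod_except k (fun k' => t - lam k'))) / cprod (fun k => t - lam k)
  = 1 + csum (fun k => residue lam mu k * cprod_except k (fun k' => t - lam k')) * / cprod (fun k => t - lam k) by field.
congr Cplus; rewrite -csum_scal_r; apply: csum_ext => k; rewrite (cprod_D1 k).
have := Cminus_eq_contra _ _ (ht k).
have : cprod_except k (fun k' => t - lam k') <> RtoC 0 by apply: cprod_except_ne0 => i _; apply: Cminus_eq_contra.
by move=> h1 h2; field.
Qed.

Lemma residue_unique N (lam mu dl : 'I_N -> C) : (forall i k, lam i = lam k -> i = k) ->
  (forall i k, mu i = mu k -> i = k) -> (forall m k, mu m <> lam k) ->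
  (forall m, 1 + csum (fun k => dl k / (mu m - lam k)) = RtoC 0) -> forall k, dl k = residue lam mu k.
Proof.
move=> inj injm ne hz k.
have h : charpoly_diff lam mu dl = 0%ring.
  apply: (poly_eq0_of_roots injm (size_charpoly_diff _ _ _)) => m.
  rewrite charpoly_diffE (cprod_eq0 (i := m) (F := fun k => mu m - mu k)); last exact: Cplus_opp_r.
  have p0 : cprod (fun k => mu m - lam k) <> RtoC 0 by apply: cprod_ne0 => j; apply: Cminus_eq_contra.
  have -> : csum (fun k0 => dl k0 * cprod_except k0 (fun k' => mu m - lam k')) =
     csum (fun k => dl k / (mu m - lam k)) * cprod (fun k => mu m - lam k).
    rewrite -csum_scal_r; apply: csum_ext => j; rewrite (cprod_D1 j); field.
    exact: Cminus_eq_contra.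
  have -> : csum (fun k => dl k / (mu m - lam k)) = (1 + csum (fun k => dl k / (mu m - lam k))) - 1 by ring.
  rewrite hz; set p := cprod _.
  change (RtoC 0 - p - (RtoC 0 - RtoC 1) * p = RtoC 0); ring.
have := charpoly_diffE lam mu dl (lam k); rewrite h horner0 csum_except_at.
rewrite (cprod_eq0 (i := k) (F := fun j => lam k - lam j)); last exact: Cplus_opp_r.
move=> /esym e; rewrite /residue.
have d0 := distinct_prod (k := k) inj.
have -> : cprod (fun m => lam k - mu m) = dl k * cprod_except k (fun k' => lam k - lam k').
  move: e; set p := cprod _; set q := dl k * _ => e.
  have e' : p - RtoC 0 - q = RtoC 0 by [].
  have -> : p = p - RtoC 0 - q + q by ring.
  by rewrite e'; ring.
by field.
Qed.

(** * A linear differential equation on the strip 0 < Im s < 2 pi *)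

Definition sh (c : nat -> C) (n : nat) : C := if n is m.+1 then c m else RtoC 0.

Lemma gb_sh c : gb c -> gb (sh c).
Proof.
move=> hc rho hr; have [B hB] := hc rho hr; exists (Rabs B) => -[|n] /=.
  by rewrite Cmod_0 Rmult_0_l; apply: Rabs_pos.
have p : (0 <= Cmod (c n) * rho ^ n)%R by apply: Rmult_le_pos; [apply: Cmod_ge_0 | apply: pow_le; lra].
by have := hB n; have := Rle_abs B; have -> : (Cmod (c n) * (rho * rho ^ n) = rho * (Cmod (c n) * rho ^ n))%R by [ring]; nra.
Qed.

Lemma PSc_ext c d w : (forall n, c n = d n) -> PSc c w = PSc d w.
Proof. by move=> h; apply: Cser_ext => n; rewrite h. Qed.

Lemma PSc_sh c w : gb c -> (Cmod w < 1)%R -> PSc (sh c) w = w * PSc c w.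
Proof.
move=> hc hw; rewrite /PSc Cser_S; last exact: gb_summable (gb_sh hc) hw.
rewrite /= Cmult_0_l Cplus_0_l -Cser_scal; last exact: gb_summable.
by apply: Cser_ext => n; ring.
Qed.

Lemma PSc_plus c d w : gb c -> gb d -> (Cmod w < 1)%R ->
  PSc (fun n => c n + d n) w = PSc c w + PSc d w.
Proof.
move=> hc hd hw; rewrite /PSc -Cser_plus; [|exact: gb_summable..].
by apply: Cser_ext => n; ring.
Qed.

Lemma PSc_scal a c w : gb c -> (Cmod w < 1)%R -> PSc (fun n => a * c n) w = a * PSc c w.
Proof.
move=> hc hw; rewrite /PSc -Cser_scal; last exact: gb_summable.
by apply: Cser_ext => n; ring.
Qed.

Lemma gb_csum N (c : 'I_N -> nat -> C) : (forall i, gb (c i)) -> gb (fun n => csum (fun i => c i n)).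
Proof.
move=> h; rewrite /csum; elim: (index_enum _) => [|i r IH].
  by move=> rho hr; exists 0%R => n; rewrite big_nil Cmod_0; lra.
by apply: (@gb_le _ (fun n => c i n + \big[Cplus/RtoC 0]_(i <- r) c i n)) (gb_plus (h i) IH) => n; rewrite big_cons; lra.
Qed.

Lemma PSc_csum N (c : 'I_N -> nat -> C) w : (forall i, gb (c i)) -> (Cmod w < 1)%R ->
  PSc (fun n => csum (fun i => c i n)) w = csum (fun i => PSc (c i) w).
Proof.
move=> h hw; rewrite /PSc -Cser_csum; last by move=> i; apply: gb_summable.
by apply: Cser_ext => n; rewrite csum_scal_r.
Qed.

Lemma PSc_euler c w : gb c -> (Cmod w < 1)%R ->
  w * PSc (fun n => RtoC (INR n.+1) * c n.+1) w = PSc (fun n => RtoC (INR n) * c n) w.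
Proof.
move=> hc hw; rewrite -PSc_sh //; last exact: gb_dc.
by apply: PSc_ext => -[|n] //; rewrite Cmult_0_l.
Qed.

Lemma gb_const (a : C) : gb (fun _ => a).
Proof.
move=> rho hr; exists (Cmod a) => n.
rewrite -[X in (_ <= X)%R]Rmult_1_r; apply: Rmult_le_compat_l; first exact: Cmod_ge_0.
by rewrite -(pow1 n); apply: pow_incr; lra.
Qed.

Lemma gb_poly (M : R) (E : nat) c : (forall n, (Cmod (c n) <= M * (INR n + 1) ^ E)%R) -> gb c.
Proof.
move=> h; have h1 : gb (fun n => RtoC ((INR n + 1) ^ E)).
  elim: (E) => [|e IH]; first exact: (gb_const (RtoC 1)).
  apply: (@gb_le _ (fun n => RtoC (INR n) * RtoC ((INR n + 1) ^ e) + RtoC ((INR n + 1) ^ e))).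
    move=> n; rewrite -RtoC_mult -RtoC_plus; apply: Req_le; congr (Cmod (RtoC _)); rewrite /=; ring.
  by apply: gb_plus => //; apply: gb_mul_n.
apply: (@gb_le _ (fun n => RtoC M * RtoC ((INR n + 1) ^ E))); last exact: gb_scal.
move=> n; rewrite -RtoC_mult Cmod_R; apply: Rle_trans (h n) (Rle_abs _).
Qed.

(** The binomial coefficient of n + E over n. It solves (n + 1) g(n + 1) = (n + 1 + E) g(n), the
    majorant of the recursion of [solc]. *)
Fixpoint growth (E : nat) (n : nat) : R :=
  if n is m.+1 then (growth E m * (1 + INR E / (INR m + 1)))%R else 1%R.

Lemma growth_ge0 E n : (1 <= growth E n)%R.
Proof.
elim: n => [|n IH] /=; first lra.
have h := pos_INR n; have h' := pos_INR E.
have : (0 <= INR E / (INR n + 1))%R by apply: Rmult_le_pos => //; apply: Rlt_le; apply: Rinv_0_lt_compat; lra.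
nra.
Qed.

Lemma growth_le E n : (growth E n <= (INR n + 1) ^ E)%R.
Proof.
elim: n => [|n IH]; first by rewrite /= Rplus_0_l pow1; lra.
have h := pos_INR n; have h1 := growth_ge0 E n.
have x0 : (0 < / (INR n + 1))%R by apply: Rinv_0_lt_compat; lra.
have p := Rfunctions.poly E (/ (INR n + 1)) x0.
rewrite [growth _ _]/= S_INR.
have -> : ((INR n + 1 + 1) ^ E = (INR n + 1) ^ E * (1 + / (INR n + 1)) ^ E)%R.
  by rewrite -Rpow_mult_distr; congr (_ ^ _)%R; field; lra.
apply: Rmult_le_compat => //; [lra|].
have := pos_INR E; rewrite /Rdiv; nra.
Qed.

(** Coefficient matrices of the equation in the disc variable w, namely (1 - w^4) y' = (B0 (1 + w^2)
    + B1 w) y. *)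
Definition stepB0 N (L Q : cmat N) : cmat N := fun k l => RtoC 4 * L k l - RtoC 2 * Q k l.
Definition stepB1 N (Q : cmat N) : cmat N := fun k l => - (RtoC 4 * Q k l).

(* The state is (c_n, c_{n-1}, c_{n-2}, c_{n-3}). *)
Fixpoint solstate N (L Q : cmat N) (c0 : cvec N) (n : nat) : cvec N * cvec N * cvec N * cvec N :=
  if n is m.+1 then
    let: (a, b, c, d) := solstate L Q c0 m in
    (* The factor m - 3 comes from w^4 y'. For m < 3 it is negative but multiplies a zero vector. *)
    (fun k => (RtoC (INR m - 3) * d k + mapply (stepB0 L Q) a k + mapply (stepB1 Q) b k
        + mapply (stepB0 L Q) c k) / RtoC (INR m + 1), a, b, c)
  else (c0, @vzero N, @vzero N, @vzero N).

Definition solc N (L Q : cmat N) (c0 : cvec N) (n : nat) : cvec N :=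
  let: (a, _, _, _) := solstate L Q c0 n in a.

Lemma solstateE N (L Q : cmat N) (c0 : cvec N) (n : nat) :
  solstate L Q c0 n = (solc L Q c0 n, prevc (solc L Q c0) n, prevc (prevc (solc L Q c0)) n,
    prevc (prevc (prevc (solc L Q c0))) n).
Proof.
elim: n => [|n IH] //.
by rewrite /solc /=; move: IH; case: (solstate L Q c0 n) => -[[a b] c] d -[ea eb ec ed]; rewrite ea eb ec.
Qed.

Lemma INR1_neq0 (n : nat) : RtoC (INR n + 1) <> RtoC 0.
Proof. by move/RtoC_inj; have := pos_INR n; lra. Qed.

Lemma solcS N (L Q : cmat N) (c0 : cvec N) (n : nat) k : let c := solc L Q c0 in
  RtoC (INR n.+1) * c n.+1 k = RtoC (INR n - 3) * prevc (prevc (prevc c)) n k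
   + mapply (stepB0 L Q) (c n) k + mapply (stepB1 Q) (prevc c n) k + mapply (stepB0 L Q) (prevc (prevc c) n) k.
Proof.
move=> c; rewrite {1}/c /solc [solstate _ _ _ _]/= solstateE -/c S_INR.
field; exact: INR1_neq0.
Qed.

Lemma mapply_bound N (B : cmat N) (x : cvec N) (beta M : R) k :
  (forall k, (\big[Rplus/0%R]_(l < N) Cmod (B k l) <= beta)%R) -> (0 <= M)%R ->
  (forall l, (Cmod (x l) <= M)%R) -> (Cmod (mapply B x k) <= beta * M)%R.
Proof.
move=> hB M0 hx; apply: (Rle_trans _ ((\big[Rplus/0%R]_(l < N) Cmod (B k l)) * M)); last first.
  exact: Rmult_le_compat_r.
rewrite /mapply /csum; elim: (index_enum _) => [|l r IH].
  by rewrite !big_nil Cmod_0 Rmult_0_l; lra.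
rewrite !big_cons; apply: Rle_trans (Cmod_triangle _ _) _; rewrite Cmod_mult Rmult_plus_distr_r.
by apply: Rplus_le_compat => //; apply: Rmult_le_compat_l => //; apply: Cmod_ge_0.
Qed.

(** The recursion has depth four, so four consecutive coefficients are bounded together. The
    condition on [E] gives n + 3 + 3 beta <= n + 1 + E, which is one step of [growth]. The constants
    depend only on bounds for the matrices, so the estimate is uniform along convergent sequences of
    equations. *)
Lemma solc_bound N (L Q : cmat N) (c0 : cvec N) (beta M : R) (E : nat) :
  (0 <= M)%R -> (forall l, (Cmod (c0 l) <= M)%R) -> (3 * beta + 2 <= INR E)%R ->
  (forall k, (\big[Rplus/0%R]_(l < N) Cmod (stepB0 L Q k l) <= beta)%R) ->
  (forall k, (\big[Rplus/0%R]_(l < N) Cmod (stepB1 Q k l) <= beta)%R) ->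
  forall n k, (Cmod (solc L Q c0 n k) <= M * (INR n + 1) ^ E)%R.
Proof.
move=> M0 hc0 hE h0 h1 n k.
suff : [/\ forall k, (Cmod (solc L Q c0 n k) <= M * growth E n)%R,
  forall k, (Cmod (prevc (solc L Q c0) n k) <= M * growth E n)%R,
  forall k, (Cmod (prevc (prevc (solc L Q c0)) n k) <= M * growth E n)%R &
  forall k, (Cmod (prevc (prevc (prevc (solc L Q c0))) n k) <= M * growth E n)%R].
  by case=> h _ _ _; apply: Rle_trans (h k) _; apply: Rmult_le_compat_l => //; apply: growth_le.
elim: n {k} => [|n [IH1 IH2 IH3 IH4]].
  by split=> k /=; rewrite ?Rmult_1_r //; rewrite ?Cmod_0.
have g1 := growth_ge0 E n; have n0 := pos_INR n.
have mono : (growth E n <= growth E n.+1)%R.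
  rewrite /=; have : (0 <= INR E / (INR n + 1))%R.
    by apply: Rmult_le_pos; [apply: pos_INR | apply: Rlt_le; apply: Rinv_0_lt_compat; lra].
  nra.
have Mm : (M * growth E n <= M * growth E n.+1)%R by apply: Rmult_le_compat_l.
split=> [k|k|k|k]; [|exact: Rle_trans (IH1 k) Mm|exact: Rle_trans (IH2 k) Mm|exact: Rle_trans (IH3 k) Mm].
have Mg : (0 <= M * growth E n)%R by apply: Rmult_le_pos; lra.
have e := solcS L Q c0 n k; rewrite /= in e.
apply: (Rmult_le_reg_l (INR n + 1)); first lra.
have -> : ((INR n + 1) * Cmod (solc L Q c0 n.+1 k) = Cmod (RtoC (INR n.+1) * solc L Q c0 n.+1 k))%R.
  by rewrite Cmod_mult Cmod_R S_INR Rabs_pos_eq //; lra.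
rewrite e.
have b1 := mapply_bound k h0 Mg IH1; have b2 := mapply_bound k h1 Mg IH2; have b3 := mapply_bound k h0 Mg IH3.
have b4 : (Rabs (INR n - 3) * Cmod (prevc (prevc (prevc (solc L Q c0))) n k) <= (INR n + 3) * (M * growth E n))%R.
  by apply: Rmult_le_compat => //; [exact: Rabs_pos | exact: Cmod_ge_0 | apply: Rabs_le; lra].
have -> : ((INR n + 1) * (M * growth E n.+1) = (INR n + 1 + INR E) * (M * growth E n))%R.
  by rewrite /=; field; lra.
apply: (Rle_trans _ ((INR n + 3 + 3 * beta) * (M * growth E n)))%R.
  rewrite -(Cmod_R (INR n - 3)) -Cmod_mult in b4; move: b1 b2 b3 b4.
  set x1 := mapply _ _ _; set x2 := mapply _ _ _; set x3 := mapply _ _ _; set x4 := RtoC (INR n - 3) * _.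
  have := Cmod_triangle (x4 + x1 + x2) x3; have := Cmod_triangle (x4 + x1) x2; have := Cmod_triangle x4 x1.
  lra.
by apply: Rmult_le_compat_r => //; lra.
Qed.

Lemma big_Rle N (F : 'I_N -> R) : exists B : R, forall k, (F k <= B)%R.
Proof.
have h (s : seq 'I_N) : exists B : R, forall k, k \in s -> (F k <= B)%R.
  elim: s => [|i s [B hB]]; first by exists 0%R.
  exists (Rmax (F i) B) => k; rewrite in_cons => /orP [/eqP ->|/hB h]; first exact: Rmax_l.
  exact: Rle_trans h (Rmax_r _ _).
by have [B hB] := h (index_enum 'I_N); exists B => k; apply: hB; apply: mem_index_enum.
Qed.

Lemma nat_above (x : R) : exists E : nat, (x <= INR E)%R.
Proof. by have [E hE] := INR_unbounded x; exists E; lra. Qed.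

Lemma solc_gb N (L Q : cmat N) (c0 : cvec N) k : gb (fun n => solc L Q c0 n k).
Proof.
have [b0 h0] := big_Rle (fun k => \big[Rplus/0%R]_(l < N) Cmod (stepB0 L Q k l)).
have [b1 h1] := big_Rle (fun k => \big[Rplus/0%R]_(l < N) Cmod (stepB1 Q k l)).
have [M hM] := big_Rle (fun k => Cmod (c0 k)).
have [E hE] := nat_above (3 * Rmax b0 b1 + 2).
apply: (gb_poly (M := Rabs M) (E := E)) => n.
apply: (solc_bound (beta := Rmax b0 b1)) => //.
- exact: Rabs_pos.
- by move=> l; apply: Rle_trans (hM l) (Rle_abs _).
- by move=> j; apply: Rle_trans (h0 j) (Rmax_l _ _).
- by move=> j; apply: Rle_trans (h1 j) (Rmax_r _ _).
Qed.

Definition soly N (L Q : cmat N) (c0 : cvec N) (w : C) : cvec N := fun k => PSc (fun n => solc L Q c0 n k) w.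

Lemma prevc_sh N (a : nat -> cvec N) n k : prevc a n k = sh (fun n => a n k) n.
Proof. by case: n. Qed.

Lemma PSc_mapply N (B : cmat N) (c : nat -> cvec N) (w : C) k :
  (forall l, gb (fun n => c n l)) -> (Cmod w < 1)%R ->
  gb (fun n => mapply B (c n) k) /\
  PSc (fun n => mapply B (c n) k) w = csum (fun l => B k l * PSc (fun n => c n l) w).
Proof.
move=> hc hw; have h l : gb (fun n => B k l * c n l) by apply: gb_scal.
split; first exact: gb_csum.
by rewrite /mapply PSc_csum //; apply: csum_ext => l; rewrite PSc_scal.
Qed.

Lemma soly_ode N (L Q : cmat N) (c0 : cvec N) (w : C) k : (Cmod w < 1)%R ->
  exists y', Cder (fun w => soly L Q c0 w k) w y' /\
  (1 - w * w * w * w) * y' =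
  csum (fun l => (stepB0 L Q k l * (1 + w * w) + stepB1 Q k l * w) * soly L Q c0 w l).
Proof.
move=> hw; set c := solc L Q c0.
have gc l : gb (fun n => c n l) by apply: solc_gb.
exists (PSc (fun n => RtoC (INR n.+1) * c n.+1 k) w); split; first exact: (Cder_PSc (gc k) hw).
set dc := fun n => _ * _.
have gdc : gb dc by exact: (gb_dc (gc k)).
have gp1 l : gb (fun n => prevc c n l) by apply: (@gb_le _ (sh (fun n => c n l)) _ (gb_sh (gc l))) => n; rewrite prevc_sh; lra.
have gp2 l : gb (fun n => prevc (prevc c) n l) by apply: (@gb_le _ (sh (fun n => prevc c n l)) _ (gb_sh (gp1 l))) => n; rewrite prevc_sh; lra.
have ep1 l : PSc (fun n => prevc c n l) w = w * soly L Q c0 w l.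
  by rewrite -(PSc_sh (gc l) hw); apply: PSc_ext => n; rewrite prevc_sh.
have ep2 l : PSc (fun n => prevc (prevc c) n l) w = w * (w * soly L Q c0 w l).
  by rewrite -ep1 -(PSc_sh (gp1 l) hw); apply: PSc_ext => n; rewrite prevc_sh.
have [g1 e1] := PSc_mapply (stepB0 L Q) k gc hw.
have [g2 e2] := PSc_mapply (stepB1 Q) k gp1 hw.
have [g3 e3] := PSc_mapply (stepB0 L Q) k gp2 hw.
have gs1 := gb_sh gdc; have gs2 := gb_sh gs1; have gs3 := gb_sh gs2; have gs4 := gb_sh gs3.
have edc n : dc n = sh (sh (sh (sh dc))) n + mapply (stepB0 L Q) (c n) k + mapply (stepB1 Q) (prevc c n) k
   + mapply (stepB0 L Q) (prevc (prevc c) n) k.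
  rewrite {1}/dc solcS -/c; congr (_ + _ + _ + _).
  case: n => [|[|[|[|n]]]].
  - exact: Cmult_0_r.
  - exact: Cmult_0_r.
  - exact: Cmult_0_r.
  - by rewrite /= (_ : (1 + 1 + 1 - 3 = 0)%R) ?Cmult_0_l //; ring.
  change (RtoC (INR n.+4 - 3) * c n.+1 k = RtoC (INR n.+1) * c n.+1 k).
  congr (RtoC _ * _); rewrite !S_INR; ring.
have e : PSc dc w = w * (w * (w * (w * PSc dc w))) + csum (fun l => stepB0 L Q k l * soly L Q c0 w l)
   + csum (fun l => stepB1 Q k l * (w * soly L Q c0 w l)) + csum (fun l => stepB0 L Q k l * (w * (w * soly L Q c0 w l))).
  rewrite {1}(PSc_ext w edc) !PSc_plus //; try (by repeat apply: gb_plus).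
  rewrite !PSc_sh // e1 e2 e3; congr (_ + _ + _ + _); apply: csum_ext => l.
    by rewrite ep1.
  by rewrite ep2.
have -> : (1 - w * w * w * w) * PSc dc w = PSc dc w - w * (w * (w * (w * PSc dc w))) by ring.
rewrite {1}e.
transitivity (csum (fun l => stepB0 L Q k l * soly L Q c0 w l)
   + csum (fun l => stepB1 Q k l * (w * soly L Q c0 w l)) + csum (fun l => stepB0 L Q k l * (w * (w * soly L Q c0 w l)))); first ring.
by rewrite -!csum_plus; apply: csum_ext => l; ring.
Qed.

Definition strip (s : C) : Prop := (0 < Im s < 2 * PI)%R.

Definition zt (s : C) : C := Cexp (RtoC (/ 2) * s + - (Ci * RtoC (PI / 2))).
(* [w = (zeta - 1) / (zeta + 1)] with [zeta = e^((s - i pi) / 2)] maps the strip into the unit disc; in this variable the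
   equation reads [(1 - w^4) y' = ((4 L - 2 Q) (1 + w^2) - 4 Q w) y], so its power series at [w = 0] converges on the strip. *)
Definition wof (s : C) : C := (zt s - 1) / (zt s + 1).
Definition zz (s : C) : C := Cexp s / (1 - Cexp s).

Lemma re_zt s : strip s -> (0 < Re (zt s))%R.
Proof.
move=> [h1 h2]; rewrite /zt re_Cexp; apply: Rmult_lt_0_compat; first exact: exp_pos.
have -> : Im (RtoC (/ 2) * s + - (Ci * RtoC (PI / 2))) = ((Im s - PI) / 2)%R.
  rewrite im_plus im_opp !im_mult !re_RtoC !im_RtoC -[Re Ci]/0%R -[Im Ci]/1%R; field.
apply: cos_gt_0; lra.
Qed.

Lemma zt_sq s : Cexp s = - (zt s * zt s).
Proof.
rewrite /zt -Cexp_plus.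
have -> : - Cexp (RtoC (/ 2) * s + - (Ci * RtoC (PI / 2)) + (RtoC (/ 2) * s + - (Ci * RtoC (PI / 2))))
  = Cexp (Ci * RtoC PI) * Cexp (RtoC (/ 2) * s + - (Ci * RtoC (PI / 2)) + (RtoC (/ 2) * s + - (Ci * RtoC (PI / 2)))).
  rewrite Cexp_PI; have -> : RtoC (-1) = - RtoC 1 by rewrite -RtoC_opp.
  ring.
rewrite -Cexp_plus; congr Cexp; rewrite /Rdiv !RtoC_mult RtoC_inv; last lra.
by field.
Qed.

Lemma zt1_ne0 s : strip s -> zt s + 1 <> RtoC 0.
Proof. by move=> /re_zt h /(f_equal Re); rewrite re_plus !re_RtoC; lra. Qed.

Lemma one_minus_z s : strip s -> 1 - Cexp s <> RtoC 0.
Proof.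
move=> /re_zt h; rewrite zt_sq; have -> : 1 - - (zt s * zt s) = 1 + zt s * zt s by ring.
move=> e; have h1 := f_equal Re e; have h2 := f_equal Im e; move: h1 h2.
rewrite re_plus im_plus re_mult im_mult !re_RtoC !im_RtoC; set x := Re _ in h *; set y := Im _ => h1 h2.
have : (x * y = 0)%R by lra.
case/Rmult_integral => h3; first lra.
by rewrite h3 in h1; nra.
Qed.

Lemma wof_lt1 s : strip s -> (Cmod (wof s) < 1)%R.
Proof.
move=> hs; have h := re_zt hs; have h1 := zt1_ne0 hs.
rewrite /wof Cmod_div //; have m0 : (0 < Cmod (zt s + 1)%C)%R by apply/Cmod_gt_0.
apply: (Rmult_lt_reg_r (Cmod (zt s + 1)%C)) => //; rewrite /Rdiv Rmult_assoc Rinv_l; last lra.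
rewrite Rmult_1_l Rmult_1_r.
apply: Rsqr_incrst_0; [|exact: Cmod_ge_0|exact: Cmod_ge_0].
rewrite !Rsqr_pow2 !Cmod2_alt re_minus im_minus re_plus im_plus !re_RtoC !im_RtoC.
move: (Re _) (Im _) h => x y h; nra.
Qed.

Lemma Cder_wof s : strip s -> Cder wof s (zt s / ((zt s + 1) * (zt s + 1))).
Proof.
move=> hs; have h1 := zt1_ne0 hs.
have hz : Cder zt s (RtoC (/ 2) * zt s) by apply: Cder_Cexp_lin.
have hp := Cder_plus hz (Cder_const 1 s); have hm := Cder_plus hz (Cder_const (- RtoC 1) s).
have hi := Cder_comp hp (Cder_inv h1).
apply: Cder_eq (Cder_mult hm hi); rewrite RtoC_inv; last lra.
by field.
Qed.

Definition ysol N (L Q : cmat N) (c0 : cvec N) (s : C) : cvec N := soly L Q c0 (wof s).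

Lemma ysol_ode N (L Q : cmat N) (c0 : cvec N) s k : strip s ->
  Cder (fun s => ysol L Q c0 s k) s (csum (fun l => (L k l + zz s * Q k l) * ysol L Q c0 s l)).
Proof.
move=> hs; have [y' [hy e]] := soly_ode L Q c0 k (wof_lt1 hs).
apply: Cder_eq (Cder_comp (Cder_wof hs) hy).
have h1 := zt1_ne0 hs; have h2 := one_minus_z hs; rewrite /zz zt_sq.
have t0 : zt s <> RtoC 0 by apply: Cexp_ne0.
rewrite zt_sq in h2; rewrite /ysol; set t := zt s in h1 h2 t0 *.
have h2' : t * t + 1 <> RtoC 0 by move=> h; apply: h2; rewrite -h; ring.
(* 1 - w^4 carries the factor zeta^2 + 1 = 1 - z, so dividing by it reproduces the denominator of
   [zz]. *)
have ew : 1 - wof s * wof s * wof s * wof s = RtoC 8 * t * (t * t + 1) / ((t + 1) * (t + 1) * ((t + 1) * (t + 1))).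
  by rewrite /wof -/t; field.
have n0 : RtoC 8 * t * (t * t + 1) <> RtoC 0.
  by do 2 (apply: Cmult_neq_0 => //); move/RtoC_inj; lra.
have -> : y' = (1 - wof s * wof s * wof s * wof s) * y' * ((t + 1) * (t + 1) * ((t + 1) * (t + 1))) / (RtoC 8 * t * (t * t + 1)).
  rewrite ew; field; repeat split => //; by move/RtoC_inj; lra.
rewrite e /Cdiv -!csum_scal_r -csum_scal; apply: csum_ext => l; rewrite /stepB0 /stepB1 /wof -/t.
field; repeat split => //; by move=> h; apply: h2; rewrite -h; ring.
Qed.

(* A solution of the adjoint equation has a constant pairing with every solution; this inverts the fundamental matrix
   and extends local solutions to the whole strip. *)
Definition adjm N (L : cmat N) : cmat N := fun k l => - L l k.

Lemma pairing_der N (m : cmat N) (x y : C -> cvec N) (s : C) :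
  (forall k, Cder (fun s => y s k) s (csum (fun l => m k l * y s l))) ->
  (forall k, Cder (fun s => x s k) s (csum (fun l => - m l k * x s l))) ->
  Cder (fun s => csum (fun k => x s k * y s k)) s 0.
Proof.
move=> hy hx.
have h k := Cder_mult (hx k) (hy k).
apply: Cder_eq (Cder_csum h).
rewrite csum_plus.
have -> : csum (fun k => csum (fun l => - m l k * x s l) * y s k) =
   - csum (fun k => csum (fun l => m l k * x s l * y s k)).
  rewrite -csum_opp; apply: csum_ext => k; rewrite -csum_scal_r -csum_opp; apply: csum_ext => l; ring.
have -> : csum (fun k => x s k * csum (fun l => m k l * y s l)) =
   csum (fun k => csum (fun l => m k l * x s k * y s l)).
  by apply: csum_ext => k; rewrite -csum_scal; apply: csum_ext => l; ring.
rewrite csum_exchange; ring.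
Qed.

Definition convex_set (U : C -> Prop) : Prop :=
  forall a b (t : R), U a -> U b -> (0 <= t <= 1)%R -> U (a + RtoC t * (b - a)).

Lemma convex_pos (x y t : R) : (0 < x -> 0 < y -> 0 <= t <= 1 -> 0 < x + t * (y - x))%R.
Proof.
move=> hx hy [t0 t1]; case: (Rle_dec t (/ 2)) => h.
  have := Rmult_le_pos _ _ t0 (Rlt_le _ _ hy); nra.
have : (0 <= (1 - t) * x)%R by apply: Rmult_le_pos; lra.
nra.
Qed.

Lemma strip_convex : convex_set strip.
Proof.
move=> a b t [a1 a2] [b1 b2] ht; rewrite /strip im_plus im_scal_l im_minus.
have := convex_pos a1 b1 ht; have := @convex_pos (2 * PI - Im a) (2 * PI - Im b) t ltac:(lra) ltac:(lra) ht.
by split; lra.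
Qed.

Definition lstrip (s : C) : Prop := strip s /\ (Re s < 0)%R.
Definition rstrip (s : C) : Prop := strip s /\ (0 < Re s)%R.

Lemma lstrip_convex : convex_set lstrip.
Proof.
move=> a b t [ha ra] [hb rb] ht; split; first exact: strip_convex.
rewrite re_plus re_scal_l re_minus.
by have := @convex_pos (- Re a) (- Re b) t ltac:(lra) ltac:(lra) ht; lra.
Qed.

Lemma rstrip_convex : convex_set rstrip.
Proof.
move=> a b t [ha ra] [hb rb] ht; split; first exact: strip_convex.
by rewrite re_plus re_scal_l re_minus; apply: convex_pos.
Qed.

(** The point mapped to w = 0: values of solutions at [smid] are the constant terms of their series
    in w. *)
Definition smid : C := Ci * RtoC PI.

Lemma smid_strip : strip smid.
Proof. have := PI_RGT_0; rewrite /strip /smid im_mult im_RtoC re_RtoC -[Re Ci]/0%R -[Im Ci]/1%R; split; lra. Qed.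

Lemma wof_smid : wof smid = RtoC 0.
Proof.
rewrite /wof /zt /smid; have -> : RtoC (/ 2) * (Ci * RtoC PI) + - (Ci * RtoC (PI / 2)) = 0.
  by rewrite /Rdiv RtoC_mult; ring.
rewrite Cexp_0; field; by move/RtoC_inj || (rewrite -RtoC_plus; move/RtoC_inj; lra).
Qed.

Lemma PSc_0 c : PSc c (RtoC 0) = c 0%N.
Proof.
have s : summable (fun n => c n * Cpow (RtoC 0) n).
  apply/summable_S; apply: summable_ext summable_0 => n; rewrite Cpow_S; ring.
rewrite /PSc Cser_S //= Cmult_1_r -[RHS]Cplus_0_r; congr Cplus.
rewrite -[RHS]Cser_0; apply: Cser_ext => n; ring.
Qed.

Lemma ysol_smid N (L Q : cmat N) (c0 : cvec N) k : ysol L Q c0 smid k = c0 k.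
Proof. by rewrite /ysol wof_smid /soly PSc_0. Qed.

(** Rows of the inverse of the fundamental matrix whose columns are the [ysolY]; both are normalised
    to the identity at [smid]. *)
Definition ysolX N (L Q : cmat N) (a : 'I_N) (s : C) : cvec N := ysol (adjm L) (adjm Q) (kron a) s.
Definition ysolY N (L Q : cmat N) (a : 'I_N) (s : C) : cvec N := ysol L Q (kron a) s.

Lemma ysolX_der N (L Q : cmat N) a s k : strip s ->
  Cder (fun s => ysolX L Q a s k) s (csum (fun l => - (L l k + zz s * Q l k) * ysolX L Q a s l)).
Proof.
move=> hs; apply: Cder_eq (ysol_ode _ _ _ _ hs); apply: csum_ext => l; rewrite /ysolX; move: (ysol _ _ _ _ _) => y; rewrite /adjm; ring.
Qed.

Lemma ysolX_pair N (L Q : cmat N) (G : C -> cvec N) (U : C -> Prop) a s s' :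
  convex_set U -> (forall s, U s -> strip s) ->
  (forall s k, U s -> Cder (fun s => G s k) s (csum (fun l => (L k l + zz s * Q k l) * G s l))) ->
  U s -> U s' ->
  csum (fun k => ysolX L Q a s k * G s k) = csum (fun k => ysolX L Q a s' k * G s' k).
Proof.
move=> hU hs hG us us'; apply: (Cder0_const (f := fun s => csum (fun k => ysolX L Q a s k * G s k))) => t ht.
have ut := hU _ _ _ us us' ht.
apply: (@pairing_der N (fun k l => L k l + zz (s + RtoC t * (s' - s)) * Q k l)) => k; first exact: hG.
by apply: ysolX_der; apply: hs.
Qed.

Lemma ysolXY N (L Q : cmat N) a b s : strip s ->
  csum (fun k => ysolX L Q a s k * ysolY L Q b s k) = kron a b.
Proof.
move=> hs; rewrite (ysolX_pair (U := strip) a strip_convex _ _ hs smid_strip) //; last first.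
  by move=> u k hu; apply: ysol_ode.
rewrite /ysolX /ysolY -[RHS](csum_kron a (fun k => kron k b)); apply: csum_ext => k.
by rewrite !ysol_smid /kron [b == k]eq_sym.
Qed.

Lemma ysolYX N (L Q : cmat N) k l s : strip s ->
  csum (fun a => ysolY L Q a s k * ysolX L Q a s l) = kron k l.
Proof.
move=> hs; apply: (left_inverse_right (A := fun a k => ysolX L Q a s k) (B := fun k b => ysolY L Q b s k)).
by move=> a b; apply: ysolXY.
Qed.

Definition ext N (L Q : cmat N) (A : cvec N) (s : C) : cvec N :=
  fun k => csum (fun a => A a * ysolY L Q a s k).

Lemma ext_der N (L Q : cmat N) (A : cvec N) s k : strip s -> exists d, Cder (fun s => ext L Q A s k) s d.
Proof.
move=> hs; eexists; apply: Cder_csum => a; apply: Cder_scal; exact: ysol_ode.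
Qed.

Lemma ext_smid N (L Q : cmat N) (A : cvec N) k : ext L Q A smid k = A k.
Proof.
rewrite /ext -[RHS](csum_kron_r k A); apply: csum_ext => a; by rewrite /ysolY ysol_smid.
Qed.

Definition coordX N (L Q : cmat N) (G : C -> cvec N) (s : C) : cvec N :=
  fun a => csum (fun k => ysolX L Q a s k * G s k).

(** The pairings of [G] with the [ysolX] are constant on [U], so [G] is there the combination of the
    [ysolY] with these constants; that combination is defined on the whole strip. *)
Lemma ext_coord N (L Q : cmat N) (G : C -> cvec N) (U : C -> Prop) s s' k :
  convex_set U -> (forall s, U s -> strip s) ->
  (forall s k, U s -> Cder (fun s => G s k) s (csum (fun l => (L k l + zz s * Q k l) * G s l))) ->
  U s -> U s' -> ext L Q (coordX L Q G s') s k = G s k.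
Proof.
move=> hU hs hG us us'; rewrite /ext.
transitivity (csum (fun l => csum (fun a => ysolY L Q a s k * ysolX L Q a s l) * G s l)).
  rewrite (csum_ext (G := fun a => csum (fun l => ysolY L Q a s k * ysolX L Q a s l * G s l))); last first.
    move=> a; rewrite /coordX -(ysolX_pair a hU hs hG us us') Cmult_comm -csum_scal; apply: csum_ext => l; ring.
  by rewrite csum_exchange; apply: csum_ext => l; rewrite csum_scal_r.
rewrite -[RHS](csum_kron k (fun l => G s l)); apply: csum_ext => l; rewrite ysolYX //; exact: hs.
Qed.

(** ** Series solutions at 0 and at infinity *)

Definition ser0 N (la : C) (a : nat -> cvec N) (s : C) : cvec N :=
  fun k => Cexp (la * s) * PSc (fun n => a n k) (Cexp s).
Definition serinf N (m : C) (b : nat -> cvec N) (s : C) : cvec N :=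
  fun k => Cexp (m * s) * PSc (fun n => b n k) (Cexp (- s)).

Definition diagm N (lam : 'I_N -> C) : cmat N := fun k l => lam k * kron k l.
(** The matrix of Q after the k-th coordinate has been divided by [dl k], the k-th coordinate of
    [v]: all its rows become equal. *)
Definition rank1 N (dl : 'I_N -> C) : cmat N := fun _ l => dl l.

Lemma diag_rank1_apply N (lam dl : 'I_N -> C) (c : C) (y : cvec N) k :
  csum (fun l => (diagm lam k l + c * rank1 dl k l) * y l) = lam k * y k + c * csum (fun l => dl l * y l).
Proof.
rewrite -csum_scal -[in RHS](csum_kron k y) -csum_scal -csum_plus; apply: csum_ext => l.
rewrite /diagm /rank1; ring.
Qed.

Lemma Cmod_Cexp_lt1 s : (Re s < 0)%R -> (Cmod (Cexp s) < 1)%R.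
Proof. by move=> h; rewrite Cmod_Cexp -exp_0; apply: exp_increasing. Qed.

Lemma Cder_lin_exp (a s : C) : Cder (fun s => Cexp (a * s)) s (a * Cexp (a * s)).
Proof.
apply: (Cder_ext (f := fun s => Cexp (a * s + 0))) => [x|]; first by rewrite Cplus_0_r.
by have := Cder_Cexp_lin a 0 s; rewrite Cplus_0_r.
Qed.

(** Let D be the series of the sums of dl_l a_l. As a relation of power series in z the recursion
    reads W = z (W + D), that is W = z / (1 - z) D. *)
Lemma ser0_zu N (la : C) (dl : 'I_N -> C) (a : nat -> cvec N) (W : nat -> C) s :
  (forall k, gb (fun n => a n k)) -> gb W -> W 0%N = RtoC 0 ->
  (forall n, W n.+1 = W n + csum (fun l => dl l * a n l)) -> lstrip s ->
  Cexp (la * s) * PSc W (Cexp s) = zz s * csum (fun l => dl l * ser0 la a s l).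
Proof.
move=> ga gW W0 WS [hs hr].
have hz := Cmod_Cexp_lt1 hr; have h1 := one_minus_z hs.
have gd : gb (fun n => csum (fun l => dl l * a n l)) by apply: gb_csum => l; apply: gb_scal.
have e : PSc W (Cexp s) = Cexp s * (PSc W (Cexp s) + csum (fun l => dl l * PSc (fun n => a n l) (Cexp s))).
  rewrite {1}(@PSc_ext W (sh (fun n => W n + csum (fun l => dl l * a n l)))); last first.
    by case=> [|n]; [rewrite W0 | rewrite WS].
  rewrite PSc_sh //; last exact: gb_plus.
  rewrite PSc_plus // PSc_csum //; last by move=> l; apply: gb_scal.
  by congr (_ * (_ + _)); apply: csum_ext => l; rewrite PSc_scal.
have -> : csum (fun l => dl l * ser0 la a s l) = Cexp (la * s) * csum (fun l => dl l * PSc (fun n => a n l) (Cexp s)).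
  by rewrite -csum_scal; apply: csum_ext => l; rewrite /ser0; ring.
move: e; set w := PSc W _; set D := csum _ => e.
have -> : w = Cexp s * D / (1 - Cexp s).
  have e2 : w * (1 - Cexp s) = Cexp s * D by have -> : w * (1 - Cexp s) = w - Cexp s * w by [ring]; rewrite {1}e; ring.
  by rewrite -e2; field.
by rewrite /zz; field.
Qed.

Lemma ser0_ode N (la : C) (lam dl : 'I_N -> C) (a : nat -> cvec N) (W : nat -> C) s k :
  (forall k, gb (fun n => a n k)) -> gb W -> W 0%N = RtoC 0 ->
  (forall n k, (la + RtoC (INR n) - lam k) * a n k = W n) ->
  (forall n, W n.+1 = W n + csum (fun l => dl l * a n l)) -> lstrip s ->
  Cder (fun s => ser0 la a s k) s (csum (fun l => (diagm lam k l + zz s * rank1 dl k l) * ser0 la a s l)).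
Proof.
move=> ga gW W0 hW WS hs; rewrite diag_rank1_apply -(ser0_zu la ga gW W0 WS hs).
have hz := Cmod_Cexp_lt1 (proj2 hs).
apply: Cder_eq (Cder_mult (Cder_lin_exp la s) (Cder_comp (Cder_Cexp s) (Cder_PSc (ga k) hz))).
rewrite (PSc_euler (ga k) hz) /ser0.
have -> : PSc W (Cexp s) = (la - lam k) * PSc (fun n => a n k) (Cexp s) + PSc (fun n => RtoC (INR n) * a n k) (Cexp s).
  rewrite -PSc_scal // -PSc_plus //; [|exact: gb_scal|exact: gb_mul_n].
  by apply: PSc_ext => n; rewrite -(hW n k); ring.
ring.
Qed.

(** In powers of 1/z the recursion reads (1/z - 1) V = D, which is again V = z / (1 - z) D. *)
Lemma serinf_zu N (m : C) (dl : 'I_N -> C) (b : nat -> cvec N) (V : nat -> C) s :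
  (forall k, gb (fun n => b n k)) -> gb V ->
  (forall n, sh V n - V n = csum (fun l => dl l * b n l)) -> rstrip s ->
  Cexp (m * s) * PSc V (Cexp (- s)) = zz s * csum (fun l => dl l * serinf m b s l).
Proof.
move=> gbb gV VS [hs hr].
have hz : (Cmod (Cexp (- s)) < 1)%R by apply: Cmod_Cexp_lt1; rewrite re_opp; lra.
have h1 := one_minus_z hs.
have -> : csum (fun l => dl l * serinf m b s l) = Cexp (m * s) * csum (fun l => dl l * PSc (fun n => b n l) (Cexp (- s))).
  by rewrite -csum_scal; apply: csum_ext => l; rewrite /serinf; ring.
have <- : Cexp (- s) * PSc V (Cexp (- s)) - PSc V (Cexp (- s)) = csum (fun l => dl l * PSc (fun n => b n l) (Cexp (- s))).
  rewrite -PSc_sh //.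
  have -> : PSc (sh V) (Cexp (- s)) - PSc V (Cexp (- s)) = PSc (sh V) (Cexp (- s)) + (- RtoC 1) * PSc V (Cexp (- s)) by ring.
  rewrite -PSc_scal // -PSc_plus //; [|exact: gb_sh|exact: gb_scal].
  rewrite (@PSc_ext _ (fun n => csum (fun l => dl l * b n l))); last by move=> n; rewrite -VS; ring.
  rewrite PSc_csum //; last by move=> l; apply: gb_scal.
  by apply: csum_ext => l; rewrite PSc_scal.
rewrite Cexp_opp /zz; field; split=> //; exact: Cexp_ne0.
Qed.

Lemma serinf_ode N (m : C) (lam dl : 'I_N -> C) (b : nat -> cvec N) (V : nat -> C) s k :
  (forall k, gb (fun n => b n k)) -> gb V ->
  (forall n k, (m - RtoC (INR n) - lam k) * b n k = V n) ->
  (forall n, sh V n - V n = csum (fun l => dl l * b n l)) -> rstrip s ->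
  Cder (fun s => serinf m b s k) s (csum (fun l => (diagm lam k l + zz s * rank1 dl k l) * serinf m b s l)).
Proof.
move=> gbb gV hV VS hs; rewrite diag_rank1_apply -(serinf_zu m gbb gV VS hs).
have hz : (Cmod (Cexp (- s)) < 1)%R by apply: Cmod_Cexp_lt1; rewrite re_opp; case: hs; lra.
have hn : Cder (fun s => Cexp (- s)) s (- Cexp (- s)).
  apply: (Cder_ext (f := fun s => Cexp (- RtoC 1 * s))) => [x|]; first by congr Cexp; ring.
  by apply: Cder_eq (Cder_lin_exp _ _); rewrite (_ : - RtoC 1 * s = - s); ring.
apply: Cder_eq (Cder_mult (Cder_lin_exp m s) (Cder_comp hn (Cder_PSc (gbb k) hz))).
have -> : PSc V (Cexp (- s)) = (m - lam k) * PSc (fun n => b n k) (Cexp (- s)) + (- RtoC 1) * PSc (fun n => RtoC (INR n) * b n k) (Cexp (- s)).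
  rewrite -!PSc_scal // -?PSc_plus //; [|exact: gb_scal|by apply: gb_scal; apply: gb_mul_n|exact: gb_mul_n].
  by apply: PSc_ext => n; rewrite -(hV n k); ring.
rewrite -(PSc_euler (gbb k) hz) /serinf; ring.
Qed.

(** * Pochhammer products and the reciprocal Gamma function *)

Definition poch (a : C) (n : nat) : C := \big[Cmult/RtoC 1]_(k < n) (a + RtoC (INR k)).

(** Excludes the poles of Gamma, so that no Pochhammer product starting at [a] vanishes. *)
Definition good (a : C) : Prop := forall l : nat, a + RtoC (INR l) <> RtoC 0.

Lemma poch0 a : poch a 0 = RtoC 1.
Proof. by rewrite /poch big_ord0. Qed.

Lemma pochS a n : poch a n.+1 = poch a n * (a + RtoC (INR n)).
Proof. by rewrite /poch big_ord_recr. Qed.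

Lemma poch_add a m n : poch a (m + n) = poch a m * poch (a + RtoC (INR m)) n.
Proof.
elim: n => [|n IH]; first by rewrite addn0 poch0 Cmult_1_r.
by rewrite addnS !pochS IH plus_INR RtoC_plus; ring.
Qed.

Lemma poch1 a : poch a 1 = a.
Proof. by rewrite pochS poch0 /=; ring. Qed.

Lemma poch_left a n : poch a n.+1 = a * poch (a + 1) n.
Proof. by rewrite -add1n poch_add poch1. Qed.

Lemma good_S a : good a -> good (a + 1).
Proof.
move=> h l e; apply: (h l.+1); rewrite S_INR RtoC_plus -e; ring.
Qed.

Lemma good_nat a (n : nat) : good a -> good (a + RtoC (INR n)).
Proof. by move=> h l e; apply: (h (n + l)%N); rewrite plus_INR RtoC_plus -e; ring. Qed.

Lemma poch_ne0 a n : good a -> poch a n <> RtoC 0.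
Proof.
move=> h; elim: n => [|n IH]; first by rewrite poch0; apply: C1_nz.
by rewrite pochS; apply: Cmult_neq_0.
Qed.

(** A telescoping weight, the common majorant for the infinite products and for the series at z =
    -1. *)
Definition telw (n : nat) : R := (/ ((INR n + 1) * (INR n + 2)))%R.

Lemma telw_eq n : telw n = (/ (INR n + 1) - / (INR n + 2))%R.
Proof. by rewrite /telw; field; have := pos_INR n; lra. Qed.

Lemma telw_pos n : (0 < telw n)%R.
Proof. by apply: Rinv_0_lt_compat; have := pos_INR n; nra. Qed.

Lemma telw_series : ex_series telw.
Proof.
exists 1%R; change (is_lim_seq (sum_n telw) 1%R); have h n : sum_n telw n = (1 - / (INR n + 2))%R.
  elim: n => [|n IH]; first by rewrite sum_O telw_eq /=; field.
  rewrite sum_Sn IH telw_eq S_INR /plus /=; field; have := pos_INR n; lra.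
apply: (is_lim_seq_ext (fun n => 1 - / (INR n + 2))%R) => [n|]; first by rewrite h.
have {2}-> : 1%R = (1 - 0)%R by ring.
apply: is_lim_seq_minus'; first exact: is_lim_seq_const.
apply: (is_lim_seq_inv _ p_infty) => //.
apply: (is_lim_seq_plus _ _ p_infty (Rbar.Finite 2)) => //; [exact: is_lim_seq_INR | exact: is_lim_seq_const].
Qed.

(** A discrete Gronwall inequality: each step multiplies the modulus by at most 1 + K telw(n) <=
    exp(K telw(n)), and the exponents telescope. *)
Lemma prod_seq_bound (P : nat -> C) (K : R) : (0 <= K)%R ->
  (forall n, (Cmod (P n.+1 - P n) <= Cmod (P n) * (K * telw n))%R) ->
  forall n, (Cmod (P n) <= Cmod (P 0%N) * exp (2 * K))%R.
Proof.
move=> K0 h n.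
suff : (Cmod (P n) <= Cmod (P 0%N) * exp (K * (2 - / (INR n + 1))))%R.
  move=> h1; apply: Rle_trans h1 _; apply: Rmult_le_compat_l; first exact: Cmod_ge_0.
  have : (0 < / (INR n + 1))%R by apply: Rinv_0_lt_compat; have := pos_INR n; lra.
  move=> h2; case: (Req_dec K 0) => [->|Kn]; first by rewrite !Rmult_0_r Rmult_0_l; lra.
  by apply: Rlt_le; apply: exp_increasing; nra.
elim: n => [|n IH].
  have h1 := exp_ineq1_le (K * (2 - / (INR 0 + 1))).
  have e : (/ (INR 0 + 1) = 1)%R by rewrite /=; field.
  rewrite e in h1 *; have := Cmod_ge_0 (P 0%N); nra.
have h1 : (Cmod (P n.+1) <= Cmod (P n) * (1 + K * telw n))%R.
  have := Cmod_triangle (P n) (P n.+1 - P n); have -> : P n + (P n.+1 - P n) = P n.+1 by ring.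
  have := h n; lra.
apply: Rle_trans h1 _.
have -> : (K * (2 - / (INR n.+1 + 1)) = K * (2 - / (INR n + 1)) + K * telw n)%R.
  by rewrite telw_eq S_INR; field; have := pos_INR n; lra.
rewrite exp_plus -Rmult_assoc; apply: Rmult_le_compat => //; first exact: Cmod_ge_0.
  by have := telw_pos n; nra.
exact: exp_ineq1_le.
Qed.

Lemma sum_n_tel (P : nat -> C) n : @sum_n C_AbelianGroup (fun n => P n.+1 - P n) n = P n.+1 - P 0%N.
Proof.
elim: n => [|n IH]; first by rewrite sum_O.
by rewrite sum_Sn IH /plus /=; ring.
Qed.

Lemma prod_seq_lim (P : nat -> C) (K : R) : (0 <= K)%R ->
  (forall n, (Cmod (P n.+1 - P n) <= Cmod (P n) * (K * telw n))%R) ->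
  Clim P (P 0%N + Cser (fun n => P n.+1 - P n)).
Proof.
move=> K0 h; have hb := prod_seq_bound K0 h.
have s : summable (fun n => P n.+1 - P n).
  apply: (summable_le (b := fun n => (Cmod (P 0%N) * exp (2 * K) * K * telw n)%R)).
    move=> n; apply: Rle_trans (h n) _; have := hb n; have := telw_pos n => t0 b.
    by rewrite Rmult_assoc; apply: Rmult_le_compat_r => //; nra.
  exact: (ex_series_scal_l _ _ telw_series).
apply: Clim_incr_1'; apply: Clim_ext (Clim_plus (Clim_const (P 0%N)) (Cser_Clim s)) => n.
rewrite sum_n_tel; ring.
Qed.

(** Each limit is the initial value plus the sum of the increments, and the common constant [K] lets
    [tannery] exchange this sum with the limit in [q]. *)
Lemma prod_seq_cont (P : nat -> nat -> C) (Q : nat -> C) (K : R) (l : nat -> C) (m : C) : (0 <= K)%R ->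
  (forall q n, (Cmod (P q n.+1 - P q n) <= Cmod (P q n) * (K * telw n))%R) ->
  (forall n, Clim (fun q => P q n) (Q n)) ->
  (forall q, Clim (P q) (l q)) -> Clim Q m -> Clim l m.
Proof.
move=> K0 h hQ hl hm.
have hq n : (Cmod (Q n.+1 - Q n) <= Cmod (Q n) * (K * telw n))%R.
  apply: (is_lim_seq_le _ _ (Rbar.Finite _) (Rbar.Finite _) (fun q => h q n)).
    exact: Clim_Cmod (Clim_minus (hQ n.+1) (hQ n)).
  have -> : (Cmod (Q n) * (K * telw n) = (K * telw n) * Cmod (Q n))%R by ring.
  apply: (is_lim_seq_ext (fun q => (K * telw n) * Cmod (P q n))%R) => [q|]; first ring.
  exact: (is_lim_seq_scal_l _ (K * telw n)%R (Rbar.Finite _) (Clim_Cmod (hQ n))).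
have em := Clim_unique hm (prod_seq_lim K0 hq).
have el q := Clim_unique (hl q) (prod_seq_lim K0 (h q)).
rewrite em; apply: (Clim_ext (u := fun q => P q 0%N + Cser (fun n => P q n.+1 - P q n))) => [q|]; first by rewrite el.
apply: Clim_plus => //.
have [n1 hn1] := is_lim_seq_epsE (Clim_Cmod (hQ 0%N)) (eps := 1%R) ltac:(lra).
apply: (tannery (b := fun n => ((Cmod (Q 0%N) + 1) * exp (2 * K) * K * telw n)%R) (q0 := n1) _ _ _).2.
- exact: (ex_series_scal_l _ _ telw_series).
- move=> q n /hn1 /Rabs_def2 [h1 _]; apply: Rle_trans (h q n) _.
  have hb := prod_seq_bound K0 (h q) n; have t0 := telw_pos n; have e0 := exp_pos (2 * K).
  rewrite Rmult_assoc; apply: Rmult_le_compat_r; first nra.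
  apply: Rle_trans hb _; apply: Rmult_le_compat_r; lra.
- by move=> n; apply: Clim_minus.
Qed.

(** Gauss' sequence with (n + 1)^a in place of n^a: it needs no exception at n = 0 and has the same
    limit, since ln (n + 2) - ln (n + 1) tends to 0. *)
Definition gs (a : C) (n : nat) : C :=
  poch a n.+1 / (RtoC (INR (Factorial.fact n)) * Cexp (a * RtoC (ln (INR n + 1)))).

Lemma fact_ne0 n : RtoC (INR (Factorial.fact n)) <> RtoC 0.
Proof. by move/RtoC_inj; apply: INR_fact_neq_0. Qed.

Definition gsr (a : C) (n : nat) : C :=
  (1 + a * RtoC (/ (INR n + 1))) * Cexp (- (a * RtoC (ln (INR n + 2) - ln (INR n + 1)))).

Lemma gsS a n : gs a n.+1 = gs a n * gsr a n.
Proof.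
rewrite /gs /gsr [poch a n.+2]pochS fact_simpl mult_INR RtoC_mult Cexp_opp RtoC_minus.
have -> : a * (RtoC (ln (INR n + 2)) - RtoC (ln (INR n + 1))) = a * RtoC (ln (INR n + 2)) - a * RtoC (ln (INR n + 1)) by ring.
have -> : (INR n.+1 + 1 = INR n + 2)%R by rewrite S_INR; ring.
rewrite Cexp_minus RtoC_inv; last by have := pos_INR n; lra.
rewrite S_INR; have := @INR1_neq0 n; have := @fact_ne0 n.
move: (@Cexp_ne0 (a * RtoC (ln (INR n + 2)))) (@Cexp_ne0 (a * RtoC (ln (INR n + 1)))).
move: (Cexp _) (Cexp _) => x y hx hy h1 h2; field; repeat split => //.
Qed.

Lemma ln_step n : (/ (INR n + 2) <= ln (INR n + 2) - ln (INR n + 1) <= / (INR n + 1))%R.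
Proof.
have n0 := pos_INR n.
have key (x y : R) : (0 < x)%R -> (0 < y)%R -> (ln y - ln x <= (y - x) * / x)%R.
  move=> ha hb; rewrite -ln_div //.
  have h1 := exp_ineq1_le (ln (y / x)); rewrite exp_ln in h1; last exact: Rdiv_lt_0_compat.
  have e : ((y - x) * / x = y / x - 1)%R by field; lra.
  lra.
have h1 := key (INR n + 1)%R (INR n + 2)%R ltac:(lra) ltac:(lra).
have h2 := key (INR n + 2)%R (INR n + 1)%R ltac:(lra) ltac:(lra).
split.
  have : ((INR n + 1 - (INR n + 2)) * / (INR n + 2) = - / (INR n + 2))%R by field; lra.
  lra.
have : ((INR n + 2 - (INR n + 1)) * / (INR n + 1) = / (INR n + 1))%R by field; lra.
lra.
Qed.

(** With x = 1 / (n + 1) and t = ln ((n + 2) / (n + 1)) the ratio minus 1 equals a (x - t) - a^2 x t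
    + (1 + a x) E, where E is the second order remainder of exp (- a t). The three terms of the
    constant bound these three summands, using x - t <= telw(n) and x^2 <= 2 telw(n). *)
Lemma gsr_est (A : R) (a : C) (n : nat) : (Cmod a <= A)%R -> (2 * A <= INR n + 1)%R ->
  (Cmod (gsr a n - 1) <= (A + 2 * A * A + 16 * A * A * (1 + A)) * telw n)%R.
Proof.
move=> hA hn; have a0 := Cmod_ge_0 a; have n0 := pos_INR n.
have [t1 t2] := ln_step n; rewrite /gsr; set t := (ln _ - ln _)%R in t1 t2 *.
set x := (/ (INR n + 1))%R in t2 *.
have x0 : (0 < x)%R by apply: Rinv_0_lt_compat; lra.
have t0 : (0 < t)%R by apply: Rlt_le_trans t1; apply: Rinv_0_lt_compat; lra.
have xt : (0 <= x - t <= telw n)%R by rewrite telw_eq -/x; lra.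
have xx : (x * x <= 2 * telw n)%R.
  have -> : (2 * telw n = 2 * (INR n + 1) * / (INR n + 2) * (x * x))%R by rewrite /telw /x; field; lra.
  have : (1 <= 2 * (INR n + 1) * / (INR n + 2))%R.
    apply: (Rmult_le_reg_r (INR n + 2)); first lra.
    rewrite Rmult_assoc Rinv_l; lra.
  nra.
have xA : (x <= 1)%R by rewrite -Rinv_1; apply: Rinv_le_contravar; lra.
have Ax : (2 * A * x <= 1)%R.
  apply: (Rmult_le_reg_r (INR n + 1)); first lra.
  by rewrite Rmult_assoc /x Rinv_l; lra.
have hat : (Cmod (- (a * RtoC t)) = Cmod a * t)%R by rewrite Cmod_opp Cmod_mult Cmod_R Rabs_pos_eq //; lra.
have est := @Cexp_est (- (a * RtoC t)); rewrite hat in est.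
have {}est := est ltac:(nra).
set E := Cexp _ - 1 - _ in est.
have -> : Cexp (- (a * RtoC t)) = 1 - a * RtoC t + E by rewrite /E; ring.
have -> : (1 + a * RtoC x) * (1 - a * RtoC t + E) - 1 =
  a * RtoC (x - t) - a * a * RtoC (x * t) + (1 + a * RtoC x) * E by rewrite RtoC_minus RtoC_mult; ring.
have tw := telw_pos n.
have b1 : (Cmod (a * RtoC (x - t)) <= A * telw n)%R.
  by rewrite Cmod_mult Cmod_R Rabs_pos_eq; [apply: Rmult_le_compat; lra | lra].
have tt : (t * t <= x * x)%R by apply: Rmult_le_compat; lra.
have aa : (Cmod a * Cmod a <= A * A)%R by apply: Rmult_le_compat.
have b2 : (Cmod (a * a * RtoC (x * t)) <= 2 * A * A * telw n)%R.
  rewrite !Cmod_mult Cmod_R Rabs_pos_eq; last nra.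
  have -> : (2 * A * A * telw n = A * A * (2 * telw n))%R by ring.
  by apply: Rmult_le_compat => //; nra.
have b3 : (Cmod ((1 + a * RtoC x) * E) <= 16 * A * A * (1 + A) * telw n)%R.
  rewrite Cmod_mult.
  have c1 : (Cmod (1 + a * RtoC x)%C <= 1 + A)%R.
    apply: Rle_trans (Cmod_triangle _ _) _; rewrite Cmod_mult !Cmod_R Rabs_R1 Rabs_pos_eq; last lra.
    have : (Cmod a * x <= A * 1)%R by apply: Rmult_le_compat; lra.
    lra.
  have c2 : (Cmod E <= 16 * A * A * telw n)%R.
    apply: Rle_trans est _.
    have : ((Cmod a * Cmod a) * (t * t) <= (A * A) * (2 * telw n))%R by apply: Rmult_le_compat; [nra | nra | exact: aa | lra].
    lra.
  have -> : (16 * A * A * (1 + A) * telw n = (1 + A) * (16 * A * A * telw n))%R by ring.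
  by apply: Rmult_le_compat => //; exact: Cmod_ge_0.
move: b1 b2 b3; move: (a * RtoC (x - t)) (a * a * RtoC (x * t)) ((1 + a * RtoC x) * E) => p q r b1 b2 b3.
have := Cmod_triangle (p - q) r; have : (Cmod (p - q)%C <= Cmod p + Cmod q)%R.
  by rewrite -(Cmod_opp q); apply: Cmod_triangle.
lra.
Qed.

Lemma telw_shift m n : (telw (m + n) <= telw n)%R.
Proof.
have := pos_INR m; have := pos_INR n; rewrite /telw plus_INR => h1 h2; apply: Rinv_le_contravar; nra.
Qed.

(** One starting index and one constant serve the whole disc |a| <= A, which gives continuity of
    1/Gamma; the bound 1/2 keeps the ratios away from 0 and serves the reciprocals. *)
Lemma gs_seq (A : R) : (0 <= A)%R -> exists (n0 : nat) (K : R), (0 <= K)%R /\ forall a, (Cmod a <= A)%R ->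
  forall n, (Cmod (gs a (n0 + n.+1)%N - gs a (n0 + n)%N) <= Cmod (gs a (n0 + n)%N) * (K * telw n))%R /\
   (Cmod (gsr a (n0 + n)%N - 1) <= / 2)%R /\ (Cmod (gsr a (n0 + n)%N - 1) <= K * telw n)%R.
Proof.
move=> A0; set K := (A + 2 * A * A + 16 * A * A * (1 + A))%R.
have K0 : (0 <= K)%R by rewrite /K; nra.
have [n1 h1] := nat_above (2 * A); have [n2 h2] := nat_above (2 * K).
exists (n1 + n2)%N, K; split=> // a ha n.
have p1 := pos_INR n1; have p2 := pos_INR n2; have p3 := pos_INR n.
have e : (Cmod (gsr a (n1 + n2 + n)%N - 1) <= K * telw (n1 + n2 + n))%R.
  by apply: gsr_est => //; rewrite !plus_INR; lra.
have e' : (Cmod (gsr a (n1 + n2 + n)%N - 1) <= K * telw n)%R.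
  by apply: Rle_trans e _; apply: Rmult_le_compat_l => //; apply: telw_shift.
split.
  rewrite addnS gsS; have -> : gs a (n1 + n2 + n) * gsr a (n1 + n2 + n) - gs a (n1 + n2 + n) =
    gs a (n1 + n2 + n) * (gsr a (n1 + n2 + n) - 1) by ring.
  by rewrite Cmod_mult; apply: Rmult_le_compat_l => //; apply: Cmod_ge_0.
split=> //; apply: Rle_trans e _.
rewrite /telw !plus_INR; set y := (INR n1 + INR n2 + INR n)%R.
have y0 : (2 * K <= y /\ 0 <= y)%R by rewrite /y; lra.
apply: (Rmult_le_reg_r ((y + 1) * (y + 2))); first nra.
rewrite Rmult_assoc Rinv_l; nra.
Qed.

Lemma Clim_shift (n0 : nat) u l : Clim (fun n => u (n0 + n)%N) l -> Clim u l.
Proof.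
move=> [h1 h2]; split.
  by apply: (is_lim_seq_incr_n _ n0 _).2; apply: is_lim_seq_ext h1 => n; rewrite plusE addnC.
by apply: (is_lim_seq_incr_n _ n0 _).2; apply: is_lim_seq_ext h2 => n; rewrite plusE addnC.
Qed.

Lemma Clim_shift' (n0 : nat) u l : Clim u l -> Clim (fun n => u (n0 + n)%N) l.
Proof.
move=> [h1 h2]; split.
  by move/(is_lim_seq_incr_n _ n0 _).1: h1; apply: is_lim_seq_ext => n; rewrite plusE addnC.
by move/(is_lim_seq_incr_n _ n0 _).1: h2; apply: is_lim_seq_ext => n; rewrite plusE addnC.
Qed.

Lemma gs_ex_lim a : exists l, Clim (gs a) l.
Proof.
have [n0 [K [K0 h]]] := gs_seq (Cmod_ge_0 a).
have {}h n := proj1 (h a (Rle_refl _) n).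
by eexists; apply: (@Clim_shift n0); apply: (prod_seq_lim (P := fun n => gs a (n0 + n)%N) K0).
Qed.

Lemma filterlim_Clim u (l : C) : filterlim u eventually (@locally C_UniformSpace l) -> Clim u l.
Proof.
move=> h; split; apply/is_lim_seq_spec => eps.
  have [n0 hn] := h _ (ex_intro _ eps (fun y (hy : ball l eps y) => hy)).
  by exists n0 => n /hn [].
have [n0 hn] := h _ (ex_intro _ eps (fun y (hy : ball l eps y) => hy)).
by exists n0 => n /hn [].
Qed.

(** [lim] is total; on a convergent sequence the filter is Cauchy, and completeness identifies the
    value. *)
Lemma Clim_lim u l : Clim u l -> @lim C_CompleteNormedModule (filtermap u eventually) = l.
Proof.
move=> hu; have hf := Clim_filterlim hu.
have pf : ProperFilter (filtermap u eventually) by apply: filtermap_proper_filter; apply: eventually_filter.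
have hc : @cauchy C_CompleteNormedModule (filtermap u eventually).
  by move=> eps; exists l; apply: hf; exists eps.
apply: (Clim_unique (u := u)) => //.
apply: filterlim_Clim => P [eps he].
have h := @complete_cauchy C_CompleteNormedModule _ pf hc eps.
by apply: filter_imp h => x hx; apply: he.
Qed.

Lemma ln_ratio_lim : is_lim_seq (fun n => ln (INR n + 2) - ln (INR n + 1))%R 0%R.
Proof.
apply: (is_lim_seq_le_le (fun _ => 0%R) _ (fun n => / (INR n + 1))%R).
- move=> n; have [h1 h2] := ln_step n; split=> //; apply: Rle_trans h1.
  by apply: Rlt_le; apply: Rinv_0_lt_compat; have := pos_INR n; lra.
- exact: is_lim_seq_const.
apply: (is_lim_seq_inv _ p_infty) => //.
apply: (is_lim_seq_plus _ _ p_infty (Rbar.Finite 1)) => //; [exact: is_lim_seq_INR | exact: is_lim_seq_const].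
Qed.

Lemma Clim_RtoC (u : nat -> R) (l : R) : is_lim_seq u l -> Clim (fun n => RtoC (u n)) (RtoC l).
Proof. by move=> h; split=> //; apply: is_lim_seq_const. Qed.

Lemma rGamma_seq_gs a n : rGamma_seq a n.+1 = gs a n.+1 * Cexp (a * RtoC (ln (INR n + 2) - ln (INR n + 1))).
Proof.
rewrite /rGamma_seq /gs -[\big[_/_]_(_ < _) _]/(poch a n.+2).
have -> : a * RtoC (ln (INR n + 2) - ln (INR n + 1)) = a * RtoC (ln (INR n + 2)) - a * RtoC (ln (INR n + 1)).
  by rewrite RtoC_minus; ring.
have -> : (INR n.+1 + 1 = INR n + 2)%R by rewrite S_INR; ring.
rewrite Cexp_minus S_INR; move: (@fact_ne0 n.+1) (@Cexp_ne0 (a * RtoC (ln (INR n + 2)))) (@Cexp_ne0 (a * RtoC (ln (INR n + 1)))).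
by move: (Cexp _) (Cexp _) (RtoC (INR _)) => x y f h1 h2 h3; field.
Qed.

Lemma gs_cv a : Clim (gs a) (rGamma a).
Proof.
have [l hl] := gs_ex_lim a.
suff h : Clim (rGamma_seq a) l by rewrite /rGamma (Clim_lim h).
apply: Clim_incr_1'.
have h1 : Clim (fun n => Cexp (a * RtoC (ln (INR n + 2) - ln (INR n + 1)))) (RtoC 1).
  rewrite -Cexp_0 -(Cmult_0_r a); apply: Clim_Cexp; apply: Clim_scal; apply: Clim_RtoC; exact: ln_ratio_lim.
rewrite -(Cmult_1_r l); apply: Clim_ext (Clim_mult (Clim_incr_1 hl) h1) => n.
by rewrite rGamma_seq_gs.
Qed.

Lemma gs_ne0 a n : good a -> gs a n <> RtoC 0.
Proof.
move=> h; rewrite /gs; apply: Cmult_neq_0; first exact: poch_ne0.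
move=> e; have p : RtoC (INR (Factorial.fact n)) * Cexp (a * RtoC (ln (INR n + 1))) <> RtoC 0.
  by apply: Cmult_neq_0; [exact: fact_ne0 | exact: Cexp_ne0].
by have := Cinv_r _ p; rewrite e Cmult_0_r => /esym /C1_nz.
Qed.

(** The reciprocals also form a convergent product, because the ratios have modulus at least 1/2
    from some index on. The two limits multiply to 1, so neither vanishes. *)
Lemma gs_inv_cv a : good a -> rGamma a <> RtoC 0 /\ Clim (fun n => / gs a n) (/ rGamma a).
Proof.
move=> ga; have [n0 [K [K0 h]]] := gs_seq (Cmod_ge_0 a).
have {}h n := h a (Rle_refl _) n.
have h' n : (Cmod (/ gs a (n0 + n.+1)%N - / gs a (n0 + n)%N) <= Cmod (/ gs a (n0 + n)%N) * (2 * K * telw n))%R.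
  have [_ [h1 h2]] := h n.
  have g0 := gs_ne0 (n := (n0 + n)%N) ga; have g1 := gs_ne0 (n := (n0 + n.+1)%N) ga.
  move: (g1); rewrite addnS gsS => g1'.
  have r0 : gsr a (n0 + n) <> RtoC 0 by move=> e; apply: g1'; rewrite e Cmult_0_r.
  have -> : / (gs a (n0 + n) * gsr a (n0 + n)) - / gs a (n0 + n) =
    / gs a (n0 + n) * (- (gsr a (n0 + n) - 1) * / gsr a (n0 + n)) by field.
  rewrite Cmod_mult; apply: Rmult_le_compat_l; first exact: Cmod_ge_0.
  rewrite Cmod_mult Cmod_opp Cmod_inv //.
  have rl : (/ 2 <= Cmod (gsr a (n0 + n)))%R.
    have := Cmod_triangle (gsr a (n0 + n)) (- (gsr a (n0 + n) - 1)); rewrite Cmod_opp.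
    have -> : gsr a (n0 + n) + - (gsr a (n0 + n) - 1) = RtoC 1 by ring.
    rewrite Cmod_1; lra.
  have : (/ Cmod (gsr a (n0 + n)) <= 2)%R.
    have -> : 2%R = (/ / 2)%R by field.
    by apply: Rinv_le_contravar; lra.
  have : (0 < / Cmod (gsr a (n0 + n)))%R by apply: Rinv_0_lt_compat; lra.
  have := Cmod_ge_0 (gsr a (n0 + n) - 1).
  move: (/ _)%R (Cmod _) h2 => i c h2 c0 i0 i2; nra.
have K2 : (0 <= 2 * K)%R by lra.
have hl := prod_seq_lim (P := fun n => / gs a (n0 + n)%N) K2 h'.
have {}hl := @Clim_shift n0 (fun n => / gs a n) _ hl; set l := _ + _ in hl.
have h1 : rGamma a * l = RtoC 1.
  apply: Clim_unique (Clim_mult (gs_cv a) hl) _.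
  by apply: Clim_ext (Clim_const (RtoC 1)) => n; rewrite Cinv_r //; apply: gs_ne0.
have r0 : rGamma a <> RtoC 0 by move=> e; move: h1; rewrite e Cmult_0_l => /esym /C1_nz.
split=> //; have -> : / rGamma a = l by rewrite -[l]Cmult_1_l -(Cinv_l _ r0) -Cmult_assoc h1 Cmult_1_r.
exact: hl.
Qed.

Lemma rGamma_ne0 a : good a -> rGamma a <> RtoC 0.
Proof. by case/gs_inv_cv. Qed.

Lemma Clim_bounded u l : Clim u l -> exists B : R, (0 < B)%R /\ forall n, (Cmod (u n) <= B)%R.
Proof.
move=> h; have [M hM] := filterlim_bounded (K := C_AbsRing) (V := C_NormedModule) u (ex_intro _ l (Clim_filterlim h)).
exists (M + 1)%R; split; last by move=> n; apply: Rle_trans (hM n) _; lra.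
have := hM 0%N; have := Cmod_ge_0 (u 0%N); rewrite /norm /=; lra.
Qed.

Lemma Clim_poch n (a : nat -> C) (l : C) : Clim a l -> Clim (fun q => poch (a q) n) (poch l n).
Proof.
move=> h; elim: n => [|n IH].
  by rewrite poch0; apply: Clim_ext (Clim_const _) => q; rewrite poch0.
rewrite pochS; apply: Clim_ext (Clim_mult IH (Clim_plus h (Clim_const (RtoC (INR n))))) => q.
by rewrite pochS.
Qed.

Lemma rGamma_cont (a : nat -> C) (l : C) : Clim a l -> Clim (fun q => rGamma (a q)) (rGamma l).
Proof.
move=> h; have [B [B0 hB]] := Clim_bounded h.
have [n0 [K [K0 hK]]] := gs_seq (Rlt_le _ _ B0).
apply: (prod_seq_cont (P := fun q n => gs (a q) (n0 + n)%N) (Q := fun n => gs l (n0 + n)%N) K0).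
- by move=> q n; case: (hK (a q) (hB q) n).
- move=> n; apply: Clim_div; first by apply: Cmult_neq_0; [exact: fact_ne0 | exact: Cexp_ne0].
    exact: Clim_poch.
  apply: Clim_scal; apply: Clim_Cexp; apply: Clim_mult => //; exact: Clim_const.
- by move=> q; apply: (@Clim_shift' n0 _ _ (gs_cv (a q))).
- exact: (@Clim_shift' n0 _ _ (gs_cv l)).
Qed.

Lemma rGamma_S a : rGamma a = a * rGamma (a + 1).
Proof.
apply: (Clim_unique (Clim_incr_1 (gs_cv a))).
have h1 : Clim (fun n => RtoC (/ (INR n + 1) + 1)) (RtoC (0 + 1)).
  apply: Clim_RtoC; apply: is_lim_seq_plus'; last exact: is_lim_seq_const.
  apply: (is_lim_seq_inv _ p_infty) => //.
  apply: (is_lim_seq_plus _ _ p_infty (Rbar.Finite 1)) => //; [exact: is_lim_seq_INR | exact: is_lim_seq_const].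
have h3 : Clim (fun n => Cexp ((a + 1) * - RtoC (ln (INR n + 2) - ln (INR n + 1)))) (RtoC 1).
  have e : Cexp ((a + 1) * - RtoC 0) = RtoC 1 by rewrite -Cexp_0; congr Cexp; ring.
  rewrite -[X in Clim _ X]e.
  apply: Clim_Cexp; apply: Clim_mult; [exact: Clim_const | apply: Clim_opp; apply: Clim_RtoC; exact: ln_ratio_lim].
have h2 := Clim_scal a (Clim_mult (Clim_mult (gs_cv (a + 1)) h1) h3).
rewrite Rplus_0_l !Cmult_1_r in h2; apply: Clim_ext h2 => n.
rewrite /gs [poch a n.+2]poch_left.
have n0 := pos_INR n.
have e3 : RtoC (INR n + 2) = Cexp (RtoC (ln (INR n + 2))) by rewrite Cexp_R exp_ln //; lra.
have -> : RtoC (/ (INR n + 1) + 1) = Cexp (RtoC (ln (INR n + 2))) / RtoC (INR n + 1).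
  rewrite -e3 RtoC_plus RtoC_inv; last lra.
  have -> : (INR n + 2 = INR n + 1 + 1)%R by ring.
  by rewrite [RtoC (INR n + 1 + 1)]RtoC_plus; field; exact: INR1_neq0.
have -> : (INR n.+1 + 1 = INR n + 2)%R by rewrite S_INR; ring.
have -> : (a + 1) * - RtoC (ln (INR n + 2) - ln (INR n + 1)) = (a + 1) * RtoC (ln (INR n + 1)) - (a * RtoC (ln (INR n + 2)) + RtoC (ln (INR n + 2))).
  by rewrite RtoC_minus; ring.
rewrite Cexp_minus Cexp_plus fact_simpl mult_INR RtoC_mult S_INR.
move: (@fact_ne0 n) (@INR1_neq0 n) (@Cexp_ne0 (a * RtoC (ln (INR n + 2)))) (@Cexp_ne0 (RtoC (ln (INR n + 2)))) (@Cexp_ne0 ((a + 1) * RtoC (ln (INR n + 1)))).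
move: (Cexp _) (Cexp _) (Cexp _) (RtoC (INR (Factorial.fact n))) => x y z f h4 h5 h6 h7 h8.
by field; repeat split.
Qed.

(** * Growth of Pochhammer quotients *)

(** Equality of |g| with om th^e up to constant factors. The bounds are two-sided so that quotients
    can be formed; [om] holds the factorials, which cancel between products of equal length. *)
Definition comparable (T : Type) (om th : T -> R) (g : T -> C) (e : R) : Prop :=
  exists K : R, (0 < K)%R /\ forall t,
   (om t * Rpower (th t) e <= K * Cmod (g t))%R /\ (Cmod (g t) <= K * (om t * Rpower (th t) e))%R.

Lemma Rpower_pos x y : (0 < Rpower x y)%R.
Proof. exact: exp_pos. Qed.

Lemma comparable_ext (T : Type) (om om' th th' : T -> R) (g g' : T -> C) (e e' : R) :
  (forall t, om t * Rpower (th t) e = om' t * Rpower (th' t) e')%R -> (forall t, g t = g' t) ->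
  comparable om th g e -> comparable om' th' g' e'.
Proof. by move=> h1 h2 [K [K0 h]]; exists K; split=> // t; rewrite -h1 -h2. Qed.

Lemma comparable_div (T : Type) (om om' th th' th'' : T -> R) (g g' : T -> C) (e e' e'' : R) :
  (forall t, 0 < om t)%R -> (forall t, 0 < om' t)%R -> (forall t, g' t <> RtoC 0) ->
  (forall t, Rpower (th t) e / Rpower (th' t) e' = Rpower (th'' t) e'')%R ->
  comparable om th g e -> comparable om' th' g' e' ->
  comparable (fun t => om t / om' t)%R th'' (fun t => g t / g' t) e''.
Proof.
move=> o0 o0' g0 ht [K [K0 h]] [K' [K0' h']]; exists (K * K')%R; split; first nra.
move=> t; have [h1 h2] := h t; have [h3 h4] := h' t.
have gp : (0 < Cmod (g' t))%R by apply/Cmod_gt_0.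
rewrite -(ht t) Cmod_div //.
move: (Rpower_pos (th t) e) (Rpower_pos (th' t) e') h1 h2 h3 h4; move: (Rpower (th t) e) (Rpower (th' t) e') => r r' r0 r0' h1 h2 h3 h4.
have := o0 t; have := o0' t; move: (om t) (om' t) h1 h2 h3 h4 => o o' h1 h2 h3 h4 p' p.
have q0 : (0 < o' * r')%R by nra.
have -> : (o / o' * (r / r') = (o * r) / (o' * r'))%R by field; lra.
split.
  apply: (Rmult_le_reg_r (o' * r' * Cmod (g' t))); first nra.
  have -> : (o * r / (o' * r') * (o' * r' * Cmod (g' t)) = (o * r) * Cmod (g' t))%R by field; lra.
  have -> : (K * K' * (Cmod (g t) / Cmod (g' t)) * (o' * r' * Cmod (g' t)) = (K * Cmod (g t)) * (K' * (o' * r')))%R by field; lra.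
  by apply: Rmult_le_compat => //; nra.
apply: (Rmult_le_reg_r (o' * r' * Cmod (g' t))); first nra.
have -> : (Cmod (g t) / Cmod (g' t) * (o' * r' * Cmod (g' t)) = Cmod (g t) * (o' * r'))%R by field; lra.
have -> : (K * K' * (o * r / (o' * r')) * (o' * r' * Cmod (g' t)) = (K * (o * r)) * (K' * Cmod (g' t)))%R by field; lra.
by apply: Rmult_le_compat => //; [exact: Cmod_ge_0 | nra].
Qed.

Lemma comparable_comp (T U : Type) (f : U -> T) (om th : T -> R) (g : T -> C) (e : R) :
  comparable om th g e -> comparable (fun u => om (f u)) (fun u => th (f u)) (fun u => g (f u)) e.
Proof. by move=> [K [K0 h]]; exists K; split=> // u; apply: h. Qed.

(** Chosen so that |[poch a n]| is comparable to (n - 1)! n^(Re a); at n = 0 both [om1] and [th1]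
    equal 1, in agreement with the empty product. *)
Definition th1 (n : nat) : R := INR (maxn n 1).
Definition om1 (n : nat) : R := INR (Factorial.fact n.-1).

Lemma th1_ge1 n : (1 <= th1 n)%R.
Proof. by rewrite /th1; apply: (le_INR 1); apply/leP; rewrite leq_maxr. Qed.

Lemma th1_pos n : (0 < th1 n)%R.
Proof. have := th1_ge1 n; lra. Qed.

Lemma th1_le n : (th1 n <= INR n + 1)%R.
Proof. by rewrite /th1 -S_INR; apply: le_INR; apply/leP; rewrite geq_max leqnSn. Qed.

Lemma th1_ge n : (INR n + 1 <= 2 * th1 n)%R.
Proof.
have := th1_ge1 n; have : (INR n <= th1 n)%R by apply: le_INR; apply/leP; rewrite leq_maxl.
lra.
Qed.

Lemma om1_pos n : (0 < om1 n)%R.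
Proof. exact: INR_fact_lt_0. Qed.

Lemma poch_comparable a : good a -> comparable om1 th1 (poch a) (Re a).
Proof.
move=> ga; have [B [B0 hB]] := Clim_bounded (gs_cv a).
have [B' [B0' hB']] := Clim_bounded (gs_inv_cv ga).2.
exists (B + B' + 1)%R; split; first lra.
case=> [|n].
  rewrite poch0 Cmod_1 /om1 /th1 /= /Rpower ln_1 Rmult_0_r exp_0; lra.
have e : Cmod (poch a n.+1) = (Cmod (gs a n) * (om1 n.+1 * Rpower (th1 n.+1) (Re a)))%R.
  have -> : poch a n.+1 = gs a n * (RtoC (INR (Factorial.fact n)) * Cexp (a * RtoC (ln (INR n + 1)))).
    rewrite /gs; move: (@fact_ne0 n) (@Cexp_ne0 (a * RtoC (ln (INR n + 1)))) => h1 h2.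
    by field.
  rewrite Cmod_mult (Cmod_mult (RtoC _)) Cmod_R Rabs_pos_eq; last by apply: Rlt_le; apply: INR_fact_lt_0.
  rewrite Cmod_Cexp re_scal_r /om1 /th1 /Rpower; congr (_ * (_ * exp (_ * ln _)))%R.
  by rewrite -S_INR; congr INR; rewrite (maxn_idPl _).
have p : (0 < om1 n.+1 * Rpower (th1 n.+1) (Re a))%R by apply: Rmult_lt_0_compat; [exact: om1_pos | exact: Rpower_pos].
rewrite e; move: p; set r := (om1 _ * _)%R => p.
have h1 := hB n; have := hB' n; rewrite Cmod_inv; last exact: gs_ne0.
have g0 : (0 < Cmod (gs a n))%R by apply/Cmod_gt_0; apply: gs_ne0.
move=> h2; have h3 : (1 <= B' * Cmod (gs a n))%R.
  apply: (Rmult_le_reg_l (/ Cmod (gs a n))); first exact: Rinv_0_lt_compat.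
  have -> : (/ Cmod (gs a n) * (B' * Cmod (gs a n)) = B')%R by field; lra.
  lra.
split; last by nra.
have : (r <= B' * Cmod (gs a n) * r)%R by nra.
have : (0 <= Cmod (gs a n) * r)%R by nra.
nra.
Qed.

(* The pair (M, n) indexes the n-th factor of the series with parameters shifted M times. *)
Definition th2 (t : nat * nat) : R := (th1 (t.1 + t.2)%N / th1 t.1)%R.
Definition om2 (t : nat * nat) : R := (om1 (t.1 + t.2)%N / om1 t.1)%R.

Lemma Rpower_div x y e : (0 < x)%R -> (0 < y)%R -> (Rpower x e / Rpower y e = Rpower (x / y) e)%R.
Proof.
move=> hx hy; rewrite /Rpower ln_div // Rmult_minus_distr_l /Rminus exp_plus exp_Ropp //.
Qed.

Lemma poch_comparable2 a : good a ->
  comparable om2 th2 (fun t => poch (a + RtoC (INR t.1)) t.2) (Re a).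
Proof.
move=> ga; have h := poch_comparable ga.
have h1 := comparable_comp (fun t : nat * nat => (t.1 + t.2)%N) h.
have h2 := comparable_comp (fun t : nat * nat => t.1) h.
apply: comparable_ext (comparable_div (th'' := th2) (e'' := Re a) _ _ _ _ h1 h2) => //.
- by move=> t; rewrite poch_add; field; apply: poch_ne0.
- by move=> t; apply: om1_pos.
- by move=> t; apply: om1_pos.
- by move=> t; apply: poch_ne0.
- by move=> t; apply: Rpower_div; apply: th1_pos.
Qed.

(** Comparison functions for [poch (a - M) n]. By reflection its modulus is that of poch (1 - a) M
    divided by poch (1 - a) (M - n) when n <= M, and that of poch (1 - a) M times poch a (n - M)
    when n > M; the factors [th1] inside [om3] come from the exponent 1 - Re a. *)
Definition th3 (t : nat * nat) : R :=
  if (t.2 <= t.1)%N then (th1 (t.1 - t.2)%N / th1 t.1)%R else (th1 (t.2 - t.1)%N / th1 t.1)%R.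
Definition om3 (t : nat * nat) : R :=
  if (t.2 <= t.1)%N then (om1 t.1 * th1 t.1 / (om1 (t.1 - t.2)%N * th1 (t.1 - t.2)%N))%R
  else (om1 t.1 * th1 t.1 * om1 (t.2 - t.1)%N)%R.

Lemma poch_reflect a M n : (n <= M)%N ->
  poch (a - RtoC (INR M)) n * poch (1 - a) (M - n) = Cpow (- RtoC 1) n * poch (1 - a) M.
Proof.
elim: n => [|n IH] h; first by rewrite subn0 poch0 /=; ring.
rewrite Cpow_S -Cmult_assoc -IH; last exact: ltnW.
rewrite -(subnSK h) !pochS minus_INR; last by apply/leP.
rewrite S_INR RtoC_minus RtoC_plus; ring.
Qed.

Lemma Cmod_pow_m1 n : Cmod (Cpow (- RtoC 1) n) = 1%R.
Proof. by rewrite Cmod_pow Cmod_opp Cmod_1 pow1. Qed.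

(** The first half excludes the integers up to 0, the second those from 1 on. *)
Definition nonint (a : C) : Prop := good a /\ good (1 - a).

Lemma poch_comparable3 a : nonint a ->
  comparable om3 th3 (fun t => poch (a - RtoC (INR t.1)) t.2) (Re a).
Proof.
move=> [ga ga'].
have [K [K0 h]] := poch_comparable ga; have [K' [K0' h']] := poch_comparable ga'.
have rp (x : R) : (0 < x)%R -> Rpower x (Re (1 - a)) = (x * / Rpower x (Re a))%R.
  by move=> hx; rewrite re_minus re_RtoC /Rminus Rpower_plus Rpower_1 // Rpower_Ropp.
exists (K' * K' + K * K')%R; split; first nra.
move=> [M n] /=; rewrite /om3 /th3 /=; case: leqP => hMn.
  have [h1 h2] := h' M; have [h3 h4] := h' (M - n)%N.
  rewrite !rp in h1 h2 h3 h4; try exact: th1_pos.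
  have := f_equal Cmod (@poch_reflect a M n hMn); rewrite !Cmod_mult Cmod_pow_m1 Rmult_1_l.
  have g1 : (0 < Cmod (poch (1 - a) (M - n)))%R by apply/Cmod_gt_0; apply: poch_ne0.
  rewrite -Rpower_div; try exact: th1_pos.
  move: (om1_pos M) (th1_pos M) (Rpower_pos (th1 M) (Re a)) (om1_pos (M - n)%N) (th1_pos (M - n)%N) (Rpower_pos (th1 (M - n)%N) (Re a)) g1 h1 h2 h3 h4.
  move: (om1 M) (th1 M) (Rpower (th1 M) (Re a)) (om1 (M - n)%N) (th1 (M - n)%N) (Rpower (th1 (M - n)%N) (Re a)) (Cmod (poch (1 - a) (M - n))) (Cmod (poch (a - RtoC (INR M)) n)) (Cmod (poch (1 - a) M)).
  move=> o t r o' t' r' D A B o0 t0 r0 o0' t0' r0' D0 h1 h2 h3 h4 e.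
  have -> : (o * t / (o' * t') * (r' / r) = (o * (t * / r)) / (o' * (t' * / r')))%R by field; lra.
  have i0 : (0 < o * (t * / r))%R by repeat apply: Rmult_lt_0_compat => //; apply: Rinv_0_lt_compat.
  have i0' : (0 < o' * (t' * / r'))%R by repeat apply: Rmult_lt_0_compat => //; apply: Rinv_0_lt_compat.
  move: i0 i0' h1 h2 h3 h4; move: (o * (t * / r))%R (o' * (t' * / r'))%R => u u' u0 u0' h1 h2 h3 h4.
  have A0 : (0 < A)%R.
    have : (0 < B)%R by nra.
    by rewrite -e => p; apply: (Rmult_lt_reg_r D) => //; lra.
  split.
    apply: (Rmult_le_reg_r u') => //.
    have -> : (u / u' * u' = u)%R by field; lra.
    have : (u <= K' * (A * D))%R by rewrite e.
    have : (K' * A * D <= K' * A * (K' * u'))%R by apply: Rmult_le_compat_l; nra.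
    have : (0 <= K * K' * A * u')%R by repeat apply: Rmult_le_pos; lra.
    nra.
  apply: (Rmult_le_reg_r (D * u')); first nra.
  have -> : ((K' * K' + K * K') * (u / u') * (D * u') = (K' * K' + K * K') * u * D)%R by field; lra.
  have : (A * D * u' <= (K' * u) * (K' * D))%R.
    rewrite e; apply: Rmult_le_compat; nra.
  have : (0 <= K * K' * u * D)%R by repeat apply: Rmult_le_pos; lra.
  nra.
have [h1 h2] := h' M; have [h3 h4] := h (n - M)%N.
rewrite !rp in h1 h2; try exact: th1_pos.
have e : Cmod (poch (a - RtoC (INR M)) n) = (Cmod (poch (1 - a) M) * Cmod (poch a (n - M)))%R.
  rewrite -{1}(subnKC (ltnW hMn)) poch_add Cmod_mult; congr (_ * Cmod (poch _ _))%R; last by ring.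
  have := f_equal Cmod (@poch_reflect a M M (leqnn _)).
  by rewrite subnn poch0 Cmult_1_r Cmod_mult Cmod_pow_m1 Rmult_1_l.
rewrite e -Rpower_div; try exact: th1_pos.
move: (om1_pos M) (th1_pos M) (Rpower_pos (th1 M) (Re a)) (om1_pos (n - M)%N) (Rpower_pos (th1 (n - M)%N) (Re a)) h1 h2 h3 h4.
move: (om1 M) (th1 M) (Rpower (th1 M) (Re a)) (om1 (n - M)%N) (Rpower (th1 (n - M)%N) (Re a)) (Cmod_ge_0 (poch (1 - a) M)) (Cmod_ge_0 (poch a (n - M))).
move: (Cmod (poch (1 - a) M)) (Cmod (poch a (n - M))) => A B o t r o' r' A0 B0 o0 t0 r0 o0' r0' h1 h2 h3 h4.
have -> : (o * t * o' * (r' / r) = (o * (t * / r)) * (o' * r'))%R by field; lra.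
have i0 : (0 < o * (t * / r))%R by repeat apply: Rmult_lt_0_compat => //; apply: Rinv_0_lt_compat.
have i0' : (0 < o' * r')%R by apply: Rmult_lt_0_compat.
move: i0 i0' h1 h2 h3 h4; move: (o * (t * / r))%R (o' * r')%R => u u' u0 u0' h1 h2 h3 h4.
have c1 : (u * u' <= (K' * A) * (K * B))%R by apply: Rmult_le_compat; lra.
have c2 : (A * B <= (K' * u) * (K * u'))%R by apply: Rmult_le_compat; lra.
have : (0 <= K' * K' * (A * B))%R by apply: Rmult_le_pos; nra.
have : (0 <= K' * K' * (u * u'))%R by apply: Rmult_le_pos; nra.
split; lra.
Qed.

Lemma comparable_prod (T : Type) (I : Type) (s : seq I) (om th : T -> R) (g : I -> T -> C) (e : I -> R) :
  (forall t, 0 < om t)%R -> (forall k, comparable om th (g k) (e k)) ->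
  comparable (fun t => om t ^ size s)%R th (fun t => \big[Cmult/RtoC 1]_(k <- s) g k t)
    (\big[Rplus/0%R]_(k <- s) e k).
Proof.
move=> o0 h; elim: s => [|k s [K [K0 IH]]].
  exists 1%R; split; first lra.
  by move=> t; rewrite !big_nil Cmod_1 /= /Rpower Rmult_0_l exp_0; lra.
have [K' [K0' h']] := h k; exists (K' * K)%R; split; first nra.
move=> t; rewrite !big_cons Cmod_mult Rpower_plus /=.
have [h1 h2] := h' t; have [h3 h4] := IH t.
have p0 := o0 t; have q0 : (0 < om t ^ size s)%R by apply: pow_lt.
move: (Rpower_pos (th t) (e k)) (Rpower_pos (th t) (\big[Rplus/0%R]_(k <- s) e k)) h1 h2 h3 h4.
move: (Rpower (th t) (e k)) (Rpower (th t) (\big[Rplus/0%R]_(k <- s) e k)) (Cmod_ge_0 (g k t)) (Cmod_ge_0 (\big[Cmult/RtoC 1]_(j <- s) g j t)).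
move: (Cmod (g k t)) (Cmod (\big[Cmult/RtoC 1]_(j <- s) g j t)) (om t) (om t ^ size s)%R q0 p0 => A B o q q0 p0 r r' A0 B0 r0 r0' h1 h2 h3 h4.
have -> : (o * q * (r * r') = (o * r) * (q * r'))%R by ring.
have u0 : (0 < o * r)%R by nra.
have v0 : (0 < q * r')%R by nra.
have c1 : ((o * r) * (q * r') <= (K' * A) * (K * B))%R by apply: Rmult_le_compat; lra.
have c2 : (A * B <= (K' * (o * r)) * (K * (q * r')))%R by apply: Rmult_le_compat; lra.
split; lra.
Qed.

Definition rsum_except N (i : 'I_N) (f : 'I_N -> R) : R := \big[Rplus/0%R]_(k < N | k != i) f k.

Lemma size_except N (i : 'I_N) : size [seq k <- index_enum 'I_N | k != i] = N.-1.
Proof.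
rewrite size_filter -[index_enum _]enumT.
have := f_equal predn (count_predC (pred1 i) (enum 'I_N)); rewrite size_enum_ord => <-.
by rewrite count_uniq_mem ?enum_uniq // mem_enum.
Qed.

(* Quotients of products over [m <> j] and [k <> i]: both have [N - 1] factors, so [om] cancels. *)
Lemma comparable_ratio (T : Type) N (i j : 'I_N) (om th : T -> R) (g h : 'I_N -> T -> C) (e f : 'I_N -> R) :
  (forall t, 0 < om t)%R -> (forall t, 0 < th t)%R ->
  (forall m, m != j -> comparable om th (g m) (e m)) ->
  (forall k, k != i -> comparable om th (h k) (f k)) ->
  (forall k t, k != i -> h k t <> RtoC 0) ->
  exists K : R, (0 < K)%R /\ forall t,
   (Cmod (cprod_except j (fun m => g m t) / cprod_except i (fun k => h k t))
     <= K * Rpower (th t) (rsum_except j e - rsum_except i f))%R.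
Proof.
move=> o0 t0 hg hh hn.
have triv : comparable om th (fun t => RtoC (om t)) 0%R.
  exists 1%R; split; first lra.
  by move=> t; rewrite Cmod_R Rabs_pos_eq ?Rpower_O //; [lra | have := o0 t; lra].
have hg' m : comparable om th (fun t => if m != j then g m t else RtoC (om t)) (if m != j then e m else 0%R).
  by case: (boolP (m != j)) => // hm; apply: hg.
have hh' k : comparable om th (fun t => if k != i then h k t else RtoC (om t)) (if k != i then f k else 0%R).
  by case: (boolP (k != i)) => // hm; apply: hh.
have [K1 [K1p c1]] := comparable_prod [seq k <- index_enum 'I_N | k != j] o0 hg'.
have [K2 [K2p c2]] := comparable_prod [seq k <- index_enum 'I_N | k != i] o0 hh'.
exists (K1 * K2)%R; split; first nra.
move=> t; have [_ u1] := c1 t; have [u2 _] := c2 t.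
move: u1 u2; rewrite !big_filter !size_except.
rewrite (eq_bigr (fun m => g m t)); last by move=> m ->.
rewrite [in X in _ -> X -> _](eq_bigr (fun m => h m t)); last by move=> m ->.
rewrite (eq_bigr e); last by move=> m ->.
rewrite [in X in _ -> X -> _](eq_bigr f); last by move=> m ->.
rewrite -/(cprod_except j (fun m => g m t)) -/(cprod_except i (fun k => h k t)).
rewrite -/(rsum_except j e) -/(rsum_except i f) => u1 u2.
have h0 : cprod_except i (fun k => h k t) <> RtoC 0 by apply: cprod_except_ne0 => k hk; apply: hn.
have hp : (0 < Cmod (cprod_except i (fun k => h k t)))%R by apply/Cmod_gt_0.
rewrite Cmod_div // /Rminus Rpower_plus Rpower_Ropp.
have q0 : (0 < om t ^ N.-1)%R by apply: pow_lt.
move: (Rpower_pos (th t) (rsum_except j e)) (Rpower_pos (th t) (rsum_except i f)) u1 u2 hp (Cmod_ge_0 (cprod_except j (fun m => g m t))).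
move: (Rpower (th t) (rsum_except j e)) (Rpower (th t) (rsum_except i f)) (Cmod (cprod_except i (fun k => h k t))) (Cmod (cprod_except j (fun m => g m t))) (om t ^ N.-1)%R q0 => r r' A B q q0 r0 r0' u1 u2 A0 B0.
apply: (Rmult_le_reg_r (A * (q * r'))); first by apply: Rmult_lt_0_compat => //; nra.
have -> : (B / A * (A * (q * r')) = B * (q * r'))%R by field; lra.
have -> : (K1 * K2 * (r * / r') * (A * (q * r')) = (K1 * (q * r)) * (K2 * A))%R by field; lra.
by apply: Rmult_le_compat => //; nra.
Qed.

(** * Explicit series solutions of the diagonalised equation *)

(** Nonresonance. Since i and k may be exchanged, differences of distinct entries are never
    integers. *)
Definition nr N (lam : 'I_N -> C) : Prop :=
  (forall i k, lam i = lam k -> i = k) /\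
  (forall i k (n : nat), lam i - lam k <> RtoC (INR n.+1)).

Lemma nr_good N (lam : 'I_N -> C) i k : nr lam -> good (lam i - lam k + 1).
Proof.
move=> [_ h] l e; apply: (h k i l); rewrite S_INR RtoC_plus.
have -> : lam k - lam i = RtoC (INR l) + 1 - (lam i - lam k + 1 + RtoC (INR l)) by ring.
rewrite e; ring.
Qed.

Lemma nr_nonint N (lam : 'I_N -> C) i k : nr lam -> i <> k -> nonint (lam i - lam k).
Proof.
move=> h ik; split.
  case=> [|l] e; first by apply: ik; apply: (proj1 h); apply/Ceq_minus; rewrite -[RHS]e /=; ring.
  by apply: (nr_good (i := i) (k := k) h (l := l)); rewrite -[RHS]e S_INR RtoC_plus; ring.
have -> : 1 - (lam i - lam k) = lam k - lam i + 1 by ring.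
exact: nr_good.
Qed.

(* In coordinates [f = sum_k residue_k y_k xi_k] with respect to the eigenvectors of [P], the quantity
   [z / (1 - z) * sum_k residue_k y_k] is [sum_n Scoef n z^(lam i + n + 1)] for [f_i] and [- sum_n Tcoef n z^(mu j - n)] for [h_j]. *)
Definition Scoef N (lam mu : 'I_N -> C) (i : 'I_N) (n : nat) : C :=
  cprod (fun m => poch (lam i - mu m + 1) n) / cprod (fun k => poch (lam i - lam k + 1) n).
Definition Tcoef N (lam mu : 'I_N -> C) (j : 'I_N) (n : nat) : C :=
  cprod (fun k => poch (lam k - mu j + 1) n) / cprod (fun m => poch (mu m - mu j + 1) n).

Definition WF N (lam mu : 'I_N -> C) (i : 'I_N) (n : nat) : C :=
  if n is p.+1 then Scoef lam mu i p else RtoC 0.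

Definition aF N (lam mu : 'I_N -> C) (i : 'I_N) (n : nat) : cvec N := fun k =>
  if n is p.+1 then Scoef lam mu i p / (lam i - lam k + 1 + RtoC (INR p))
  (* As the k-th coordinate is divided by residue_k, the eigenvector xi_i has the single coordinate
     1 / residue_i. *)
  else if k == i then / residue lam mu i else RtoC 0.

Definition VH N (lam mu : 'I_N -> C) (j : 'I_N) (n : nat) : C := - Tcoef lam mu j n.

(* This is [Tcoef n / (lam k - mu j + n)], written so that no denominator vanishes when [lam k - mu j] is a negative integer. *)
Definition bH N (lam mu : 'I_N -> C) (j : 'I_N) (n : nat) : cvec N := fun k =>
  poch (lam k - mu j) n / (lam k - mu j) * cprod_except k (fun l => poch (lam l - mu j + 1) n)
   / cprod (fun m => poch (mu m - mu j + 1) n).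

Definition sep N (lam mu : 'I_N -> C) : Prop := forall k m, lam k <> mu m.

Lemma sep_ne N (lam mu : 'I_N -> C) k m : sep lam mu -> lam k - mu m <> RtoC 0.
Proof. by move=> h; apply: Cminus_eq_contra; apply: h. Qed.

Lemma residue_ne0 N (lam mu : 'I_N -> C) i : nr lam -> sep lam mu -> residue lam mu i <> RtoC 0.
Proof.
move=> [inj _] hs; have d0 := distinct_prod (k := i) inj; rewrite /residue => e.
have p0 : cprod (fun m => lam i - mu m) <> RtoC 0 by apply: cprod_ne0 => m; apply: sep_ne.
apply: p0; have -> : cprod (fun m => lam i - mu m) =
  cprod (fun m => lam i - mu m) / cprod_except i (fun k => lam i - lam k) * cprod_except i (fun k => lam i - lam k) by field.
by rewrite e Cmult_0_l.
Qed.

Lemma cprod_pochS N (a : 'I_N -> C) n :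
  cprod (fun m => poch (a m) n.+1) = cprod (fun m => poch (a m) n) * cprod (fun m => a m + RtoC (INR n)).
Proof. by rewrite -cprod_mult; apply: cprod_ext => m; rewrite pochS. Qed.

Lemma cprod_except_pochS N (a : 'I_N -> C) k n :
  cprod_except k (fun m => poch (a m) n.+1) = cprod_except k (fun m => poch (a m) n) * cprod_except k (fun m => a m + RtoC (INR n)).
Proof. by rewrite -cprod_except_mult; apply: cprod_except_ext => m; rewrite pochS. Qed.

Lemma cprod_poch0 N (a : 'I_N -> C) : cprod (fun m => poch (a m) 0) = RtoC 1.
Proof. by rewrite /cprod big1 // => m _; rewrite poch0. Qed.

Lemma cprod_except_poch0 N (a : 'I_N -> C) k : cprod_except k (fun m => poch (a m) 0) = RtoC 1.
Proof. by rewrite /cprod_except big1 // => m _; rewrite poch0. Qed.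

Lemma Cdiv11 : RtoC 1 / RtoC 1 = RtoC 1.
Proof. by field. Qed.

Lemma ScoefS N (lam mu : 'I_N -> C) i n : nr lam ->
  Scoef lam mu i n.+1 = Scoef lam mu i n * (cprod (fun m => lam i - mu m + 1 + RtoC (INR n)) / cprod (fun k => lam i - lam k + 1 + RtoC (INR n))).
Proof.
move=> hn; rewrite /Scoef !cprod_pochS.
have h1 : cprod (fun k => poch (lam i - lam k + 1) n) <> RtoC 0 by apply: cprod_ne0 => k; apply: poch_ne0; apply: nr_good.
have h2 : cprod (fun k => lam i - lam k + 1 + RtoC (INR n)) <> RtoC 0 by apply: cprod_ne0 => k; apply: nr_good.
by field.
Qed.

Lemma aF_eigen N (lam mu : 'I_N -> C) i n k : nr lam ->
  (lam i + RtoC (INR n) - lam k) * aF lam mu i n k = WF lam mu i n.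
Proof.
move=> hn; case: n => [|n] /=.
  case: eqP => [->|_]; last by rewrite Cmult_0_r.
  have -> : lam i + 0 - lam i = RtoC 0 by ring.
  by rewrite Cmult_0_l.
have h := nr_good (i := i) (k := k) hn (l := n).
rewrite -/(INR n.+1) S_INR RtoC_plus.
have -> : lam i + (RtoC (INR n) + 1) - lam k = lam i - lam k + 1 + RtoC (INR n) by ring.
by field.
Qed.

(** The ratio of consecutive [Scoef] is the right side of the partial fraction identity at t = lam_i
    + 1 + n; nonresonance keeps t away from the lam_k. *)
Lemma WF_rec N (lam mu : 'I_N -> C) i n : nr lam -> sep lam mu ->
  WF lam mu i n.+1 = WF lam mu i n + csum (fun l => residue lam mu l * aF lam mu i n l).
Proof.
move=> hn hs; have r0 := residue_ne0 (i := i) hn hs; case: n => [|n].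
  rewrite /= /Scoef !cprod_poch0 (csum_only (i := i)) => [|k hk]; last by rewrite /aF (negbTE hk) Cmult_0_r.
  by rewrite /aF eqxx; field.
rewrite /= ScoefS //.
have ht k : lam i + 1 + RtoC (INR n) <> lam k.
  move=> e; apply: (nr_good (i := i) (k := k) hn (l := n)).
  have -> : lam i - lam k + 1 + RtoC (INR n) = lam i + 1 + RtoC (INR n) - lam k by ring.
  by rewrite e; ring.
have e := residue_pf mu (proj1 hn) ht.
rewrite (cprod_ext (G := fun m => lam i + 1 + RtoC (INR n) - mu m)); last by move=> m; ring.
rewrite [cprod (fun k => lam i - lam k + _ + _)](cprod_ext (G := fun m => lam i + 1 + RtoC (INR n) - lam m)); last by move=> m; ring.
rewrite -e Cmult_plus_distr_l Cmult_1_r; congr Cplus; rewrite -csum_scal; apply: csum_ext => k.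
have := nr_good (i := i) (k := k) hn (l := n); have -> : lam i + 1 + RtoC (INR n) - lam k = lam i - lam k + 1 + RtoC (INR n) by ring.
by move=> h; field.
Qed.

Lemma cprod_opp N (F : 'I_N -> C) : cprod (fun i => - F i) = cprod (fun _ : 'I_N => - RtoC 1) * cprod F.
Proof. by rewrite -cprod_mult; apply: cprod_ext => i; ring. Qed.

Lemma cprod_except_opp N k (F : 'I_N -> C) :
  cprod_except k (fun i => - F i) = cprod_except k (fun _ : 'I_N => - RtoC 1) * cprod_except k F.
Proof. by rewrite -cprod_except_mult; apply: cprod_except_ext => i _; ring. Qed.

Lemma poch_swap a n : a * poch (a + 1) n = poch a n * (a + RtoC (INR n)).
Proof. by rewrite -poch_left pochS. Qed.

Lemma bHT N (lam mu : 'I_N -> C) j n k : sep lam mu ->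
  (lam k - mu j + RtoC (INR n)) * bH lam mu j n k = Tcoef lam mu j n.
Proof.
move=> hs; rewrite /bH /Tcoef (cprod_D1 k (fun k => poch (lam k - mu j + 1) n)).
have h := sep_ne (k := k) (m := j) hs; have e := poch_swap (lam k - mu j) n.
have -> : poch (lam k - mu j + 1) n = poch (lam k - mu j) n * (lam k - mu j + RtoC (INR n)) / (lam k - mu j).
  by rewrite -e; field.
by rewrite /Cdiv; ring.
Qed.

Lemma bH_eigen N (lam mu : 'I_N -> C) j n k : sep lam mu ->
  (mu j - RtoC (INR n) - lam k) * bH lam mu j n k = VH lam mu j n.
Proof. by move=> hs; rewrite /VH -(bHT j n k hs); ring. Qed.

(** For n = 0 this is the partial fraction identity at t = mu_j, whose product side vanishes.
    Afterwards t = mu_j - n may coincide with some lam_k, so the polynomial form [residue_poly] is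
    used instead. *)
Lemma VH_rec N (lam mu : 'I_N -> C) j n : nr lam -> nr mu -> sep lam mu ->
  sh (VH lam mu j) n - VH lam mu j n = csum (fun l => residue lam mu l * bH lam mu j n l).
Proof.
move=> hl hm hs; case: n => [|n].
  rewrite /= /VH /Tcoef !cprod_poch0 Cdiv11.
  have e := residue_pf (t := mu j) mu (proj1 hl) (fun k h => hs k j (esym h)).
  have c0 : cprod (fun m => mu j - mu m) = RtoC 0 by apply: (cprod_eq0 (i := j)); exact: Cplus_opp_r.
  rewrite c0 /Cdiv Cmult_0_l in e.
  have -> : RtoC 0 - - RtoC 1 = RtoC 1 - (1 + csum (fun k => residue lam mu k * / (mu j - lam k))) by rewrite e; ring.
  have -> : RtoC 1 - (1 + csum (fun k => residue lam mu k * / (mu j - lam k))) = - csum (fun k => residue lam mu k * / (mu j - lam k)) by ring.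
  rewrite -csum_opp; apply: csum_ext => k; rewrite /bH poch0 cprod_poch0 cprod_except_poch0.
  have h1 := sep_ne (k := k) (m := j) hs.
  have h2 : mu j - lam k <> RtoC 0 by move=> h2; apply: h1; rewrite -Copp_minus_distr h2 Copp_0.
  by field.
set t := mu j - 1 - RtoC (INR n).
set q := cprod (fun k => poch (lam k - mu j + 1) n) / cprod (fun m => poch (mu m - mu j + 1) n.+1).
have g0 m : mu m - mu j + 1 + RtoC (INR n) <> RtoC 0 by apply: nr_good.
have g1 : cprod (fun m => poch (mu m - mu j + 1) n) <> RtoC 0 by apply: cprod_ne0 => k; apply: poch_ne0; apply: nr_good.
have g2 : cprod (fun m => mu m - mu j + 1 + RtoC (INR n)) <> RtoC 0 by apply: cprod_ne0.
have eT0 : Tcoef lam mu j n = q * cprod (fun m => - (t - mu m)).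
  rewrite (cprod_ext (G := fun m => mu m - mu j + 1 + RtoC (INR n))); last by move=> m; rewrite /t; ring.
  by rewrite /q /Tcoef cprod_pochS; field.
have eT1 : Tcoef lam mu j n.+1 = q * cprod (fun m => - (t - lam m)).
  rewrite (cprod_ext (G := fun k => lam k - mu j + 1 + RtoC (INR n))); last by move=> m; rewrite /t; ring.
  by rewrite /q /Tcoef !cprod_pochS; field.
have eb k : bH lam mu j n.+1 k = q * cprod_except k (fun l => - (t - lam l)).
  rewrite (cprod_except_ext (G := fun k => lam k - mu j + 1 + RtoC (INR n))); last by move=> m _; rewrite /t; ring.
  have h1 := sep_ne (k := k) (m := j) hs.
  rewrite /bH /q (cprod_D1 k (fun k => poch (lam k - mu j + 1) n)) poch_left cprod_except_pochS cprod_pochS.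
  by field; repeat split.
rewrite /sh /VH eT0 eT1 (csum_ext (G := fun k => q * (residue lam mu k * cprod_except k (fun l => - (t - lam l))))); last first.
  by move=> k; rewrite eb; ring.
rewrite csum_scal (cprod_opp (fun m => t - mu m)) (cprod_opp (fun m => t - lam m)) (residue_poly mu t (proj1 hl)).
set s := cprod (fun _ => _).
have -> : csum (fun k => residue lam mu k * cprod_except k (fun l => - (t - lam l))) =
  - s * csum (fun k => residue lam mu k * cprod_except k (fun l => t - lam l)).
  rewrite -csum_scal; apply: csum_ext => k; rewrite cprod_except_opp /s (cprod_D1 k (fun _ => - RtoC 1)); ring.
ring.
Qed.

(** ** Polynomial bounds for the coefficients *)

Lemma poch_upper (A : nat) a n : (Cmod a <= INR A)%R ->
  (Cmod (poch a n) <= INR (Factorial.fact n) * (INR n + 1) ^ A)%R.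
Proof.
move=> ha; apply: (Rle_trans _ (INR (Factorial.fact n) * growth A n)); last first.
  by apply: Rmult_le_compat_l; [exact: pos_INR | exact: growth_le].
elim: n => [|n IH]; first by rewrite poch0 Cmod_1 /=; lra.
rewrite pochS Cmod_mult fact_simpl mult_INR [growth _ _]/= S_INR.
have n0 := pos_INR n; have f0 := INR_fact_lt_0 n.
have -> : ((INR n + 1) * INR (Factorial.fact n) * (growth A n * (1 + INR A / (INR n + 1))) =
   (INR (Factorial.fact n) * growth A n) * (INR n + 1 + INR A))%R by field; lra.
apply: Rmult_le_compat => //; try exact: Cmod_ge_0.
apply: Rle_trans (Cmod_triangle _ _) _; rewrite Cmod_R Rabs_pos_eq //; lra.
Qed.

Lemma poch_lower b : good b -> exists (K : R) (B : nat), (0 < K)%R /\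
  forall n, (INR (Factorial.fact n) <= K * (INR n + 1) ^ B * Cmod (poch b n))%R.
Proof.
move=> gb0; have [K [K0 h]] := poch_comparable gb0.
have [B hB] := nat_above (1 - Re b).
exists K, B; split=> // n; have [h1 _] := h n.
have t1 := th1_ge1 n; have t2 := th1_le n; have n0 := pos_INR n.
have hf : (INR (Factorial.fact n) <= om1 n * th1 n)%R.
  case: n {h1 t1 t2 n0} => [|n]; first by rewrite /om1 /th1 /=; lra.
  rewrite fact_simpl mult_INR /om1 /th1 (maxn_idPl _) // Rmult_comm; exact: Rle_refl.
have o0 := om1_pos n.
apply: Rle_trans hf _.
have r0 := Rpower_pos (th1 n) (Re b).
have hr : (th1 n <= (INR n + 1) ^ B * Rpower (th1 n) (Re b))%R.
  rewrite -Rpower_pow; last lra.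
  have e : th1 n = (Rpower (th1 n) (1 - Re b) * Rpower (th1 n) (Re b))%R.
    rewrite -Rpower_plus (_ : (1 - Re b + Re b = 1)%R); last by ring.
    by rewrite Rpower_1 //; lra.
  rewrite {1}e; apply: Rmult_le_compat_r; first lra.
  apply: (Rle_trans _ (Rpower (th1 n) (INR B))).
    by apply: Rle_Rpower.
  apply: Rle_Rpower_l; first exact: pos_INR.
  by split; lra.
apply: (Rle_trans _ (om1 n * ((INR n + 1) ^ B * Rpower (th1 n) (Re b)))).
  by apply: Rmult_le_compat_l; lra.
have p0 : (0 <= (INR n + 1) ^ B)%R by apply: pow_le; lra.
have -> : (om1 n * ((INR n + 1) ^ B * Rpower (th1 n) (Re b)) = (INR n + 1) ^ B * (om1 n * Rpower (th1 n) (Re b)))%R by ring.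
have -> : (K * (INR n + 1) ^ B * Cmod (poch b n) = (INR n + 1) ^ B * (K * Cmod (poch b n)))%R by ring.
exact: Rmult_le_compat_l.
Qed.

Lemma big_poch_upper (I : Type) (s : seq I) (A : nat) (a : I -> C) n : (forall k, Cmod (a k) <= INR A)%R ->
  (Cmod (\big[Cmult/RtoC 1]_(k <- s) poch (a k) n) <= INR (Factorial.fact n) ^ size s * (INR n + 1) ^ (A * size s))%R.
Proof.
move=> ha; elim: s => [|k s IH]; first by rewrite big_nil Cmod_1 muln0 /=; lra.
rewrite big_cons Cmod_mult [size _]/= mulnS -plusE pow_add.
have -> : (INR (Factorial.fact n) ^ (size s).+1 * ((INR n + 1) ^ A * (INR n + 1) ^ (A * size s)) =
  (INR (Factorial.fact n) * (INR n + 1) ^ A) * (INR (Factorial.fact n) ^ size s * (INR n + 1) ^ (A * size s)))%R by rewrite /=; ring.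
by apply: Rmult_le_compat => //; [exact: Cmod_ge_0 | exact: Cmod_ge_0 | exact: poch_upper].
Qed.

Lemma big_poch_lower (I : Type) (s : seq I) (b : I -> C) : (forall k, good (b k)) ->
  exists (K : R) (B : nat), (0 < K)%R /\
  forall n, (INR (Factorial.fact n) ^ size s <= K * (INR n + 1) ^ B * Cmod (\big[Cmult/RtoC 1]_(k <- s) poch (b k) n))%R.
Proof.
move=> hg; elim: s => [|k s [K [B [K0 IH]]]].
  exists 1%R, 0%N; split; first lra.
  by move=> n; rewrite big_nil Cmod_1 /=; lra.
have [K' [B' [K0' h']]] := poch_lower (hg k).
exists (K' * K)%R, (B' + B)%N; split; first nra.
move=> n; rewrite big_cons Cmod_mult pow_add [(_ ^ size _)%R]/=.
have p0 := INR_fact_lt_0 n; have p1 : (0 < INR (Factorial.fact n) ^ size s)%R by apply: pow_lt.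
have := Rmult_le_compat _ _ _ _ (Rlt_le _ _ p0) (Rlt_le _ _ p1) (h' n) (IH n); lra.
Qed.

(* The bound is uniform in the numerator parameters, as the perturbation argument requires. *)
Lemma quot_bound (I : Type) (s s' : seq I) (A : nat) (b : I -> C) : size s = size s' -> (forall k, good (b k)) ->
  exists (K : R) (E : nat), (0 < K)%R /\ forall a : I -> C, (forall k, Cmod (a k) <= INR A)%R -> forall n,
   (Cmod (\big[Cmult/RtoC 1]_(k <- s) poch (a k) n / \big[Cmult/RtoC 1]_(k <- s') poch (b k) n) <= K * (INR n + 1) ^ E)%R.
Proof.
move=> hs hg; have [K [B [K0 h]]] := big_poch_lower s' hg.
exists K, (B + A * size s)%N; split=> // a ha n.
have hn : \big[Cmult/RtoC 1]_(k <- s') poch (b k) n <> RtoC 0.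
  elim/big_ind: _ => [|x y hx hy|l _]; [exact: C1_nz | exact: Cmult_neq_0 | exact: poch_ne0].
have hp : (0 < Cmod (\big[Cmult/RtoC 1]_(k <- s') poch (b k) n))%R by apply/Cmod_gt_0.
rewrite Cmod_div // pow_add; apply: (Rmult_le_reg_r (Cmod (\big[Cmult/RtoC 1]_(k <- s') poch (b k) n))) => //.
rewrite /Rdiv Rmult_assoc Rinv_l; last lra.
rewrite Rmult_1_r; apply: Rle_trans (big_poch_upper s n ha) _.
have q0 : (0 <= (INR n + 1) ^ (A * size s))%R by apply: pow_le; have := pos_INR n; lra.
have := Rmult_le_compat_r _ _ _ q0 (h n); rewrite hs; lra.
Qed.

Lemma good_dist b : good b -> exists c : R, (0 < c)%R /\ forall n, (c <= Cmod (b + RtoC (INR n))%C)%R.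
Proof.
move=> hb; have [M hM] := nat_above (Cmod b + 1).
have [c [c0 hc]] : exists c : R, (0 < c)%R /\ forall n, (n < M)%N -> (c <= Cmod (b + RtoC (INR n))%C)%R.
  elim: (M) => [|m [c [c0 IH]]]; first by exists 1%R; split; [lra|].
  exists (Rmin c (Cmod (b + RtoC (INR m)))); split; first by apply: Rmin_pos => //; apply/Cmod_gt_0.
  move=> n; rewrite ltnS leq_eqVlt => /orP [/eqP ->|/IH h]; first exact: Rmin_r.
  exact: Rle_trans (Rmin_l _ _) h.
exists (Rmin c 1); split; first by apply: Rmin_pos => //; lra.
move=> n; case: (ltnP n M) => [/hc h|h]; first exact: Rle_trans (Rmin_l _ _) h.
apply: Rle_trans (Rmin_r _ _) _.
have := Cmod_triangle (b + RtoC (INR n)) (- b); have -> : b + RtoC (INR n) + - b = RtoC (INR n) by ring.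
have : (INR M <= INR n)%R by apply: le_INR; apply/leP.
rewrite Cmod_opp Cmod_R Rabs_pos_eq; [lra | exact: pos_INR].
Qed.

Lemma Scoef_bound N (A : nat) (dn : 'I_N -> C) : (forall k, good (dn k)) ->
  exists (K : R) (E : nat), (0 < K)%R /\ forall a : 'I_N -> C, (forall k, Cmod (a k) <= INR A)%R -> forall n,
   (Cmod (cprod (fun m => poch (a m) n) / cprod (fun k => poch (dn k) n)) <= K * (INR n + 1) ^ E)%R.
Proof. exact: quot_bound. Qed.

Lemma Scoef_gb N (lam mu : 'I_N -> C) i : nr lam -> gb (Scoef lam mu i).
Proof.
move=> hl; have [A0 hA0] := big_Rle (fun m => Cmod (lam i - mu m + 1)).
have [A hA] := nat_above A0.
have [K [E [_ h]]] := @Scoef_bound N A (fun k => lam i - lam k + 1) (fun k => nr_good hl).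
by apply: (gb_poly (M := K) (E := E)) => n; apply: (h (fun m => lam i - mu m + 1)) => k; apply: Rle_trans (hA0 k) hA.
Qed.

Lemma Tcoef_gb N (lam mu : 'I_N -> C) j : nr mu -> gb (Tcoef lam mu j).
Proof.
move=> hl; have [A0 hA0] := big_Rle (fun m => Cmod (lam m - mu j + 1)).
have [A hA] := nat_above A0.
have [K [E [_ h]]] := @Scoef_bound N A (fun m => mu m - mu j + 1) (fun k => nr_good hl).
by apply: (gb_poly (M := K) (E := E)) => n; apply: (h (fun m => lam m - mu j + 1)) => k; apply: Rle_trans (hA0 k) hA.
Qed.

Lemma WF_gb N (lam mu : 'I_N -> C) i : nr lam -> gb (WF lam mu i).
Proof.
by move=> h; apply: (@gb_le _ (sh (Scoef lam mu i)) _ (gb_sh (Scoef_gb mu i h))) => -[|n]; apply: Rle_refl.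
Qed.

Lemma VH_gb N (lam mu : 'I_N -> C) j : nr mu -> gb (VH lam mu j).
Proof. by move=> h; apply: (@gb_le _ (Tcoef lam mu j)) (Tcoef_gb lam j h) => n; rewrite Cmod_opp; apply: Rle_refl. Qed.

(** A perturbation common to all lam_k cancels in the denominators, so constants depending on the
    unperturbed differences serve all small perturbations at once. *)
Lemma aF_bound N (A : nat) (lam mu : 'I_N -> C) i : nr lam ->
  exists (K : R) (E : nat), (0 < K)%R /\ forall (pert : C) n k, (forall m, Cmod (lam i + pert - mu m + 1) <= INR A)%R ->
    (Cmod (aF (fun k => lam k + pert)%C mu i n.+1 k) <= K * (INR n + 1) ^ E)%R.
Proof.
move=> hl.
have hg k : good (lam i - lam k + 1) by apply: nr_good.
have [K [E [K0 h]]] := @Scoef_bound N A _ hg.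
have [c [c0 hc]] : exists c : R, (0 < c)%R /\ forall k n, (c <= Cmod (lam i - lam k + 1 + RtoC (INR n))%C)%R.
  have hs (s : seq 'I_N) : exists c : R, (0 < c)%R /\ forall k, k \in s -> forall n, (c <= Cmod (lam i - lam k + 1 + RtoC (INR n))%C)%R.
    elim: s => [|k s [c [c0 IH]]]; first by exists 1%R; split; [lra|].
    have [c' [c0' h']] := good_dist (hg k).
    exists (Rmin c' c); split; first exact: Rmin_pos.
    move=> l; rewrite in_cons => /orP [/eqP -> n|/IH hl' n]; first exact: Rle_trans (Rmin_l _ _) (h' n).
    exact: Rle_trans (Rmin_r _ _) (hl' n).
  have [c [c0 h']] := hs (index_enum 'I_N); exists c; split=> // k; apply: h'; exact: mem_index_enum.
exists (K / c)%R, E; split; first exact: Rdiv_lt_0_compat.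
move=> pert n k ha; rewrite /aF /Scoef.
rewrite (cprod_ext (F := fun k0 => poch (lam i + pert - (lam k0 + pert) + 1) n) (G := fun k => poch (lam i - lam k + 1) n)); last by move=> l; congr poch; ring.
have -> : lam i + pert - (lam k + pert) + 1 + RtoC (INR n) = lam i - lam k + 1 + RtoC (INR n) by ring.
have d0 : (0 < Cmod (lam i - lam k + 1 + RtoC (INR n)))%R by apply: Rlt_le_trans (hc k n).
rewrite Cmod_div; last by apply/Cmod_gt_0.
apply: (Rmult_le_reg_r (Cmod (lam i - lam k + 1 + RtoC (INR n)))) => //.
rewrite {1}/Rdiv Rmult_assoc Rinv_l; last lra.
rewrite Rmult_1_r; apply: Rle_trans (h _ ha n) _.
have p : (0 <= (INR n + 1) ^ E)%R by apply: pow_le; have := pos_INR n; lra.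
have -> : (K * (INR n + 1) ^ E = K / c * (INR n + 1) ^ E * c)%R by field; lra.
apply: Rmult_le_compat_l => //; apply: Rmult_le_pos => //; apply: Rlt_le; exact: Rdiv_lt_0_compat.
Qed.

Lemma aF_gb N (lam mu : 'I_N -> C) i k : nr lam -> gb (fun n => aF lam mu i n k).
Proof.
move=> hl; have [A0 hA0] := big_Rle (fun m => Cmod (lam i + 0 - mu m + 1)).
have [A hA] := nat_above A0.
have [K [E [_ h]]] := @aF_bound N A lam mu i hl.
have g : gb (fun n => aF lam mu i n.+1 k).
  apply: (gb_poly (M := K) (E := E)) => n.
  have -> : aF lam mu i n.+1 k = aF (fun k => lam k + 0) mu i n.+1 k.
    by congr (aF _ mu i n.+1 k); apply: functional_extensionality => l; rewrite Cplus_0_r.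
  by apply: h => m; apply: Rle_trans (hA0 m) hA.
have e : forall n, aF lam mu i n k = sh (fun n => aF lam mu i n.+1 k) n + (if n is 0%N then aF lam mu i 0 k else RtoC 0).
  by case=> [|n]; rewrite ?Cplus_0_l ?Cplus_0_r.
apply: (@gb_le _ (fun n => sh (fun n => aF lam mu i n.+1 k) n + (if n is 0%N then aF lam mu i 0 k else RtoC 0))).
  by move=> n; rewrite e; apply: Rle_refl.
apply: gb_plus; first exact: gb_sh.
by apply: (@gb_le _ (fun _ => aF lam mu i 0 k)) (gb_const _) => -[|n]; rewrite ?Cmod_0; [apply: Rle_refl | apply: Cmod_ge_0].
Qed.

(** The denominators involve only [mu], which makes the bound uniform in [la]. The factor la_k -
    mu_j cancels for n > 0; [D] bounds its inverse for n = 0. *)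
Lemma bH_bound N (A : nat) (D : R) (lam mu : 'I_N -> C) j : nr mu ->
  exists (K : R) (E : nat), (0 < K)%R /\ forall (la : 'I_N -> C) n k, (forall k, Cmod (la k - mu j + 1) <= INR A)%R ->
    (forall k, Cmod (/ (la k - mu j)) <= D)%R -> (forall k, la k - mu j <> RtoC 0) ->
    (Cmod (bH la mu j n k) <= K * (INR n + 1) ^ E)%R.
Proof.
move=> hm; have [K [B [K0 h]]] := @big_poch_lower _ (index_enum 'I_N) (fun m => mu m - mu j + 1) (fun k => nr_good hm).
set sz := size (index_enum 'I_N) in h.
exists ((Rabs D + 1) * K)%R, (A + A * N.-1 + B)%N; split.
  by apply: Rmult_lt_0_compat => //; have := Rabs_pos D; lra.
move=> la n k ha hD hn; have f0 := INR_fact_lt_0 n; have n0 := pos_INR n.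
have hsz : sz = (N.-1).+1.
  by rewrite /sz -[index_enum _]enumT size_enum_ord prednK //; apply: leq_ltn_trans (ltn_ord k).
have h1 : (Cmod (poch (la k - mu j) n / (la k - mu j)) <= (Rabs D + 1) * (INR (Factorial.fact n) * (INR n + 1) ^ A))%R.
  case: n {f0} n0 => [|n] n0.
    rewrite poch0 /Cdiv Cmult_1_l /= Rplus_0_l pow1.
    by have := hD k; have := Rle_abs D; lra.
  have -> : poch (la k - mu j) n.+1 / (la k - mu j) = poch (la k - mu j + 1) n.
    by rewrite poch_left; field; apply: hn.
  apply: Rle_trans (poch_upper n (ha k)) _; rewrite fact_simpl mult_INR S_INR.
  have p0 := pos_INR n; have f0 := INR_fact_lt_0 n.
  have q : ((INR n + 1) ^ A <= (INR n + 1 + 1) ^ A)%R by apply: pow_incr; lra.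
  have q0 : (0 <= (INR n + 1) ^ A)%R by apply: pow_le; lra.
  have c1 : (INR (Factorial.fact n) * (INR n + 1) ^ A <= ((INR n + 1) * INR (Factorial.fact n)) * (INR n + 1 + 1) ^ A)%R.
    by apply: Rmult_le_compat => //; nra.
  have : (0 <= ((INR n + 1) * INR (Factorial.fact n)) * (INR n + 1 + 1) ^ A)%R by apply: Rmult_le_pos; [nra | lra].
  by have := Rabs_pos D; nra.
have h2 := big_poch_upper [seq l <- index_enum 'I_N | l != k] n ha.
rewrite big_filter size_except -/(cprod_except k (fun l => poch (la l - mu j + 1) n)) in h2.
have h3 := h n; rewrite hsz in h3; rewrite -/(cprod (fun m => poch (mu m - mu j + 1) n)) [(_ ^ _.+1)%R]/= in h3.
have g1 : cprod (fun m => poch (mu m - mu j + 1) n) <> RtoC 0 by apply: cprod_ne0 => l; apply: poch_ne0; apply: nr_good.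
have gp : (0 < Cmod (cprod (fun m => poch (mu m - mu j + 1) n)))%R by apply/Cmod_gt_0.
rewrite /bH Cmod_div // Cmod_mult; apply: (Rmult_le_reg_r (Cmod (cprod (fun m => poch (mu m - mu j + 1) n)))) => //.
rewrite {1}/Rdiv Rmult_assoc Rinv_l; last lra.
rewrite Rmult_1_r !pow_add.
have d1 := Rabs_pos D.
have p1 : (0 <= (INR n + 1) ^ A)%R by apply: pow_le; lra.
have p2 : (0 <= (INR n + 1) ^ (A * N.-1))%R by apply: pow_le; lra.
apply: Rle_trans (Rmult_le_compat _ _ _ _ (Cmod_ge_0 _) (Cmod_ge_0 _) h1 h2) _.
have p3 : (0 <= (Rabs D + 1) * ((INR n + 1) ^ A * (INR n + 1) ^ (A * N.-1)))%R.
  by apply: Rmult_le_pos; [lra | apply: Rmult_le_pos].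
have := Rmult_le_compat_l _ _ _ p3 h3; lra.
Qed.

Lemma bH_gb N (lam mu : 'I_N -> C) j k : nr mu -> sep lam mu -> gb (fun n => bH lam mu j n k).
Proof.
move=> hm hs; have [A0 hA0] := big_Rle (fun m => Cmod (lam m - mu j + 1)).
have [A hA] := nat_above A0.
have [D hD] := big_Rle (fun m => Cmod (/ (lam m - mu j))).
have [K [E [_ h]]] := @bH_bound N A D lam mu j hm.
apply: (gb_poly (M := K) (E := E)) => n; apply: h => //.
- by move=> l; apply: Rle_trans (hA0 l) hA.
- by move=> l; apply: sep_ne.
Qed.

Definition yF N (lam mu : 'I_N -> C) (i : 'I_N) : C -> cvec N := ser0 (lam i) (aF lam mu i).
Definition yH N (lam mu : 'I_N -> C) (j : 'I_N) : C -> cvec N := serinf (mu j) (bH lam mu j).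

Lemma yF_ode N (lam mu : 'I_N -> C) i s k : nr lam -> sep lam mu -> lstrip s ->
  Cder (fun s => yF lam mu i s k) s
    (csum (fun l => (diagm lam k l + zz s * rank1 (residue lam mu) k l) * yF lam mu i s l)).
Proof.
move=> hl hs; apply: (ser0_ode (W := WF lam mu i)) => //.
- by move=> l; apply: aF_gb.
- exact: WF_gb.
- by move=> n l; apply: aF_eigen.
- by move=> n; apply: WF_rec.
Qed.

Lemma yH_ode N (lam mu : 'I_N -> C) j s k : nr lam -> nr mu -> sep lam mu -> rstrip s ->
  Cder (fun s => yH lam mu j s k) s
    (csum (fun l => (diagm lam k l + zz s * rank1 (residue lam mu) k l) * yH lam mu j s l)).
Proof.
move=> hl hm hs; apply: (serinf_ode (V := VH lam mu j)) => //.
- by move=> l; apply: bH_gb.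
- exact: VH_gb.
- by move=> n l; apply: bH_eigen.
- by move=> n; apply: VH_rec.
Qed.

Lemma yF_zu N (lam mu : 'I_N -> C) i s : nr lam -> sep lam mu -> lstrip s ->
  Cexp (lam i * s) * PSc (WF lam mu i) (Cexp s) = zz s * csum (fun l => residue lam mu l * yF lam mu i s l).
Proof.
move=> hl hs; apply: ser0_zu => //.
- by move=> l; apply: aF_gb.
- exact: WF_gb.
- by move=> n; apply: WF_rec.
Qed.

Lemma yH_zu N (lam mu : 'I_N -> C) j s : nr lam -> nr mu -> sep lam mu -> rstrip s ->
  Cexp (mu j * s) * PSc (VH lam mu j) (Cexp (- s)) = zz s * csum (fun l => residue lam mu l * yH lam mu j s l).
Proof.
move=> hl hm hs; apply: serinf_zu => //.
- by move=> l; apply: bH_gb.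
- exact: VH_gb.
- by move=> n; apply: VH_rec.
Qed.

(** * Matching at z = -1 and integer shifts of the parameters *)

Lemma nonint_opp a : nonint a -> nonint (- a).
Proof.
move=> [h1 h2]; split.
  case=> [|l] e.
    apply: (h1 0%N); have -> : a + RtoC (INR 0) = - (- a + RtoC (INR 0)) by rewrite /=; ring.
    by rewrite e Copp_0.
  by apply: (h2 l); rewrite -[RHS]e S_INR RtoC_plus; ring.
have -> : 1 - - a = a + 1 by ring.
exact: good_S.
Qed.

Lemma nonint_S a : nonint a -> nonint (a + 1).
Proof.
move=> h; split; first exact: good_S (proj1 h).
have -> : 1 - (a + 1) = - a by ring.
exact: (proj1 (nonint_opp h)).
Qed.

Lemma nonint_P a : nonint a -> nonint (a - 1).
Proof.
move=> h; have -> : a - 1 = - (- a + 1) by ring.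
by apply: nonint_opp; apply: nonint_S; apply: nonint_opp.
Qed.

Lemma nonint_ne a : nonint a -> a <> RtoC 0.
Proof. by move=> [h _] e; apply: (h 0%N); rewrite e /=; ring. Qed.

Lemma nonint_nat a n : nonint a -> nonint (a + RtoC (INR n)).
Proof.
move=> h; elim: n => [|n IH]; first by rewrite Cplus_0_r.
by rewrite S_INR RtoC_plus Cplus_assoc; apply: nonint_S.
Qed.

Lemma nr_nonintP N (lam : 'I_N -> C) : nr lam <-> (forall i k, i <> k -> nonint (lam i - lam k)).
Proof.
split=> [h i k|h]; first exact: nr_nonint.
split=> [i k e|i k n e].
  case: (eqVneq i k) => // /eqP ik; case: (nonint_ne (h _ _ ik)); rewrite e; ring.
case: (eqVneq i k) => [ik|/eqP ik].
  move: e; rewrite ik; have -> : lam k - lam k = RtoC 0 by ring.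
  by move/RtoC_inj; have := lt_0_INR n.+1 (Nat.lt_0_succ n); lra.
have [_ h2] := h _ _ ik; apply: (h2 n); rewrite e S_INR RtoC_plus; ring.
Qed.

Definition upd N (f : 'I_N -> C) (i : 'I_N) (d : C) : 'I_N -> C := fun k => if k == i then f k + d else f k.

Lemma upd_at N (f : 'I_N -> C) i d : upd f i d i = f i + d.
Proof. by rewrite /upd eqxx. Qed.
Lemma upd_ne N (f : 'I_N -> C) i d k : k != i -> upd f i d k = f k.
Proof. by rewrite /upd => /negbTE ->. Qed.

Lemma nr_upd N (f : 'I_N -> C) i : nr f -> nr (upd f i 1).
Proof.
move=> /nr_nonintP h; apply/nr_nonintP => k l kl; rewrite /upd.
case: eqP => ki; case: eqP => li.
- by case: kl; rewrite ki li.
- by have -> : f k + 1 - f l = f k - f l + 1 by [ring]; apply: nonint_S; apply: h.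
- by have -> : f k - (f l + 1) = f k - f l - 1 by [ring]; apply: nonint_P; apply: h.
- exact: h.
Qed.

(* Under this assumption no integer shift of the parameters destroys the hypotheses; it is removed at the end by perturbing [lam]. *)
Definition generic N (lam mu : 'I_N -> C) : Prop := forall k m, nonint (lam k - mu m).

Lemma generic_updl N (lam mu : 'I_N -> C) i : generic lam mu -> generic (upd lam i 1) mu.
Proof.
move=> h k m; rewrite /upd; case: eqP => _ //.
by have -> : lam k + 1 - mu m = lam k - mu m + 1 by [ring]; apply: nonint_S.
Qed.

Lemma generic_updm N (lam mu : 'I_N -> C) j : generic lam mu -> generic lam (upd mu j 1).
Proof.
move=> h k m; rewrite /upd; case: eqP => _ //.
by have -> : lam k - (mu m + 1) = lam k - mu m - 1 by [ring]; apply: nonint_P.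
Qed.

Lemma generic_sep N (lam mu : 'I_N -> C) : generic lam mu -> sep lam mu.
Proof. by move=> h k m e; apply: (nonint_ne (h k m)); rewrite e; ring. Qed.

Definition sL (q : nat) : C := smid - RtoC (/ (INR q + 1)).
Definition sR (q : nat) : C := smid + RtoC (/ (INR q + 1)).

Lemma inv_INR1_pos q : (0 < / (INR q + 1))%R.
Proof. by apply: Rinv_0_lt_compat; have := pos_INR q; lra. Qed.

Lemma re_smid : Re smid = 0%R.
Proof. by rewrite /smid re_mult re_RtoC im_RtoC -[Re Ci]/0%R -[Im Ci]/1%R; ring. Qed.

Lemma sL_l q : lstrip (sL q).
Proof.
have := inv_INR1_pos q; have [h1 h2] := smid_strip; split.
  rewrite /strip /sL im_minus im_RtoC; split; lra.
rewrite /sL re_minus re_RtoC re_smid; lra.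
Qed.

Lemma sR_r q : rstrip (sR q).
Proof.
have := inv_INR1_pos q; have [h1 h2] := smid_strip; split.
  rewrite /strip /sR im_plus im_RtoC; split; lra.
rewrite /sR re_plus re_RtoC re_smid; lra.
Qed.

Lemma inv_INR1_lim : is_lim_seq (fun q => / (INR q + 1))%R 0%R.
Proof.
apply: (is_lim_seq_inv _ p_infty) => //.
apply: (is_lim_seq_plus _ _ p_infty (Rbar.Finite 1)) => //; [exact: is_lim_seq_INR | exact: is_lim_seq_const].
Qed.

Lemma sL_lim : Clim sL smid.
Proof.
have e : smid - RtoC 0 = smid by ring.
rewrite -[X in Clim _ X]e; apply: Clim_minus; [exact: Clim_const | apply: Clim_RtoC; exact: inv_INR1_lim].
Qed.

Lemma sR_lim : Clim sR smid.
Proof.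
rewrite -[X in Clim _ X]Cplus_0_r; apply: Clim_plus; [exact: Clim_const | apply: Clim_RtoC; exact: inv_INR1_lim].
Qed.

(* [smid = i pi] corresponds to [z = -1], where both series are at the boundary of convergence: the connection relation with
   coefficients [c] is expressed by radial limits from both sides. *)
Definition Conn N (lam mu : 'I_N -> C) (i : 'I_N) (c : 'I_N -> C) : Prop :=
  exists l : cvec N, (forall k, Clim (fun q => yF lam mu i (sL q) k) (l k)) /\
   (forall k, Clim (fun q => csum (fun m => c m * yH lam mu m (sR q) k)) (l k)).

(** ** Raising an exponent at infinity *)

(* [upA] maps solutions for [(lam, mu)] to multiples of solutions for [(lam, upd mu j 1)]. *)
Definition upA N (lam mu : 'I_N -> C) (j : 'I_N) (s : C) (y : cvec N) : cvec N := fun k =>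
  (y k - Cexp s * csum (fun l => residue lam (upd mu j 1) l / (lam l - mu j - 1) * y l)) / (lam k - mu j - 1).

(** Solves the intertwining relation for [yh]. The weights residue_l / (lam_l - mu_j - 1) add up to
    1, because mu_j + 1 is a root of the shifted product; pairing the relation with them gives D + z
    / (1 - z) D = D / (1 - z), where D is the pairing of [yh] with the residues, and D can be
    eliminated. *)
Lemma upA_alg N (lam mu : 'I_N -> C) j s (y yh : cvec N) (al : C) : nr lam -> generic lam mu -> strip s ->
  (forall k, al * y k = (lam k - mu j - 1) * yh k + zz s * csum (fun l => residue lam (upd mu j 1) l * yh l)) ->
  forall k, yh k = al * upA lam mu j s y k.
Proof.
move=> hn hg hs h k; set dl := residue lam (upd mu j 1) in h *.
have ne l : lam l - mu j - 1 <> RtoC 0 by apply: nonint_ne; apply: nonint_P.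
have ne' l : mu j + 1 - lam l <> RtoC 0.
  by move=> e; apply: (ne l); rewrite -Copp_0 -e; ring.
have h1 := one_minus_z hs.
have pf := @residue_pf _ lam (upd mu j 1) (mu j + 1) (proj1 hn) (fun l e => ne' l (proj1 (Ceq_minus _ _) e)).
rewrite (cprod_eq0 (i := j) (F := fun m => mu j + 1 - upd mu j 1 m)) in pf; last by rewrite upd_at; exact: Cplus_opp_r.
rewrite -/dl /Cdiv Cmult_0_l in pf.
have pf' : csum (fun l => dl l / (lam l - mu j - 1)) = 1.
  have -> : csum (fun l => dl l / (lam l - mu j - 1)) = - csum (fun l => dl l * / (mu j + 1 - lam l)).
    by rewrite -csum_opp; apply: csum_ext => l; have := ne l; have := ne' l => a b; field; split.
  have -> : csum (fun l => dl l * / (mu j + 1 - lam l)) = (1 + csum (fun l => dl l * / (mu j + 1 - lam l))) - 1 by ring.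
  by rewrite pf; ring.
set D := csum (fun l => dl l * yh l) in h.
have e : al * csum (fun l => dl l / (lam l - mu j - 1) * y l) = D / (1 - Cexp s).
  rewrite -csum_scal.
  transitivity (csum (fun l => dl l * yh l) + zz s * D * csum (fun l => dl l / (lam l - mu j - 1))).
    rewrite -csum_scal -csum_plus; apply: csum_ext => l.
    have -> : al * (dl l / (lam l - mu j - 1) * y l) = dl l / (lam l - mu j - 1) * (al * y l) by ring.
    by rewrite h; have := ne l => a; field.
  by rewrite pf' -/D /zz; field.
have nk := ne k.
have -> : al * upA lam mu j s y k = (al * y k - Cexp s * (al * csum (fun l => dl l / (lam l - mu j - 1) * y l))) / (lam k - mu j - 1).
  by rewrite /upA -/dl; field.
rewrite e h /zz; field; split=> //.
Qed.

Lemma upA_csum N (lam mu : 'I_N -> C) j s (c : 'I_N -> C) (y : 'I_N -> cvec N) k :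
  upA lam mu j s (fun k => csum (fun m => c m * y m k)) k = csum (fun m => c m * upA lam mu j s (y m) k).
Proof.
rewrite /upA; set d := _ - _ - _.
have -> : csum (fun l => residue lam (upd mu j 1) l / (lam l - mu j - 1) * csum (fun m => c m * y m l)) =
   csum (fun m => c m * csum (fun l => residue lam (upd mu j 1) l / (lam l - mu j - 1) * y m l)).
  transitivity (csum (fun l => csum (fun m => c m * (residue lam (upd mu j 1) l / (lam l - mu j - 1) * y m l)))).
    by apply: csum_ext => l; rewrite -csum_scal; apply: csum_ext => m; ring.
  by rewrite csum_exchange; apply: csum_ext => m; rewrite csum_scal.
rewrite -csum_scal -csum_minus /Cdiv -csum_scal_r; apply: csum_ext => m; ring.
Qed.

Lemma upA_lim N (lam mu : 'I_N -> C) j (s : nat -> C) s0 (y : nat -> cvec N) (l : cvec N) k :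
  generic lam mu -> Clim s s0 -> (forall k, Clim (fun q => y q k) (l k)) ->
  Clim (fun q => upA lam mu j (s q) (y q) k) (upA lam mu j s0 l k).
Proof.
move=> hg hs hy; apply: Clim_div.
- by apply: nonint_ne; apply: nonint_P.
- apply: Clim_minus => //; apply: Clim_mult; first exact: Clim_Cexp.
  by apply: Clim_csum => i; apply: Clim_scal.
- exact: Clim_const.
Qed.

Lemma residue_updm N (lam mu : 'I_N -> C) j k : nr lam ->
  residue lam (upd mu j 1) k * (lam k - mu j) = residue lam mu k * (lam k - mu j - 1).
Proof.
move=> hn; have d0 := distinct_prod (k := k) (proj1 hn).
rewrite /residue !(cprod_D1 j) upd_at.
rewrite (cprod_except_ext (i := j) (F := fun m => lam k - upd mu j 1 m) (G := fun m => lam k - mu m)); last by move=> m hm; rewrite upd_ne.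
by field.
Qed.

Lemma Scoef_updm N (lam mu : 'I_N -> C) i j n :
  (lam i - mu j) * Scoef lam mu i n = (lam i - mu j + RtoC (INR n)) * Scoef lam (upd mu j 1) i n.
Proof.
rewrite /Scoef !(cprod_D1 j (fun m => poch (lam i - _ + 1) n)) upd_at.
rewrite (cprod_except_ext (i := j) (F := fun m => poch (lam i - upd mu j 1 m + 1) n) (G := fun m => poch (lam i - mu m + 1) n)); last by move=> m hm; rewrite upd_ne.
have -> : lam i - (mu j + 1) + 1 = lam i - mu j by ring.
have e := poch_swap (lam i - mu j) n; rewrite /Cdiv.
set p := poch _ _ in e *; set p' := poch _ _ in e *; set Q := cprod_except _ _; set D := / _.
have -> : (lam i - mu j) * (p * Q * D) = (lam i - mu j) * p * (Q * D) by ring.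
by rewrite e; ring.
Qed.

Lemma aF_updm N (lam mu : 'I_N -> C) i j n k : nr lam -> generic lam mu ->
  (lam k - mu j - 1) * aF lam (upd mu j 1) i n k + WF lam (upd mu j 1) i n = (lam i - mu j) * aF lam mu i n k.
Proof.
move=> hn hg; case: n => [|n].
  rewrite /aF /WF; case: eqP => [->|_]; last by ring.
  have r0 := residue_ne0 (i := i) hn (generic_sep hg); have r0' := residue_ne0 (i := i) hn (generic_sep (generic_updm j hg)).
  have e := @residue_updm N lam mu j i hn.
  have -> : (lam i - mu j - 1) * / residue lam (upd mu j 1) i + 0 = (residue lam mu i * (lam i - mu j - 1)) / (residue lam mu i * residue lam (upd mu j 1) i).
    by field.
  by rewrite -e; field.
rewrite /aF /WF; have h := nr_good (i := i) (k := k) hn (l := n).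
have -> : (lam i - mu j) * (Scoef lam mu i n / (lam i - lam k + 1 + RtoC (INR n))) = (lam i - mu j) * Scoef lam mu i n / (lam i - lam k + 1 + RtoC (INR n)) by field.
by rewrite Scoef_updm; field.
Qed.

(** The factor with [yH lam (upd mu j 1) m] = [betaA] times [upA] of [yH lam mu m]. The case m = j
    is separate because there the leading exponent moves and the coefficients shift by one index. *)
Definition betaA N (lam mu : 'I_N -> C) (j m : 'I_N) : C :=
  if m == j then - (cprod (fun k => lam k - mu j) / cprod_except j (fun m' => mu m' - mu j)) else mu m - mu j - 1.

Lemma bH_generic N (lam mu : 'I_N -> C) j n k : generic lam mu ->
  bH lam mu j n k = Tcoef lam mu j n / (lam k - mu j + RtoC (INR n)).
Proof.
move=> hg; rewrite -(bHT j n k (generic_sep hg)); field.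
exact: (proj1 (hg k j) n).
Qed.

Lemma Tcoef_updm N (lam mu : 'I_N -> C) j m n : nr mu -> m != j ->
  (mu j - mu m + 1) * Tcoef lam mu m n = (mu j - mu m + 1 + RtoC (INR n)) * Tcoef lam (upd mu j 1) m n.
Proof.
move=> hm mj; have hm' := nr_upd j hm.
have g1 : cprod (fun k => poch (mu k - mu m + 1) n) <> RtoC 0 by apply: cprod_ne0 => k; apply: poch_ne0; apply: nr_good.
have g2 : cprod (fun k => poch (upd mu j 1 k - upd mu j 1 m + 1) n) <> RtoC 0 by apply: cprod_ne0 => k; apply: poch_ne0; apply: nr_good.
rewrite /Tcoef (upd_ne _ _ mj) in g2 *.
move: g1 g2; rewrite (cprod_D1 j (fun k => poch (mu k - mu m + 1) n)) (cprod_D1 j (fun k => poch (upd mu j 1 k - mu m + 1) n)) upd_at.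
rewrite (cprod_except_ext (i := j) (F := fun k => poch (upd mu j 1 k - mu m + 1) n) (G := fun k => poch (mu k - mu m + 1) n)); last by move=> k hk; rewrite upd_ne.
have e := poch_swap (mu j - mu m + 1) n.
have -> : mu j + 1 - mu m + 1 = mu j - mu m + 1 + 1 by ring.
have n0 : mu j - mu m + 1 <> RtoC 0 by have := nr_good (i := j) (k := m) hm (l := 0%N); rewrite Cplus_0_r.
set p := poch _ _ in e *; set p' := poch _ _ in e *; set Q := cprod_except _ _; set D := cprod _ => g1 g2.
have q0 : Q <> RtoC 0 by move=> h; apply: g1; rewrite h; ring.
have p0 : p <> RtoC 0 by move=> h; apply: g2; rewrite h; ring.
have p0' : p' <> RtoC 0 by move=> h; apply: g1; rewrite h; ring.
have -> : (mu j - mu m + 1) * (D / (p' * Q)) = (mu j - mu m + 1) * p * D / (p * p' * Q) by field; repeat split.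
by rewrite e; field; repeat split.
Qed.

Lemma Tcoef_updm_at N (lam mu : 'I_N -> C) j n : nr mu ->
  RtoC (INR n + 1) * Tcoef lam (upd mu j 1) j n.+1 = - betaA lam mu j j * Tcoef lam mu j n.
Proof.
move=> hm; have hm' := nr_upd j hm.
have e1 : cprod (fun k => poch (lam k - upd mu j 1 j + 1) n.+1) = cprod (fun k => lam k - mu j) * cprod (fun k => poch (lam k - mu j + 1) n).
  rewrite -cprod_mult; apply: cprod_ext => k; rewrite upd_at -poch_left; congr poch; ring.
have e2 : cprod (fun m => poch (upd mu j 1 m - upd mu j 1 j + 1) n.+1) =
   RtoC (INR n + 1) * cprod_except j (fun m' => mu m' - mu j) * cprod (fun m => poch (mu m - mu j + 1) n).
  rewrite (cprod_D1 j) [cprod (fun m => poch (mu m - mu j + 1) n)](cprod_D1 j).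
  have -> : upd mu j 1 j - upd mu j 1 j + 1 = RtoC 1 by ring.
  have -> : mu j - mu j + 1 = RtoC 1 by ring.
  have -> : cprod_except j (fun m => poch (upd mu j 1 m - upd mu j 1 j + 1) n.+1) =
     cprod_except j (fun m' => mu m' - mu j) * cprod_except j (fun m => poch (mu m - mu j + 1) n).
    rewrite -cprod_except_mult; apply: cprod_except_ext => m hm1; rewrite upd_at upd_ne // -poch_left; congr poch; ring.
  rewrite pochS RtoC_plus; ring.
have g1 : cprod (fun k => poch (mu k - mu j + 1) n) <> RtoC 0 by apply: cprod_ne0 => k; apply: poch_ne0; apply: nr_good.
have g2 : cprod_except j (fun m' => mu m' - mu j) <> RtoC 0.
  by apply: cprod_except_ne0 => m mj; apply: nonint_ne; apply: nr_nonint => //; apply/eqP.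
rewrite /Tcoef e1 e2 /betaA eqxx; have := @INR1_neq0 n => h; field; repeat split => //.
Qed.

Lemma bH_updm N (lam mu : 'I_N -> C) j m n k : nr mu -> generic lam mu -> m != j ->
  (lam k - mu j - 1) * bH lam (upd mu j 1) m n k + VH lam (upd mu j 1) m n = betaA lam mu j m * bH lam mu m n k.
Proof.
move=> hm hg mj; have hg' := generic_updm j hg.
rewrite !bH_generic // /VH /betaA (negbTE mj) (upd_ne _ _ mj).
have h := proj1 (hg k m) n.
have e := @Tcoef_updm N lam mu j m n hm mj.
have -> : (mu m - mu j - 1) * (Tcoef lam mu m n / (lam k - mu m + RtoC (INR n))) =
  - ((mu j - mu m + 1) * Tcoef lam mu m n) / (lam k - mu m + RtoC (INR n)) by field.
by rewrite e; field.
Qed.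

Lemma bH_updm_at N (lam mu : 'I_N -> C) j n k : nr mu -> generic lam mu ->
  (lam k - mu j - 1) * bH lam (upd mu j 1) j n k + VH lam (upd mu j 1) j n
   = betaA lam mu j j * sh (fun n => bH lam mu j n k) n.
Proof.
move=> hm hg; have hg' := generic_updm j hg.
rewrite bH_generic // /VH upd_at; case: n => [|n].
  rewrite /sh /=; have h := proj1 (nonint_P (hg k j)) 0%N; rewrite Cplus_0_r in h.
  by field; move=> e; apply: h; rewrite -[RHS]e; ring.
rewrite /sh bH_generic //; have h := proj1 (hg k j) n.
rewrite S_INR; have e := @Tcoef_updm_at N lam mu j n hm.
have -> : betaA lam mu j j * (Tcoef lam mu j n / (lam k - mu j + RtoC (INR n))) =
  - (- betaA lam mu j j * Tcoef lam mu j n) / (lam k - mu j + RtoC (INR n)) by field.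
rewrite -e RtoC_plus; field; repeat split => //; move=> e0; apply: h; rewrite -[RHS]e0; ring.
Qed.

Lemma yF_updm N (lam mu : 'I_N -> C) i j s k : nr lam -> generic lam mu -> lstrip s ->
  (lam i - mu j) * yF lam mu i s k = (lam k - mu j - 1) * yF lam (upd mu j 1) i s k
    + zz s * csum (fun l => residue lam (upd mu j 1) l * yF lam (upd mu j 1) i s l).
Proof.
move=> hn hg hs; have hg' := generic_updm j hg.
rewrite -(yF_zu i hn (generic_sep hg') hs) /yF /ser0.
have hz := Cmod_Cexp_lt1 (proj2 hs).
have e : (lam i - mu j) * PSc (fun n => aF lam mu i n k) (Cexp s) =
  (lam k - mu j - 1) * PSc (fun n => aF lam (upd mu j 1) i n k) (Cexp s) + PSc (WF lam (upd mu j 1) i) (Cexp s).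
  rewrite -!PSc_scal //; try exact: aF_gb.
  rewrite -PSc_plus //; [|by apply: gb_scal; apply: aF_gb|exact: WF_gb].
  by apply: PSc_ext => n; rewrite aF_updm.
have -> : (lam i - mu j) * (Cexp (lam i * s) * PSc (fun n => aF lam mu i n k) (Cexp s)) =
  Cexp (lam i * s) * ((lam i - mu j) * PSc (fun n => aF lam mu i n k) (Cexp s)) by ring.
rewrite e; ring.
Qed.

Lemma yH_updm N (lam mu : 'I_N -> C) j m s k : nr lam -> nr mu -> generic lam mu -> rstrip s ->
  betaA lam mu j m * yH lam mu m s k = (lam k - mu j - 1) * yH lam (upd mu j 1) m s k
    + zz s * csum (fun l => residue lam (upd mu j 1) l * yH lam (upd mu j 1) m s l).
Proof.
move=> hn hm hg hs; have hg' := generic_updm j hg; have hm' := nr_upd j hm.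
rewrite -(yH_zu m hn hm' (generic_sep hg') hs) /yH /serinf.
have hz : (Cmod (Cexp (- s)) < 1)%R by apply: Cmod_Cexp_lt1; rewrite re_opp; case: hs; lra.
have g1 := bH_gb m k hm (generic_sep hg); have g2 := bH_gb m k hm' (generic_sep hg'); have g3 := VH_gb lam m hm'.
case: (eqVneq m j) => [mj|mj]; last first.
  have e : betaA lam mu j m * PSc (fun n => bH lam mu m n k) (Cexp (- s)) =
    (lam k - mu j - 1) * PSc (fun n => bH lam (upd mu j 1) m n k) (Cexp (- s)) + PSc (VH lam (upd mu j 1) m) (Cexp (- s)).
    rewrite -!PSc_scal // -PSc_plus //; last exact: gb_scal.
    by apply: PSc_ext => n; rewrite bH_updm.
  have -> : betaA lam mu j m * (Cexp (mu m * s) * PSc (fun n => bH lam mu m n k) (Cexp (- s))) =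
    Cexp (mu m * s) * (betaA lam mu j m * PSc (fun n => bH lam mu m n k) (Cexp (- s))) by ring.
  rewrite e upd_ne //; ring.
rewrite {}mj in g1 g2 g3 *.
have e : betaA lam mu j j * (Cexp (- s) * PSc (fun n => bH lam mu j n k) (Cexp (- s))) =
  (lam k - mu j - 1) * PSc (fun n => bH lam (upd mu j 1) j n k) (Cexp (- s)) + PSc (VH lam (upd mu j 1) j) (Cexp (- s)).
  rewrite -PSc_sh // -!PSc_scal //; last exact: gb_sh.
  rewrite -PSc_plus //; last exact: gb_scal.
  by apply: PSc_ext => n; rewrite bH_updm_at.
have -> : Cexp (mu j * s) = Cexp ((mu j + 1) * s) * Cexp (- s) by rewrite -Cexp_plus; congr Cexp; ring.
have -> : betaA lam mu j j * (Cexp ((mu j + 1) * s) * Cexp (- s) * PSc (fun n => bH lam mu j n k) (Cexp (- s))) =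
  Cexp ((mu j + 1) * s) * (betaA lam mu j j * (Cexp (- s) * PSc (fun n => bH lam mu j n k) (Cexp (- s)))) by ring.
rewrite e upd_at; ring.
Qed.

Lemma betaA_ne0 N (lam mu : 'I_N -> C) j m : nr mu -> generic lam mu -> betaA lam mu j m <> RtoC 0.
Proof.
move=> hm hg; rewrite /betaA; case: (eqVneq m j) => [mj|/eqP mj]; last first.
  by apply: nonint_ne; apply: nonint_P; apply: nr_nonint.
have p1 : cprod (fun k => lam k - mu j) <> RtoC 0 by apply: cprod_ne0 => k; apply: nonint_ne.
have p2 : cprod_except j (fun m' => mu m' - mu j) <> RtoC 0.
  by apply: cprod_except_ne0 => m' hm'; apply: nonint_ne; apply: nr_nonint => //; apply/eqP.
move=> e; apply: p1.
have -> : cprod (fun k => lam k - mu j) = - (- (cprod (fun k => lam k - mu j) / cprod_except j (fun m' => mu m' - mu j))) * cprod_except j (fun m' => mu m' - mu j) by field.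
rewrite e; ring.
Qed.

(** [upA] is linear and continuous up to z = -1, so equal limits have equal images; each coefficient
    changes by the quotient of the factors belonging to f_i and to h_m. *)
Lemma Conn_updm N (lam mu : 'I_N -> C) i j c : nr lam -> nr mu -> generic lam mu -> Conn lam mu i c ->
  Conn lam (upd mu j 1) i (fun m => c m * (lam i - mu j) / betaA lam mu j m).
Proof.
move=> hn hm hg [l [hF hH]]; exists (fun k => (lam i - mu j) * upA lam mu j smid l k); split=> k.
  apply: (Clim_ext (u := fun q => (lam i - mu j) * upA lam mu j (sL q) (yF lam mu i (sL q)) k)).
    move=> q; symmetry; apply: upA_alg => //; first exact: (proj1 (sL_l q)).
    by move=> k'; apply: yF_updm => //; apply: sL_l.
  by apply: Clim_scal; apply: upA_lim => //; exact: sL_lim.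
apply: (Clim_ext (u := fun q => (lam i - mu j) * upA lam mu j (sR q) (fun k => csum (fun m => c m * yH lam mu m (sR q) k)) k)).
  move=> q; rewrite (@upA_csum N lam mu j (sR q) c (fun m => yH lam mu m (sR q)) k) -csum_scal; apply: csum_ext => m.
  have -> : yH lam (upd mu j 1) m (sR q) k = betaA lam mu j m * upA lam mu j (sR q) (yH lam mu m (sR q)) k.
    apply: upA_alg => //; first exact: (proj1 (sR_r q)).
    by move=> k'; apply: yH_updm => //; apply: sR_r.
  lazy beta; field; exact: betaA_ne0.
apply: Clim_scal; apply: upA_lim => //; exact: sR_lim.
Qed.

(** ** Raising an exponent at the origin *)

(* [upB] maps solutions for [(lam, mu)] to multiples of solutions for [(upd lam i 1, mu)]. *)
Definition upB N (lam mu : 'I_N -> C) (i : 'I_N) (s : C) (y : cvec N) : cvec N := fun k =>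
  (* The zero entry at k = i annihilates the leading vector of f_i, which raises its exponent by
     one. *)
  (if k == i then RtoC 0 else lam k - lam i - 1) * y k + zz s * csum (fun l => residue lam mu l * y l).

Lemma upB_csum N (lam mu : 'I_N -> C) j s (c : 'I_N -> C) (y : 'I_N -> cvec N) k :
  upB lam mu j s (fun k => csum (fun m => c m * y m k)) k = csum (fun m => c m * upB lam mu j s (y m) k).
Proof.
rewrite /upB; set d := if _ then _ else _.
have -> : csum (fun l => residue lam mu l * csum (fun m => c m * y m l)) =
   csum (fun m => c m * csum (fun l => residue lam mu l * y m l)).
  transitivity (csum (fun l => csum (fun m => c m * (residue lam mu l * y m l)))).
    by apply: csum_ext => l; rewrite -csum_scal; apply: csum_ext => m; ring.
  by rewrite csum_exchange; apply: csum_ext => m; rewrite csum_scal.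
rewrite -!csum_scal -csum_plus; apply: csum_ext => m; ring.
Qed.

Lemma zz_lim (s : nat -> C) s0 : strip s0 -> Clim s s0 -> Clim (fun q => zz (s q)) (zz s0).
Proof.
move=> h0 hs; apply: Clim_div; [exact: one_minus_z | exact: Clim_Cexp | apply: Clim_minus; [exact: Clim_const | exact: Clim_Cexp]].
Qed.

Lemma upB_lim N (lam mu : 'I_N -> C) j (s : nat -> C) s0 (y : nat -> cvec N) (l : cvec N) k :
  strip s0 -> Clim s s0 -> (forall k, Clim (fun q => y q k) (l k)) ->
  Clim (fun q => upB lam mu j (s q) (y q) k) (upB lam mu j s0 l k).
Proof.
move=> h0 hs hy; apply: Clim_plus; first exact: Clim_scal.
apply: Clim_mult; first exact: zz_lim.
by apply: Clim_csum => i; apply: Clim_scal.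
Qed.

Lemma Scoef_updl N (lam mu : 'I_N -> C) i n : nr lam ->
  RtoC (INR n + 1) * Scoef lam mu i n.+1 = residue (upd lam i 1) mu i * Scoef (upd lam i 1) mu i n.
Proof.
move=> hn; have hn' := nr_upd i hn.
have e1 : cprod (fun m => poch (lam i - mu m + 1) n.+1) = cprod (fun m => upd lam i 1 i - mu m) * cprod (fun m => poch (upd lam i 1 i - mu m + 1) n).
  rewrite -cprod_mult; apply: cprod_ext => k; rewrite upd_at -poch_left; congr poch; ring.
have e2 : cprod (fun k => poch (lam i - lam k + 1) n.+1) =
   RtoC (INR n + 1) * cprod_except i (fun k => upd lam i 1 i - upd lam i 1 k) * cprod (fun k => poch (upd lam i 1 i - upd lam i 1 k + 1) n).
  rewrite (cprod_D1 i) [cprod (fun k => poch (upd lam i 1 i - upd lam i 1 k + 1) n)](cprod_D1 i).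
  have -> : upd lam i 1 i - upd lam i 1 i + 1 = RtoC 1 by ring.
  have -> : lam i - lam i + 1 = RtoC 1 by ring.
  have -> : cprod_except i (fun k => poch (lam i - lam k + 1) n.+1) =
     cprod_except i (fun k => upd lam i 1 i - upd lam i 1 k) * cprod_except i (fun k => poch (upd lam i 1 i - upd lam i 1 k + 1) n).
    rewrite -cprod_except_mult; apply: cprod_except_ext => m hm1; rewrite upd_at upd_ne // -poch_left; congr poch; ring.
  rewrite pochS RtoC_plus; ring.
have g1 : cprod (fun k => poch (upd lam i 1 i - upd lam i 1 k + 1) n) <> RtoC 0.
  by apply: cprod_ne0 => k; apply: poch_ne0; apply: (nr_good hn').
have g2 := distinct_prod (k := i) (proj1 hn').
rewrite /Scoef e1 e2 /residue; have := @INR1_neq0 n => h; field; repeat split => //.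
Qed.

Lemma Tcoef_updl N (lam mu : 'I_N -> C) i m n :
  (lam i - mu m + 1) * Tcoef (upd lam i 1) mu m n = (lam i - mu m + 1 + RtoC (INR n)) * Tcoef lam mu m n.
Proof.
rewrite /Tcoef !(cprod_D1 i (fun k => poch (_ - mu m + 1) n)) upd_at.
rewrite (cprod_except_ext (i := i) (F := fun k => poch (upd lam i 1 k - mu m + 1) n) (G := fun k => poch (lam k - mu m + 1) n)); last by move=> k hk; rewrite upd_ne.
have -> : lam i + 1 - mu m + 1 = lam i - mu m + 1 + 1 by ring.
have e := poch_swap (lam i - mu m + 1) n; rewrite /Cdiv.
set p := poch _ _ in e *; set p' := poch _ _ in e *; set Q := cprod_except _ _; set D := / _.
have -> : (lam i - mu m + 1) * (p * Q * D) = (lam i - mu m + 1) * p * (Q * D) by ring.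
by rewrite e; ring.
Qed.

Lemma aF_updl N (lam mu : 'I_N -> C) i n k : nr lam -> generic lam mu ->
  (if k == i then RtoC 0 else lam k - lam i - 1) * aF lam mu i n k + WF lam mu i n
    = residue (upd lam i 1) mu i * sh (fun n => aF (upd lam i 1) mu i n k) n.
Proof.
move=> hn hg; have hn' := nr_upd i hn; have hg' := generic_updl i hg.
have r0 := residue_ne0 (i := i) hn' (generic_sep hg').
case: n => [|n].
  rewrite /aF /WF /sh; case: eqP => _; ring.
have h := nr_good (i := i) (k := k) hn (l := n).
case: n h => [|n] h.
  rewrite /sh /aF /WF /Scoef !cprod_poch0 Cdiv11; case: eqP => [ki|_]; first by rewrite Cmult_0_l Cplus_0_l Cinv_r.
  rewrite Cplus_0_r in h; rewrite /= Cplus_0_r; field; exact: h.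
rewrite /sh /aF /WF.
have -> : residue (upd lam i 1) mu i * (Scoef (upd lam i 1) mu i n / (upd lam i 1 i - upd lam i 1 k + 1 + RtoC (INR n))) =
  (residue (upd lam i 1) mu i * Scoef (upd lam i 1) mu i n) / (upd lam i 1 i - upd lam i 1 k + 1 + RtoC (INR n)).
  by rewrite /Cdiv; ring.
rewrite -Scoef_updl //; rewrite S_INR RtoC_plus in h *; rewrite upd_at.
case: (eqVneq k i) => [->|ki].
  rewrite upd_at.
  have -> : lam i + 1 - (lam i + 1) + 1 + RtoC (INR n) = RtoC (INR n + 1) by rewrite RtoC_plus; ring.
  rewrite Cmult_0_l Cplus_0_l; rewrite -RtoC_plus; field; exact: INR1_neq0.
rewrite (upd_ne _ _ ki).
have h' : lam i + 1 - lam k + 1 + RtoC (INR n) <> RtoC 0 by move=> e; apply: h; rewrite -[RHS]e; ring.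
have h2 : lam i - lam k + 1 + (RtoC (INR n) + 1) <> RtoC 0 by move=> e; apply: h; rewrite -[RHS]e; ring.
by field.
Qed.

Lemma bH_updl N (lam mu : 'I_N -> C) i m n k : generic lam mu ->
  (if k == i then RtoC 0 else lam k - lam i - 1) * bH lam mu m n k + VH lam mu m n
   = (mu m - lam i - 1) * bH (upd lam i 1) mu m n k.
Proof.
move=> hg; have hg' := generic_updl i hg.
rewrite !bH_generic // /VH; have h := proj1 (hg k m) n; have h' := proj1 (hg' k m) n.
have -> : (mu m - lam i - 1) * (Tcoef (upd lam i 1) mu m n / (upd lam i 1 k - mu m + RtoC (INR n))) =
  - ((lam i - mu m + 1) * Tcoef (upd lam i 1) mu m n) / (upd lam i 1 k - mu m + RtoC (INR n)) by field.
rewrite Tcoef_updl; move: h'; rewrite /upd; case: (eqVneq k i) => [->|ki] h'; last by field.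
rewrite Cmult_0_l Cplus_0_l.
have h2 : lam i + 1 - mu m + RtoC (INR n) <> RtoC 0 by [].
by field.
Qed.

Lemma yF_updl N (lam mu : 'I_N -> C) i s k : nr lam -> generic lam mu -> lstrip s ->
  residue (upd lam i 1) mu i * yF (upd lam i 1) mu i s k = upB lam mu i s (yF lam mu i s) k.
Proof.
move=> hn hg hs; have hg' := generic_updl i hg; have hn' := nr_upd i hn.
rewrite /upB -(yF_zu i hn (generic_sep hg) hs) /yF /ser0.
have hz := Cmod_Cexp_lt1 (proj2 hs); set d := if _ then _ else _.
have e : residue (upd lam i 1) mu i * (Cexp s * PSc (fun n => aF (upd lam i 1) mu i n k) (Cexp s)) =
  d * PSc (fun n => aF lam mu i n k) (Cexp s) + PSc (WF lam mu i) (Cexp s).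
  have g := aF_gb mu i k hn'; have g' := aF_gb mu i k hn.
  rewrite -PSc_sh // -!PSc_scal //; last exact: gb_sh.
  rewrite -PSc_plus //; [|exact: gb_scal|exact: WF_gb].
  by apply: PSc_ext => n; rewrite aF_updl.
have -> : Cexp (upd lam i 1 i * s) = Cexp (lam i * s) * Cexp s by rewrite -Cexp_plus upd_at; congr Cexp; ring.
have -> : residue (upd lam i 1) mu i * (Cexp (lam i * s) * Cexp s * PSc (fun n => aF (upd lam i 1) mu i n k) (Cexp s)) =
  Cexp (lam i * s) * (residue (upd lam i 1) mu i * (Cexp s * PSc (fun n => aF (upd lam i 1) mu i n k) (Cexp s))) by ring.
rewrite e; ring.
Qed.

Lemma yH_updl N (lam mu : 'I_N -> C) i m s k : nr lam -> nr mu -> generic lam mu -> rstrip s ->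
  (mu m - lam i - 1) * yH (upd lam i 1) mu m s k = upB lam mu i s (yH lam mu m s) k.
Proof.
move=> hn hm hg hs; have hg' := generic_updl i hg; have hn' := nr_upd i hn.
rewrite /upB -(yH_zu m hn hm (generic_sep hg) hs) /yH /serinf.
have hz : (Cmod (Cexp (- s)) < 1)%R by apply: Cmod_Cexp_lt1; rewrite re_opp; case: hs; lra.
set d := if _ then _ else _.
have g1 := bH_gb m k hm (generic_sep hg); have g2 := bH_gb m k hm (generic_sep hg'); have g3 := VH_gb lam m hm.
have e : (mu m - lam i - 1) * PSc (fun n => bH (upd lam i 1) mu m n k) (Cexp (- s)) =
  d * PSc (fun n => bH lam mu m n k) (Cexp (- s)) + PSc (VH lam mu m) (Cexp (- s)).
  rewrite -!PSc_scal // -PSc_plus //; last exact: gb_scal.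
  by apply: PSc_ext => n; rewrite bH_updl.
have -> : (mu m - lam i - 1) * (Cexp (mu m * s) * PSc (fun n => bH (upd lam i 1) mu m n k) (Cexp (- s))) =
  Cexp (mu m * s) * ((mu m - lam i - 1) * PSc (fun n => bH (upd lam i 1) mu m n k) (Cexp (- s))) by ring.
rewrite e; ring.
Qed.

Lemma Conn_updl N (lam mu : 'I_N -> C) i c : nr lam -> nr mu -> generic lam mu -> Conn lam mu i c ->
  Conn (upd lam i 1) mu i (fun m => c m * (mu m - lam i - 1) / residue (upd lam i 1) mu i).
Proof.
move=> hn hm hg [l [hF hH]]; set al := residue _ _ _.
have hg' := generic_updl i hg; have hn' := nr_upd i hn.
have r0 : al <> RtoC 0 := residue_ne0 (i := i) hn' (generic_sep hg').
exists (fun k => / al * upB lam mu i smid l k); split=> k.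
  apply: (Clim_ext (u := fun q => / al * upB lam mu i (sL q) (yF lam mu i (sL q)) k)).
    by move=> q; rewrite -yF_updl //; [rewrite -/al; field | apply: sL_l].
  by apply: Clim_scal; apply: upB_lim => //; [exact: smid_strip | exact: sL_lim].
apply: (Clim_ext (u := fun q => / al * upB lam mu i (sR q) (fun k => csum (fun m => c m * yH lam mu m (sR q) k)) k)).
  move=> q; rewrite (@upB_csum N lam mu i (sR q) c (fun m => yH lam mu m (sR q)) k) -csum_scal; apply: csum_ext => m.
  by rewrite -yH_updl //; [field | apply: sR_r].
by apply: Clim_scal; apply: upB_lim => //; [exact: smid_strip | exact: sR_lim].
Qed.

(** * The limit of infinitely shifted parameters *)

(** For absolutely summable coefficients Abel's limit theorem is an instance of [tannery]: the
    moduli of the coefficients dominate on the closed disc. *)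
Lemma summable_abel c (u : nat -> C) l : summable c -> (forall q, (Cmod (u q) <= 1)%R) -> Clim u l ->
  Clim (fun q => PSc c (u q)) (PSc c l).
Proof.
move=> hc hu hl; apply: (tannery (b := fun n => Cmod (c n)) (q0 := 0%N) hc _ _).2.
- move=> q n _; rewrite Cmod_mult Cmod_pow -[X in (_ <= X)%R]Rmult_1_r.
  apply: Rmult_le_compat_l; first exact: Cmod_ge_0.
  by rewrite -(pow1 n); apply: pow_incr; split=> //; apply: Cmod_ge_0.
- move=> n; apply: Clim_scal; elim: n => [|n IH]; first exact: Clim_const.
  by apply: Clim_ext (Clim_mult hl IH) => q; rewrite Cpow_S.
Qed.

Lemma Cexp_smid : Cexp smid = - RtoC 1.
Proof. by rewrite /smid Cexp_PI -RtoC_opp. Qed.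

Definition altsum (c : nat -> C) : C := PSc c (- RtoC 1).

Lemma summable_sh c : summable c -> summable (sh c).
Proof. by move=> h; apply/summable_S. Qed.

Lemma PSc_sh_m1 c : summable c -> PSc (sh c) (- RtoC 1) = - altsum c.
Proof.
move=> hc; have s : summable (fun n => c n * Cpow (- RtoC 1) n).
  by apply: (summable_le (b := fun n => Cmod (c n))) => // n; rewrite Cmod_mult Cmod_pow_m1; lra.
rewrite /PSc Cser_S; last first.
  by apply: (summable_le (b := fun n => Cmod (sh c n))) (summable_sh hc) => n; rewrite Cmod_mult Cmod_pow_m1; lra.
rewrite /= Cmult_0_l Cplus_0_l /altsum /PSc -Cser_opp //.
apply: Cser_ext => n; ring.
Qed.

(** Applying z / (1 - z) times the functional with weights residue_k turns the vector relation into
    a scalar one between the series [WF] and [VH]; these converge absolutely at z = -1 and give, up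
    to a common sign, the alternating sums of [Scoef] and [Tcoef]. *)
Lemma Conn_minus1 N (lam mu : 'I_N -> C) i c : nr lam -> nr mu -> sep lam mu -> Conn lam mu i c ->
  summable (Scoef lam mu i) -> (forall m, summable (Tcoef lam mu m)) ->
  Cexp (lam i * smid) * altsum (Scoef lam mu i) =
  csum (fun m => c m * (Cexp (mu m * smid) * altsum (Tcoef lam mu m))).
Proof.
move=> hl hm hs [l [hF hH]] sS sT.
set U := zz smid * csum (fun k => residue lam mu k * l k).
have a1 q : (Cmod (Cexp (sL q)) <= 1)%R by apply: Rlt_le; apply: Cmod_Cexp_lt1; case: (sL_l q).
have a2 q : (Cmod (Cexp (- sR q)) <= 1)%R by apply: Rlt_le; apply: Cmod_Cexp_lt1; rewrite re_opp; case: (sR_r q); lra.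
have l1 : Clim (fun q => Cexp (sL q)) (- RtoC 1) by rewrite -Cexp_smid; apply: Clim_Cexp; exact: sL_lim.
have l2 : Clim (fun q => Cexp (- sR q)) (- RtoC 1).
  have <- : Cexp (- smid) = - RtoC 1 by rewrite Cexp_opp Cexp_smid; field.
  by apply: Clim_Cexp; apply: Clim_opp; exact: sR_lim.
have hU1 : Clim (fun q => Cexp (lam i * sL q) * PSc (WF lam mu i) (Cexp (sL q))) U.
  apply: (Clim_ext (u := fun q => zz (sL q) * csum (fun k => residue lam mu k * yF lam mu i (sL q) k))).
    by move=> q; rewrite yF_zu //; apply: sL_l.
  apply: Clim_mult; first by apply: zz_lim; [exact: smid_strip | exact: sL_lim].
  by apply: Clim_csum => k; apply: Clim_scal.
have hU2 : Clim (fun q => csum (fun m => c m * (Cexp (mu m * sR q) * PSc (VH lam mu m) (Cexp (- sR q))))) U.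
  apply: (Clim_ext (u := fun q => zz (sR q) * csum (fun k => residue lam mu k * csum (fun m => c m * yH lam mu m (sR q) k)))).
    move=> q; transitivity (csum (fun m => c m * (zz (sR q) * csum (fun k => residue lam mu k * yH lam mu m (sR q) k)))); last first.
      by apply: csum_ext => m; rewrite yH_zu //; apply: sR_r.
    rewrite -csum_scal; transitivity (csum (fun k => csum (fun m => c m * (zz (sR q) * (residue lam mu k * yH lam mu m (sR q) k))))).
      by apply: csum_ext => k; rewrite -!csum_scal; apply: csum_ext => m; ring.
    by rewrite csum_exchange; apply: csum_ext => m; rewrite -!csum_scal; apply: csum_ext => k; ring.
  apply: Clim_mult; first by apply: zz_lim; [exact: smid_strip | exact: sR_lim].
  by apply: Clim_csum => k; apply: Clim_scal.
have sW : summable (WF lam mu i) by apply/summable_S.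
have hV1 : Clim (fun q => Cexp (lam i * sL q) * PSc (WF lam mu i) (Cexp (sL q))) (Cexp (lam i * smid) * (- altsum (Scoef lam mu i))).
  apply: Clim_mult; first by apply: Clim_Cexp; apply: Clim_scal; exact: sL_lim.
  rewrite -PSc_sh_m1 // -(@PSc_ext (WF lam mu i)); last by case.
  exact: summable_abel.
have hV2 : Clim (fun q => csum (fun m => c m * (Cexp (mu m * sR q) * PSc (VH lam mu m) (Cexp (- sR q)))))
   (csum (fun m => c m * (Cexp (mu m * smid) * (- altsum (Tcoef lam mu m))))).
  apply: Clim_csum => m; apply: Clim_scal; apply: Clim_mult; first by apply: Clim_Cexp; apply: Clim_scal; exact: sR_lim.
  have sV : summable (VH lam mu m) by apply: summable_opp.
  have -> : - altsum (Tcoef lam mu m) = PSc (VH lam mu m) (- RtoC 1); last exact: summable_abel.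
  rewrite /altsum /PSc -Cser_opp; first by apply: Cser_ext => n; rewrite /VH; ring.
  by apply: (summable_le (b := fun n => Cmod (Tcoef lam mu m n))) (sT m) => n; rewrite Cmod_mult Cmod_pow_m1; lra.
have e1 := Clim_unique hU1 hV1; have e2 := Clim_unique hU2 hV2.
have -> : Cexp (lam i * smid) * altsum (Scoef lam mu i) = - U by rewrite e1; ring.
by rewrite e2 -csum_opp; apply: csum_ext => m; ring.
Qed.

(** ** The binomial series at -1 *)

Lemma good1 : good (RtoC 1).
Proof. move=> l; rewrite -RtoC_plus => /RtoC_inj; have := pos_INR l; lra. Qed.

(** Coefficients of (1 - w)^(-a); [poch 1 n] is n!. *)
Definition binc (a : C) (n : nat) : C := poch a n / poch 1 n.

Lemma bincS a n : RtoC (INR n + 1) * binc a n.+1 = (a + RtoC (INR n)) * binc a n.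
Proof.
rewrite /binc !pochS; have h := poch_ne0 (n := n) good1; have h' := @INR1_neq0 n.
have -> : RtoC 1 + RtoC (INR n) = RtoC (INR n + 1) by rewrite RtoC_plus; ring.
by field.
Qed.

Lemma binc_gb a : gb (binc a).
Proof.
have [A hA] := nat_above (Cmod a).
have [K [E [_ h]]] := @Scoef_bound 1 A (fun _ => RtoC 1) (fun _ => good1).
apply: (gb_poly (M := K) (E := E)) => n.
by have := h (fun _ => a) (fun _ => hA) n; rewrite /cprod !big_ord1.
Qed.

Lemma binc_ode a w : (Cmod w < 1)%R ->
  (1 - w) * PSc (fun n => RtoC (INR n.+1) * binc a n.+1) w = a * PSc (binc a) w.
Proof.
move=> hw; have g := binc_gb a.
have e : PSc (fun n => RtoC (INR n.+1) * binc a n.+1) w = a * PSc (binc a) w + w * PSc (fun n => RtoC (INR n.+1) * binc a n.+1) w.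
  rewrite (PSc_euler g hw) -(PSc_scal a g hw) -PSc_plus //; [|exact: gb_scal|exact: gb_mul_n].
  by apply: PSc_ext => n; rewrite S_INR bincS; ring.
set D := PSc _ _ in e *.
have -> : (1 - w) * D = D - w * D by ring.
rewrite {1}e; ring.
Qed.

(** On w = 1 - e^t the series should equal e^(-a t), and the product with e^(a t) has derivative 0
    by [binc_ode]. The range t < ln 2 keeps |w| < 1. *)
Lemma binc_exp a (t : R) : (0 <= t < ln 2)%R ->
  PSc (binc a) (1 - Cexp (RtoC t)) * Cexp (a * RtoC t) = 1.
Proof.
move=> ht; pose G (s : C) := PSc (binc a) (1 - Cexp s) * Cexp (a * s).
have e1 : G (RtoC 0) = 1.
  by rewrite /G Cexp_0 Cmult_0_r Cexp_0 Cmult_1_r (_ : 1 - 1 = RtoC 0) ?PSc_0 /binc ?poch0; [field | ring].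
rewrite -[RHS]e1 -/(G (RtoC t)); symmetry; apply: (Cder0_const (f := G)) => u hu.
have -> : RtoC 0 + RtoC u * (RtoC t - RtoC 0) = RtoC (u * t) by rewrite RtoC_mult; ring.
set s := (u * t)%R; have hs : (0 <= s < ln 2)%R by rewrite /s; nra.
have hw : (Cmod (1 - Cexp (RtoC s)) < 1)%R.
  rewrite Cexp_R -RtoC_minus Cmod_R.
  have h1 : (1 <= exp s)%R by have := exp_ineq1_le s; lra.
  have h2 : (exp s < 2)%R by rewrite -(exp_ln 2); [apply: exp_increasing; lra | lra].
  rewrite Rabs_left1; lra.
have d1 : Cder (fun s => 1 - Cexp s) (RtoC s) (- Cexp (RtoC s)).
  by apply: Cder_eq (Cder_plus (Cder_const 1 _) (Cder_opp (Cder_Cexp _))); ring.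
apply: Cder_eq (Cder_mult (Cder_comp d1 (Cder_PSc (binc_gb a) hw)) (Cder_lin_exp a (RtoC s))).
have := binc_ode a hw; set D := PSc (fun n => _) _; set P := PSc _ _ => e.
have -> : - Cexp (RtoC s) * D * Cexp (a * RtoC s) + P * (a * Cexp (a * RtoC s)) =
  (a * P - (1 - (1 - Cexp (RtoC s))) * D) * Cexp (a * RtoC s) by ring.
rewrite e; ring.
Qed.

(** Let t tend to ln 2, so that w tends to -1: by Abel's theorem a vanishing sum would make the
    series small, while its product with the bounded factor e^(a t) is always 1. *)
Lemma binc_altsum a : summable (binc a) -> altsum (binc a) <> RtoC 0.
Proof.
move=> hs e0.
pose t (q : nat) := ln (2 - / (INR q + 1))%R.
have hr q : (1 <= 2 - / (INR q + 1) < 2)%R.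
  have := inv_INR1_pos q; have : (/ (INR q + 1) <= / 1)%R by apply: Rinv_le_contravar; have := pos_INR q; lra.
  rewrite Rinv_1; lra.
have ht q : (0 <= t q < ln 2)%R.
  have [h1 h2] := hr q; split; last by apply: ln_increasing; lra.
  by rewrite -ln_1; apply: ln_le; lra.
have et q : Cexp (RtoC (t q)) = RtoC (2 - / (INR q + 1)).
  by rewrite Cexp_R exp_ln //; have := hr q; lra.
have l1 : Clim (fun q => 1 - Cexp (RtoC (t q))) (- RtoC 1).
  have e : RtoC (-1 + 0) = - RtoC 1 by rewrite -RtoC_opp; congr RtoC; ring.
  rewrite -e; apply: (Clim_ext (u := fun q => RtoC (-1 + / (INR q + 1)))).
    by move=> q; rewrite et -RtoC_minus; congr RtoC; ring.
  by apply: Clim_RtoC; apply: is_lim_seq_plus'; [exact: is_lim_seq_const | exact: inv_INR1_lim].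
have hb q : (Cmod (1 - Cexp (RtoC (t q))) <= 1)%R.
  rewrite et -RtoC_minus Cmod_R Rabs_left1; have := hr q; lra.
have l2 := summable_abel hs hb l1; rewrite -/(altsum (binc a)) e0 in l2.
have [B [B0 hB]] : exists B : R, (0 < B)%R /\ forall q, (Cmod (Cexp (a * RtoC (t q))) <= B)%R.
  exists (exp (Rabs (Re a) * ln 2)); split; first exact: exp_pos.
  move=> q; rewrite Cmod_Cexp re_scal_r.
  have le : (Re a * t q <= Rabs (Re a) * ln 2)%R.
    by have := ht q; have := Rle_abs (Re a); have := Rabs_pos (Re a); nra.
  by case: le => [/exp_increasing /Rlt_le|->] //; lra.
have [q0 hq] := is_lim_seq_epsE (Clim_Cmod l2) (eps := (/ (2 * B))%R) ltac:(apply: Rinv_0_lt_compat; lra).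
have {}hq := hq q0 (leqnn _); rewrite Cmod_0 Rminus_0_r Rabs_pos_eq in hq; last exact: Cmod_ge_0.
have := f_equal Cmod (binc_exp a (ht q0)); rewrite Cmod_mult Cmod_1 => e1.
have : (/ (2 * B) * B = / 2)%R by field; lra.
have := hB q0; have := Cmod_ge_0 (Cexp (a * RtoC (t q0))); have := Cmod_ge_0 (PSc (binc a) (1 - Cexp (RtoC (t q0)))).
have i0 : (0 < / (2 * B))%R by apply: Rinv_0_lt_compat; lra.
move: hq e1; move: (Cmod (PSc _ _)) (Cmod (Cexp _)) (/ (2 * B))%R i0 => p e ib i0; nra.
Qed.

(** ** Bounds that are uniform in the shift *)

Lemma th1_addn M n : (th1 (M + n)%N <= (INR n + 1) * th1 M)%R.
Proof.
rewrite /th1 -S_INR -mult_INR; apply: le_INR; apply/leP.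
rewrite geq_max; apply/andP; split; last by rewrite multE muln_gt0 /= leq_maxr.
rewrite multE mulSn; apply: leq_add; first exact: leq_maxl.
by apply: leq_pmulr; rewrite leq_maxr.
Qed.

Lemma th1_mono m n : (m <= n)%N -> (th1 m <= th1 n)%R.
Proof.
move=> h; apply: le_INR; apply/leP; rewrite geq_max leq_maxr andbT.
exact: leq_trans h (leq_maxl _ _).
Qed.

Lemma th2_bound M n : (1 <= th2 (M, n) <= INR n + 1)%R.
Proof.
rewrite /th2 /=; have p := th1_pos M; have h1 := th1_mono (leq_addr n M); have h2 := th1_addn M n.
split; apply: (Rmult_le_reg_r (th1 M)) => //; rewrite /Rdiv Rmult_assoc Rinv_l; lra.
Qed.

(** Negative powers of [th2] thereby yield decay in n at the price of a power of M, as needed for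
    h_m with m <> j. *)
Lemma th2_lower M n : ((INR n + 1) / (2 * (INR M + 1)) <= th2 (M, n))%R.
Proof.
rewrite /th2 /=; have p := th1_pos M; have M0 := pos_INR M; have n0 := pos_INR n.
have h1 := th1_mono (leq_addl M n); have h2 := th1_ge n; have h3 := th1_le M.
apply: (Rmult_le_reg_r (th1 M * (2 * (INR M + 1)))); first by apply: Rmult_lt_0_compat; lra.
have -> : ((INR n + 1) / (2 * (INR M + 1)) * (th1 M * (2 * (INR M + 1))) = (INR n + 1) * th1 M)%R by field; lra.
have -> : (th1 (M + n)%N / th1 M * (th1 M * (2 * (INR M + 1))) = (2 * th1 (M + n)%N) * (INR M + 1))%R by field; lra.
by apply: Rmult_le_compat; lra.
Qed.

Lemma th3_bound M n : (/ (INR n + 1) <= th3 (M, n) <= INR n + 1)%R.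
Proof.
have n0 := pos_INR n; have i1 : (0 < / (INR n + 1))%R by apply: Rinv_0_lt_compat; lra.
have p := th1_pos M; rewrite /th3 /=; case: leqP => h.
  have h1 := th1_mono (leq_subr n M); have h2 := th1_addn (M - n) n; rewrite subnK // in h2.
  split; apply: (Rmult_le_reg_r (th1 M)) => //; rewrite /Rdiv ?Rmult_assoc ?Rinv_l; try lra; last by nra.
  apply: (Rmult_le_reg_l (INR n + 1)); first lra.
  rewrite -Rmult_assoc Rinv_r; lra.
have h1 := th1_ge1 (n - M); have h2 : (th1 (n - M) <= INR n + 1)%R.
  by apply: Rle_trans (th1_mono (leq_subr M n)) (th1_le n).
have h3 : (th1 M <= INR n + 1)%R.
  by apply: Rle_trans (th1_mono (ltnW h)) (th1_le n).
have h4 := th1_ge1 M.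
split; apply: (Rmult_le_reg_r (th1 M)) => //; rewrite /Rdiv ?Rmult_assoc ?Rinv_l; try lra; last by nra.
apply: (Rmult_le_reg_l (INR n + 1)); first lra.
rewrite -Rmult_assoc Rinv_r; [nra | lra].
Qed.

Lemma Rpower_bound x y e : (1 <= y)%R -> (/ y <= x <= y)%R -> (Rpower x e <= Rpower y (Rabs e))%R.
Proof.
move=> hy [h1 h2]; have x0 : (0 < x)%R by apply: Rlt_le_trans h1; apply: Rinv_0_lt_compat; lra.
have l1 : (ln x <= ln y)%R by apply: ln_le; lra.
have l2 : (- ln y <= ln x)%R by rewrite -ln_Rinv; [apply: ln_le => //; apply: Rinv_0_lt_compat; lra | lra].
have l0 : (0 <= ln y)%R by rewrite -ln_1; apply: ln_le; lra.
have le : (e * ln x <= Rabs e * ln y)%R.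
  by rewrite /Rabs; case: Rcase_abs => he; nra.
by rewrite /Rpower; case: le => [/exp_increasing /Rlt_le|->] //; lra.
Qed.

Lemma Rpower_neg_mono x y e : (0 < x)%R -> (x <= y)%R -> (e <= 0)%R -> (Rpower y e <= Rpower x e)%R.
Proof.
move=> x0 xy e0; have l1 : (ln x <= ln y)%R by apply: ln_le.
have le : (e * ln y <= e * ln x)%R by nra.
by rewrite /Rpower; case: le => [/exp_increasing /Rlt_le|->] //; lra.
Qed.

Lemma th1_Rpower n e : (e <= 0)%R -> (Rpower (th1 n) e <= Rpower 2 (- e) * Rpower (INR n + 1) e)%R.
Proof.
move=> he; have h := th1_ge n; have n0 := pos_INR n.
apply: Rle_trans (@Rpower_neg_mono ((INR n + 1) / 2) (th1 n) e ltac:(lra) ltac:(lra) he) _.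
by rewrite -Rpower_div; [rewrite Rpower_Ropp /Rdiv Rmult_comm; lra | lra | lra].
Qed.

Lemma Rpower_telw n e : (e <= -2)%R -> (Rpower (INR n + 1) e <= 2 * telw n)%R.
Proof.
move=> he; have n0 := pos_INR n.
have h1 : (Rpower (INR n + 1) e <= Rpower (INR n + 1) (- INR 2))%R by apply: Rle_Rpower; rewrite /=; lra.
apply: Rle_trans h1 _; rewrite Rpower_Ropp Rpower_pow; last lra.
rewrite /telw; apply: (Rmult_le_reg_r ((INR n + 1) ^ 2 * (INR n + 2))); first by apply: Rmult_lt_0_compat; [apply: pow_lt|]; lra.
have -> : (/ (INR n + 1) ^ 2 * ((INR n + 1) ^ 2 * (INR n + 2)) = INR n + 2)%R by field; lra.
have -> : (2 * / ((INR n + 1) * (INR n + 2)) * ((INR n + 1) ^ 2 * (INR n + 2)) = 2 * (INR n + 1))%R by field; lra.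
lra.
Qed.

Lemma comparable_quot (T : Type) (om th : T -> R) (g h : T -> C) (e f : R) :
  (forall t, 0 < om t)%R -> (forall t, h t <> RtoC 0) ->
  comparable om th g e -> comparable om th h f ->
  exists K : R, (0 < K)%R /\ forall t, (Cmod (g t / h t) <= K * Rpower (th t) (e - f))%R.
Proof.
move=> o0 h0 [K [K0 hg]] [K' [K0' hh]]; exists (K * K')%R; split; first nra.
move=> t; have [_ h2] := hg t; have [h3 _] := hh t; have p0 := o0 t.
have hp : (0 < Cmod (h t))%R by apply/Cmod_gt_0.
rewrite Cmod_div // /Rminus Rpower_plus Rpower_Ropp.
move: (Rpower_pos (th t) e) (Rpower_pos (th t) f) (Cmod_ge_0 (g t)) h2 h3 hp.
move: (Rpower (th t) e) (Rpower (th t) f) (om t) p0 (Cmod (g t)) (Cmod (h t)) => r r' o o1 A B r0 r0' A0 h2 h3 B0.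
apply: (Rmult_le_reg_r (B * (o * r'))); first by apply: Rmult_lt_0_compat => //; nra.
have -> : (A / B * (B * (o * r')) = A * (o * r'))%R by field; lra.
have -> : (K * K' * (r * / r') * (B * (o * r')) = (K * (o * r)) * (K' * B))%R by field; lra.
by apply: Rmult_le_compat => //; nra.
Qed.

(** Both sums have N - 1 terms, so the constant cancels. *)
Lemma rsum_affine N (i j : 'I_N) (c s : R) (f g : 'I_N -> R) :
  (rsum_except j (fun m => c + s * f m) - rsum_except i (fun k => c + s * g k) =
   s * (rsum_except j f - rsum_except i g))%R.
Proof.
have h (r : seq 'I_N) (u : 'I_N -> R) : (\big[Rplus/0%R]_(k <- r) (c + s * u k) = INR (size r) * c + s * \big[Rplus/0%R]_(k <- r) u k)%R.
  elim: r => [|k r IH]; first by rewrite !big_nil /=; ring.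
  rewrite !big_cons IH -[size (k :: r)]/((size r).+1) S_INR; ring.
have hj := h [seq k <- index_enum 'I_N | k != j] f; have hi := h [seq k <- index_enum 'I_N | k != i] g.
rewrite !big_filter !size_except in hj hi; rewrite /rsum_except hj hi; move: (bigop _ _ _) (bigop _ _ _) => A B; ring.
Qed.

Lemma cprod_except_const N (i j : 'I_N) (c : C) : cprod_except i (fun _ => c) = cprod_except j (fun _ => c).
Proof.
have h (r : seq 'I_N) : \big[Cmult/RtoC 1]_(k <- r) c = Cpow c (size r).
  by elim: r => [|k r IH]; rewrite ?big_nil ?big_cons ?IH.
by rewrite /cprod_except -(big_filter _ (fun k => k != i)) -(big_filter _ (fun k => k != j)) !h !size_except.
Qed.

Lemma cprod_except_ratio N (i j : 'I_N) (F G : 'I_N -> C) (c : C) : c <> RtoC 0 ->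
  (forall k, k != i -> G k <> RtoC 0) ->
  cprod_except j (fun m => F m / c) / cprod_except i (fun k => G k / c) = cprod_except j F / cprod_except i G.
Proof.
move=> c0 hG.
have g0 : cprod_except i G <> RtoC 0 by apply: cprod_except_ne0.
have c0' : / c <> RtoC 0 by move=> e; have := Cinv_r _ c0; rewrite e Cmult_0_r => /esym /C1_nz.
have d0 : cprod_except i (fun _ => / c) <> RtoC 0 by apply: cprod_except_ne0.
rewrite /Cdiv !cprod_except_mult (cprod_except_const j i (/ c)); field; split=> //.
Qed.

Lemma Clim_affine (s a : C) : Clim (fun M => (a + s * RtoC (INR M)) / RtoC (INR M + 1)) s.
Proof.
have h : Clim (fun M => s + (a - s) * RtoC (/ (INR M + 1))) (s + (a - s) * RtoC 0).
  by apply: Clim_plus; [exact: Clim_const | apply: Clim_scal; apply: Clim_RtoC; exact: inv_INR1_lim].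
rewrite Cmult_0_r Cplus_0_r in h; apply: Clim_ext h => M.
rewrite RtoC_inv; last by have := pos_INR M; lra.
have h0 := @INR1_neq0 M; rewrite RtoC_plus in h0 *; by field.
Qed.

Lemma poch_shift_lim (s a : C) n :
  Clim (fun M => poch (a + s * RtoC (INR M)) n / Cpow (RtoC (INR M + 1)) n) (Cpow s n).
Proof.
elim: n => [|n IH].
  apply: (Clim_ext (u := fun _ => RtoC 1)); last exact: Clim_const.
  by move=> M; rewrite poch0 /=; field.
rewrite Cpow_S; apply: Clim_ext (Clim_mult (Clim_affine s (a + RtoC (INR n))) IH) => M.
rewrite pochS Cpow_S; have h := @INR1_neq0 M.
have h' : Cpow (RtoC (INR M + 1)) n <> RtoC 0 by apply: Cpow_nz.
by field.
Qed.

(** All factors are asymptotic to (s M)^n and there are N - 1 of them on each side. The sign [s]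
    covers the increasing parameters of f_i and the decreasing ones of h_j. *)
Lemma shift_ratio_lim N (i j : 'I_N) (s : C) (a b : 'I_N -> C) n : s <> RtoC 0 ->
  (forall k M, k != i -> poch (b k + s * RtoC (INR M)) n <> RtoC 0) ->
  Clim (fun M => cprod_except j (fun m => poch (a m + s * RtoC (INR M)) n)
     / cprod_except i (fun k => poch (b k + s * RtoC (INR M)) n)) 1.
Proof.
move=> s0 hb.
have c0 : Cpow s n <> RtoC 0 by apply: Cpow_nz.
have d0 : cprod_except i (fun _ : 'I_N => Cpow s n) <> RtoC 0 by apply: cprod_except_ne0.
have e : cprod_except j (fun _ : 'I_N => Cpow s n) / cprod_except i (fun _ : 'I_N => Cpow s n) = RtoC 1.
  by rewrite (cprod_except_const j i); field.
rewrite -[X in Clim _ X]e.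
apply: (Clim_ext (u := fun M => cprod_except j (fun m => poch (a m + s * RtoC (INR M)) n / Cpow (RtoC (INR M + 1)) n)
     / cprod_except i (fun k => poch (b k + s * RtoC (INR M)) n / Cpow (RtoC (INR M + 1)) n))).
  by move=> M; apply: cprod_except_ratio => [|k hk]; [apply: Cpow_nz; exact: INR1_neq0 | exact: hb].
by apply: Clim_div => //; apply: Clim_big_prod => k _; apply: poch_shift_lim.
Qed.

(** ** Simultaneous shifts of [lam i] and [mu j] *)

Lemma upd_upd N (f : 'I_N -> C) i a b : upd (upd f i a) i b = upd f i (a + b).
Proof. by apply: functional_extensionality => k; rewrite /upd; case: eqP => // _; ring. Qed.

Lemma upd0 N (f : 'I_N -> C) i : upd f i (RtoC 0) = f.
Proof. by apply: functional_extensionality => k; rewrite /upd; case: eqP => // _; ring. Qed.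

Lemma upd_INR_S N (f : 'I_N -> C) i M : upd f i (RtoC (INR M.+1)) = upd (upd f i (RtoC (INR M))) i 1.
Proof. by rewrite upd_upd S_INR RtoC_plus. Qed.

Lemma nr_updn N (f : 'I_N -> C) i M : nr f -> nr (upd f i (RtoC (INR M))).
Proof. by move=> h; elim: M => [|M IH]; rewrite ?upd0 // upd_INR_S; apply: nr_upd. Qed.

Lemma generic_updn N (lam mu : 'I_N -> C) i j M M' : generic lam mu ->
  generic (upd lam i (RtoC (INR M))) (upd mu j (RtoC (INR M'))).
Proof.
move=> h; have h1 : generic (upd lam i (RtoC (INR M))) mu.
  by elim: M => [|M IH]; rewrite ?upd0 // upd_INR_S; apply: generic_updl.
by elim: M' => [|M' IH]; rewrite ?upd0 // upd_INR_S; apply: generic_updm.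
Qed.

Lemma cprod_except_opp_ratio N (i j : 'I_N) (F G : 'I_N -> C) : (forall k, k != i -> G k <> RtoC 0) ->
  cprod_except j (fun m => - F m) / cprod_except i (fun k => - G k) = cprod_except j F / cprod_except i G.
Proof.
move=> hG; have m0 : - RtoC 1 <> RtoC 0 by rewrite -RtoC_opp; move/RtoC_inj; lra.
rewrite -(@cprod_except_ratio N i j F G (- RtoC 1)) //.
congr (_ / _); apply: cprod_except_ext => k _; field; exact: m0.
Qed.

(** Factors accumulated by M rounds of the two gauge transformations: [shiftR1] is common to all
    coefficients, [shiftRj] belongs to h_j and [shiftRm] to the other h_m. *)
Definition shiftR1 N (lam mu : 'I_N -> C) i j M : C :=
  cprod_except i (fun k => poch (lam i - lam k + 1) M) / cprod_except j (fun m => poch (lam i - mu m + 1) M).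
Definition shiftRj N (lam mu : 'I_N -> C) i j M : C :=
  cprod_except j (fun m => poch (mu j - mu m) M) / cprod_except i (fun k => poch (mu j - lam k) M).
Definition shiftRm N (lam mu : 'I_N -> C) i j m M : C :=
  poch (lam i - mu m + 1) M / poch (mu j - mu m + 1) M.
(* The connection coefficients after [lam i] and [mu j] have both been raised by [M]. *)
Definition shiftc N (lam mu : 'I_N -> C) i j (c : 'I_N -> C) M : 'I_N -> C := fun m =>
  c m * shiftR1 lam mu i j M * (if m == j then shiftRj lam mu i j M else shiftRm lam mu i j m M).

Lemma gen_num N (lam mu : 'I_N -> C) i m M : generic lam mu -> lam i - mu m + 1 + RtoC (INR M) <> RtoC 0.
Proof. by move=> h; have := proj1 (nonint_S (h i m)) M. Qed.

Lemma gen_opp N (lam mu : 'I_N -> C) k m : generic lam mu -> nonint (mu m - lam k).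
Proof. by move=> h; rewrite -Copp_minus_distr; apply: nonint_opp. Qed.

Lemma shiftR1_S N (lam mu : 'I_N -> C) i j M : generic lam mu ->
  shiftR1 lam mu i j M.+1 = shiftR1 lam mu i j M *
   (cprod_except i (fun k => lam i - lam k + 1 + RtoC (INR M)) / cprod_except j (fun m => lam i - mu m + 1 + RtoC (INR M))).
Proof.
move=> hg; rewrite /shiftR1 !cprod_except_pochS.
have h1 : cprod_except j (fun m => poch (lam i - mu m + 1) M) <> RtoC 0.
  by apply: cprod_except_ne0 => m _; apply: poch_ne0; apply: (proj1 (nonint_S (hg i m))).
have h2 : cprod_except j (fun m => lam i - mu m + 1 + RtoC (INR M)) <> RtoC 0.
  by apply: cprod_except_ne0 => m _; apply: gen_num.
by field.
Qed.

Lemma shiftRj_S N (lam mu : 'I_N -> C) i j M : generic lam mu ->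
  shiftRj lam mu i j M.+1 = shiftRj lam mu i j M *
   (cprod_except j (fun m => mu j - mu m + RtoC (INR M)) / cprod_except i (fun k => mu j - lam k + RtoC (INR M))).
Proof.
move=> hg; rewrite /shiftRj !cprod_except_pochS.
have h1 : cprod_except i (fun k => poch (mu j - lam k) M) <> RtoC 0.
  by apply: cprod_except_ne0 => m _; apply: poch_ne0; apply: (proj1 (gen_opp m j hg)).
have h2 : cprod_except i (fun k => mu j - lam k + RtoC (INR M)) <> RtoC 0.
  by apply: cprod_except_ne0 => m _; apply: (proj1 (gen_opp m j hg)).
by field.
Qed.

Lemma shiftRm_S N (lam mu : 'I_N -> C) i j m M : nr mu ->
  shiftRm lam mu i j m M.+1 = shiftRm lam mu i j m M *
    ((lam i - mu m + 1 + RtoC (INR M)) / (mu j - mu m + 1 + RtoC (INR M))).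
Proof.
move=> hm; rewrite /shiftRm !pochS.
have h := nr_good (i := j) (k := m) hm; have h1 := poch_ne0 (n := M) h; have h2 := h M.
by field.
Qed.

Lemma Conn_ext N (lam mu : 'I_N -> C) i c c' : (forall m, c m = c' m) -> Conn lam mu i c -> Conn lam mu i c'.
Proof. by move=> h; have -> : c' = c by apply: functional_extensionality => m; rewrite h. Qed.

Lemma Conn_shift N (lam mu : 'I_N -> C) i j c M : nr lam -> nr mu -> generic lam mu -> Conn lam mu i c ->
  Conn (upd lam i (RtoC (INR M))) (upd mu j (RtoC (INR M))) i (shiftc lam mu i j c M).
Proof.
move=> hl hm hg hc; elim: M => [|M IH].
  rewrite !upd0; apply: Conn_ext hc => m; rewrite /shiftc /shiftR1 /shiftRj /shiftRm !cprod_except_poch0 !poch0.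
  by rewrite Cdiv11; case: (m == j); ring.
have hlM := nr_updn i M hl; have hmM := nr_updn j M hm; have hgM := generic_updn i j M M hg.
(* Raising lam_i comes before raising mu_j, so [betaA] is taken at the raised lam_i. All factors
   lam_i - mu_j + 1, which do not depend on M, cancel. *)
have h1 := Conn_updl hlM hmM hgM IH.
have h2 := Conn_updm j (nr_upd i hlM) hmM (generic_updl i hgM) h1.
rewrite !upd_INR_S; apply: Conn_ext h2 => m.
set t := RtoC (INR M).
have er : residue (upd (upd lam i t) i 1) (upd mu j t) i =
   (lam i - mu j + 1) * cprod_except j (fun m => lam i - mu m + 1 + t) / cprod_except i (fun k => lam i - lam k + 1 + t).
  rewrite /residue (cprod_D1 j) !upd_at; congr (_ * _ / _).
  - ring.
  - by apply: cprod_except_ext => k hk; rewrite upd_ne //; ring.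
  - by apply: cprod_except_ext => k hk; rewrite !upd_ne //; ring.
have x0 : lam i - mu j + 1 <> RtoC 0 by apply: nonint_ne; apply: nonint_S.
have pA : cprod_except i (fun k => lam i - lam k + 1 + t) <> RtoC 0.
  by apply: cprod_except_ne0 => k _; apply: nr_good.
have pB : cprod_except j (fun m => lam i - mu m + 1 + t) <> RtoC 0.
  by apply: cprod_except_ne0 => k _; apply: gen_num.
rewrite er !upd_at /betaA /shiftc shiftR1_S //.
case: (eqVneq m j) => [->|mj].
  rewrite upd_at shiftRj_S // -/t.
  have -> : cprod (fun k => upd (upd lam i t) i 1 k - (mu j + t)) = (lam i - mu j + 1) * cprod_except i (fun k => - (mu j - lam k + t)).
    rewrite (cprod_D1 i) !upd_at; congr (_ * _); first ring.
    by apply: cprod_except_ext => k hk; rewrite !upd_ne //; ring.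
  have -> : cprod_except j (fun m' => upd mu j t m' - (mu j + t)) = cprod_except j (fun m => - (mu j - mu m + t)).
    by apply: cprod_except_ext => k hk; rewrite upd_ne //; ring.
  have n1 k : k != i -> mu j - lam k + t <> RtoC 0 by move=> _; apply: (proj1 (gen_opp k j hg)).
  rewrite -(@cprod_except_opp_ratio N i j (fun m => mu j - mu m + t) _ n1).
  have p1 : cprod_except i (fun k => - (mu j - lam k + t)) <> RtoC 0.
    by apply: cprod_except_ne0 => k /n1 h e; apply: h; rewrite -Copp_0 -e; ring.
  have p2 : cprod_except j (fun m => - (mu j - mu m + t)) <> RtoC 0.
    apply: cprod_except_ne0 => k /eqP kj e; apply: (proj1 (nr_nonint hm (not_eq_sym kj)) M).
    have -> : mu j - mu k + RtoC (INR M) = - - (mu j - mu k + t) by rewrite /t; ring.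
    by rewrite e Copp_0.
  move: p1 p2 pA pB x0.
  move: (cprod_except i (fun k => - (mu j - lam k + t))) (cprod_except j (fun m => - (mu j - mu m + t))) => p q.
  move: (cprod_except i (fun k => lam i - lam k + 1 + t)) (cprod_except j (fun m => lam i - mu m + 1 + t)) => A B p0 q0 A0 B0 x0.
  move: (shiftR1 _ _ _ _ _) (shiftRj _ _ _ _ _) => r r'; clear -p0 q0 A0 B0 x0.
  have -> : mu j + t - (lam i + t) - 1 = - (lam i - mu j + 1) by ring.
  have -> : lam i + t + 1 - (mu j + t) = lam i - mu j + 1 by ring.
  by move: (lam i - mu j + 1) x0 => x x0; field; repeat split.
rewrite (upd_ne _ _ mj) shiftRm_S // -/t.
have q1 : mu j - mu m + 1 + t <> RtoC 0 by apply: nr_good.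
have q2 : mu m - (mu j + t) - 1 <> RtoC 0 by move=> e; apply: q1; rewrite -Copp_0 -e; ring.
rewrite upd_at.
have -> : mu m - (lam i + t) - 1 = - (lam i - mu m + 1 + t) by ring.
have -> : lam i + t + 1 - (mu j + t) = lam i - mu j + 1 by ring.
have -> : mu m - (mu j + t) - 1 = - (mu j - mu m + 1 + t) by ring.
by field; repeat split.
Qed.

(** The simultaneous shift leaves lam_i - mu_j unchanged: the numerator factor of index j over the
    denominator factor of index i is the binomial coefficient, and M enters only the other
    factors. *)
Lemma Scoef_shift N (lam mu : 'I_N -> C) i j M n : nr lam ->
  Scoef (upd lam i (RtoC (INR M))) (upd mu j (RtoC (INR M))) i n = binc (lam i - mu j + 1) n *
   (cprod_except j (fun m => poch (lam i - mu m + 1 + RtoC (INR M)) n) / cprod_except i (fun k => poch (lam i - lam k + 1 + RtoC (INR M)) n)).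
Proof.
move=> hl; set t := RtoC (INR M).
have h1 := poch_ne0 (n := n) good1.
have h2 : cprod_except i (fun k => poch (lam i - lam k + 1 + t) n) <> RtoC 0.
  by apply: cprod_except_ne0 => k _; apply: poch_ne0; apply: good_nat; apply: nr_good.
rewrite /Scoef (cprod_D1 j) (cprod_D1 i (fun k => poch _ n)) !upd_at.
have -> : lam i + t - (mu j + t) + 1 = lam i - mu j + 1 by ring.
have -> : lam i + t - (lam i + t) + 1 = RtoC 1 by ring.
rewrite (cprod_except_ext (i := j) (G := fun m => poch (lam i - mu m + 1 + t) n)); last first.
  by move=> m mj; rewrite upd_ne //; congr poch; ring.
rewrite [cprod_except i _](cprod_except_ext (G := fun k => poch (lam i - lam k + 1 + t) n)); last first.
  by move=> m mj; rewrite upd_ne //; congr poch; ring.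
by rewrite /binc; field.
Qed.

Lemma Tcoef_shift_at N (lam mu : 'I_N -> C) i j M n : nr mu ->
  Tcoef (upd lam i (RtoC (INR M))) (upd mu j (RtoC (INR M))) j n = binc (lam i - mu j + 1) n *
   (cprod_except i (fun k => poch (lam k - mu j + 1 - RtoC (INR M)) n) / cprod_except j (fun m => poch (mu m - mu j + 1 - RtoC (INR M)) n)).
Proof.
move=> hm; set t := RtoC (INR M).
have h1 := poch_ne0 (n := n) good1.
have hmM := nr_updn j M hm.
have e2 : cprod_except j (fun m => poch (upd mu j t m - (mu j + t) + 1) n) = cprod_except j (fun m => poch (mu m - mu j + 1 - t) n).
  by apply: cprod_except_ext => m mj; rewrite upd_ne //; congr poch; ring.
have h2 : cprod_except j (fun m => poch (mu m - mu j + 1 - t) n) <> RtoC 0.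
  rewrite -e2 -(upd_at mu j t); apply: cprod_except_ne0 => k _; apply: poch_ne0; apply: (nr_good hmM).
rewrite /Tcoef (cprod_D1 i) (cprod_D1 j (fun k => poch (upd mu j t k - _ + 1) n)) !upd_at e2.
have -> : lam i + t - (mu j + t) + 1 = lam i - mu j + 1 by ring.
have -> : mu j + t - (mu j + t) + 1 = RtoC 1 by ring.
rewrite (cprod_except_ext (i := i) (G := fun k => poch (lam k - mu j + 1 - t) n)); last first.
  by move=> m mj; rewrite upd_ne //; congr poch; ring.
by rewrite /binc; field.
Qed.

Lemma Tcoef_shift_ne N (lam mu : 'I_N -> C) i j m M n : nr mu -> m != j ->
  Tcoef (upd lam i (RtoC (INR M))) (upd mu j (RtoC (INR M))) m n =
   poch (lam i - mu m + 1 + RtoC (INR M)) n / poch (mu j - mu m + 1 + RtoC (INR M)) n *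
   (cprod_except i (fun k => poch (lam k - mu m + 1) n) / cprod_except j (fun l => poch (mu l - mu m + 1) n)).
Proof.
move=> hm mj; set t := RtoC (INR M).
have h1 : poch (mu j - mu m + 1 + t) n <> RtoC 0 by apply: poch_ne0; apply: good_nat; apply: nr_good.
have h2 : cprod_except j (fun l => poch (mu l - mu m + 1) n) <> RtoC 0.
  by apply: cprod_except_ne0 => k _; apply: poch_ne0; apply: nr_good.
rewrite /Tcoef (upd_ne _ _ mj) (cprod_D1 i) (cprod_D1 j (fun k => poch (upd mu j t k - _ + 1) n)) !upd_at.
have -> : lam i + t - mu m + 1 = lam i - mu m + 1 + t by ring.
have -> : mu j + t - mu m + 1 = mu j - mu m + 1 + t by ring.
rewrite (cprod_except_ext (i := i) (G := fun k => poch (lam k - mu m + 1) n)); last by move=> l li; rewrite upd_ne.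
rewrite [cprod_except j _](cprod_except_ext (G := fun k => poch (mu k - mu m + 1) n)); last by move=> l li; rewrite upd_ne.
by field.
Qed.

(* Together with [Re (lam i - mu j)] this governs the growth in [n] and [M] of the shifted coefficients. *)
Definition exponent_balance N (lam mu : 'I_N -> C) (i j : 'I_N) : R :=
  (rsum_except j (fun m => Re (mu m)) - rsum_except i (fun k => Re (lam k)))%R.

Lemma om2_pos t : (0 < om2 t)%R.
Proof. by apply: Rdiv_lt_0_compat; apply: om1_pos. Qed.
Lemma th2_pos t : (0 < th2 t)%R.
Proof. by apply: Rdiv_lt_0_compat; apply: th1_pos. Qed.
Lemma th3_pos t : (0 < th3 t)%R.
Proof. by rewrite /th3; case: ifP => _; apply: Rdiv_lt_0_compat; apply: th1_pos. Qed.
Lemma om3_pos t : (0 < om3 t)%R.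
Proof.
have a := om1_pos; have b := th1_pos; rewrite /om3; case: ifP => _.
  by apply: Rdiv_lt_0_compat; apply: Rmult_lt_0_compat.
by apply: Rmult_lt_0_compat => //; apply: Rmult_lt_0_compat.
Qed.

Lemma binc_bound a : good a -> exists K : R, (0 < K)%R /\ forall n,
  (Cmod (binc a n) <= K * Rpower (th1 n) (Re a - 1))%R.
Proof.
move=> ga; have [K [K0 h]] := comparable_quot om1_pos (fun n => poch_ne0 (n := n) good1) (poch_comparable ga) (poch_comparable good1).
by exists K; split=> // n; have := h n; rewrite re_RtoC.
Qed.

Lemma telw_combine (K K' x e : R) (n : nat) (A B : R) : (0 < K)%R -> (0 < K')%R -> (x <= 0)%R -> (0 <= A)%R -> (0 <= B)%R ->
  (A <= K * Rpower (th1 n) x)%R -> (B <= K' * Rpower (INR n + 1) e)%R -> (x + e <= -2)%R ->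
  (A * B <= (2 * (K * K' * Rpower 2 (- x))) * telw n)%R.
Proof.
move=> K0 K0' x0 A0 B0 hA hB hxe.
have h1 := th1_Rpower n x0; have h2 := @Rpower_telw n _ hxe; rewrite Rpower_plus in h2.
have p1 := Rpower_pos (th1 n) x; have p2 := Rpower_pos (INR n + 1) e; have p3 := Rpower_pos 2 (- x); have p4 := Rpower_pos (INR n + 1) x.
apply: (Rle_trans _ ((K * Rpower (th1 n) x) * (K' * Rpower (INR n + 1) e))); first by apply: Rmult_le_compat.
apply: (Rle_trans _ ((K * (Rpower 2 (- x) * Rpower (INR n + 1) x)) * (K' * Rpower (INR n + 1) e))).
  apply: Rmult_le_compat_r; first nra.
  by apply: Rmult_le_compat_l; lra.
have -> : (K * (Rpower 2 (- x) * Rpower (INR n + 1) x) * (K' * Rpower (INR n + 1) e) =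
  (K * K' * Rpower 2 (- x)) * (Rpower (INR n + 1) x * Rpower (INR n + 1) e))%R by ring.
have -> : (2 * (K * K' * Rpower 2 (- x)) * telw n = (K * K' * Rpower 2 (- x)) * (2 * telw n))%R by ring.
apply: Rmult_le_compat_l => //; apply: Rmult_le_pos; [nra | lra].
Qed.

(** The binomial coefficient decays like n^(Re (lam_i - mu_j)), and the remaining quotient is at
    most a constant times (n + 1)^|Y| with Y the exponent balance, uniformly in M because [th2] lies
    between 1 and n + 1. The total exponent is at most -2. *)
Lemma Scoef_shift_bound N (lam mu : 'I_N -> C) i j : nr lam -> generic lam mu ->
  (Re (lam i - mu j)%C <= - (2 * Rabs (exponent_balance lam mu i j) + 3))%R ->
  exists K : R, forall M n, (Cmod (Scoef (upd lam i (RtoC (INR M))) (upd mu j (RtoC (INR M))) i n) <= K * telw n)%R.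
Proof.
move=> hl hg hx; have Y0 := Rabs_pos (exponent_balance lam mu i j).
have [K [K0 h1]] := binc_bound (proj1 (nonint_S (hg i j))).
have [K' [K0' h2]] := @comparable_ratio _ N i j om2 th2 (fun m t => poch (lam i - mu m + 1 + RtoC (INR t.1)) t.2)
  (fun k t => poch (lam i - lam k + 1 + RtoC (INR t.1)) t.2) (fun m => Re (lam i - mu m + 1)) (fun k => Re (lam i - lam k + 1))
  om2_pos th2_pos (fun m _ => poch_comparable2 (proj1 (nonint_S (hg i m)))) (fun k _ => poch_comparable2 (nr_good hl))
  (fun k t _ => poch_ne0 (good_nat (nr_good hl))).
exists (2 * (K * K' * Rpower 2 (- Re (lam i - mu j)%C)))%R => M n.
rewrite Scoef_shift // Cmod_mult; apply: (@telw_combine _ _ _ (Rabs (exponent_balance lam mu i j))) => //; try exact: Cmod_ge_0; try lra.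
  by have := h1 n; rewrite re_plus re_RtoC; have -> : (Re (lam i - mu j)%C + 1 - 1 = Re (lam i - mu j)%C)%R by ring.
apply: Rle_trans (h2 (M, n)) _; apply: Rmult_le_compat_l; first lra.
have -> : (rsum_except j (fun m => Re (lam i - mu m + 1)) - rsum_except i (fun k => Re (lam i - lam k + 1)) = -1 * exponent_balance lam mu i j)%R.
  rewrite /exponent_balance -(rsum_affine i j (Re (lam i) + 1)%R); congr (_ - _)%R; apply: eq_bigr => k _; rewrite re_plus re_minus re_RtoC; ring.
have [b1 b2] := th2_bound M n; have n0 := pos_INR n.
have -> : Rabs (exponent_balance lam mu i j) = Rabs (-1 * exponent_balance lam mu i j) by rewrite -(Rabs_Ropp (exponent_balance _ _ _ _)); congr Rabs; ring.
apply: Rpower_bound; first lra.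
by split=> //; apply: Rle_trans b1; rewrite -Rinv_1; apply: Rinv_le_contravar; lra.
Qed.

(** As for [Scoef], but the parameters now move downwards: [th3] lies between 1 / (n + 1) and n + 1,
    so the sign of its exponent is immaterial. *)
Lemma Tcoef_shift_at_bound N (lam mu : 'I_N -> C) i j : nr mu -> generic lam mu ->
  (Re (lam i - mu j)%C <= - (2 * Rabs (exponent_balance lam mu i j) + 3))%R ->
  exists K : R, forall M n, (Cmod (Tcoef (upd lam i (RtoC (INR M))) (upd mu j (RtoC (INR M))) j n) <= K * telw n)%R.
Proof.
move=> hm hg hx; have Y0 := Rabs_pos (exponent_balance lam mu i j).
have [K [K0 h1]] := binc_bound (proj1 (nonint_S (hg i j))).
have hni m : m != j -> nonint (mu m - mu j + 1) by move=> /eqP mj; apply: nonint_S; apply: nr_nonint.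
have hne k (t : nat * nat) : k != j -> poch (mu k - mu j + 1 - RtoC (INR t.1)) t.2 <> RtoC 0.
  move=> /hni h; apply: poch_ne0.
  have -> : mu k - mu j + 1 - RtoC (INR t.1) = - (- (mu k - mu j + 1) + RtoC (INR t.1)) by ring.
  by apply: (proj1 (nonint_opp (nonint_nat t.1 (nonint_opp h)))).
have [K' [K0' h2]] := @comparable_ratio _ N j i om3 th3 (fun k t => poch (lam k - mu j + 1 - RtoC (INR t.1)) t.2)
  (fun m t => poch (mu m - mu j + 1 - RtoC (INR t.1)) t.2) (fun k => Re (lam k - mu j + 1)) (fun m => Re (mu m - mu j + 1))
  om3_pos th3_pos (fun k _ => poch_comparable3 (nonint_S (hg k j))) (fun m mj => poch_comparable3 (hni m mj)) hne.
exists (2 * (K * K' * Rpower 2 (- Re (lam i - mu j)%C)))%R => M n.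
rewrite Tcoef_shift_at // Cmod_mult; apply: (@telw_combine _ _ _ (Rabs (exponent_balance lam mu i j))) => //; try exact: Cmod_ge_0; try lra.
  by have := h1 n; rewrite re_plus re_RtoC; have -> : (Re (lam i - mu j)%C + 1 - 1 = Re (lam i - mu j)%C)%R by ring.
apply: Rle_trans (h2 (M, n)) _; apply: Rmult_le_compat_l; first lra.
have -> : (rsum_except i (fun k => Re (lam k - mu j + 1)) - rsum_except j (fun m => Re (mu m - mu j + 1)) = - exponent_balance lam mu i j)%R.
  have -> : (- exponent_balance lam mu i j = 1 * (rsum_except i (fun k => Re (lam k)) - rsum_except j (fun m => Re (mu m))))%R by rewrite /exponent_balance; ring.
  rewrite -(rsum_affine j i (- Re (mu j) + 1)%R); congr (_ - _)%R; apply: eq_bigr => k _; rewrite re_plus re_minus re_RtoC; ring.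
have [b1 b2] := th3_bound M n; have n0 := pos_INR n.
rewrite -(Rabs_Ropp (exponent_balance _ _ _ _)); apply: Rpower_bound; [lra | by split].
Qed.

(** With F = |Y| + 2, the factor depending on M is at most a constant times th2^(-F), hence times (M
    + 1)^F (n + 1)^(-F), and the other quotient grows at most like (n + 1)^|Y|. This leaves exponent
    -2 in n; the power of M is beaten later by [shiftc]. *)
Lemma Tcoef_shift_ne_bound N (lam mu : 'I_N -> C) i j m : nr mu -> generic lam mu -> m != j ->
  (Re (lam i - mu j)%C <= - (2 * Rabs (exponent_balance lam mu i j) + 3))%R ->
  exists K : R, (0 < K)%R /\ forall M n, (Cmod (Tcoef (upd lam i (RtoC (INR M))) (upd mu j (RtoC (INR M))) m n)
     <= K * Rpower (INR M + 1) (Rabs (exponent_balance lam mu i j) + 2) * telw n)%R.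
Proof.
move=> hm hg mj hx; have Y0 := Rabs_pos (exponent_balance lam mu i j); set Y := exponent_balance lam mu i j in hx Y0 *.
have [K [K0 h1]] := comparable_quot om2_pos (fun t => poch_ne0 (n := t.2) (good_nat (n := t.1) (nr_good (i := j) (k := m) hm)))
   (poch_comparable2 (proj1 (nonint_S (hg i m)))) (poch_comparable2 (nr_good hm)).
have [K' [K0' h2]] := @comparable_ratio _ N j i om1 th1 (fun k n => poch (lam k - mu m + 1) n)
  (fun l n => poch (mu l - mu m + 1) n) (fun k => Re (lam k - mu m + 1)) (fun l => Re (mu l - mu m + 1))
  om1_pos th1_pos (fun k _ => poch_comparable (proj1 (nonint_S (hg k m)))) (fun l _ => poch_comparable (nr_good hm))
  (fun l n _ => poch_ne0 (nr_good hm)).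
set F := (Rabs Y + 2)%R.
exists (2 * (K * K' * Rpower 2 F))%R; split.
  by have := Rpower_pos 2 F; have := Rmult_lt_0_compat _ _ K0 K0'; nra.
move=> M n; rewrite Tcoef_shift_ne // Cmod_mult.
have M0 := pos_INR M; have n0 := pos_INR n.
have [b1 b2] := th2_bound M n; have b3 := th2_lower M n.
have q1 : (Cmod (poch (lam i - mu m + 1 + RtoC (INR M)) n / poch (mu j - mu m + 1 + RtoC (INR M)) n) <=
   K * (Rpower 2 F * Rpower (INR M + 1) F * Rpower (INR n + 1) (- F)))%R.
  apply: Rle_trans (h1 (M, n)) _; apply: Rmult_le_compat_l; first lra.
  have -> : (Re (lam i - mu m + 1)%C - Re (mu j - mu m + 1)%C = Re (lam i - mu j)%C)%R.
    by rewrite (re_plus (lam i - mu m)) (re_plus (mu j - mu m)) !re_minus; ring.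
  apply: (Rle_trans _ (Rpower (th2 (M, n)) (- F))).
    case: (Req_dec (th2 (M, n)) 1) => [->|ne]; first by rewrite /Rpower ln_1 !Rmult_0_r; lra.
    by apply: Rle_Rpower; [lra | rewrite /F; lra].
  apply: Rle_trans (@Rpower_neg_mono ((INR n + 1) / (2 * (INR M + 1))) (th2 (M, n)) (- F) _ b3 _) _.
  - by apply: Rdiv_lt_0_compat; lra.
  - by rewrite /F; lra.
  rewrite -Rpower_div; [|lra|lra].
  rewrite -(@Rpower_mult_distr 2 (INR M + 1) (- F)); [|lra|lra].
  rewrite !Rpower_Ropp; move: (Rpower_pos 2 F) (Rpower_pos (INR M + 1) F) (Rpower_pos (INR n + 1) F).
  move: (Rpower 2 F) (Rpower (INR M + 1) F) (Rpower (INR n + 1) F) => a b c a0 b0 c0.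
  by apply: Req_le; field; lra.
have q2 : (Cmod (cprod_except i (fun k => poch (lam k - mu m + 1) n) / cprod_except j (fun l => poch (mu l - mu m + 1) n))
   <= K' * Rpower (INR n + 1) (Rabs Y))%R.
  apply: Rle_trans (h2 n) _; apply: Rmult_le_compat_l; first lra.
  have -> : (rsum_except i (fun k => Re (lam k - mu m + 1)) - rsum_except j (fun l => Re (mu l - mu m + 1)) = - Y)%R.
    have -> : (- Y = 1 * (rsum_except i (fun k => Re (lam k)) - rsum_except j (fun m => Re (mu m))))%R by rewrite /Y /exponent_balance; ring.
    rewrite -(rsum_affine j i (- Re (mu m) + 1)%R); congr (_ - _)%R; apply: eq_bigr => k _; rewrite re_plus re_minus re_RtoC; ring.
  have t1 := th1_ge1 n; have t2 := th1_le n.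
  rewrite -(Rabs_Ropp Y); apply: Rpower_bound; first lra.
  by split=> //; apply: Rle_trans t1; rewrite -Rinv_1; apply: Rinv_le_contravar; lra.
have q3 := @Rpower_telw n (- F + Rabs Y) ltac:(rewrite /F; lra); rewrite Rpower_plus in q3.
apply: Rle_trans (Rmult_le_compat _ _ _ _ (Cmod_ge_0 _) (Cmod_ge_0 _) q1 q2) _.
move: (Rpower_pos 2 F) (Rpower_pos (INR M + 1) F) q3.
move: (Rpower 2 F) (Rpower (INR M + 1) F) (Rpower (INR n + 1) (- F)) (Rpower (INR n + 1) (Rabs Y)) => a b c d a0 b0 q3.
have -> : (K * (a * b * c) * (K' * d) = (K * K' * a * b) * (c * d))%R by ring.
have -> : (2 * (K * K' * a) * b * telw n = (K * K' * a * b) * (2 * telw n))%R by ring.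
by apply: Rmult_le_compat_l => //; repeat apply: Rmult_le_pos; lra.
Qed.

(** [shiftR1] contributes the exponent Y and [shiftRm] the exponent Re (lam_i - mu_j). *)
Lemma shiftc_ne_bound N (lam mu : 'I_N -> C) i j c m : nr lam -> nr mu -> generic lam mu -> m != j ->
  (Re (lam i - mu j)%C <= - (2 * Rabs (exponent_balance lam mu i j) + 3))%R ->
  exists K : R, forall M, (Cmod (shiftc lam mu i j c M m)
     <= K * Rpower (INR M + 1) (Re (lam i - mu j)%C + exponent_balance lam mu i j))%R.
Proof.
move=> hl hm hg mj hx; set Y := exponent_balance lam mu i j in hx *; have Y1 := Rle_abs Y; have Y0 := Rabs_pos Y.
have [K [K0 h1]] := comparable_quot om1_pos (fun n => poch_ne0 (n := n) (nr_good (i := j) (k := m) hm))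
   (poch_comparable (proj1 (nonint_S (hg i m)))) (poch_comparable (nr_good hm)).
have [K' [K0' h2]] := @comparable_ratio _ N j i om1 th1 (fun k n => poch (lam i - lam k + 1) n)
  (fun l n => poch (lam i - mu l + 1) n) (fun k => Re (lam i - lam k + 1)) (fun l => Re (lam i - mu l + 1))
  om1_pos th1_pos (fun k _ => poch_comparable (nr_good hl)) (fun l _ => poch_comparable (proj1 (nonint_S (hg i l))))
  (fun l n _ => poch_ne0 (proj1 (nonint_S (hg i l)))).
exists (Cmod (c m) * K' * K * Rpower 2 (- (Re (lam i - mu j)%C + Y)))%R => M.
rewrite /shiftc (negbTE mj) Cmod_mult (Cmod_mult (c m)).
have q1 := h1 M; have q2 := h2 M.
have e1 : (Re (lam i - mu m + 1)%C - Re (mu j - mu m + 1)%C = Re (lam i - mu j)%C)%R.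
  by rewrite (re_plus (lam i - mu m)) (re_plus (mu j - mu m)) !re_minus; ring.
have e2 : (rsum_except i (fun k => Re (lam i - lam k + 1)) - rsum_except j (fun l => Re (lam i - mu l + 1)) = Y)%R.
  have -> : (Y = -1 * (rsum_except i (fun k => Re (lam k)) - rsum_except j (fun m => Re (mu m))))%R by rewrite /Y /exponent_balance; ring.
  rewrite -(rsum_affine j i (Re (lam i) + 1)%R); congr (_ - _)%R; apply: eq_bigr => k _; rewrite re_plus re_minus re_RtoC; ring.
rewrite e1 in q1; rewrite e2 in q2.
have q3 := @th1_Rpower M (Re (lam i - mu j)%C + Y) ltac:(lra); rewrite [Rpower (th1 M) _]Rpower_plus in q3.
have c0 := Cmod_ge_0 (c m); have p1 := Rpower_pos (th1 M) (Re (lam i - mu j)); have p2 := Rpower_pos (th1 M) Y.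
apply: (Rle_trans _ (Cmod (c m) * (K' * Rpower (th1 M) Y) * (K * Rpower (th1 M) (Re (lam i - mu j)))))%R.
  apply: Rmult_le_compat => //; [by apply: Rmult_le_pos => //; exact: Cmod_ge_0 | exact: Cmod_ge_0 | by apply: Rmult_le_compat_l].
have -> : (Cmod (c m) * (K' * Rpower (th1 M) Y) * (K * Rpower (th1 M) (Re (lam i - mu j)%C)) =
  (Cmod (c m) * K' * K) * (Rpower (th1 M) (Re (lam i - mu j)%C) * Rpower (th1 M) Y))%R by ring.
rewrite (Rmult_assoc (Cmod (c m) * K' * K)); apply: Rmult_le_compat_l => //; repeat apply: Rmult_le_pos; lra.
Qed.

(** ** The connection coefficients for generic parameters *)

Lemma tannery_altsum (c : nat -> nat -> C) (l : nat -> C) (b : nat -> R) : ex_series b ->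
  (forall q n, (Cmod (c q n) <= b n)%R) -> (forall n, Clim (fun q => c q n) (l n)) ->
  summable l /\ Clim (fun q => altsum (c q)) (altsum l).
Proof.
move=> hb h1 h2; split; first exact: (proj1 (@tannery c l b 0%N hb (fun q n _ => h1 q n) h2)).
apply: (proj2 (@tannery (fun q n => c q n * Cpow (- RtoC 1) n) (fun n => l n * Cpow (- RtoC 1) n) b 0%N hb _ _)).
  by move=> q n _; rewrite Cmod_mult Cmod_pow_m1 Rmult_1_r.
by move=> n; apply: Clim_mult => //; apply: Clim_const.
Qed.

Lemma altsum_bound (c : nat -> C) (K : R) : (forall n, (Cmod (c n) <= K * telw n)%R) ->
  (Cmod (altsum c) <= K * Series telw)%R.
Proof.
move=> h; have e n : Cmod (c n * Cpow (- RtoC 1) n) = Cmod (c n) by rewrite Cmod_mult Cmod_pow_m1 Rmult_1_r.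
have hs : ex_series (fun n => K * telw n)%R by apply: (ex_series_scal_l K); exact: telw_series.
have hc : summable (fun n => c n * Cpow (- RtoC 1) n).
  by apply: (summable_le (b := fun n => K * telw n)%R) => // n; rewrite e.
apply: Rle_trans (Cmod_Cser hc) _.
rewrite -(Series_scal_l K); apply: Series_le => // n; rewrite e; split=> //; exact: Cmod_ge_0.
Qed.

Lemma cprod_except_div N (i : 'I_N) (F G : 'I_N -> C) : (forall k, k != i -> G k <> RtoC 0) ->
  cprod_except i (fun k => F k / G k) = cprod_except i F / cprod_except i G.
Proof.
move=> hG; have g0 := cprod_except_ne0 hG.
have -> : cprod_except i F = cprod_except i (fun k => F k / G k) * cprod_except i G.
  by rewrite -cprod_except_mult; apply: cprod_except_ext => k /hG h; field.
by field.
Qed.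

Lemma cprod_except_1 N (i : 'I_N) : cprod_except i (fun _ : 'I_N => RtoC 1) = RtoC 1.
Proof. by rewrite /cprod_except big1. Qed.

Lemma poch_ratio_gs a b n : good b ->
  poch a n.+1 / poch b n.+1 = gs a n / gs b n * Cexp ((a - b) * RtoC (ln (INR n + 1))).
Proof.
move=> hb; rewrite /gs; have h1 := poch_ne0 (n := n.+1) hb; have h2 := @fact_ne0 n.
have -> : (a - b) * RtoC (ln (INR n + 1)) = a * RtoC (ln (INR n + 1)) - b * RtoC (ln (INR n + 1)) by ring.
rewrite Cexp_minus.
have h3 := @Cexp_ne0 (a * RtoC (ln (INR n + 1))); have h4 := @Cexp_ne0 (b * RtoC (ln (INR n + 1))).
by field.
Qed.

Definition gamma_quot N (lam mu : 'I_N -> C) i j : C :=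
  cprod_except i (fun k => rGamma (lam i - lam k + 1) / rGamma (mu j - lam k)) *
  cprod_except j (fun m => rGamma (mu j - mu m) / rGamma (lam i - mu m + 1)).

(** Gauss' formula for each quotient of Pochhammer products. The powers of M + 1 have exponents x
    and -x with x = lam_i - mu_j + 1, N - 1 times each, and cancel. *)
Lemma shift_gamma_lim N (lam mu : 'I_N -> C) i j : generic lam mu ->
  Clim (fun M => shiftR1 lam mu i j M * shiftRj lam mu i j M) (gamma_quot lam mu i j).
Proof.
move=> hg; apply: Clim_incr_1'.
have g1 m : good (lam i - mu m + 1) by apply: (proj1 (nonint_S (hg i m))).
have g2 k : good (mu j - lam k) by apply: (proj1 (gen_opp k j hg)).
have h : Clim (fun M => cprod_except i (fun k => gs (lam i - lam k + 1) M / gs (mu j - lam k) M) *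
  cprod_except j (fun m => gs (mu j - mu m) M / gs (lam i - mu m + 1) M)) (gamma_quot lam mu i j).
  apply: Clim_mult; apply: Clim_big_prod => k _; apply: Clim_div; try exact: gs_cv; exact: rGamma_ne0.
apply: Clim_ext h => M; set L := RtoC (ln (INR M + 1)); set x := lam i - mu j + 1.
have -> : shiftR1 lam mu i j M.+1 * shiftRj lam mu i j M.+1 =
  cprod_except i (fun k => poch (lam i - lam k + 1) M.+1 / poch (mu j - lam k) M.+1) *
  cprod_except j (fun m => poch (mu j - mu m) M.+1 / poch (lam i - mu m + 1) M.+1).
  rewrite !cprod_except_div => [||k _]; [|by move=> k _; apply: poch_ne0|by apply: poch_ne0].
  have h1 : cprod_except i (fun k => poch (mu j - lam k) M.+1) <> RtoC 0 by apply: cprod_except_ne0 => k _; apply: poch_ne0.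
  have h2 : cprod_except j (fun m => poch (lam i - mu m + 1) M.+1) <> RtoC 0 by apply: cprod_except_ne0 => k _; apply: poch_ne0.
  by rewrite /shiftR1 /shiftRj; field.
rewrite (cprod_except_ext (i := i) (F := fun k => poch (lam i - lam k + 1) M.+1 / poch (mu j - lam k) M.+1)
  (G := fun k => gs (lam i - lam k + 1) M / gs (mu j - lam k) M * Cexp (x * L))); last first.
  by move=> k _; rewrite poch_ratio_gs //; congr (_ * Cexp (_ * _)); rewrite /x; ring.
rewrite (cprod_except_ext (i := j) (F := fun m => poch (mu j - mu m) M.+1 / poch (lam i - mu m + 1) M.+1)
  (G := fun m => gs (mu j - mu m) M / gs (lam i - mu m + 1) M * Cexp (- (x * L)))); last first.
  by move=> k _; rewrite poch_ratio_gs //; congr (_ * Cexp _); rewrite /x /L; ring.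
rewrite (cprod_except_mult i (fun k => gs (lam i - lam k + 1) M / gs (mu j - lam k) M) (fun _ => Cexp (x * L))).
rewrite (cprod_except_mult j (fun m => gs (mu j - mu m) M / gs (lam i - mu m + 1) M) (fun _ => Cexp (- (x * L)))).
rewrite (cprod_except_const i j (Cexp (x * L))).
have e : cprod_except j (fun _ : 'I_N => Cexp (x * L)) * cprod_except j (fun _ : 'I_N => Cexp (- (x * L))) = RtoC 1.
  rewrite -cprod_except_mult -[RHS](cprod_except_1 j); apply: cprod_except_ext => k _.
  by rewrite -Cexp_plus Cplus_opp_r Cexp_0.
set A := cprod_except i _; set B := cprod_except j (fun m => gs _ _ / _).
set E := cprod_except j _ in e *; set E' := cprod_except j _ in e *.
have -> : A * E * (B * E') = A * B * (E * E') by ring.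
by rewrite e Cmult_1_r.
Qed.

Lemma gamma_quot_conn N (lam mu : 'I_N -> C) i j : nr lam -> nr mu -> generic lam mu ->
  Cexp ((lam i - mu j) * smid) = conn_coef lam mu i j * gamma_quot lam mu i j.
Proof.
move=> hl hm hg; rewrite /gamma_quot /conn_coef.
have g1 m : rGamma (lam i - mu m + 1) <> RtoC 0 by apply: rGamma_ne0; apply: (proj1 (nonint_S (hg i m))).
have g2 k : rGamma (mu j - lam k) <> RtoC 0 by apply: rGamma_ne0; apply: (proj1 (gen_opp k j hg)).
have g3 k : rGamma (lam i - lam k + 1) <> RtoC 0 by apply: rGamma_ne0; apply: nr_good.
have g4 (m : 'I_N) : m != j -> rGamma (mu j - mu m) <> RtoC 0.
  by move=> /eqP mj; apply: rGamma_ne0; apply: (proj1 (nr_nonint hm (not_eq_sym mj))).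
have d1 (k : 'I_N) : k != i -> rGamma (mu j - lam k) <> RtoC 0 by [].
have d2 (m : 'I_N) : m != j -> rGamma (lam i - mu m + 1) <> RtoC 0 by [].
have q1 := cprod_except_ne0 d1; have q2 := cprod_except_ne0 d2.
have q3 := cprod_except_ne0 (i := i) (fun k _ => g3 k); have q4 := cprod_except_ne0 g4.
rewrite (cprod_except_div _ d1) (cprod_except_div _ d2).
have e1 : cprod_except i (fun k => CGamma (lam i - lam k + 1)) = / cprod_except i (fun k => rGamma (lam i - lam k + 1)).
  have -> : cprod_except i (fun k => CGamma (lam i - lam k + 1)) = cprod_except i (fun k => RtoC 1 / rGamma (lam i - lam k + 1)).
    by apply: cprod_except_ext => k _; rewrite /CGamma; field.
  by rewrite cprod_except_div // cprod_except_1; field.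
have e2 : cprod_except j (fun m => CGamma (mu j - mu m)) = / cprod_except j (fun m => rGamma (mu j - mu m)).
  have -> : cprod_except j (fun m => CGamma (mu j - mu m)) = cprod_except j (fun m => RtoC 1 / rGamma (mu j - mu m)).
    by apply: cprod_except_ext => k /g4 h; rewrite /CGamma; field.
  by rewrite cprod_except_div // cprod_except_1; field.
rewrite e1 e2.
have -> : Ci * (RtoC PI * (lam i - mu j)) = (lam i - mu j) * smid by rewrite /smid; ring.
by field; repeat split.
Qed.

Lemma Cexp_M_smid M : Cmod (Cexp (- (RtoC (INR M) * smid))) = 1%R.
Proof. by rewrite Cmod_Cexp /smid /= -exp_0; congr exp; ring. Qed.

(* As [M] grows, the coefficients at [z = -1] of the shifted [f_i] and [h_j] tend to the same binomial series, and the
   contribution of [h_m] for [m <> j] vanishes, so that [c j] is determined by [Conn_minus1]. *)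
Lemma conn_coef_limit N (lam mu : 'I_N -> C) i j c : nr lam -> nr mu -> generic lam mu -> Conn lam mu i c ->
  (Re (lam i - mu j)%C <= - (2 * Rabs (exponent_balance lam mu i j) + 3))%R -> c j = conn_coef lam mu i j.
Proof.
move=> hl hm hg hc hx; have hs := telw_series.
set Y := exponent_balance lam mu i j in hx.
have Y0 := Rabs_pos Y; have Y1 := Rle_abs Y.
pose lM M := upd lam i (RtoC (INR M)); pose mM M := upd mu j (RtoC (INR M)).
pose cM := shiftc lam mu i j c.
set B := altsum (binc (lam i - mu j + 1)).
have sK (K : R) : ex_series (fun n => K * telw n)%R by apply: (ex_series_scal_l K).
have [K1 hK1] := Scoef_shift_bound hl hg hx.
have [K2 hK2] := Tcoef_shift_at_bound hm hg hx.
have hfix : forall n, Clim (fun M => binc (lam i - mu j + 1) n) (binc (lam i - mu j + 1) n) by move=> n; apply: Clim_const.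
have one0 : RtoC 1 <> RtoC 0 by move/RtoC_inj; lra.
have m10 : - RtoC 1 <> RtoC 0 by rewrite -RtoC_opp; move/RtoC_inj; lra.
have [sB lS] : summable (binc (lam i - mu j + 1)) /\ Clim (fun M => altsum (Scoef (lM M) (mM M) i)) B.
  apply: (tannery_altsum (sK K1)) => // n.
  apply: (Clim_ext (fun M => esym (Scoef_shift mu i j M n hl))).
  rewrite -[X in Clim _ X]Cmult_1_r; apply: Clim_mult => //.
  apply: Clim_ext (@shift_ratio_lim N i j 1 (fun m => lam i - mu m + 1) (fun k => lam i - lam k + 1) n one0 _) => [M|k M _].
    by congr (_ / _); apply: cprod_except_ext => k _; rewrite Cmult_1_l.
  by rewrite Cmult_1_l; apply: poch_ne0; apply: good_nat; apply: nr_good.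
have lT : Clim (fun M => altsum (Tcoef (lM M) (mM M) j)) B.
  apply: (proj2 (tannery_altsum (sK K2) hK2 _)) => n.
  apply: (Clim_ext (fun M => esym (Tcoef_shift_at lam i j M n hm))).
  rewrite -[X in Clim _ X]Cmult_1_r; apply: Clim_mult => //.
  have em z t : z + - RtoC 1 * t = z - t by ring.
  apply: Clim_ext (@shift_ratio_lim N j i (- RtoC 1) (fun k => lam k - mu j + 1) (fun m => mu m - mu j + 1) n m10 _) => [M|k M /eqP kj].
    by congr (_ / _); apply: cprod_except_ext => k _; rewrite em.
  rewrite em; apply: poch_ne0.
  have -> : mu k - mu j + 1 - RtoC (INR M) = - (- (mu k - mu j + 1) + RtoC (INR M)) by ring.
  by apply: (proj1 (nonint_opp (nonint_nat M (nonint_opp (nonint_S (nr_nonint hm kj)))))).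
(* Divided by e^(M smid), the phase that f_i and h_j both acquire from the shift; it has modulus 1
   and does not affect the estimates of the other terms. *)
pose rest M m := Cexp (- (RtoC (INR M) * smid)) * (cM M m * (Cexp (mM M m * smid) * altsum (Tcoef (lM M) (mM M) m))).
have lR m : m != j -> Clim (fun M => rest M m) 0.
  move=> mj; have [K3 [K30 hK3]] := Tcoef_shift_ne_bound hm hg mj hx; have [K4 hK4] := shiftc_ne_bound c hl hm hg mj hx.
  set G := (K4 * (Cmod (Cexp (mu m * smid)) * (K3 * Series telw)))%R.
  have hG M : (Cmod (rest M m) <= Rabs G * / (INR M + 1))%R.
    rewrite /rest {1}/mM (upd_ne _ _ mj) Cmod_mult Cexp_M_smid Rmult_1_l Cmod_mult (Cmod_mult (Cexp _)).
    have M0 := pos_INR M.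
    have b1 := hK4 M; have b2 := altsum_bound (hK3 M).
    have p1 := Rpower_pos (INR M + 1) (Re (lam i - mu j)%C + Y).
    have p2 := Rpower_pos (INR M + 1) (Rabs Y + 2).
    have p0 := Cmod_ge_0 (Cexp (mu m * smid)).
    apply: Rle_trans (Rmult_le_compat _ _ _ _ (Cmod_ge_0 _) (Rmult_le_pos _ _ p0 (Cmod_ge_0 _)) b1 (Rmult_le_compat_l _ _ _ p0 b2)) _.
    have -> : (K4 * Rpower (INR M + 1) (Re (lam i - mu j)%C + exponent_balance lam mu i j) *
       (Cmod (Cexp (mu m * smid)) * (K3 * Rpower (INR M + 1) (Rabs (exponent_balance lam mu i j) + 2) * Series telw)))%R =
       (G * (Rpower (INR M + 1) (Re (lam i - mu j)%C + Y) * Rpower (INR M + 1) (Rabs Y + 2)))%R.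
      by rewrite /G /Y; ring.
    rewrite -Rpower_plus.
    apply: (Rle_trans _ (Rabs G * Rpower (INR M + 1) (Re (lam i - mu j)%C + Y + (Rabs Y + 2))))%R.
      by apply: Rmult_le_compat_r; [apply: Rlt_le; apply: Rpower_pos | exact: Rle_abs].
    apply: Rmult_le_compat_l; first exact: Rabs_pos.
    (* The exponent Re (lam_i - mu_j) + Y + |Y| + 2 must be at most -1; this is the origin of the
       bound 2 |Y| + 3 in the hypothesis. *)
    have -> : (/ (INR M + 1))%R = Rpower (INR M + 1) (- (1)) by rewrite Rpower_Ropp Rpower_1 //; lra.
    case: (Req_dec (INR M) 0) => [->|ne]; first by rewrite Rplus_0_l /Rpower ln_1 !Rmult_0_r; lra.
    by apply: Rle_Rpower; lra.
  apply: (Clim_squeeze (e := fun M => Rabs G * / (INR M + 1))%R).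
    by move=> M; have -> : rest M m - 0 = rest M m by ring.
  have := is_lim_seq_scal_l _ (Rabs G) _ inv_INR1_lim.
  by have -> : Rbar_mult (Rabs G) 0%R = Rbar.Finite 0 by rewrite /= Rmult_0_r.
pose ll m := if m == j then c j * gamma_quot lam mu i j * (Cexp (mu j * smid) * B) else RtoC 0.
have hlim m : Clim (fun M => rest M m) (ll m).
  rewrite /ll; case: (eqVneq m j) => [->|mj]; last exact: lR.
  have h := Clim_mult (Clim_scal (c j) (shift_gamma_lim i j hg)) (Clim_scal (Cexp (mu j * smid)) lT).
  apply: Clim_ext h => M; rewrite /rest /mM /cM /shiftc eqxx upd_at.
  have -> : (mu j + RtoC (INR M)) * smid = mu j * smid + RtoC (INR M) * smid by ring.
  by rewrite Cexp_plus Cexp_opp; field; apply: Cexp_ne0.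
have lL := Clim_scal (Cexp (lam i * smid)) lS.
have eqM M : Cexp (lam i * smid) * altsum (Scoef (lM M) (mM M) i) = csum (fun m => rest M m).
  have hlM := nr_updn i M hl; have hmM := nr_updn j M hm; have hgM := generic_updn i j M M hg.
  have e := @Conn_minus1 N (lM M) (mM M) i (cM M) hlM hmM (generic_sep hgM) (Conn_shift j M hl hm hg hc) _ _.
  rewrite csum_scal -e.
  - rewrite /lM upd_at.
    have -> : (lam i + RtoC (INR M)) * smid = lam i * smid + RtoC (INR M) * smid by ring.
    by rewrite Cexp_plus Cexp_opp; field; apply: Cexp_ne0.
  - exact: (summable_le (hK1 M) (sK K1)).
  - move=> m; case: (eqVneq m j) => [->|mj]; first exact: (summable_le (hK2 M) (sK K2)).
    by have [K3 [_ hK3]] := Tcoef_shift_ne_bound hm hg mj hx; apply: (summable_le (hK3 M)); apply: sK.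
(* The limit relation is e^(lam_i smid) B = c_j G e^(mu_j smid) B with G = [gamma_quot]; B and G are
   nonzero, so it determines c_j. *)
have e := Clim_unique lL (Clim_ext (fun M => esym (eqM M)) (Clim_csum hlim)).
rewrite (csum_only (i := j)) /ll ?eqxx in e; last by move=> k /negbTE ->.
have B0 : B <> RtoC 0 by apply: binc_altsum.
have ej := @Cexp_ne0 (mu j * smid).
have gq := gamma_quot_conn i j hl hm hg.
have gq0 : gamma_quot lam mu i j <> RtoC 0 by move=> e0; rewrite e0 Cmult_0_r in gq; apply: Cexp_ne0 gq.
have -> : c j = c j * gamma_quot lam mu i j * (Cexp (mu j * smid) * B) / (gamma_quot lam mu i j * Cexp (mu j * smid) * B).
  by field; repeat split.
rewrite -e; have -> : Cexp (lam i * smid) = Cexp ((lam i - mu j) * smid) * Cexp (mu j * smid).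
  by rewrite -Cexp_plus; congr Cexp; ring.
by rewrite gq; field; repeat split.
Qed.

Lemma gamma_quot_updm N (lam mu : 'I_N -> C) i j : nr mu -> generic lam mu ->
  gamma_quot lam (upd mu j 1) i j * (lam i - mu j) = - (gamma_quot lam mu i j * betaA lam mu j j).
Proof.
move=> hm hg.
have x0 : lam i - mu j <> RtoC 0 by apply: nonint_ne.
have n1 (k : 'I_N) : k != i -> mu j - lam k <> RtoC 0 by move=> _; apply: nonint_ne; apply: gen_opp.
have n2 (m : 'I_N) : m != j -> mu j - mu m <> RtoC 0.
  by move=> /eqP mj; apply: nonint_ne; apply: nr_nonint => //; apply: not_eq_sym.
have n3 (k : 'I_N) : k != i -> lam k - mu j <> RtoC 0 by move=> _; apply: nonint_ne.
have n4 (m : 'I_N) : m != j -> mu m - mu j <> RtoC 0 by move=> /eqP mj; apply: nonint_ne; apply: nr_nonint.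
have e1 : cprod_except i (fun k => rGamma (lam i - lam k + 1) / rGamma (upd mu j 1 j - lam k)) =
  cprod_except i (fun k => rGamma (lam i - lam k + 1) / rGamma (mu j - lam k)) * cprod_except i (fun k => mu j - lam k).
  rewrite -cprod_except_mult; apply: cprod_except_ext => k ki; rewrite upd_at.
  have -> : mu j + 1 - lam k = mu j - lam k + 1 by ring.
  rewrite (rGamma_S (mu j - lam k)).
  have g : rGamma (mu j - lam k + 1) <> RtoC 0 by apply: rGamma_ne0; apply: (proj1 (nonint_S (gen_opp k j hg))).
  have := n1 k ki => h; by field.
have e2 : cprod_except j (fun m => rGamma (upd mu j 1 j - upd mu j 1 m) / rGamma (lam i - upd mu j 1 m + 1)) =
  cprod_except j (fun m => rGamma (mu j - mu m) / rGamma (lam i - mu m + 1)) / cprod_except j (fun m => mu j - mu m).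
  rewrite -cprod_except_div //; apply: cprod_except_ext => m mj; rewrite upd_at (upd_ne _ _ mj).
  have -> : mu j + 1 - mu m = mu j - mu m + 1 by ring.
  rewrite (rGamma_S (mu j - mu m)).
  have g : rGamma (lam i - mu m + 1) <> RtoC 0 by apply: rGamma_ne0; apply: (proj1 (nonint_S (hg i m))).
  have := n2 m mj => h; by field.
rewrite /gamma_quot e1 e2 /betaA eqxx (cprod_D1 i).
have p1 := cprod_except_ne0 n1; have p2 := cprod_except_ne0 n2; have p4 := cprod_except_ne0 n4.
have er := @cprod_except_opp_ratio N j i (fun k => mu j - lam k) (fun m => mu j - mu m) n2.
have o1 : cprod_except i (fun k => - (mu j - lam k)) = cprod_except i (fun k => lam k - mu j).
  by apply: cprod_except_ext => k _; ring.
have o2 : cprod_except j (fun k => - (mu j - mu k)) = cprod_except j (fun k => mu k - mu j).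
  by apply: cprod_except_ext => k _; ring.
rewrite o1 o2 in er.
have -> : (lam i - mu j) * cprod_except i (fun k => lam k - mu j) / cprod_except j (fun m' => mu m' - mu j) =
  (lam i - mu j) * (cprod_except i (fun k => lam k - mu j) / cprod_except j (fun m' => mu m' - mu j)) by rewrite /Cdiv; ring.
by rewrite er; field.
Qed.

(** The closed formula scales under raising mu_j exactly as c_j does in [Conn_updm]. The sign from
    e^(-i pi) cancels the one in [gamma_quot_updm]. *)
Lemma conn_coef_updm N (lam mu : 'I_N -> C) i j : nr lam -> nr mu -> generic lam mu ->
  conn_coef lam (upd mu j 1) i j * betaA lam mu j j = conn_coef lam mu i j * (lam i - mu j).
Proof.
move=> hl hm hg.
have x0 : lam i - mu j <> RtoC 0 by apply: nonint_ne.
have b0 : betaA lam mu j j <> RtoC 0 by apply: betaA_ne0.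
have g1 := gamma_quot_conn i j hl hm hg.
have g2 := gamma_quot_conn i j hl (nr_upd j hm) (generic_updm j hg).
have g3 := gamma_quot_updm i j hm hg.
have q0 : gamma_quot lam mu i j <> RtoC 0 by move=> e0; rewrite e0 Cmult_0_r in g1; apply: Cexp_ne0 g1.
have e : Cexp ((lam i - upd mu j 1 j) * smid) = - Cexp ((lam i - mu j) * smid).
  rewrite upd_at; have -> : (lam i - (mu j + 1)) * smid = (lam i - mu j) * smid + - smid by ring.
  rewrite Cexp_plus Cexp_opp Cexp_smid; field.
have e4 : conn_coef lam (upd mu j 1) i j * gamma_quot lam (upd mu j 1) i j = - (conn_coef lam mu i j * gamma_quot lam mu i j).
  by rewrite -g1 -g2 e.
move: e4 g3 q0; move: (conn_coef lam (upd mu j 1) i j) (conn_coef lam mu i j) => u v.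
move: (gamma_quot lam (upd mu j 1) i j) (gamma_quot lam mu i j) => gq gq' e4 g3 q0.
have -> : u * betaA lam mu j j = - (u * - (gq' * betaA lam mu j j)) / gq' by field.
rewrite -g3; have -> : - (u * (gq * (lam i - mu j))) = - (u * gq) * (lam i - mu j) by ring.
by rewrite e4; field.
Qed.

(* Raising [mu j] lowers [Re (lam i - mu j)] and leaves [exponent_balance] unchanged, hence reduces to [conn_coef_limit]. *)
Lemma conn_coef_generic N (lam mu : 'I_N -> C) i j c : nr lam -> nr mu -> generic lam mu -> Conn lam mu i c ->
  c j = conn_coef lam mu i j.
Proof.
move=> hl; have [K hK] := nat_above (Re (lam i - mu j)%C + (2 * Rabs (exponent_balance lam mu i j) + 3)).
have {}hK : (Re (lam i - mu j)%C - INR K <= - (2 * Rabs (exponent_balance lam mu i j) + 3))%R by lra.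
elim: K mu c hK => [|K IH] mu c hK hm hg hc.
  by apply: conn_coef_limit => //; move: hK; rewrite /= Rminus_0_r.
have x0 : lam i - mu j <> RtoC 0 by apply: nonint_ne.
have b0 : betaA lam mu j j <> RtoC 0 by apply: betaA_ne0.
have h := IH (upd mu j 1) _ _ (nr_upd j hm) (generic_updm j hg) (Conn_updm j hl hm hg hc).
have e := conn_coef_updm i j hl hm hg.
rewrite -h in e; last first.
  have -> : exponent_balance lam (upd mu j 1) i j = exponent_balance lam mu i j.
    by rewrite /exponent_balance /rsum_except; congr (_ - _)%R; apply: eq_bigr => k kj; rewrite upd_ne.
  by move: hK; rewrite upd_at S_INR !re_minus re_plus re_RtoC; lra.
have -> : c j = c j * (lam i - mu j) / betaA lam mu j j * betaA lam mu j j / (lam i - mu j) by field.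
by rewrite e; field.
Qed.

(** * The connection relation between coordinate vectors *)

(** Values at [smid] of the continued solutions. Any point of the half strip would give the same
    vector, the pairings being constant. *)
Definition coordF N (lam mu : 'I_N -> C) (i : 'I_N) : cvec N :=
  coordX (diagm lam) (rank1 (residue lam mu)) (yF lam mu i) (sL 0).
Definition coordH N (lam mu : 'I_N -> C) (j : 'I_N) : cvec N :=
  coordX (diagm lam) (rank1 (residue lam mu)) (yH lam mu j) (sR 0).

Lemma ext_coordF N (lam mu : 'I_N -> C) i s k : nr lam -> sep lam mu -> lstrip s ->
  ext (diagm lam) (rank1 (residue lam mu)) (coordF lam mu i) s k = yF lam mu i s k.
Proof.
move=> hl hs h; apply: (ext_coord (U := lstrip)) => //.
- exact: lstrip_convex.
- by move=> ? [].
- by move=> s' l h'; apply: yF_ode.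
- exact: sL_l.
Qed.

Lemma ext_coordH N (lam mu : 'I_N -> C) j s k : nr lam -> nr mu -> sep lam mu -> rstrip s ->
  ext (diagm lam) (rank1 (residue lam mu)) (coordH lam mu j) s k = yH lam mu j s k.
Proof.
move=> hl hm hs h; apply: (ext_coord (U := rstrip)) => //.
- exact: rstrip_convex.
- by move=> ? [].
- by move=> s' l h'; apply: yH_ode.
- exact: sR_r.
Qed.

Lemma bH_0 N (lam mu : 'I_N -> C) j k : bH lam mu j 0 k = / (lam k - mu j).
Proof. by rewrite /bH cprod_except_poch0 cprod_poch0 poch0 /Cdiv; have := Cdiv11; rewrite /Cdiv => h; ring [h]. Qed.

Lemma residue_sum N (lam mu : 'I_N -> C) m : nr lam -> sep lam mu ->
  csum (fun k => residue lam mu k / (lam k - mu m)) = RtoC 1.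
Proof.
move=> [hl _] hs.
have h := @residue_pf N lam mu (mu m) hl (fun k e => hs k m (esym e)).
rewrite (@cprod_eq0 _ m) in h; last by ring.
have e : csum (fun k => residue lam mu k / (lam k - mu m)) = - csum (fun k => residue lam mu k / (mu m - lam k)).
  rewrite -csum_opp; apply: csum_ext => k; have h1 := sep_ne (k := k) (m := m) hs.
  have h2 : mu m - lam k <> RtoC 0.
    move=> e0; apply: h1; have -> : lam k - mu m = - (mu m - lam k) by ring.
    by rewrite e0; ring.
  by field.
rewrite e; have -> : csum (fun k => residue lam mu k / (mu m - lam k)) = (1 + csum (fun k => residue lam mu k / (mu m - lam k))) - 1 by ring.
by rewrite h /Cdiv; ring.
Qed.

(** In the rescaled coordinates these are eigenvectors of P - Q for the distinct eigenvalues mu_m;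
    [residue_sum] provides the eigenvector equation. *)
Lemma indep_bH0 N (lam mu : 'I_N -> C) : nr lam -> nr mu -> sep lam mu ->
  indep (fun m k => / (lam k - mu m)).
Proof.
move=> hl [hm _] hs.
apply: (@eigen_indep N (fun k l => diagm lam k l + - RtoC 1 * rank1 (residue lam mu) k l) mu) => // [m|m].
  apply: functional_extensionality => k; rewrite /mapply diag_rank1_apply /vscale.
  have -> : csum (fun l => residue lam mu l * / (lam l - mu m)) = RtoC 1 by apply: residue_sum.
  by have h := sep_ne (k := k) (m := m) hs; field.
by exists m; have h := sep_ne (k := m) (m := m) hs; move=> e; apply: C1_nz; rewrite -(Cinv_r _ h) e Cmult_0_r.
Qed.

Lemma exp_neg_lim : is_lim_seq (fun q => exp (- (INR q + 1))) 0%R.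
Proof.
apply: (is_lim_seq_le_le (fun _ => 0%R) _ (fun q => / (INR q + 1))%R) => [q||]; [|exact: is_lim_seq_const|exact: inv_INR1_lim].
have q0 := pos_INR q; have h := exp_ineq1_le (INR q + 1); have p := exp_pos (- (INR q + 1)).
split; first lra.
rewrite exp_Ropp; apply: Rinv_le_contravar; lra.
Qed.

(* As [Re s] tends to infinity, [e^(- mu m s) yH m] tends to an eigenvector of [R] for the eigenvalue [- mu m]. *)
Lemma indep_coordH N (lam mu : 'I_N -> C) : nr lam -> nr mu -> sep lam mu -> indep (coordH lam mu).
Proof.
move=> hl hm hs.
pose s q := smid + RtoC (INR q + 1).
have sr q : rstrip (s q).
  have q0 := pos_INR q; split; last by rewrite re_plus re_smid re_RtoC; lra.
  by have := smid_strip; rewrite /strip im_plus im_RtoC Rplus_0_r.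
pose e q m k := PSc (fun n => bH lam mu m n k) (Cexp (- s q)).
have hE : Clim (fun q => Cexp (- s q)) 0.
  apply: (Clim_squeeze (e := fun q => exp (- (INR q + 1)))); last exact: exp_neg_lim.
  move=> q; have -> : Cexp (- s q) - 0 = Cexp (- s q) by ring.
  by rewrite Cmod_Cexp re_opp re_plus re_smid re_RtoC Rplus_0_l; apply: Rle_refl.
have [q hq] : exists q, indep (e q).
  apply: (indep_lim (e0 := fun m k => / (lam k - mu m))); last exact: indep_bH0.
  move=> m k; rewrite -bH_0 -(PSc_0 (fun n => bH lam mu m n k)).
  apply: (Cder_Clim (Cder_PSc (bH_gb m k hm hs) _) hE); rewrite Cmod_0; lra.
move=> c hc m.
have h := hq (fun m => c m * Cexp (mu m * s q)).
have {}h := h _ m.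
have -> : c m = c m * Cexp (mu m * s q) / Cexp (mu m * s q) by field; apply: Cexp_ne0.
rewrite h; first by rewrite /Cdiv Cmult_0_l.
move=> k; have -> : csum (fun i => c i * Cexp (mu i * s q) * e q i k) = csum (fun i => c i * yH lam mu i (s q) k).
  by apply: csum_ext => i; rewrite /e /yH /serinf; ring.
rewrite (csum_ext (G := fun i => csum (fun a => c i * coordH lam mu i a * ysolY (diagm lam) (rank1 (residue lam mu)) a (s q) k))); last first.
  by move=> i; rewrite -ext_coordH // /ext -csum_scal; apply: csum_ext => a; ring.
rewrite csum_exchange -[RHS](csum_0 N); apply: csum_ext => a.
by rewrite csum_scal_r hc Cmult_0_l.
Qed.

Lemma ext_lim N (L Q : cmat N) (A : cvec N) (s : nat -> C) k : Clim s smid ->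
  Clim (fun q => ext L Q A (s q) k) (A k).
Proof.
move=> h; rewrite -(ext_smid L Q A k).
have [d hd] := ext_der L Q A k smid_strip.
exact: (Cder_Clim hd h).
Qed.

(** Some coefficients exist because the [coordH] form a basis. The continued solutions are
    continuous at [smid], so these coefficients satisfy [Conn], which determines them. *)
Lemma coord_conn_generic N (lam mu : 'I_N -> C) i k : nr lam -> nr mu -> generic lam mu ->
  coordF lam mu i k = csum (fun j => conn_coef lam mu i j * coordH lam mu j k).
Proof.
move=> hl hm hg; have hs := generic_sep hg.
have [D [_ hD]] := indep_inverse (indep_coordH hl hm hs).
pose c m := csum (fun a => coordF lam mu i a * D a m).
have e l : coordF lam mu i l = csum (fun m => c m * coordH lam mu m l).
  rewrite -[LHS](csum_kron_r l (coordF lam mu i)).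
  rewrite (csum_ext (G := fun a => csum (fun m => coordF lam mu i a * D a m * coordH lam mu m l))); last first.
    by move=> a; rewrite -hD -csum_scal; apply: csum_ext => m; ring.
  by rewrite csum_exchange; apply: csum_ext => m; rewrite csum_scal_r.
have hc : Conn lam mu i c.
  exists (coordF lam mu i); split=> l.
    apply: (Clim_ext _ (ext_lim (diagm lam) (rank1 (residue lam mu)) (coordF lam mu i) l sL_lim)) => q.
    by apply: ext_coordF => //; apply: sL_l.
  rewrite e; apply: Clim_csum => m; apply: Clim_scal.
  apply: (Clim_ext _ (ext_lim (diagm lam) (rank1 (residue lam mu)) (coordH lam mu m) l sR_lim)) => q.
  by apply: ext_coordH => //; apply: sR_r.
by rewrite e; apply: csum_ext => j; rewrite (conn_coef_generic j hl hm hg hc).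
Qed.

(** * Removal of the genericity assumption *)

Lemma Clim_mapply N (B : nat -> cmat N) (B0 : cmat N) (x : nat -> cvec N) (x0 : cvec N) k :
  (forall l, Clim (fun q => B q k l) (B0 k l)) -> (forall l, Clim (fun q => x q l) (x0 l)) ->
  Clim (fun q => mapply (B q) (x q) k) (mapply B0 x0 k).
Proof. by move=> h1 h2; apply: Clim_csum => l; apply: Clim_mult. Qed.

Lemma Clim_prevc N (c : nat -> nat -> cvec N) (l : nat -> cvec N) (n : nat) :
  (forall m, (m <= n)%N -> forall k, Clim (fun q => c q m k) (l m k)) ->
  forall m, (m <= n)%N -> forall k, Clim (fun q => prevc (c q) m k) (prevc l m k).
Proof. by move=> h [|m] hm k; [apply: Clim_const | apply: h; apply: ltnW]. Qed.

Lemma solc_cont N (L Q : nat -> cmat N) (L0 Q0 : cmat N) (c0 : cvec N) :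
  (forall k l, Clim (fun q => L q k l) (L0 k l)) -> (forall k l, Clim (fun q => Q q k l) (Q0 k l)) ->
  forall n k, Clim (fun q => solc (L q) (Q q) c0 n k) (solc L0 Q0 c0 n k).
Proof.
move=> hL hQ n k.
have h0 k0 l : Clim (fun q => stepB0 (L q) (Q q) k0 l) (stepB0 L0 Q0 k0 l).
  by apply: Clim_minus; apply: Clim_scal.
have h1 k0 l : Clim (fun q => stepB1 (Q q) k0 l) (stepB1 Q0 k0 l).
  by apply: Clim_opp; apply: Clim_scal.
suff H : forall n m, (m <= n)%N -> forall k, Clim (fun q => solc (L q) (Q q) c0 m k) (solc L0 Q0 c0 m k) by apply: (H n).
clear n k; elim=> [|n IH] m.
  by rewrite leqn0 => /eqP -> k; apply: Clim_const.
rewrite leq_eqVlt => /orP [/eqP ->|]; last by rewrite ltnS; apply: IH.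
move=> k; have i0 : RtoC (INR n.+1) <> RtoC 0 by rewrite S_INR; apply: @INR1_neq0.
have e (L' Q' : cmat N) : solc L' Q' c0 n.+1 k = / RtoC (INR n.+1) * (RtoC (INR n.+1) * solc L' Q' c0 n.+1 k) by field.
rewrite e; apply: (Clim_ext (fun q => esym (e (L q) (Q q)))).
apply: Clim_scal; rewrite solcS; apply: (Clim_ext (fun q => esym (solcS (L q) (Q q) c0 n k))).
have p1 := Clim_prevc IH; have p2 := Clim_prevc p1; have p3 := Clim_prevc p2.
apply: Clim_plus; [apply: Clim_plus; [apply: Clim_plus|]|].
- by apply: Clim_scal; apply: p3.
- by apply: Clim_mapply => l //; apply: IH.
- by apply: Clim_mapply => l //; apply: p1.
- by apply: Clim_mapply => l //; apply: p2.
Qed.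

Lemma Clim_PSc (c : nat -> nat -> C) (l : nat -> C) (K : R) (E : nat) (w : C) (q0 : nat) :
  (forall q n, (q0 <= q)%N -> (Cmod (c q n) <= K * (INR n + 1) ^ E)%R) -> (forall n, Clim (fun q => c q n) (l n)) ->
  (Cmod w < 1)%R -> Clim (fun q => PSc (c q) w) (PSc l w).
Proof.
move=> hb hc hw.
have K0 n : (0 <= K * (INR n + 1) ^ E)%R by apply: Rle_trans (hb q0 n (leqnn _)); exact: Cmod_ge_0.
have hg : gb (fun n => RtoC (K * (INR n + 1) ^ E)).
  by apply: (@gb_poly K E) => n; rewrite Cmod_R Rabs_pos_eq //; apply: Rle_refl.
have hs := gb_abs_summable hg (conj (Cmod_ge_0 w) hw).
apply: (proj2 (@tannery (fun q n => c q n * Cpow w n) (fun n => l n * Cpow w n) _ q0 hs _ _)).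
  move=> q n hq; rewrite Cmod_mult Cmod_pow Cmod_R Rabs_pos_eq //.
  by apply: Rmult_le_compat_r; [apply: pow_le; exact: Cmod_ge_0 | apply: hb].
by move=> n; apply: Clim_mult => //; apply: Clim_const.
Qed.

Lemma Clim_bounded_fin (I : finType) (u : I -> nat -> C) (l : I -> C) : (forall i, Clim (u i) (l i)) ->
  exists B : R, (0 < B)%R /\ forall i n, (Cmod (u i n) <= B)%R.
Proof.
move=> h; suff [B [B0 hB]] : exists B : R, (0 < B)%R /\ forall i, i \in enum I -> forall n, (Cmod (u i n) <= B)%R.
  by exists B; split=> // i n; apply: hB; rewrite mem_enum.
elim: (enum I) => [|i s [B [B0 IH]]]; first by exists 1%R; split; [lra|].
have [B' [B0' hB']] := Clim_bounded (h i).
exists (B + B')%R; split; first lra.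
move=> k; rewrite inE => /orP [/eqP ->|hk] n; first by have := hB' n; lra.
by have := IH k hk n; lra.
Qed.

Lemma sum_bound N (x : 'I_N -> R) (B : R) : (forall l, x l <= B)%R -> (\big[Rplus/0%R]_(l < N) x l <= INR N * B)%R.
Proof.
elim: N x => [|N IH] x h; first by rewrite big_ord0 /=; lra.
rewrite big_ord_recl S_INR; have := IH (fun l => x (lift ord0 l)) (fun l => h _); have := h ord0; lra.
Qed.

(** Convergent matrices are bounded, so [solc_bound] gives one polynomial majorant for all [q], and
    the coefficients converge by their recursion. *)
Lemma ysol_cont N (L Q : nat -> cmat N) (L0 Q0 : cmat N) (c0 : cvec N) s k : strip s ->
  (forall k l, Clim (fun q => L q k l) (L0 k l)) -> (forall k l, Clim (fun q => Q q k l) (Q0 k l)) ->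
  Clim (fun q => ysol (L q) (Q q) c0 s k) (ysol L0 Q0 c0 s k).
Proof.
move=> hs hL hQ.
have h0 (p : 'I_N * 'I_N) : Clim (fun q => stepB0 (L q) (Q q) p.1 p.2) (stepB0 L0 Q0 p.1 p.2).
  by apply: Clim_minus; apply: Clim_scal.
have h1 (p : 'I_N * 'I_N) : Clim (fun q => stepB1 (Q q) p.1 p.2) (stepB1 Q0 p.1 p.2).
  by apply: Clim_opp; apply: Clim_scal.
have [B [B0 hB]] := Clim_bounded_fin h0; have [B' [B0' hB']] := Clim_bounded_fin h1.
pose beta := (INR N * (B + B'))%R.
have [M0 hM] := big_Rle (fun l => Cmod (c0 l)).
pose M := Rmax M0 0.
have [E hE] := nat_above (3 * beta + 2).
apply: (@Clim_PSc _ _ M E _ 0%N); last exact: wof_lt1.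
  move=> q n _; apply: (@solc_bound _ _ _ _ beta) => //.
  - exact: Rmax_r.
  - by move=> l; apply: Rle_trans (hM l) _; apply: Rmax_l.
  - by move=> r; apply: sum_bound => l; have := hB (r, l) q => /=; lra.
  - by move=> r; apply: sum_bound => l; have := hB' (r, l) q => /=; lra.
by move=> n; apply: solc_cont.
Qed.

Lemma coordX_cont N (L Q : nat -> cmat N) (L0 Q0 : cmat N) (G : nat -> C -> cvec N) (G0 : C -> cvec N) s a : strip s ->
  (forall k l, Clim (fun q => L q k l) (L0 k l)) -> (forall k l, Clim (fun q => Q q k l) (Q0 k l)) ->
  (forall k, Clim (fun q => G q s k) (G0 s k)) ->
  Clim (fun q => coordX (L q) (Q q) (G q) s a) (coordX L0 Q0 G0 s a).
Proof.
move=> hs hL hQ hG; apply: Clim_csum => k; apply: Clim_mult => //.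
by apply: ysol_cont => // k' l; apply: Clim_opp.
Qed.

(** Purely imaginary, so that eventually no lam_k - mu_m is real; common to all lam_k, so that
    nonresonance and the differences lam_i - lam_k are preserved. *)
Definition pert (q : nat) : C := Ci * RtoC (/ (INR q + 1)).
Definition lam_pert N (lam : 'I_N -> C) (q : nat) : 'I_N -> C := fun k => lam k + pert q.

Lemma pert_lim : Clim pert 0.
Proof.
have h := Clim_scal Ci (Clim_RtoC inv_INR1_lim).
by rewrite Cmult_0_r in h.
Qed.

Lemma pert_le1 q : (Cmod (pert q) <= 1)%R.
Proof.
have q0 := pos_INR q; have p := inv_INR1_pos q.
rewrite Cmod_mult Cmod_Ci Cmod_R Rabs_pos_eq ?Rmult_1_l; last lra.
rewrite -[X in (_ <= X)%R]Rinv_1; apply: Rinv_le_contravar; lra.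
Qed.

Lemma lam_pert_lim N (lam : 'I_N -> C) k : Clim (fun q => lam_pert lam q k) (lam k).
Proof. by rewrite -[X in Clim _ X]Cplus_0_r; apply: Clim_plus; [apply: Clim_const | exact: pert_lim]. Qed.

Lemma lam_pert_diff N (lam : 'I_N -> C) q i k : lam_pert lam q i - lam_pert lam q k = lam i - lam k.
Proof. by rewrite /lam_pert; ring. Qed.

Lemma nr_pert N (lam : 'I_N -> C) q : nr lam -> nr (lam_pert lam q).
Proof.
case=> h1 h2; split=> [i k e|i k n]; last by rewrite lam_pert_diff.
apply: h1; have -> : lam i = lam k + (lam_pert lam q i - lam_pert lam q k) by rewrite lam_pert_diff; ring.
by rewrite e; ring.
Qed.

Lemma nonint_im a : Im a <> 0%R -> nonint a.
Proof.
move=> h; split=> l e; apply: h.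
  by have := f_equal Im e; rewrite im_plus !im_RtoC; lra.
by have := f_equal Im e; rewrite im_plus im_minus !im_RtoC; lra.
Qed.

Lemma eventually_all (I : finType) (P : I -> nat -> Prop) :
  (forall i, exists n0 : nat, forall n, (n0 <= n)%N -> P i n) ->
  exists n0 : nat, forall n, (n0 <= n)%N -> forall i, P i n.
Proof.
move=> h; suff [n0 hn] : exists n0 : nat, forall n, (n0 <= n)%N -> forall i, i \in enum I -> P i n.
  by exists n0 => n /hn h' i; apply: h'; rewrite mem_enum.
elim: (enum I) => [|i s [n0 IH]]; first by exists 0%N.
have [n1 h1] := h i; exists (n0 + n1)%N => n hn k; rewrite inE => /orP [/eqP ->|].
  by apply: h1; apply: leq_trans hn; apply: leq_addl.
by apply: IH; apply: leq_trans hn; apply: leq_addr.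
Qed.

(** A real difference becomes nonreal for every q; a nonreal one stays nonreal once 1 / (q + 1) is
    small enough. The pairs are finite in number. *)
Lemma generic_pert N (lam mu : 'I_N -> C) : exists q0 : nat, forall q, (q0 <= q)%N -> generic (lam_pert lam q) mu.
Proof.
have [q0 h] : exists q0 : nat, forall q, (q0 <= q)%N -> forall p : 'I_N * 'I_N, nonint (lam_pert lam q p.1 - mu p.2).
  apply: eventually_all => -[k m] /=.
  case: (Req_dec (Im (lam k - mu m)) 0) => [e|ne].
    exists 0%N => q _; apply: nonint_im.
    have -> : lam_pert lam q k - mu m = (lam k - mu m) + pert q by rewrite /lam_pert; ring.
    by rewrite im_plus e /pert /= ; have := inv_INR1_pos q; lra.
  have hl : Clim (fun q => RtoC (Im (lam k - mu m) + / (INR q + 1))) (RtoC (Im (lam k - mu m) + 0)).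
    by apply: Clim_RtoC; apply: is_lim_seq_plus'; [apply: is_lim_seq_const | exact: inv_INR1_lim].
  have [] := @Clim_ne _ _ _ hl; first by rewrite Rplus_0_r => /RtoC_inj.
  move=> q0 hq; exists q0 => q /hq h; apply: nonint_im => e; apply: h; congr RtoC; rewrite -e.
  have -> : lam_pert lam q k - mu m = (lam k - mu m) + pert q by rewrite /lam_pert; ring.
  by rewrite im_plus /pert /=; ring.
by exists q0 => q hq k m; apply: (h q hq (k, m)).
Qed.

Lemma residue_cont N (lam mu : 'I_N -> C) k : nr lam ->
  Clim (fun q => residue (lam_pert lam q) mu k) (residue lam mu k).
Proof.
move=> hl; apply: Clim_div.
- by apply: distinct_prod; case: hl.
- by apply: Clim_big_prod => m _; apply: Clim_minus; [exact: lam_pert_lim | exact: Clim_const].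
- by apply: Clim_big_prod => m _; apply: Clim_minus; exact: lam_pert_lim.
Qed.

Lemma diagm_cont N (lam : 'I_N -> C) k l : Clim (fun q => diagm (lam_pert lam q) k l) (diagm lam k l).
Proof. by apply: Clim_mult; [exact: lam_pert_lim | exact: Clim_const]. Qed.

Lemma aF_cont N (lam mu : 'I_N -> C) i n k : nr lam -> sep lam mu ->
  Clim (fun q => aF (lam_pert lam q) mu i n k) (aF lam mu i n k).
Proof.
move=> hl hs; case: n => [|n] /=.
  case: (k == i); last exact: Clim_const.
  by apply: Clim_inv; [apply: residue_ne0 | apply: residue_cont].
apply: Clim_div; first exact: (nr_good hl).
  apply: Clim_div.
  - by apply: cprod_ne0 => m; apply: poch_ne0; apply: nr_good.
  - apply: Clim_big_prod => m _; apply: Clim_poch; apply: Clim_plus; last exact: Clim_const.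
    by apply: Clim_minus; [exact: lam_pert_lim | exact: Clim_const].
  - apply: Clim_big_prod => m _; apply: Clim_poch; apply: Clim_plus; last exact: Clim_const.
    by apply: Clim_minus; exact: lam_pert_lim.
apply: Clim_plus; last exact: Clim_const.
by apply: Clim_plus; [apply: Clim_minus; exact: lam_pert_lim | exact: Clim_const].
Qed.

Lemma yF_cont N (lam mu : 'I_N -> C) i s k : nr lam -> sep lam mu -> lstrip s ->
  Clim (fun q => yF (lam_pert lam q) mu i s k) (yF lam mu i s k).
Proof.
move=> hl hs [_ hS]; apply: Clim_mult.
  by apply: Clim_Cexp; apply: Clim_mult; [exact: lam_pert_lim | exact: Clim_const].
have [A0 hA0] := big_Rle (fun m => Cmod (lam i - mu m + 1)).
have [A hA] := nat_above (A0 + 1).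
have [K [E [K0 hK]]] := @aF_bound N A lam mu i hl.
have [B [B0 hB]] := Clim_bounded (aF_cont i 0 k hl hs).
(* [B] covers the constant term, which lies outside [aF_bound]; [K] covers all others. *)
apply: (@Clim_PSc _ _ (K + B) E _ 0%N); [|by move=> n; apply: aF_cont|exact: Cmod_Cexp_lt1].
move=> q n _; have n0 := pos_INR n; have p1 := pow_R1_Rle (INR n + 1) E ltac:(lra).
case: n n0 p1 => [|n] n0 p1.
  apply: Rle_trans (hB q) _; rewrite -[X in (X <= _)%R]Rmult_1_r; apply: Rmult_le_compat; lra.
have b1 : (Cmod (aF (lam_pert lam q) mu i n.+1 k) <= K * (INR n + 1) ^ E)%R.
  apply: hK => m; apply: Rle_trans hA.
  have -> : lam i + pert q - mu m + 1 = (lam i - mu m + 1) + pert q by ring.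
  by apply: Rle_trans (Cmod_triangle _ _) _; have := hA0 m; have := pert_le1 q; lra.
apply: Rle_trans b1 _; rewrite S_INR in n0 p1 *; have n1 := pos_INR n.
apply: Rmult_le_compat; [lra | apply: pow_le; lra | lra | apply: pow_incr; lra].
Qed.

Lemma bH_cont N (lam mu : 'I_N -> C) j n k : nr mu -> sep lam mu ->
  Clim (fun q => bH (lam_pert lam q) mu j n k) (bH lam mu j n k).
Proof.
move=> hm hs.
have hd : forall l, Clim (fun q => lam_pert lam q l - mu j) (lam l - mu j).
  by move=> l; apply: Clim_minus; [exact: lam_pert_lim | exact: Clim_const].
apply: Clim_div; last exact: Clim_const.
  by apply: cprod_ne0 => m; apply: poch_ne0; apply: nr_good.
apply: Clim_mult; first by apply: Clim_div; [exact: sep_ne | apply: Clim_poch | ].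
by apply: Clim_big_prod => m _; apply: Clim_poch; apply: Clim_plus => //; exact: Clim_const.
Qed.

Lemma yH_cont N (lam mu : 'I_N -> C) j s k : nr mu -> sep lam mu -> rstrip s ->
  Clim (fun q => yH (lam_pert lam q) mu j s k) (yH lam mu j s k).
Proof.
move=> hm hs [_ hS]; apply: Clim_mult; first exact: Clim_const.
have hd : forall l, Clim (fun q => lam_pert lam q l - mu j) (lam l - mu j).
  by move=> l; apply: Clim_minus; [exact: lam_pert_lim | exact: Clim_const].
have [q0 hq0] : exists q0 : nat, forall q, (q0 <= q)%N -> forall l : 'I_N, lam_pert lam q l - mu j <> RtoC 0.
  by apply: eventually_all => l; apply: (Clim_ne _ (hd l)); apply: sep_ne.
have [A0 [_ hA0]] := Clim_bounded_fin (fun l => Clim_plus (hd l) (Clim_const 1)).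
have [A hA] := nat_above A0.
have [D [_ hD]] := Clim_bounded_fin (fun l : 'I_N => Clim_inv (@sep_ne _ _ _ l j hs) (hd l)).
have [K [E [K0 hK]]] := @bH_bound N A D lam mu j hm.
apply: (@Clim_PSc _ _ K E _ q0); [|by move=> n; apply: bH_cont|].
  move=> q n hq; apply: hK; last exact: hq0.
  - by move=> l; apply: Rle_trans hA; apply: (hA0 l q).
  - by move=> l; apply: (hD l q).
by rewrite Cmod_Cexp -exp_0; apply: exp_increasing; rewrite re_opp; lra.
Qed.

(** Gamma itself is evaluated only at differences inside [lam] or inside [mu], which the
    perturbation does not change; the mixed differences enter through the exponential and 1/Gamma,
    which are continuous everywhere. *)
Lemma conn_coef_cont N (lam mu : 'I_N -> C) i j :
  Clim (fun q => conn_coef (lam_pert lam q) mu i j) (conn_coef lam mu i j).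
Proof.
have hd k m : Clim (fun q => lam_pert lam q k - mu m) (lam k - mu m).
  by apply: Clim_minus; [exact: lam_pert_lim | exact: Clim_const].
apply: Clim_mult; first by apply: Clim_Cexp; do 2 apply: Clim_scal.
apply: Clim_mult.
  apply: (Clim_ext _ (Clim_const _)) => q; congr (_ * _).
  by apply: cprod_except_ext => k _; rewrite lam_pert_diff.
apply: Clim_mult; apply: Clim_big_prod => k _; apply: rGamma_cont.
  by apply: Clim_plus => //; exact: Clim_const.
by apply: Clim_minus; [exact: Clim_const | exact: lam_pert_lim].
Qed.

Lemma coord_conn N (lam mu : 'I_N -> C) i a : nr lam -> nr mu -> sep lam mu ->
  coordF lam mu i a = csum (fun j => conn_coef lam mu i j * coordH lam mu j a).
Proof.
move=> hl hm hs; have [q0 hg] := generic_pert lam mu.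
have hF : Clim (fun q => coordF (lam_pert lam q) mu i a) (coordF lam mu i a).
  apply: coordX_cont; [exact: (proj1 (sL_l 0))|exact: diagm_cont|by move=> ? ?; apply: residue_cont|].
  by move=> k; apply: yF_cont => //; exact: sL_l.
apply: (Clim_unique hF).
have hH : Clim (fun q => csum (fun j => conn_coef (lam_pert lam q) mu i j * coordH (lam_pert lam q) mu j a))
   (csum (fun j => conn_coef lam mu i j * coordH lam mu j a)).
  apply: Clim_csum => j; apply: Clim_mult; first exact: conn_coef_cont.
  apply: coordX_cont; [exact: (proj1 (sR_r 0))|exact: diagm_cont|by move=> ? ?; apply: residue_cont|].
  by move=> k; apply: yH_cont => //; exact: sR_r.
apply: (Clim_ext_loc (n0 := q0) _ hH) => q hq.
by rewrite (coord_conn_generic i a (nr_pert q hl) hm (hg q hq)).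
Qed.

(** * Coordinates with respect to the eigenvectors of P *)

Definition coords N (D : cmat N) (x : cvec N) : cvec N := fun i => csum (fun k => x k * D k i).

Definition dual_frame N (xi : 'I_N -> cvec N) (D : cmat N) : Prop :=
  (forall i j, csum (fun k => xi i k * D k j) = kron i j) /\
  (forall k l, csum (fun i => D k i * xi i l) = kron k l).

Lemma coords_comb N xi (D : cmat N) c i : dual_frame xi D -> coords D (vlincomb c xi) i = c i.
Proof.
case=> h _; rewrite /coords /vlincomb.
rewrite (csum_ext (G := fun k => csum (fun l => c l * (xi l k * D k i)))); last first.
  by move=> k; rewrite -csum_scal_r; apply: csum_ext => l; ring.
rewrite csum_exchange (csum_ext (G := fun l => c l * kron l i)); first exact: csum_kron_r.
by move=> l; rewrite csum_scal h.
Qed.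

Lemma coords_expand N xi (D : cmat N) x : dual_frame xi D -> x = vlincomb (coords D x) xi.
Proof.
case=> _ h; apply: functional_extensionality => l; rewrite /coords /vlincomb.
rewrite (csum_ext (G := fun i => csum (fun k => x k * (D k i * xi i l)))); last first.
  by move=> i; rewrite -csum_scal_r; apply: csum_ext => k; ring.
rewrite csum_exchange (csum_ext (G := fun k => x k * kron k l)); first by rewrite csum_kron_r.
by move=> k; rewrite csum_scal h.
Qed.

Lemma coords_add N (D : cmat N) x y i : coords D (vadd x y) i = coords D x i + coords D y i.
Proof. by rewrite /coords -csum_plus; apply: csum_ext => k; rewrite /vadd; ring. Qed.
Lemma coords_sub N (D : cmat N) x y i : coords D (vsub x y) i = coords D x i - coords D y i.
Proof. by rewrite /coords -csum_minus; apply: csum_ext => k; rewrite /vsub; ring. Qed.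
Lemma coords_scale N (D : cmat N) c x i : coords D (vscale c x) i = c * coords D x i.
Proof. by rewrite /coords -csum_scal; apply: csum_ext => k; rewrite /vscale; ring. Qed.

Lemma mapply_comb N (M : cmat N) c (xi : 'I_N -> cvec N) : mapply M (vlincomb c xi) = vlincomb c (fun i => mapply M (xi i)).
Proof.
apply: functional_extensionality => r; rewrite /mapply /vlincomb.
rewrite (csum_ext (G := fun k => csum (fun i => c i * (M r k * xi i k)))); last first.
  by move=> k; rewrite -csum_scal; apply: csum_ext => i; ring.
by rewrite csum_exchange; apply: csum_ext => i; rewrite csum_scal.
Qed.

Lemma coords_eigen N (M : cmat N) (lam : 'I_N -> C) xi (D : cmat N) x i : dual_frame xi D ->
  (forall i, mapply M (xi i) = vscale (lam i) (xi i)) -> coords D (mapply M x) i = lam i * coords D x i.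
Proof.
move=> hD he; rewrite {1}(coords_expand x hD) mapply_comb.
have -> : vlincomb (coords D x) (fun i => mapply M (xi i)) = vlincomb (fun i => lam i * coords D x i) xi.
  by apply: functional_extensionality => r; apply: csum_ext => k; rewrite he /vscale; ring.
exact: coords_comb.
Qed.

Lemma coords_phi N (phi : covec N) xi (D : cmat N) x : dual_frame xi D ->
  (forall i, cvapply phi (xi i) = RtoC 1) -> cvapply phi x = csum (coords D x).
Proof.
move=> hD h; rewrite {1}(coords_expand x hD) /cvapply /vlincomb.
rewrite (csum_ext (G := fun k => csum (fun i => coords D x i * (phi k * xi i k)))); last first.
  by move=> k; rewrite -csum_scal; apply: csum_ext => i; ring.
rewrite csum_exchange; apply: csum_ext => i; rewrite csum_scal.
have -> : csum (fun k => phi k * xi i k) = RtoC 1 by exact: (h i).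
by rewrite Cmult_1_r.
Qed.

Lemma mapply_rank1 N (phi : covec N) (v : cvec N) x : mapply (fun r c => v r * phi c) x = vscale (cvapply phi x) v.
Proof.
apply: functional_extensionality => r; rewrite /mapply /vscale /cvapply -csum_scal_r.
by apply: csum_ext => k; ring.
Qed.

Lemma mapply_msub N (A B : cmat N) x : mapply (msub A B) x = vsub (mapply A x) (mapply B x).
Proof.
by apply: functional_extensionality => r; rewrite /mapply /vsub -csum_minus; apply: csum_ext => k; rewrite /msub; ring.
Qed.

Lemma Cmult_eq0 (a b : C) : a * b = RtoC 0 -> a <> RtoC 0 -> b = RtoC 0.
Proof.
move=> e ha; have -> : b = a * b / a by field.
by rewrite e /Cdiv; ring.
Qed.

Lemma Cminus_ne0 (a b : C) : a <> b -> a - b <> RtoC 0.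
Proof.
move=> h e; apply: h; have -> : a = a - b + b by ring.
by rewrite e; ring.
Qed.

(** The basis [e] of the hypothesis is not assumed to be related to [xi]. As the lam_k are distinct,
    an e_i with nonzero k-th coordinate is a multiple of xi_k; by independence exactly one such i
    exists, so the k-th coordinate of [v] is a product of two nonzero numbers. *)
Lemma general_position_coords N (P : cmat N) phi v lam xi (D : cmat N) k : dual_frame xi D ->
  (forall i, mapply P (xi i) = vscale (lam i) (xi i)) -> (forall i k, lam i = lam k -> i = k) ->
  general_position P phi v -> coords D v k <> RtoC 0.
Proof.
move=> hD he hl [e [ev [hb [hev [_ [dl [hdl ->]]]]]]].
have ei : indep e by move=> c hc; apply: hb; apply: functional_extensionality => l; apply: hc.
have key i l : (lam l - ev i) * coords D (e i) l = RtoC 0.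
  have h := coords_eigen (e i) l hD he; rewrite hev coords_scale in h.
  have -> : (lam l - ev i) * coords D (e i) l = lam l * coords D (e i) l - ev i * coords D (e i) l by ring.
  by rewrite h; ring.
have off i l : coords D (e i) k <> RtoC 0 -> l != k -> coords D (e i) l = RtoC 0.
  move=> h lk; apply: (Cmult_eq0 (key i l)); apply: Cminus_ne0 => e1.
  have h2 : lam k <> ev i by rewrite -e1 => /hl e2; rewrite e2 eqxx in lk.
  by apply: h; apply: (Cmult_eq0 (key i k)); apply: Cminus_ne0.
have coordsE c l : coords D (vlincomb c e) l = csum (fun i => c i * coords D (e i) l).
  rewrite /coords /vlincomb (csum_ext (G := fun k => csum (fun i => c i * (e i k * D k l)))); last first.
    by move=> k'; rewrite -csum_scal_r; apply: csum_ext => i; ring.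
  by rewrite csum_exchange; apply: csum_ext => i; rewrite csum_scal.
have [D' hD'] := indep_inverse ei.
(* The e_i span: otherwise xi_k, expanded in them, would have k-th coordinate 0. *)
have [i hi] : exists i, coords D (e i) k <> RtoC 0.
  apply: NNPP => hn.
  have h0 i : coords D (e i) k = RtoC 0 by apply: NNPP => h; apply: hn; exists i.
  have h1 := coordsE (coords D' (xi k)) k; rewrite -coords_expand // in h1.
  have h2 : coords D (xi k) k = RtoC 1 by case: hD => h _; rewrite /coords h /kron eqxx.
  rewrite h2 (csum_ext (G := fun _ => RtoC 0)) ?csum_0 in h1; last by move=> i; rewrite h0; ring.
  exact: C1_nz.
have only i' : i' != i -> coords D (e i') k = RtoC 0.
  move=> ne; apply: NNPP => h.
  (* Two basis vectors that are both multiples of xi_k satisfy this explicit linear relation. *)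
  pose c l := if l == i then coords D (e i') k else if l == i' then - coords D (e i) k else RtoC 0.
  have hc : c i = RtoC 0; last by apply: h; rewrite -hc /c eqxx.
  apply: ei => l; rewrite -/(vlincomb c e l).
  rewrite (coords_expand (vlincomb c e) hD) /vlincomb -[RHS](csum_0 N); apply: csum_ext => m.
  have -> : coords D (fun r => csum (fun i0 => c i0 * e i0 r)) m = RtoC 0; last by ring.
  rewrite -/(vlincomb c e) coordsE.
  case: (eqVneq m k) => [->|mk]; last first.
    rewrite -[RHS](csum_0 N); apply: csum_ext => l'; rewrite /c.
    case: (eqVneq l' i) => [->|_]; first by rewrite (off i m) //; ring.
    by case: (eqVneq l' i') => [->|_]; [rewrite (off i' m) //; ring | ring].
  rewrite /csum (bigD1 i) //= (bigD1 i') //= big1 => [|l' /andP [l1 l2]]; rewrite /c ?eqxx.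
    by rewrite (negbTE ne); ring.
  by rewrite (negbTE l1) (negbTE l2); ring.
rewrite coordsE (csum_only (i := i)); last by move=> l /only ->; ring.
by apply: Cmult_neq_0.
Qed.

(** In coordinates, R zeta_j = - mu_j zeta_j with phi(zeta_j) = 1 reads (lam_k - mu_j) zeta_(j,k) =
    v_k. Since v_k <> 0, lam_k and mu_j differ; the normalisation then becomes the secular equation,
    which determines the v_k. *)
Lemma general_position_residue N (P : cmat N) phi v lam mu xi zeta (D : cmat N) : dual_frame xi D ->
  (forall i k, lam i = lam k -> i = k) -> (forall i k, mu i = mu k -> i = k) -> general_position P phi v ->
  (forall i, mapply P (xi i) = vscale (lam i) (xi i)) -> (forall i, cvapply phi (xi i) = RtoC 1) ->
  (forall j, mapply (msub (fun r c => v r * phi c) P) (zeta j) = vscale (- mu j) (zeta j)) ->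
  (forall j, cvapply phi (zeta j) = RtoC 1) ->
  [/\ sep lam mu, forall k, coords D v k = residue lam mu k &
      forall j k, coords D (zeta j) k = residue lam mu k / (lam k - mu j)].
Proof.
move=> hD hl hm hg hxi hphi hze hphz.
have d0 k : coords D v k <> RtoC 0 by apply: general_position_coords hD hxi hl hg.
have ez j k : (lam k - mu j) * coords D (zeta j) k = coords D v k.
  have e := f_equal (fun x => coords D x k) (hze j).
  rewrite mapply_msub mapply_rank1 hphz coords_sub !coords_scale (coords_eigen _ _ hD hxi) in e.
  have -> : coords D v k = (RtoC 1 * coords D v k - lam k * coords D (zeta j) k) + lam k * coords D (zeta j) k by ring.
  by rewrite e; ring.
have hs : sep lam mu.
  move=> k m e; apply: (d0 k); rewrite -(ez m k) e; ring.
have ez' j k : coords D (zeta j) k = coords D v k / (lam k - mu j).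
  by rewrite -(ez j k); field; apply: sep_ne.
have er k : coords D v k = residue lam mu k.
  apply: residue_unique => // [m l e|m]; first exact: (hs l m (esym e)).
  have h := coords_phi (zeta m) hD hphi; rewrite hphz in h.
  rewrite [X in X + _]h -csum_plus -[RHS](csum_0 N); apply: csum_ext => l; rewrite ez'.
  have h1 := sep_ne (k := l) (m := m) hs.
  have h2 : mu m - lam l <> RtoC 0 by apply: Cminus_ne0 => e; apply: (hs l m).
  by field.
by split=> // j k; rewrite ez' er.
Qed.

(** The recursion gives (lam_i + n + 1 - lam_k) times the new coordinate in terms of the old ones,
    and nonresonance permits the division; [aF] obeys the same recursion. *)
Lemma coords_formal_sol_at0 N (P : cmat N) phi v lam mu xi (D : cmat N) (a : nat -> cvec N) i : dual_frame xi D ->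
  nr lam -> sep lam mu -> (forall k, coords D v k = residue lam mu k) ->
  (forall i, mapply P (xi i) = vscale (lam i) (xi i)) -> (forall i, cvapply phi (xi i) = RtoC 1) ->
  a 0%N = xi i -> formal_sol_at0 P (fun r c => v r * phi c) (lam i) a ->
  forall n k, coords D (a n) k = residue lam mu k * aF lam mu i n k.
Proof.
move=> hD hl hs hv hxi hphi ha0 ha; elim=> [|n IH] k.
  rewrite ha0 /coords (proj1 hD) /kron /aF eq_sym; case: eqP => [->|_]; last by ring.
  by have h := @residue_ne0 _ _ _ i hl hs; field.
have e := f_equal (fun x => coords D x k) (ha n.+1).
rewrite coords_add !coords_sub !coords_scale !(coords_eigen _ _ hD hxi) mapply_rank1 coords_scale /= in e.
rewrite (coords_phi (a n) hD hphi) hv -/(INR n.+1) in e.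
rewrite (csum_ext IH) IH in e.
have c1 := aF_eigen mu i n k hl; have c2 := aF_eigen mu i n.+1 k hl; have c3 := WF_rec i n hl hs.
have p : lam i + RtoC (INR n.+1) - lam k <> RtoC 0.
  have -> : lam i + RtoC (INR n.+1) - lam k = lam i - lam k + 1 + RtoC (INR n) by rewrite S_INR RtoC_plus; ring.
  exact: nr_good.
have q : (lam i + RtoC (INR n.+1) - lam k) * coords D (a n.+1) k =
   residue lam mu k * WF lam mu i n.+1.
  have -> : (lam i + RtoC (INR n.+1) - lam k) * coords D (a n.+1) k =
     ((lam i + RtoC (INR n.+1)) * coords D (a n.+1) k - (lam i + RtoC (INR n.+1) - 1) * (residue lam mu k * aF lam mu i n k))
      + (lam i + RtoC (INR n.+1) - 1) * (residue lam mu k * aF lam mu i n k) - lam k * coords D (a n.+1) k by ring.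
  rewrite e c3 -c1 S_INR RtoC_plus; ring.
have -> : coords D (a n.+1) k = (lam i + RtoC (INR n.+1) - lam k) * coords D (a n.+1) k / (lam i + RtoC (INR n.+1) - lam k) by field.
by rewrite q -c2; field.
Qed.

(* The recursion determines the coordinates: a nonzero [d] would force either [t = lam k] for a single [k], or [t = mu m] by the partial fraction identity. *)
Lemma resonance_free N (lam mu dl : 'I_N -> C) (t : C) (d : 'I_N -> C) : nr lam -> sep lam mu ->
  (forall m, t <> mu m) -> (forall k, (t - lam k) * d k = - (residue lam mu k * csum d)) -> forall k, d k = RtoC 0.
Proof.
move=> hl hs ht hd k; case: (Ceq_dec (csum d) (RtoC 0)) => [e|ne].
  have h l : (t - lam l) * d l = RtoC 0 by rewrite hd e; ring.
  case: (Ceq_dec t (lam k)) => [tk|tk]; last by apply: (Cmult_eq0 (h k)); apply: Cminus_ne0.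
  rewrite -e; symmetry; apply: csum_only => l lk; apply: (Cmult_eq0 (h l)); apply: Cminus_ne0 => tl.
  by move: lk; rewrite (proj1 hl l k) ?eqxx // -tl -tk.
have tl l : t <> lam l.
  move=> e; have := hd l; rewrite e.
  have -> : (lam l - lam l) * d l = RtoC 0 by ring.
  move=> h; have r0 := @residue_ne0 _ _ _ l hl hs.
  by apply: ne; apply: (Cmult_eq0 (a := - residue lam mu l)); [rewrite h; ring | move=> e1; apply: r0; rewrite -[LHS]Cmult_1_l; ring [e1]].
have hp := @residue_pf N lam mu t (proj1 hl) tl.
have z : csum d * (1 + csum (fun k => residue lam mu k / (t - lam k))) = RtoC 0.
  rewrite Cmult_plus_distr_l Cmult_1_r -csum_scal -csum_plus -[RHS](csum_0 N); apply: csum_ext => l.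
  have h1 := Cminus_ne0 (@tl l).
  have -> : d l = (t - lam l) * d l / (t - lam l) by field.
  by rewrite hd; field.
have {}z := Cmult_eq0 z ne.
rewrite hp in z; exfalso.
have n1 : cprod (fun m => t - mu m) <> RtoC 0 by apply: cprod_ne0 => m; apply: Cminus_ne0.
have n2 : cprod (fun k => t - lam k) <> RtoC 0 by apply: cprod_ne0 => m; apply: Cminus_ne0.
apply: n1; have -> : cprod (fun m => t - mu m) = cprod (fun m => t - mu m) / cprod (fun k => t - lam k) * cprod (fun k => t - lam k) by field.
by rewrite z; ring.
Qed.

(** At infinity Q acts on b_n itself, so the recursion is an implicit linear system for b_n. The
    difference [d] of two candidates solves the homogeneous system with t = mu_j - n, and t differs
    from every mu_m by nonresonance. *)
Lemma coords_formal_sol_atinf N (P : cmat N) phi v lam mu xi (D : cmat N) (b : nat -> cvec N) j : dual_frame xi D ->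
  nr lam -> nr mu -> sep lam mu -> (forall k, coords D v k = residue lam mu k) ->
  (forall i, mapply P (xi i) = vscale (lam i) (xi i)) -> (forall i, cvapply phi (xi i) = RtoC 1) ->
  (forall k, coords D (b 0%N) k = residue lam mu k / (lam k - mu j)) ->
  formal_sol_atinf P (fun r c => v r * phi c) (mu j) b ->
  forall n k, coords D (b n) k = residue lam mu k * bH lam mu j n k.
Proof.
move=> hD hl hm hs hv hxi hphi hb0 hb; elim=> [|n IH] k; first by rewrite hb0 bH_0.
have e l := f_equal (fun x => coords D x l) (hb n.+1).
have c1 l := bH_eigen j n l hs; have c2 l := bH_eigen j n.+1 l hs; have c3 := VH_rec j n.+1 hl hm hs.
pose d l := coords D (b n.+1) l - residue lam mu l * bH lam mu j n.+1 l.
suff h : d k = RtoC 0 by have -> : coords D (b n.+1) k = d k + residue lam mu k * bH lam mu j n.+1 k by [rewrite /d; ring]; rewrite h; ring.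
apply: (@resonance_free N lam mu d (mu j - RtoC (INR n.+1))) => // [m em|l].
  by apply: (proj2 hm j m n); rewrite -em; ring.
have {}e := e l.
rewrite coords_add !coords_sub !coords_scale !(coords_eigen _ _ hD hxi) mapply_rank1 coords_scale /= in e.
rewrite (coords_phi (b n.+1) hD hphi) hv -/(INR n.+1) IH in e.
rewrite /d csum_minus -c3 /sh.
move: e; set S := csum _; move=> e.
have -> : (mu j - RtoC (INR n.+1) - lam l) * (coords D (b n.+1) l - residue lam mu l * bH lam mu j n.+1 l) =
  (mu j - RtoC (INR n.+1) - lam l) * coords D (b n.+1) l - residue lam mu l * ((mu j - RtoC (INR n.+1) - lam l) * bH lam mu j n.+1 l) by ring.
rewrite c2.
have -> : (mu j - RtoC (INR n.+1) - lam l) * coords D (b n.+1) l =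
  residue lam mu l * ((mu j - RtoC (INR n) - lam l) * bH lam mu j n l) - S * residue lam mu l.
  have -> : S * residue lam mu l = (lam l * (residue lam mu l * bH lam mu j n l) - lam l * coords D (b n.+1) l +
    S * residue lam mu l) - lam l * (residue lam mu l * bH lam mu j n l) + lam l * coords D (b n.+1) l by ring.
  rewrite -e S_INR RtoC_plus; ring.
rewrite c1; ring.
Qed.

(** * Return to the slit plane *)

Lemma Clog_strip z : slit z -> strip (Clog z).
Proof. by move=> h; rewrite /strip im_Clog; apply: Carg_bound. Qed.

Lemma Clog_lstrip z : slit z -> (Cmod z < 1)%R -> lstrip (Clog z).
Proof.
move=> h hz; split; first exact: Clog_strip.
by rewrite re_Clog -ln_1; apply: ln_increasing => //; apply/Cmod_gt_0; apply: slit_ne0.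
Qed.

Lemma Clog_rstrip z : slit z -> (1 < Cmod z)%R -> rstrip (Clog z).
Proof.
move=> h hz; split; first exact: Clog_strip.
by rewrite re_Clog -ln_1; apply: ln_increasing => //; lra.
Qed.

(** Undoes both reductions: [Clog] carries the slit plane into the strip, and the weights residue_k
    undo the rescaling of the coordinates with respect to [xi]. *)
Definition slit_sol N (lam mu : 'I_N -> C) (xi : 'I_N -> cvec N) (A : cvec N) (z : C) : cvec N := fun r =>
  csum (fun k => residue lam mu k * xi k r * ext (diagm lam) (rank1 (residue lam mu)) A (Clog z) k).

Lemma slit_sol_holo N (lam mu : 'I_N -> C) (xi : 'I_N -> cvec N) (A : cvec N) r : holo_slit (fun z => slit_sol lam mu xi A z r).
Proof.
move=> z hz; have hs := Clog_strip hz.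
have [d hd] := fin_all_exists (fun k => ext_der (diagm lam) (rank1 (residue lam mu)) A k hs).
apply: (@Cder_ex_derive _ _ (csum (fun k => residue lam mu k * xi k r * (/ z * d k)))).
by apply: Cder_csum => k; apply: Cder_scal; apply: (Cder_comp (Cder_Clog hz) (hd k)).
Qed.

Lemma slit_sol_conn N (lam mu : 'I_N -> C) (xi : 'I_N -> cvec N) i z r : nr lam -> nr mu -> sep lam mu ->
  slit_sol lam mu xi (coordF lam mu i) z r = csum (fun j => conn_coef lam mu i j * slit_sol lam mu xi (coordH lam mu j) z r).
Proof.
move=> hl hm hs; rewrite /slit_sol.
rewrite (csum_ext (G := fun k => csum (fun j => conn_coef lam mu i j * (residue lam mu k * xi k r *
   ext (diagm lam) (rank1 (residue lam mu)) (coordH lam mu j) (Clog z) k)))).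
  by rewrite csum_exchange; apply: csum_ext => j; rewrite csum_scal.
move=> k; rewrite (csum_ext (F := fun j => conn_coef lam mu i j * _)
  (G := fun j => residue lam mu k * xi k r * (conn_coef lam mu i j * ext (diagm lam) (rank1 (residue lam mu)) (coordH lam mu j) (Clog z) k))).
  rewrite csum_scal; congr (_ * _); rewrite /ext.
  rewrite (csum_ext (F := fun j => conn_coef lam mu i j * csum _) (G := fun j => csum (fun a =>
     conn_coef lam mu i j * coordH lam mu j a * ysolY (diagm lam) (rank1 (residue lam mu)) a (Clog z) k))).
    by rewrite csum_exchange; apply: csum_ext => a; rewrite csum_scal_r coord_conn.
  by move=> j; rewrite -csum_scal; apply: csum_ext => a; ring.
by move=> j; ring.
Qed.

Lemma is_series_coords N (d : 'I_N -> C) (y : 'I_N -> nat -> C) (e w : C) (t : nat -> C) :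
  (forall k, gb (y k)) -> (Cmod w < 1)%R ->
  (forall n, t n = e * csum (fun k => d k * (y k n * Cpow w n))) ->
  is_series (K := C_AbsRing) (V := C_NormedModule) t (csum (fun k => d k * (e * PSc (y k) w))).
Proof.
move=> hy hw ht.
have s1 k : summable (fun n => d k * (y k n * Cpow w n)) by apply: summable_scal; apply: gb_summable.
have s2 := summable_csum s1; have s3 := summable_scal e s2.
have -> : t = fun n => e * csum (fun k => d k * (y k n * Cpow w n)) by apply: functional_extensionality.
have -> : csum (fun k => d k * (e * PSc (y k) w)) = Cser (fun n => e * csum (fun k => d k * (y k n * Cpow w n))).
  rewrite Cser_scal // Cser_csum // -csum_scal; apply: csum_ext => k.
  by rewrite Cser_scal ?/PSc; [ring | apply: gb_summable].
exact: is_series_Cser.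
Qed.

Theorem mainTheorem12
  (N : nat) (P : cmat N) (phi : covec N) (v : cvec N) (delta : C)
  (lam mu : 'I_N -> C) (xi zeta : 'I_N -> cvec N)
  (a b : 'I_N -> nat -> cvec N) :
  let Q : cmat N := fun r c => Cmult (v r) (phi c) in
  let R : cmat N := msub Q P in
  cvapply phi v = delta -> delta <> RtoC 0%R ->
  (* P has distinct eigenvalues lam_i, none differing by a positive integer *)
  (forall i k, lam i = lam k -> i = k) ->
  (forall i k (n : nat), Cminus (lam i) (lam k) <> RtoC (INR n.+1)) ->
  general_position P phi v ->
  (* R = Q - P has distinct eigenvalues -mu_j, no two mu's differing by a positive integer *)
  (forall j m, mu j = mu m -> j = m) ->
  (forall j m (n : nat), Cminus (mu j) (mu m) <> RtoC (INR n.+1)) ->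
  general_position R phi v ->
  (* normalised eigenvectors *)
  (forall i, mapply P (xi i) = vscale (lam i) (xi i)) ->
  (forall i, cvapply phi (xi i) = RtoC 1%R) ->
  (forall j, mapply R (zeta j) = vscale (Copp (mu j)) (zeta j)) ->
  (forall j, cvapply phi (zeta j) = RtoC 1%R) ->
  (* formal series solutions *)
  (forall i, a i 0%nat = xi i /\ formal_sol_at0 P Q (lam i) (a i)) ->
  (forall j, b j 0%nat = zeta j /\ formal_sol_atinf P Q (mu j) (b j)) ->
  exists (F H : 'I_N -> C -> cvec N),
    (forall i r, holo_slit (fun z => F i z r)) /\
    (forall j r, holo_slit (fun z => H j z r)) /\
    (* f_i converges on {|z| < 1} \ [0,1) to F_i *)
    (forall i z r, slit z -> (Cmod z < 1)%R ->
       is_series (K := C_AbsRing) (V := C_NormedModule)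
         (fun n => Cmult (a i n r) (Cpowc z (Cplus (lam i) (RtoC (INR n))))) (F i z r)) /\
    (* h_j converges on {|z| > 1} \ [1,oo) to H_j *)
    (forall j z r, slit z -> (1 < Cmod z)%R ->
       is_series (K := C_AbsRing) (V := C_NormedModule)
         (fun n => Cmult (b j n r) (Cpowc z (Cminus (mu j) (RtoC (INR n))))) (H j z r)) /\
    (* connection formula on C \ [0, oo) *)
    (forall i z r, slit z ->
       F i z r = csum (fun j => Cmult (conn_coef lam mu i j) (H j z r))).
Proof.
move=> Q R0 _ _ hl1 hl2 hgP hm1 hm2 _ hxi hphi hze hphz ha hb.
have hl : nr lam by [].
have hm : nr mu by [].
have ix : indep xi.
  apply: (eigen_indep hl1 hxi) => i; apply: NNPP => hn.
  have h0 k : xi i k = RtoC 0 by apply: NNPP => h; apply: hn; exists k.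
  have h := hphi i; rewrite /cvapply (csum_ext (G := fun _ => RtoC 0)) ?csum_0 in h; last by move=> k; rewrite h0; ring.
  by move/RtoC_inj: h; lra.
have [D hD] := indep_inverse ix.
have [hs hv hz] := general_position_residue hD hl1 hm1 hgP hxi hphi hze hphz.
have ea i n r : a i n r = csum (fun k => residue lam mu k * aF lam mu i n k * xi k r).
  have [h0 h1] := ha i; rewrite {1}(coords_expand (a i n) hD); apply: csum_ext => k.
  by rewrite (coords_formal_sol_at0 hD hl hs hv hxi hphi h0 h1).
have eb j n r : b j n r = csum (fun k => residue lam mu k * bH lam mu j n k * xi k r).
  have [h0 h1] := hb j; rewrite {1}(coords_expand (b j n) hD); apply: csum_ext => k.
  by rewrite (coords_formal_sol_atinf hD hl hm hs hv hxi hphi _ h1) // => l; rewrite h0 hz.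
exists (fun i => slit_sol lam mu xi (coordF lam mu i)), (fun j => slit_sol lam mu xi (coordH lam mu j)).
split; first by move=> i r; apply: slit_sol_holo.
split; first by move=> i r; apply: slit_sol_holo.
split; [|split; last by move=> i z r _; apply: slit_sol_conn].
- move=> i z r sz hz1; have hL := Clog_lstrip sz hz1.
  have -> : slit_sol lam mu xi (coordF lam mu i) z r =
    csum (fun k => residue lam mu k * xi k r * (Cexp (lam i * Clog z) * PSc (fun n => aF lam mu i n k) (Cexp (Clog z)))).
    by apply: csum_ext => k; rewrite ext_coordF.
  apply: is_series_coords => [k||n]; [exact: aF_gb|exact: Cmod_Cexp_lt1 (proj2 hL)|].
  rewrite ea /Cpowc; have -> : (lam i + RtoC (INR n)) * Clog z = lam i * Clog z + RtoC (INR n) * Clog z by ring.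
  rewrite Cexp_plus Cexp_nat -csum_scal_r -csum_scal; apply: csum_ext => k; ring.
- move=> j z r sz hz1; have hR := Clog_rstrip sz hz1.
  have -> : slit_sol lam mu xi (coordH lam mu j) z r =
    csum (fun k => residue lam mu k * xi k r * (Cexp (mu j * Clog z) * PSc (fun n => bH lam mu j n k) (Cexp (- Clog z)))).
    by apply: csum_ext => k; rewrite ext_coordH.
  apply: is_series_coords => [k||n]; [exact: bH_gb| |].
    by apply: Cmod_Cexp_lt1; rewrite re_opp; case: hR => _; lra.
  rewrite eb /Cpowc; have -> : (mu j - RtoC (INR n)) * Clog z = mu j * Clog z + RtoC (INR n) * - Clog z by ring.
  rewrite Cexp_plus Cexp_nat -csum_scal_r -csum_scal; apply: csum_ext => k; ring.
Qed.
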